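(* Let $G$ be a Lie group of diffeomorphisms of the connected smooth manifold $M$ that preserves either a strictly pseudo-convex $CR$-structure or a conformal Riemannian structure on $M$. If $G$ is closed in the group of all diffeomorphisms of $M$, then the following are equivalent: (1) $G$ acts properly on $M$. (2) $H^1_d\left(G,C^\infty(M,\mathbb{R})\right)=\{0\}$. (3) $H^r_d\left(G,C^\infty(M,V)\right)=\{0\}$ for all $r>0$ and any differentiable $G$-module $V$.
   Context: A pseudo-Hermitian structure $\{\omega,J\}$ on $M$ consists of a contact form $\omega$ and a complex structure $J$ on $\ker\omega$ such that the Levi form $d\omega(J\cdot,\cdot)$ is a positive definite Hermitian form on $\ker\omega$. A strictly pseudo-convex $CR$-structure on $M$ is a pair $\{D,J\}$ with $D=\ker\omega$ induced by a pseudo-Hermitian structure $\{\omega,J\}$; $\alpha\in\mathrm{Diff}(M)$ preserves it if $\alpha_*D=D$ and $\alpha_*\circ J=J\circ\alpha_*|_D$. A conformal Riemannian structure is the conformal class of a Riemannian metric $g$; $\alpha$ preserves it if $\alpha^*g=f\cdot g$ for some $f\in C^\infty(M,\mathbb{R}^{>0})$. A differentiable $G$-module is a quasi-complete Hausdorff locally convex topological real vector space $V$ with a continuous linear $G$-action such that (1) for all $v\in V$ the orbit map $o_v:G\to V$, $g\mapsto g\cdot v$, is smooth, and (2) the map $V\to C^\infty(G,V)$, $v\mapsto o_v$, is smooth. $C^\infty(M,V)$, with the $C^\infty$-topology and the $G$-action $(\alpha\cdot f)(x)=\alpha\cdot(f(\alpha^{-1}x))$, is a differentiable $G$-module ($\mathbb{R}$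 carries the trivial action). For a differentiable $G$-module $W$, $H^r_d(G,W)$ is the cohomology of the complex of smooth inhomogeneous cochains $C^\infty(G^r,W)$ with $\partial^0(w)(\alpha)=\alpha\cdot w-w$ and $$\partial^r\lambda(\alpha_1,\dots,\alpha_{r+1})=\alpha_1\cdot\lambda(\alpha_2,\dots,\alpha_{r+1})+\sum_{i=1}^r(-1)^i\lambda(\alpha_1,\dots,\alpha_i\alpha_{i+1},\dots,\alpha_{r+1})+(-1)^{r+1}\lambda(\alpha_1,\dots,\alpha_r).$$ *)

(* Defs.v *)
From HB Require Import structures.
From mathcomp Require Import all_boot all_order all_algebra.
From mathcomp Require Import all_classical all_reals all_analysis.

Set Implicit Arguments.
Unset Strict Implicit.
Unset Printing Implicit Defensive.

Import Order.TTheory GRing.Theory Num.Theory.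
Import numFieldNormedType.Exports.

Local Open Scope classical_set_scope.
Local Open Scope ring_scope.

Section Calculus.
Context {R : realType}.

Definition diff_quot (E W : lmodType R) (f : E -> W) (x v : E) (h : R) : W :=
  h^-1 *: (f (x + h *: v) - f x).

(* Michal-Bastiani (Keller C^k_c) differentiability on an open set [U]:
   [f] is C^(k+1) when all directional derivatives exist on [U] and the tangent
   map [df : U x E -> W] is C^k.  For finite-dimensional [E] and Hausdorff [W]
   this is the usual notion of a C^k map; for infinite-dimensional [E] it is
   the standard one for maps between locally convex spaces.  Outside [U] the
   values of [f] are irrelevant. *)
Fixpoint Ck_on (W : preTopologicalLmodType R) (k : nat) :
    forall E : tvsType R, set E -> (E -> W) -> Prop :=
  match k with
  | 0%N => fun E U f => forall x, U x -> {for x, continuous f}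
  | k'.+1 => fun E U f =>
      (forall x, U x -> {for x, continuous f}) /\
      exists df : E * E -> W,
        (forall x v, U x -> diff_quot f x v @ 0^' --> df (x, v)) /\
        @Ck_on W k' (E * E)%type (U `*` setT) df
  end.

Definition smooth_on (E : tvsType R) (W : preTopologicalLmodType R)
  (U : set E) (f : E -> W) : Prop := forall k, Ck_on k U f.

(* The library's [derive] requires a normed codomain; this is the same
   directional derivative for values in a topological vector space (junk value
   [0] where the limit does not exist). *)
Definition dderive (E : lmodType R) (W : preTopologicalLmodType R)
  (v : E) (f : E -> W) : E -> W :=
  fun x => xget 0 [set l | diff_quot f x v @ 0^' --> l].

Definition dderives (E : lmodType R) (W : preTopologicalLmodType R)
  (s : seq E) (f : E -> W) : E -> W := foldr (@dderive E W) f s.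

Lemma Ck_on_lin (W : topologicalLmodType R) (a : R) k (E : tvsType R)
    (U : set E) (f g : E -> W) :
  Ck_on k U f -> Ck_on k U g -> Ck_on k U (fun x => a *: f x + g x).
Proof.
have addc (T : Type) (F : set_system T) (FF : Filter F) (p q : T -> W) l m :
    p @ F --> l -> q @ F --> m -> (fun t => a *: p t + q t) @ F --> a *: l + m.
  move=> pl qm.
  have sc : (fun t => a *: p t) @ F --> a *: l.
    apply: (@continuous2_cvg T R^o W W F FF (fun=> a) p
      (fun t u => t *: u) a l _ _ pl); last exact: cvg_cst.
    exact: (@scale_continuous R W (a, l)).
  apply: (@continuous2_cvg T W W W F FF (fun t => a *: p t) q
    (fun u v => u + v) (a *: l) m _ sc qm).
  exact: (@add_continuous W (a *: l, m)).
elim: k E U f g => [|k IH] E U f g /=.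
  by move=> fc gc x Ux; apply: addc; [exact: fc|exact: gc].
move=> [fc [df [fdf dfk]]] [gc [dg [gdg dgk]]]; split.
  by move=> x Ux; apply: addc; [exact: fc|exact: gc].
exists (fun z => a *: df z + dg z); split; last exact: IH.
move=> x v Ux.
have -> : diff_quot (fun x => a *: f x + g x) x v =
    fun h => a *: diff_quot f x v h + diff_quot g x v h.
  apply/funext => h; rewrite /diff_quot opprD addrACA -scalerBr scalerDr.
  by rewrite !scalerA mulrC.
by apply: addc; [exact: fdf|exact: gdg].
Qed.

Lemma Ck_on_0 (W : topologicalLmodType R) k (E : tvsType R) (U : set E) :
  Ck_on k U (fun=> 0 : W).
Proof.
have c0 (E' : tvsType R) (U' : set E') :
    forall x, U' x -> {for x, continuous (fun=> 0 : W)}.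
  by move=> x _; exact: cvg_cst.
elim: k E U => [|k IH] E U /=; first exact: c0.
split; first exact: c0.
exists (fun=> 0); split => // x v _.
have -> : diff_quot (fun=> 0 : W) x v = fun=> 0.
  by apply/funext => h; rewrite /diff_quot subrr scaler0.
exact: cvg_cst.
Qed.

End Calculus.

Section LocallyConvex.
Context {R : realType} (V : tvsType R).

Definition vn_bounded (B : set V) : Prop :=
  forall U, nbhs (0 : V) U ->
    exists r : R, forall t : R, r < `|t| -> B `<=` [set t *: u | u in U].

(* Cauchy with respect to the translation-invariant uniformity of [V]. *)
Definition tvs_cauchy (F : set_system V) : Prop :=
  forall U, nbhs (0 : V) U ->
    exists2 B, F B & forall x y, B x -> B y -> U (x - y).

Definition quasi_complete : Prop :=
  forall B : set V, vn_bounded B -> closed B ->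
  forall F : set_system V, ProperFilter F -> F B -> tvs_cauchy F ->
  exists2 x, B x & F --> x.

End LocallyConvex.

(* Only the values of [crd] on [dom], and of [prm] on [crd @` dom], matter. *)
Record chart (T E : Type) := Chart {
  dom : set T;
  crd : T -> E;
  prm : E -> T }.

Section Manifolds.
Context {R : realType}.

Definition img (T E : Type) (c : chart T E) : set E := crd c @` dom c.

Definition is_chart (T : topologicalType) (E : tvsType R) (c : chart T E) :=
  [/\ open (dom c), open (img c),
      (forall x, dom c x -> prm c (crd c x) = x),
      (forall x, dom c x -> {for x, continuous (crd c)}) &
      (forall y, img c y -> {for y, continuous (prm c)})].

(* The atlas need not be maximal. *)
Definition smooth_manifold (T : topologicalType) (E : tvsType R)
    (A : set (chart T E)) :=
  [/\ hausdorff_space T, @second_countable T,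
      (forall x, exists2 c, A c & dom c x),
      (forall c, A c -> is_chart c) &
      (forall c d, A c -> A d ->
        smooth_on (crd c @` (dom c `&` dom d)) (crd d \o prm c))].

Definition prod_atlas (T T' : Type) (E E' : Type) (A : set (chart T E))
    (A' : set (chart T' E')) : set (chart (T * T') (E * E')) :=
  [set Chart (dom c `*` dom d) (fun p => (crd c p.1, crd d p.2))
             (fun q => (prm c q.1, prm d q.2)) | c in A & d in A'].

(* The product manifold T^r; its model space is ['M_(r, n)], the i-th row being
   the coordinates of the i-th component. *)
Definition pow_atlas (T : Type) (n : nat) (A : set (chart T 'rV[R]_n))
    (r : nat) : set (chart ('I_r -> T) 'M[R]_(r, n)) :=
  [set Chart [set x | forall i, dom (c i) (x i)]
             (fun x => \matrix_(i, j) crd (c i) (x i) 0 j)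
             (fun y i => prm (c i) (row i y))
    | c in [set c : 'I_r -> chart T 'rV[R]_n | forall i, A (c i)]].

Definition smooth_fun (T : Type) (E : tvsType R) (A : set (chart T E))
    (W : preTopologicalLmodType R) (f : T -> W) : Prop :=
  forall c, A c -> smooth_on (img c) (f \o prm c).

Definition smooth_map (T T' : topologicalType) (E E' : tvsType R)
    (A : set (chart T E)) (A' : set (chart T' E')) (f : T -> T') : Prop :=
  continuous f /\
  forall c d, A c -> A' d ->
    smooth_on (crd c @` (dom c `&` f @^-1` dom d)) (crd d \o f \o prm c).

Definition diffeo (T : topologicalType) (E : tvsType R) (A : set (chart T E))
    (a : T -> T) : Prop :=
  smooth_map A A a /\
  exists b, [/\ smooth_map A A b, cancel a b & cancel b a].

End Manifolds.
Arguments pow_atlas {R T n} A r _.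

Section SmoothFunctionSpace.
Context {R : realType} (T : Type) (E : tvsType R) (A : set (chart T E)).
Context (W : topologicalLmodType R).

Definition smooth_pred : {pred T -> W} := fun f => `[< smooth_fun A f >].

Record Cinf := MkCinf { Cinf_fun :> T -> W; _ : Cinf_fun \in smooth_pred }.

HB.instance Definition _ := [isSub for Cinf_fun].
HB.instance Definition _ := [Choice of Cinf by <:].

Lemma smooth_pred_closed : subsemimod_closed smooth_pred.
Proof.
split; first split.
- by apply/asboolP => c _ k; exact: Ck_on_0.
- move=> f g /asboolP fs /asboolP gs; apply/asboolP => c Ac k.
  have := Ck_on_lin 1 (fs c Ac k) (gs c Ac k).
  by congr Ck_on; apply/funext => x /=; rewrite scale1r.
- move=> a f /asboolP fs; apply/asboolP => c Ac k.
  have := Ck_on_lin a (fs c Ac k) (Ck_on_0 W k (img c)).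
  by congr Ck_on; apply/funext => x /=; rewrite addr0.
Qed.

HB.instance Definition _ :=
  GRing.SubChoice_isSubLmodule.Build R (T -> W) smooth_pred Cinf
    smooth_pred_closed.

(* Compact-open topology on all iterated directional derivatives in charts,
   i.e. uniform convergence of all derivatives on compact subsets of charts. *)
Definition Cinf_subbase : set_system Cinf :=
  [set B | exists c K (s : seq E) (O : set W),
    [/\ A c, compact K, K `<=` img c, open O &
        B = [set f : Cinf | forall y, K y -> O (dderives s (f \o prm c) y)]]].

HB.instance Definition _ := isSubBaseTopological.Build Cinf Cinf_subbase id.

(* Junk value [0] when [f] is not smooth. *)
Definition to_Cinf (f : T -> W) : Cinf := insubd (0 : Cinf) f.

End SmoothFunctionSpace.

Section DiffeomorphismGroup.
Context {R : realType} (T : topologicalType) (E : tvsType R).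
Context (A : set (chart T E)).

Definition diffeo_pred : {pred T -> T} := fun a => `[< diffeo A a >].

Record Diff := MkDiff { Diff_fun :> T -> T; _ : Diff_fun \in diffeo_pred }.

HB.instance Definition _ := [isSub for Diff_fun].
HB.instance Definition _ := [Choice of Diff by <:].

Definition Diff_subbase : set_system Diff :=
  [set B | exists c d K (s : seq E) (O : set E),
    [/\ A c, A d, compact K /\ K `<=` img c, open O &
        B = [set a : Diff | forall y, K y -> dom d (a (prm c y)) /\
                              O (dderives s (crd d \o a \o prm c) y)]]].

HB.instance Definition _ := isSubBaseTopological.Build Diff Diff_subbase id.

End DiffeomorphismGroup.

(* Tensor fields are given by their local representatives: for every chart [c]
   and every coordinate vector [y] in [img c], a tensor on the coordinate space;
   representatives in different charts are related by the differentials of the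
   transition maps. *)
Section Geometry.
Context {R : realType} (n : nat) (T : topologicalType).
Local Notation E := 'rV[R]_n.
Context (A : set (chart T E)).
Implicit Types (a : T -> T) (c d : chart T E) (x : T) (y u v : E).

Definition loc a c d : E -> E := crd d \o a \o prm c.

(* a^* g = f g *)
Definition pullback_scaled (g : chart T E -> E -> E -> E -> R) a (f : T -> R) :=
  forall c d x u v, A c -> A d -> dom c x -> dom d (a x) ->
    g d (crd d (a x)) ('D_u (loc a c d) (crd c x)) ('D_v (loc a c d) (crd c x))
    = f x * g c (crd c x) u v.

Definition riemannian_metric (g : chart T E -> E -> E -> E -> R) : Prop :=
  [/\ (forall c y, A c -> img c y ->
        [/\ forall v, linear (fun u => g c y u v : R^o),
            forall u v, g c y u v = g c y v u &
            forall u, u != 0 -> 0 < g c y u u]),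
      (forall c u v, A c -> smooth_on (img c) (fun y => g c y u v : R^o)) &
      pullback_scaled g id (fun=> 1)].

Definition preserves_conformal g a : Prop :=
  exists f : T -> R,
    [/\ smooth_fun A (f : T -> R^o), forall x, 0 < f x & pullback_scaled g a f].

Definition one_form (w : chart T E -> E -> E -> R) : Prop :=
  [/\ (forall c y, A c -> img c y -> linear (w c y : E -> R^o)),
      (forall c u, A c -> smooth_on (img c) (fun y => w c y u : R^o)) &
      (forall c d x u, A c -> A d -> dom c x -> dom d x ->
        w d (crd d x) ('D_u (loc id c d) (crd c x)) = w c (crd c x) u)].

(* The exterior derivative on constant coordinate vector fields. *)
Definition dext (w : chart T E -> E -> E -> R) c y u v : R :=
  'D_u (fun z => w c z v : R^o) y - 'D_v (fun z => w c z u : R^o) y.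

(* Nowhere zero, with [d w] non-degenerate on the kernel. *)
Definition contact_form (w : chart T E -> E -> E -> R) : Prop :=
  one_form w /\
  forall c y, A c -> img c y ->
    (exists u, w c y u != 0) /\
    (forall u, w c y u = 0 ->
      (forall v, w c y v = 0 -> dext w c y u v = 0) -> u = 0).

(* [a_* D = D] and [a_* \o J = J \o a_*] on D = ker w. *)
Definition preserves_CR (w : chart T E -> E -> E -> R)
    (J : chart T E -> E -> E -> E) a : Prop :=
  forall c d x u, A c -> A d -> dom c x -> dom d (a x) ->
    let da v := 'D_v (loc a c d) (crd c x) in
    (w c (crd c x) u = 0 <-> w d (crd d (a x)) (da u) = 0) /\
    (w c (crd c x) u = 0 ->
      da (J c (crd c x) u) = J d (crd d (a x)) (da u)).

(* A smooth complex structure on the vector bundle ker w; the values of [J]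
   outside ker w are irrelevant. *)
Definition complex_structure_on_ker (w : chart T E -> E -> E -> R)
    (J : chart T E -> E -> E -> E) : Prop :=
  [/\ (forall c y, A c -> img c y -> forall u v (t : R),
        w c y u = 0 -> w c y v = 0 ->
        [/\ w c y (J c y u) = 0, J c y (J c y u) = - u &
            J c y (t *: u + v) = t *: J c y u + J c y v]),
      (forall c (U : set E) (X : E -> E), A c -> open U -> U `<=` img c ->
        @smooth_on R E (E : tvsType R) U X -> (forall y, U y -> w c y (X y) = 0) ->
        @smooth_on R E (E : tvsType R) U (fun y => J c y (X y))) &
      preserves_CR w J id].

Definition pseudo_hermitian (w : chart T E -> E -> E -> R)
    (J : chart T E -> E -> E -> E) : Prop :=
  [/\ contact_form w, complex_structure_on_ker w J &
      forall c y u v, A c -> img c y -> w c y u = 0 -> w c y v = 0 ->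
        let levi p q := dext w c y (J c y p) q in
        [/\ levi u v = levi v u, levi (J c y u) (J c y v) = levi u v &
            u != 0 -> 0 < levi u u]].

End Geometry.

#[short(type="preTopologicalGroupType")]
HB.structure Definition PreTopologicalGroup := {G of Topological G & Group G}.

Section LieGroups.
Context {R : realType} (G : preTopologicalGroupType) (m : nat).
Context (AG : set (chart G 'rV[R]_m)).
Local Open Scope group_scope.

Definition lie_group : Prop :=
  [/\ smooth_manifold AG,
      smooth_map (prod_atlas AG AG) AG (fun p : G * G => p.1 * p.2) &
      smooth_map AG AG (fun g : G => g^-1)].

Definition is_action (X : Type) (act : G -> X -> X) : Prop :=
  (forall x, act 1 x = x) /\
  (forall g h x, act (g * h) x = act g (act h x)).

Definition differentiable_module (V : tvsType R) (aV : G -> V -> V) : Prop :=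
  [/\ hausdorff_space V /\ quasi_complete V,
      is_action aV /\ (forall g, linear (aV g)),
      continuous (fun p : G * V => aV p.1 p.2),
      (forall v, smooth_fun AG (fun g => aV g v)) &
      smooth_on setT (fun v : V => to_Cinf AG (fun g => aV g v))].

End LieGroups.

Section Cohomology.
Context {R : realType} (G : preTopologicalGroupType) (m : nat).
Context (AG : set (chart G 'rV[R]_m)).
Context (W : preTopologicalLmodType R) (aW : G -> W -> W).

Definition smooth_cochain (r : nat) (l : ('I_r -> G) -> W) : Prop :=
  smooth_fun (pow_atlas AG r) l.

(* (a_0, ..., a_r) |-> (a_0, ..., a_i a_(i+1), ..., a_r) *)
Definition contract (r : nat) (i : 'I_r) (a : 'I_r.+1 -> G) : 'I_r -> G :=
  fun j => if (j < i)%N then a (widen_ord (leqnSn r) j)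
           else if j == i then
             (a (widen_ord (leqnSn r) i) * a (lift ord0 i))%g
           else a (lift ord0 j).

Definition coboundary (r : nat) (l : ('I_r -> G) -> W) : ('I_r.+1 -> G) -> W :=
  fun a => aW (a ord0) (l (fun j => a (lift ord0 j)))
         + \sum_(i < r) (-1) ^+ i.+1 *: l (contract i a)
         + (-1) ^+ r.+1 *: l (fun j => a (widen_ord (leqnSn r) j)).

Definition is_coboundary (r : nat) : (('I_r -> G) -> W) -> Prop :=
  match r with
  | 0%N => fun l => forall a, l a = 0
  | r'.+1 => fun l => exists2 k : ('I_r' -> G) -> W,
      smooth_cochain k & forall a, l a = coboundary k a
  end.

(* H^r_d(G, W) = {0}: every smooth r-cocycle is a coboundary. *)
Definition Hd_vanishes (r : nat) : Prop :=
  forall l : ('I_r -> G) -> W, smooth_cochain l ->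
    (forall a, coboundary l a = 0) -> is_coboundary l.

End Cohomology.

Section LieGroupOfDiffeomorphisms.
Context {R : realType} (G : preTopologicalGroupType) (m : nat).
Context (AG : set (chart G 'rV[R]_m)).
Context (M : topologicalType) (n : nat) (A : set (chart M 'rV[R]_n)).
Context (act : G -> M -> M).

Definition lie_group_of_diffeos : Prop :=
  [/\ lie_group AG, is_action act,
      (forall g h, (forall x, act g x = act h x) -> g = h) &
      smooth_map (prod_atlas AG A) A (fun p : G * M => act p.1 p.2)].

Definition closed_in_Diff : Prop :=
  closed [set a : Diff A | exists g, forall x, a x = act g x].

Definition proper_action : Prop :=
  forall K : set (M * M), compact K ->
    compact [set p : G * M | K (act p.1 p.2, p.2)].

Definition preserves_CR_or_conformal : Prop :=
  (exists w J, pseudo_hermitian A w J /\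
     forall g, preserves_CR A w J (act g)) \/
  (exists gm, riemannian_metric A gm /\
     forall g, preserves_conformal A gm (act g)).

Definition Cinf_act (V : tvsType R) (aV : G -> V -> V) (g : G)
    (f : Cinf A V) : Cinf A V :=
  to_Cinf A (fun x => aV g (f (act g^-1%g x))).

End LieGroupOfDiffeomorphisms.

(* Main.v *)
(* (1) => (3). Let f be a smooth function with integral of f(g^-1 x) over G equal to 1
   for every x, and whose support meets the orbits of a compact set in a compact set
   of group elements; properness provides it. Averaging an r-cocycle in its last
   argument against f exhibits it as a coboundary. Invariant integration is the limit,
   along an ultrafilter, of normalized counting on minimal covers of large compact
   sets by translates of a shrinking neighbourhood of 1; quasi-completeness makes the
   vector-valued averages converge.

   (2) => (1). The factors F(g, x) by which g rescales the metric, or the contact form,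
   satisfy F(gh, x) = F(g, hx) F(h, x), so ln F(g^-1, .)^2 is a 1-cocycle. If it is a
   coboundary, rescaling gives an invariant Riemannian metric; in the CR case this is
   the Webster metric of the rescaled contact form, which is invariant up to sign. The
   1-jet of an isometry solves a first order system whose coefficients are given by
   Christoffel symbols; hence, along an ultrafilter on G, convergence at one point
   implies convergence of all derivatives on all of M. The limit is a diffeomorphism,
   thus lies in G because G is closed, and a Baire category argument on the
   sigma-compact group G upgrades this convergence to convergence in G. *)
Require Import Defs.
From HB Require Import structures.
From mathcomp Require Import all_boot all_order all_algebra.
From mathcomp Require Import all_classical all_reals all_analysis.
From mathcomp Require Import ring lra.
Import Order.TTheory GRing.Theory Num.Theory.
Import numFieldNormedType.Exports.
Set Implicit Arguments.
Unset Strict Implicit.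
Unset Printing Implicit Defensive.
Local Open Scope classical_set_scope.
Local Open Scope ring_scope.

(** * Differential calculus in locally convex spaces *)

(** Cochains take values in C^oo(M, V), where V is merely locally convex and quasi-complete, so no
    norm is available. Convex neighbourhoods replace norms, and the mean value theorem becomes the
    statement that an increment lies in a convex set around the derivatives. Smoothness is mostly
    obtained by coinduction: a class of continuous functions closed under partial derivatives
    consists of smooth ones. The exponential law turns cochains into functions of a tuple of group
    elements and a point.

    In the geometric half the obstacle is that the topology of G is not assumed to be induced from
    the diffeomorphism group. Closedness only says that a limit of elements of G is, as a map, an
    element of G. Convergence in G follows once some compact subset of G contains a nonempty set
    that is open for pointwise convergence on M; this is the purpose of the category argument. The
    cocycle is squared because the factor of a contact form is only known to be nonzero: where the
    kernel of the form is trivial, its sign is not controlled. *)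

Section RealInduction.
Context {R : realType}.

(** Let [u] be the supremum of the points up to which [P] holds. The third hypothesis carries [P] to
    [u], the second beyond it unless [u] is 1. This replaces a uniformity that pointwise difference
    quotients do not offer. *)
Lemma real_ind01 (P : R -> Prop) :
  P 0 ->
  (forall t, 0 <= t < 1 -> (forall s, 0 <= s <= t -> P s) ->
     exists2 e, 0 < e & forall s, t < s < t + e -> P s) ->
  (forall t, 0 < t <= 1 -> (forall s, 0 <= s < t -> P s) -> P t) ->
  forall t, 0 <= t <= 1 -> P t.
Proof.
move=> P0 Pr Pl.
pose S := [set t : R | 0 <= t <= 1 /\ forall s, 0 <= s <= t -> P s].
have S0 : S 0.
  by split; [rewrite lexx ler01|move=> s s0; rewrite -(le_anti s0)].
have ubS : has_ubound S by exists 1 => t [/andP[]].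
have hsS : has_sup S by split; [exists 0|].
set u := sup S.
have u0 : 0 <= u by apply: ub_le_sup.
have u1 : u <= 1.
  by apply: sup_le_ub; [exists 0|move=> t [/andP[]]].
have below s : 0 <= s < u -> P s.
  move=> /andP[s0 su].
  have [t [_ tP] st] := sup_gt (ex_intro _ _ S0) su.
  by apply: tP; rewrite s0 ltW.
have Pu : P u.
  have [->|un0] := eqVneq u 0; first exact: P0.
  by apply: Pl => //; rewrite lt_neqAle eq_sym un0 u0.
have Su s : 0 <= s <= u -> P s.
  case/andP=> s0; rewrite le_eqVlt => /orP[/eqP->//|su].
  by apply: below; rewrite s0.
have [u1'|u1'] := ltP u 1; last first.
  move=> t /andP[t0 t1]; apply: Su; rewrite t0; exact: le_trans t1 u1'.
have [] := Pr u; first by rewrite u0.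
  exact: Su.
move=> e e0 eP.
pose t := Num.min (u + e / 2) 1.
have ut : u < t by rewrite lt_min u1' andbT ltrDl divr_gt0.
suff St : S t by have := ub_le_sup ubS St; rewrite leNgt ut.
split; first by rewrite (le_trans u0 (ltW ut)) ge_min lexx orbT.
move=> s /andP[s0 st]; have [su|us] := leP s u; first by apply: Su; rewrite s0.
apply: eP; rewrite us /= (le_lt_trans st)// gt_min ltrD2l.
by rewrite ltr_pdivrMr// ltr_pMr// ltr1n.
Qed.

End RealInduction.

Section Convexity.
Context {R : realType}.

Definition cvx (W : lmodType R) (D : set W) : Prop :=
  forall x y t, D x -> D y -> 0 <= t <= 1 -> D (t *: x + (1 - t) *: y).

Lemma cvxI (W : lmodType R) (A B : set W) : cvx A -> cvx B -> cvx (A `&` B).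
Proof.
by move=> cA cB x y t [Ax Bx] [Ay By] t01; split; [exact: cA|exact: cB].
Qed.

(* A weighted mean, without requiring the weights to sum to one. *)
Lemma cvx_wadd (W : lmodType R) (D : set W) (a b : R) x y :
  cvx D -> 0 <= a -> 0 <= b -> 0 < a + b -> D x -> D y ->
  exists2 z, D z & a *: x + b *: y = (a + b) *: z.
Proof.
move=> cD a0 b0 ab Dx Dy.
exists ((a / (a + b)) *: x + (1 - a / (a + b)) *: y).
  apply: cD => //; rewrite divr_ge0 ?(ltW ab)//= ler_pdivrMr// mul1r.
  by rewrite lerDl.
have abn : a + b != 0 by rewrite gt_eqF.
rewrite scalerDr !scalerA mulrC divfK//; congr (_ + _ *: _).
by field.
Qed.

Lemma cvx_translate (W : lmodType R) (D : set W) a :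
  cvx D -> cvx [set x | D (x - a)].
Proof.
move=> cD x y t /= Dx Dy t01.
have -> : t *: x + (1 - t) *: y - a = t *: (x - a) + (1 - t) *: (y - a).
  rewrite !scalerBr addrACA -opprD -scalerDl addrC [in _ + (1 - t)]addrC.
  by rewrite subrK scale1r addrC.
exact: cD.
Qed.

Variable W : tvsType R.
Implicit Types (D : set W).

Lemma addv_cvg (T : Type) (F : set_system T) {FF : Filter F} (p q : T -> W) (l m : W) :
  p @ F --> l -> q @ F --> m -> (fun t => p t + q t) @ F --> l + m.
Proof.
move=> pl qm.
apply: (@continuous2_cvg T W W W F FF p q (fun u v => u + v) l m _ pl qm).
exact: (@add_continuous W (l, m)).
Qed.

Lemma scalev_cvg (T : Type) (F : set_system T) {FF : Filter F}
    (a : T -> R^o) (p : T -> W) (l : R^o) (m : W) :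
  a @ F --> l -> p @ F --> m -> (fun t => a t *: p t) @ F --> l *: m.
Proof.
move=> pl qm.
apply: (@continuous2_cvg T R^o W W F FF a p (fun u v => u *: v) l m _ pl qm).
exact: (@scale_continuous R W (l, m)).
Qed.

Lemma oppv_cvg (T : Type) (F : set_system T) {FF : Filter F} (p : T -> W) (l : W) :
  p @ F --> l -> (fun t => - p t) @ F --> - l.
Proof.
move=> pl; apply: (@continuous_cvg _ _ _ F FF _ _ _ _ pl).
exact: opp_continuous.
Qed.

Lemma subv_cvg (T : Type) (F : set_system T) {FF : Filter F} (p q : T -> W) (l m : W) :
  p @ F --> l -> q @ F --> m -> (fun t => p t - q t) @ F --> l - m.
Proof. by move=> pl qm; apply: addv_cvg => //; apply: oppv_cvg. Qed.

Lemma nbhs_translate (x : W) D : nbhs x D <-> nbhs 0 [set y | D (x + y)].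
Proof.
split.
  move=> xD; have : (fun y => x + y) @ (0 : W) --> x.
    by rewrite -[X in _ --> X]addr0; apply: addv_cvg; [exact: cvg_cst|exact: cvg_id].
  by move=> /(_ _ xD).
move=> D0; have : (fun y => y - x) @ (x : W) --> (0 : W).
  by rewrite -[X in _ --> X](subrr x); apply: subv_cvg; [exact: cvg_id|exact: cvg_cst].
move=> /(_ _ D0); rewrite /= /nbhs /=; apply: filterS => y /=.
by rewrite addrC subrK.
Qed.

Lemma nbhs_cvx (x : W) D :
  nbhs x D -> exists N, [/\ nbhs x N, N `<=` D & cvx N].
Proof.
move=> xD; have [B Bcvx [Bopen Bx]] := @locally_convex R W.
have [N [BN Nx] ND] := Bx x _ xD.
exists N; split=> //; first by apply: open_nbhs_nbhs; split=> //; apply: Bopen.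
move=> p q t Np Nq t01.
have := Bcvx N; rewrite inE => /(_ BN p q (Itv01 (andP t01).1 (andP t01).2)).
by rewrite !inE => /(_ Np Nq).
Qed.

Lemma nbhs0_scale (D : set W) (c : R) : c != 0 ->
  nbhs 0 D -> nbhs 0 [set x | D (c *: x)].
Proof.
move=> c0 D0; have : (fun y => c *: y) @ (0 : W) --> (0 : W).
  by rewrite -[X in _ --> X](scaler0 _ c); apply: (@scalev_cvg _ _ _ (fun=> c)); [exact: cvg_cst|exact: cvg_id].
by move=> /(_ _ D0).
Qed.

(* A convex symmetric neighbourhood; these give the continuous seminorms. *)
Definition disk D := [/\ nbhs 0 D, cvx D & forall x, D x -> D (- x)].

Lemma disk0 D : disk D -> D 0.
Proof. by case=> /nbhs_singleton. Qed.

Lemma disk_scale D (t : R) x : disk D -> `|t| <= 1 -> D x -> D (t *: x).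
Proof.
move=> dD; wlog t0 : t x / 0 <= t => [wh|].
  have [t0|/ltW t0] := leP 0 t; first exact: wh.
  move=> t1 Dx; rewrite -[t]opprK scaleNr -scalerN; apply: wh => //.
  - by rewrite oppr_ge0.
  - by rewrite normrN.
  by case: dD => _ _; apply.
rewrite ger0_norm// => t1 Dx.
rewrite -[t *: x]addr0 -(scaler0 _ (1 - t)).
by case: (dD) => _ cD _; apply: cD => //; [exact: disk0|rewrite t0].
Qed.

Lemma nbhs_disk D : nbhs 0 D -> exists2 N, disk N & N `<=` D.
Proof.
move=> /nbhs_cvx[N [N0 ND cN]].
exists (N `&` [set x | N (- x)]); last by move=> x [/ND].
split; last by move=> x [? ?]; split=> //=; rewrite opprK.
  apply: filterI => //; have := @nbhs0_scale N (-1) _ N0.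
  by rewrite oppr_eq0 oner_eq0 => /(_ isT); apply: filterS => x /=; rewrite scaleN1r.
apply: cvxI => // x y t /= Nx Ny t01.
by rewrite opprD -!scalerN; apply: cN.
Qed.

(** The halving of epsilon, with disks in the role of balls. *)
Lemma disk_half D : nbhs 0 D ->
  exists2 N, disk N & forall x y, N x -> N y -> D (x + y).
Proof.
move=> /nbhs_disk[N dN ND].
exists [set x | N (2 *: x)]; first split.
- by apply: nbhs0_scale; [rewrite pnatr_eq0|case: dN].
- move=> x y t /= Nx Ny t01; rewrite scalerDr !scalerA ![2 * _]mulrC -!scalerA.
  by case: dN => _ cN _; apply: cN.
- by move=> x /= Nx; rewrite scalerN; case: dN => _ _; apply.
move=> x y /= Nx Ny; apply: ND; case: dN => _ cN _.
have -> : x + y = 2^-1 *: (2 *: x) + (1 - 2^-1) *: (2 *: y).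
  rewrite !scalerA mulVf ?pnatr_eq0// scale1r; congr (_ + _).
  have -> : (1 - 2^-1) * 2 = 1 :> R by field.
  by rewrite scale1r.
by apply: cN => //; rewrite invr_ge0 ler0n/= invf_le1// ler1n.
Qed.

Lemma cvgv_disk (T : Type) (F : set_system T) {FF : Filter F} (p : T -> W) (l : W) :
  (forall D, disk D -> F [set t | D (p t - l)]) -> p @ F --> l.
Proof.
move=> H D /nbhs_translate /nbhs_disk[N dN ND].
by rewrite nbhs_simpl /=; apply: filterS (H N dN) => t /= /ND /=; rewrite subrKC.
Qed.

(* The only use made of local convexity in the differential calculus. *)
Lemma mvt_cvx (g g' : R -> W) D : cvx D ->
  (forall t, 0 <= t <= 1 ->
     (fun h => h^-1 *: (g (t + h) - g t)) @ 0^' --> g' t /\ nbhs (g' t) D) ->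
  D (g 1 - g 0).
Proof.
move=> cD gD.
(* The increment over [0, t] is [t] times a point of [D]; by [cvx_wadd] this property passes to a
   union of consecutive intervals. *)
pose P t := t = 0 \/ exists2 z, D z & g t - g 0 = t *: z.
have near_t t : 0 <= t <= 1 -> exists2 e, 0 < e & forall s, `|s - t| < e ->
    s != t -> exists2 z, D z & g s - g t = (s - t) *: z.
  move=> /gD[gt Dt]; have := gt _ Dt; rewrite /= nbhs_simpl /= /dnbhs withinE/=.
  move=> [B /nbhs_ballP[e /= e0 eB] BE]; exists e => // s st snt.
  exists ((s - t)^-1 *: (g s - g t)); last first.
    by rewrite scalerA mulfV ?scale1r// subr_eq0.
  have : (B `&` (fun x => x != 0)) (s - t).
    split; last by rewrite subr_eq0.
    by apply: eB; rewrite -ball_normE /= sub0r normrN.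
  by rewrite -BE => -[/=]; rewrite subrKC.
suff : P 1 by move=> [/eqP|[z Dz ->]]; rewrite ?oner_eq0// scale1r.
refine (@real_ind01 R P _ _ _ 1 _); last by rewrite ler01 lexx.
- by left.
- move=> t /andP[t0 t1] Pt.
  have /near_t[e e0 eP] : 0 <= t <= 1 by rewrite t0 ltW.
  exists e => // s /andP[ts ste]; right.
  have [z Dz sz] : exists2 z, D z & g s - g t = (s - t) *: z.
    apply: eP; last by rewrite gt_eqF.
    by rewrite ger0_norm ?subr_ge0 ?(ltW ts)// ltrBlDl.
  have /Pt[t0'|[z' Dz' tz']] : 0 <= t <= t by rewrite t0 lexx.
    by exists z => //; rewrite t0' subr0 in sz.
  have [|||||y Dy yE] := @cvx_wadd _ _ (s - t) t z z' cD; rewrite ?subr_ge0 ?(ltW ts)//.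
    by rewrite subrK (le_lt_trans t0).
  by exists y => //; rewrite subrK -sz -tz' addrA subrK in yE.
- move=> t /andP[t0 t1] Pt; right.
  have /near_t[e e0 eP] : 0 <= t <= 1 by rewrite (ltW t0).
  pose s := Num.max (t - e / 2) 0.
  have s0 : 0 <= s by rewrite le_max lexx orbT.
  have st : s < t by rewrite gt_max t0 andbT gtrBl divr_gt0.
  have [z Dz] : exists2 z, D z & g s - g t = (s - t) *: z.
    apply: eP; last by rewrite lt_eqF.
    rewrite distrC ger0_norm ?subr_ge0 ?(ltW st)// ltrBlDl -ltrBlDr lt_max.
    by rewrite ltrD2l ltrN2 ltr_pdivrMr// ltr_pMr// ltr1n.
  move/(congr1 -%R); rewrite opprB -scaleNr opprB => sz.
  have /Pt[s0'|[z' Dz' tz']] : 0 <= s < t by rewrite s0 st.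
    by exists z => //; rewrite s0' subr0 in sz.
  have [|||||y Dy yE] := @cvx_wadd _ _ (t - s) s z z' cD; rewrite ?subr_ge0 ?(ltW st)//.
    by rewrite subrK.
  by exists y => //; rewrite subrK -sz -tz' addrA subrK in yE.
Qed.

End Convexity.

Lemma nbhs_setX (T T' : topologicalType) (A : set T) (B : set T') (x : T) (y : T') :
  nbhs x A -> nbhs y B -> nbhs (x, y) (A `*` B).
Proof. by move=> xA yB; exists (A, B). Qed.

Lemma open_setX (T T' : topologicalType) (A : set T) (B : set T') :
  open A -> open B -> open (A `*` B).
Proof.
move=> oA oB; rewrite openE => -[x y] [/= Ax By].
by apply: nbhs_setX; apply: open_nbhs_nbhs.
Qed.

(** * Closure properties of C^k maps *)

Section CkBasics.
Context {R : realType}.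

Lemma line_cvg (E : tvsType R) (x v : E) : (fun h : R => x + h *: v) @ 0^' --> x.
Proof.
rewrite -[X in _ --> X]addr0 -[X in _ --> x + X](scale0r v).
apply: addv_cvg; first exact: cvg_cst.
apply: scalev_cvg; last exact: cvg_cst.
by move=> A A0; apply: nbhs_dnbhs.
Qed.

Lemma near_line (E : tvsType R) (U : set E) (x v : E) :
  nbhs x U -> \forall h \near (0 : R)^', U (x + h *: v).
Proof. by move=> xU; exact: (line_cvg v xU). Qed.

Lemma continuous_eq_near (T T' : topologicalType) (f g : T -> T') (x : T) :
  (\forall y \near x, f y = g y) -> {for x, continuous f} -> {for x, continuous g}.
Proof.
move=> fg fc A; rewrite -(nbhs_singleton fg) => /fc.
by rewrite /= !nbhs_simpl/=; apply: filterS2 fg => y /= ->.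
Qed.

Lemma cvg_eq_near (T : Type) (T' : topologicalType) (F : set_system T)
    {FF : Filter F} (f g : T -> T') (l : T') :
  (\forall y \near F, f y = g y) -> f @ F --> l -> g @ F --> l.
Proof.
move=> fg fc A /fc; rewrite /= !nbhs_simpl/=.
by apply: filterS2 fg => y /= ->.
Qed.

Section Codomain.
Variable W : preTopologicalLmodType R.

Lemma diff_quot_eq (E : tvsType R) (U : set E) (f g : E -> W) x v (l : W) :
  open U -> (forall x, U x -> f x = g x) -> U x ->
  diff_quot f x v @ 0^' --> l -> diff_quot g x v @ 0^' --> l.
Proof.
move=> oU fg Ux; apply: cvg_eq_near.
apply: filterS (near_line v (open_nbhs_nbhs (conj oU Ux))) => h Uh.
by rewrite /diff_quot !fg.
Qed.

Lemma Ck_on_eq k (E : tvsType R) (U : set E) (f g : E -> W) :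
  open U -> (forall x, U x -> f x = g x) -> Ck_on k U f -> Ck_on k U g.
Proof.
move=> oU fg.
have cfg : (forall x, U x -> {for x, continuous f}) ->
    forall x, U x -> {for x, continuous g}.
  move=> fc x Ux; apply: continuous_eq_near (fc x Ux).
  by apply: filterS (open_nbhs_nbhs (conj oU Ux)) => y /fg.
case: k => [//|k] [fc [df [dfE dfk]]]; split; first exact: cfg.
by exists df; split=> // x v Ux; apply: (diff_quot_eq oU fg) => //; apply: dfE.
Qed.

Lemma Ck_on_sub k (E : tvsType R) (U U' : set E) (f : E -> W) :
  U' `<=` U -> Ck_on k U f -> Ck_on k U' f.
Proof.
elim: k E U U' f => [|k IH] E U U' f UU /=; first by move=> fc x /UU /fc.
move=> [fc [df [dfE dfk]]]; split; first by move=> x /UU /fc.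
exists df; split; first by move=> x v /UU; apply: dfE.
by apply: IH dfk => -[x v] [/UU].
Qed.

Lemma Ck_on_cont k (E : tvsType R) (U : set E) (f : E -> W) x :
  Ck_on k U f -> U x -> {for x, continuous f}.
Proof. by case: k => [|k] /=; [move=> h; exact: h|move=> [h _]; exact: h]. Qed.

Lemma Ck_on_pred k (E : tvsType R) (U : set E) (f : E -> W) :
  Ck_on k.+1 U f -> Ck_on k U f.
Proof.
elim: k E U f => [|k IH] E U f; first by case.
move=> [fc [df [dfE dfk]]]; split=> //; exists df; split=> //.
exact: IH.
Qed.

End Codomain.

(* [L0] is the linear part of [L]. *)
Definition affine (E E' : lmodType R) (L L0 : E -> E') : Prop :=
  forall x v h, L (x + h *: v) = L x + h *: L0 v /\ L0 (x + h *: v) = L0 x + h *: L0 v.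

(** No chain rule is involved: a difference quotient of [f \o L] is one of [f], and the tangent map
    is [df] composed with the map [(L, L0)], which is again affine. *)
Lemma Ck_on_affine (W : preTopologicalLmodType R) k (E E' : tvsType R)
    (U : set E') (f : E' -> W) (U' : set E) (L L0 : E -> E') :
  affine L L0 -> continuous L -> continuous L0 -> (forall x, U' x -> U (L x)) ->
  Ck_on k U f -> Ck_on k U' (f \o L).
Proof.
elim: k E E' U f U' L L0 => [|k IH] E E' U f U' L L0 aL cL cL0 UL.
  by move=> fc x /UL /fc; apply: continuous_comp; exact: cL.
move=> [fc [df [dfE dfk]]]; split.
  by move=> x /UL /fc; apply: continuous_comp; exact: cL.
exists (df \o (fun p : E * E => (L p.1, L0 p.2))); split.
  move=> x v /UL Ux; have := dfE _ (L0 v) Ux; apply: cvg_trans.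
  suff -> : diff_quot (f \o L) x v = diff_quot f (L x) (L0 v) by [].
  by apply/funext => h; rewrite /diff_quot /= (aL _ _ _).1.
apply: (IH _ _ (U `*` setT) df _ _ (fun p : E * E => (L0 p.1, L0 p.2))) => //.
- by move=> [x1 x2] [v1 v2] h /=; split; congr pair; apply: (aL _ _ _).1 || apply: (aL _ _ _).2.
- move=> [x1 x2]; apply: cvg_pair => /=.
    by apply: (@cvg_comp _ _ _ fst L _ (nbhs x1)); [exact: cvg_fst|exact: cL].
  by apply: (@cvg_comp _ _ _ snd L0 _ (nbhs x2)); [exact: cvg_snd|exact: cL0].
- move=> [x1 x2]; apply: cvg_pair => /=.
    by apply: (@cvg_comp _ _ _ fst L0 _ (nbhs x1)); [exact: cvg_fst|exact: cL0].
  by apply: (@cvg_comp _ _ _ snd L0 _ (nbhs x2)); [exact: cvg_snd|exact: cL0].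
- by move=> [x1 x2] [/= /UL].
Qed.

Lemma Ck_on_fst (W : preTopologicalLmodType R) k (E E' : tvsType R)
    (U : set E) (U' : set E') (f : E -> W) :
  Ck_on k U f -> Ck_on k (U `*` U') (f \o fst).
Proof.
apply: (@Ck_on_affine _ _ (E * E')%type _ _ _ _ fst fst) => //.
- by move=> x; exact: cvg_fst.
- by move=> x; exact: cvg_fst.
- by move=> x [].
Qed.

Lemma Ck_on_lincomp (W W' : preTopologicalLmodType R) k (E : tvsType R)
    (U : set E) (f : E -> W) (L : W -> W') :
  linear L -> continuous L -> Ck_on k U f -> Ck_on k U (L \o f).
Proof.
move=> lL cL; elim: k E U f => [|k IH] E U f.
  by move=> fc x /fc fx; apply: continuous_comp; [exact: fx|exact: cL].
move=> [fc [df [dfE dfk]]]; split.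
  by move=> x /fc fx; apply: continuous_comp; [exact: fx|exact: cL].
exists (L \o df); split; last exact: IH.
have L0 : L 0 = 0.
  by have := lL (-1) 0 0; rewrite !scaleN1r !addNr.
move=> x v Ux; have h := dfE x v Ux; have -> : diff_quot (L \o f) x v = L \o diff_quot f x v.
  apply/funext => t; rewrite /diff_quot /=.
  have LZ a u : L (a *: u) = a *: L u by rewrite -[a *: u]addr0 lL L0 addr0.
  have LB a b : L (a - b) = L a - L b.
    by rewrite addrC -scaleN1r lL scaleN1r addrC.
  by rewrite LZ LB.
by apply: continuous_cvg h; exact: cL.
Qed.

Lemma Ck_on_pair (W W' : tvsType R) k (E : tvsType R)
    (U : set E) (f : E -> W) (g : E -> W') :
  Ck_on k U f -> Ck_on k U g -> 
  @Ck_on R ((W * W')%type : tvsType R) k E U (fun x => (f x, g x)).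
Proof.
elim: k E U f g => [|k IH] E U f g.
  by move=> fc gc x Ux; apply: cvg_pair; [exact: fc|exact: gc].
move=> [fc [df [dfE dfk]]] [gc [dg [dgE dgk]]]; split.
  by move=> x Ux; apply: cvg_pair; [exact: fc|exact: gc].
exists (fun p => (df p, dg p)); split; last exact: IH.
by move=> x v Ux; apply: cvg_pair; [exact: dfE|exact: dgE].
Qed.

Lemma Ck_on_add (W : topologicalLmodType R) k (E : tvsType R)
    (U : set E) (f g : E -> W) :
  Ck_on k U f -> Ck_on k U g -> Ck_on k U (fun x => f x + g x).
Proof.
move=> fk gk; have := Ck_on_lin 1 fk gk.
by congr Ck_on; apply/funext => x; rewrite scale1r.
Qed.

Lemma Ck_on_linear (W : topologicalLmodType R) k (E : tvsType R)
    (U : set E) (L L0 : E -> W) :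
  affine L L0 -> continuous L -> continuous L0 -> Ck_on k U L.
Proof.
elim: k E U L L0 => [|k IH] E U L L0 aL cL cL0; first by move=> x _; exact: cL.
split; first by move=> x _; exact: cL.
have cLs : continuous (L0 \o (snd : E * E -> E)).
  by move=> x; apply: continuous_comp; [exact: cvg_snd|exact: cL0].
exists (L0 \o snd); split.
  move=> x v Ux /=; apply: cvg_near_cst.
  apply: filterS (@nbhs_dnbhs_neq R 0) => h h0.
  by rewrite /diff_quot (aL _ _ _).1 addrC addKr scalerA mulVf ?scale1r.
apply: (IH _ _ _ (L0 \o snd)) => //.
by move=> [x1 x2] [v1 v2] h /=; split; rewrite (aL _ _ _).2.
Qed.

Lemma Ck_on_cst (W : topologicalLmodType R) k (E : tvsType R) (U : set E) (c : W) :
  Ck_on k U (fun=> c).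
Proof.
apply: (@Ck_on_linear _ _ _ _ (fun=> c) (fun=> 0)); last 2 first.
- by move=> x; exact: cvg_cst.
- by move=> x; exact: cvg_cst.
by move=> x v h; rewrite scaler0 !addr0.
Qed.

Lemma Ck_on_scale (W : topologicalLmodType R) k (E : tvsType R)
    (U : set E) (f : E -> R^o) (g : E -> W) :
  open U -> Ck_on k U f -> Ck_on k U g -> Ck_on k U (fun x => f x *: g x).
Proof.
have sc (T : Type) (F : set_system T) (FF : Filter F) (a : T -> R^o) (p : T -> W)
    (l : R^o) (m : W) : a @ F --> l -> p @ F --> m -> (fun t => a t *: p t) @ F --> l *: m.
  move=> al pm; apply: (@continuous2_cvg T R^o W W F FF a p (fun u v => u *: v) l m _ al pm).
  exact: (@scale_continuous R W (l, m)).
elim: k E U f g => [|k IH] E U f g oU.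
  by move=> fc gc x Ux; apply: sc; [exact: fc|exact: gc].
move=> fS gS; have [fc [df [dfE dfk]]] := fS; have [gc [dg [dgE dgk]]] := gS.
split; first by move=> x Ux; apply: sc; [exact: fc|exact: gc].
exists (fun p => df p *: g p.1 + f p.1 *: dg p); split; last first.
  have oU' : open (U `*` [set: E]) by exact: open_setX oU openT.
  by apply: Ck_on_add; apply: IH => //; apply: Ck_on_fst; apply: Ck_on_pred.
move=> x v Ux /=.
have -> : diff_quot (fun x => f x *: g x) x v =
    fun h => diff_quot f x v h *: g x + f (x + h *: v) *: diff_quot g x v h.
  have e1 (a : R) (b : R^o) (w : W) : (a *: b) *: w = a *: (b *: w) by rewrite scalerA.
  have e2 (a : R) (b : R^o) (w : W) : b *: (a *: w) = a *: (b *: w).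
    by rewrite !scalerA mulrC.
  apply/funext => h; rewrite /diff_quot e1 (e2 h^-1 (f (x + h *: v))) -scalerDr; congr (_ *: _).
  by rewrite scalerBl scalerBr [RHS]addrC addrA subrK.
have fxv : (fun h => f (x + h *: v)) @ 0^' --> f x.
  by apply: (@cvg_comp _ _ _ (fun h => x + h *: v) f _ (nbhs x)); [exact: line_cvg|exact: fc].
apply: (@continuous2_cvg _ W W W _ _ _ _ (fun u v => u + v)).
- exact: (@add_continuous W (_, _)).
- by apply: sc; [exact: dfE|exact: cvg_cst].
- by apply: sc => //; exact: dgE.
Qed.

End CkBasics.

(** * Difference quotients with moving base point, and the chain rule *)

Section StrongQuotient.
Context {R : realType}.

Lemma scale_dnbhs0 (c : R) : c != 0 -> (fun k => k * c) @ (0 : R)^' --> (0 : R)^'.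
Proof.
move=> c0 A; rewrite /= !nbhs_simpl /= => A0.
have [e /= e0 eA] : exists2 e : R, 0 < e & forall x, `|x| < e -> x != 0 -> A x.
  move: A0; rewrite /dnbhs /within /= => /nbhs_ballP[e /= e0 eA]; exists e => // x xe.
  by apply: eA; rewrite -ball_normE /= sub0r normrN.
near=> k; apply: eA.
  rewrite normrM -ltr_pdivlMr ?normr_gt0//; near: k.
  apply: nbhs_dnbhs; apply/nbhs_ballP; exists (e / `|c|) => /=.
    by rewrite divr_gt0// normr_gt0.
  by move=> x; rewrite -ball_normE /= sub0r normrN.
by rewrite mulf_neq0//; near: k; exact: nbhs_dnbhs_neq.
Unshelve. all: by end_near. Qed.

(** One neighbourhood of [(y, w, 0)] serves all [s] at once, because [s * hp t] is no larger than
    [hp t]. *)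
Lemma segment_cvg (E : tvsType R) (y w : E) (T : Type) (F : set_system T)
    {FF : Filter F} (yp wp : T -> E) (hp : T -> R) (A : set E) :
  yp @ F --> y -> wp @ F --> w -> hp @ F --> (0 : R) -> nbhs y A ->
  \forall t \near F, forall s, 0 <= s <= 1 -> A (yp t + (s * hp t) *: wp t).
Proof.
move=> yF wF hF yA.
pose f := fun p : E * E * R => p.1.1 + p.2 *: p.1.2.
have : f @ nbhs (y, w, 0 : R) --> y.
  rewrite -[X in _ --> X]addr0 -[X in _ --> _ + X](scale0r w).
  apply: addv_cvg; first by apply: (@cvg_comp _ _ _ fst fst _ (nbhs (y, w))); exact: cvg_fst.
  apply: scalev_cvg; first exact: cvg_snd.
  by apply: (@cvg_comp _ _ _ fst snd _ (nbhs (y, w))); [exact: cvg_fst|exact: cvg_snd].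
move=> /(_ A yA) [[P Q] /= [[[P1 P2] /= [P1y P2w] P12] /nbhs_ballP[e /= e0 eQ]] PQ].
have h1 := yF _ P1y; have h2 := wF _ P2w.
have h3 := hF _ (nbhsx_ballx 0 e e0); rewrite /= !nbhs_simpl /= in h1 h2 h3.
apply: filterS3 h1 h2 h3 => t /= p1 p2 he s /andP[s0 s1].
apply: (PQ (yp t, wp t, s * hp t)); split; first exact: P12.
apply: eQ; move: he; rewrite -!ball_normE /= !sub0r !normrN normrM; apply: le_lt_trans.
by rewrite ger0_norm// ler_piMl.
Qed.

(** Base point, direction and step may vary together. Along the segment joining the two arguments
    the derivative lies in a convex neighbourhood of [dg (y, w)], hence so does the quotient. [Dir]
    limits the directions in which derivatives must exist, so that the lemma also applies when only
    partial derivatives are known. *)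
Lemma strong_quot (E W : tvsType R) (U Dir : set E) (g : E -> W)
    (dg : E * E -> W) (y w : E) (T : Type) (F : set_system T) {FF : Filter F}
    (yp wp : T -> E) (hp : T -> R) :
  open U -> U y ->
  (forall z v, U z -> Dir v -> diff_quot g z v @ 0^' --> dg (z, v)) ->
  {for (y, w), continuous dg} ->
  yp @ F --> y -> wp @ F --> w -> hp @ F --> (0 : R) ->
  (\forall t \near F, hp t != 0) -> (\forall t \near F, Dir (wp t)) ->
  (fun t => (hp t)^-1 *: (g (yp t + hp t *: wp t) - g (yp t))) @ F --> dg (y, w).
Proof.
move=> oU Uy gE dgc yF wF hF h0 wD; apply: cvgv_disk => D dD.
pose N := [set v | D (v - dg (y, w))].
have cN : cvx N by apply: cvx_translate; case: dD.
have Nn : nbhs (dg (y, w)) N.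
  apply/nbhs_translate; case: dD => D0 _ _; apply: filterS D0 => v /=.
  by rewrite /N /= addrAC subrr add0r.
have [[A B] /= [Ay Bw] AB] := dgc _ (nbhs_interior Nn).
have UA : nbhs y (U `&` A) by apply: filterI => //; exact: open_nbhs_nbhs.
have seg := segment_cvg yF wF hF UA.
have wB := wF _ Bw; rewrite /= nbhs_simpl /= in wB.
near=> t.
have h0t : hp t != 0 by near: t; exact: h0.
have segt : forall s, 0 <= s <= 1 -> (U `&` A) (yp t + (s * hp t) *: wp t).
  by near: t; exact: seg.
have wDt : Dir (wp t) by near: t; exact: wD.
have wBt : B (wp t) by near: t; exact: wB.
(* With this scaling the derivative of [gam] is a value of [dg], and its increment over [0, 1] is
   the quotient. *)
pose gam s := (hp t)^-1 *: g (yp t + (s * hp t) *: wp t).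
have := @mvt_cvx R W gam (fun s => dg (yp t + (s * hp t) *: wp t, wp t)) N cN.
rewrite /gam mul1r mul0r scale0r addr0 -scalerBr /=; apply.
move=> s s01; have [Us As] := segt s s01.
split; last exact: (AB (_, _)).
have := gE _ _ Us wDt; move=> /(cvg_comp _ _ (scale_dnbhs0 h0t)).
apply: cvg_trans; apply: near_eq_cvg; near=> k.
rewrite /diff_quot /=.
rewrite invfM -(scalerA k^-1) -scalerBr; congr (_ *: (_ *: (g _ - _))).
by rewrite -addrA -scalerDl -mulrDl.
Unshelve. all: by end_near. Qed.

Lemma Ck_on_succ (W : preTopologicalLmodType R) k (E : tvsType R) (U : set E) (f : E -> W) :
  Ck_on k.+1 U f -> (forall x, U x -> {for x, continuous f}) /\
    exists df : E * E -> W,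
      (forall x v, U x -> diff_quot f x v @ 0^' --> df (x, v)) /\
      @Ck_on R W k (E * E)%type (U `*` setT) df.
Proof. by []. Qed.

(** The quotient of [g \o f] is a quotient of [g] at [f x] whose direction is itself the quotient of
    [f], so [strong_quot] gives the derivative. The tangent map is a composite of the same kind on
    larger spaces, whence an induction over all spaces at once. *)
Lemma Ck_on_comp k (E E' W : tvsType R) (U : set E) (U' : set E') (f : E -> E')
    (g : E' -> W) :
  open U -> open U' -> (forall x, U x -> U' (f x)) ->
  Ck_on k U f -> Ck_on k U' g -> Ck_on k U (g \o f).
Proof.
elim: k E E' U U' f g => [|k IH] E E' U U' f g oU oU' UU fS gS.
  by move=> x Ux; apply: continuous_comp; [exact: fS|exact: gS (UU _ Ux)].
have [fc [df [dfE dfk]]] := Ck_on_succ fS.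
have [gc [dg [dgE dgk]]] := Ck_on_succ gS; split.
  by move=> x Ux; apply: continuous_comp; [exact: fc|exact: gc (UU _ Ux)].
exists (fun p => dg (f p.1, df p)); split; last first.
  apply: (IH _ _ (U `*` setT) (U' `*` setT) (fun p => (f p.1, df p)) dg) => //.
  - exact: open_setX oU openT.
  - exact: open_setX oU' openT.
  - by move=> [x v] [/= /UU].
  by apply: Ck_on_pair => //; apply: Ck_on_fst; apply: Ck_on_pred.
move=> x v Ux /=.
have dgc : {for (f x, df (x, v)), continuous dg}.
  by apply: (Ck_on_cont dgk); split => //; exact: UU.
have H : (fun h : R => h^-1 *: (g (f x + h *: diff_quot f x v h) - g (f x)))
    @ (0 : R)^' --> dg (f x, df (x, v)).
  apply: (@strong_quot E' W U' setT g dg (f x) (df (x, v)) R (0 : R)^' _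
    (fun=> f x) (diff_quot f x v) id oU' (UU _ Ux)) => //.
  - by move=> z w Uz _; exact: dgE.
  - exact: cvg_cst.
  - exact: dfE.
  - exact: nbhs_dnbhs.
  - exact: nbhs_dnbhs_neq.
  - exact: filterS filterT.
apply: cvg_eq_near H; near=> h.
have h0 : h != 0 by near: h; exact: nbhs_dnbhs_neq.
rewrite {2}/diff_quot /=; congr (_ *: (g _ - _)).
by rewrite /diff_quot scalerA mulfV// scale1r addrC subrK.
Unshelve. all: by end_near. Qed.

End StrongQuotient.

Lemma subrACA (V : zmodType) (a b c d : V) : a - b - (c - d) = a - c - (b - d).
Proof. by rewrite !opprB addrACA [RHS]addrACA [- b - c]addrC. Qed.

(** * Canonical derivatives, their linearity and symmetry, and a smoothness criterion *)

Section Canonical.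
Context {R : realType}.

Section Hausdorff.
Variable W : preTopologicalLmodType R.
Hypothesis hW : hausdorff_space W.

Lemma cvg_dderive (E : tvsType R) (f : E -> W) x v l :
  diff_quot f x v @ 0^' --> l -> dderive v f x = l.
Proof.
move=> fl; rewrite /dderive; case: xgetP => [y _ yl|/(_ l)//].
exact: cvg_unique yl fl.
Qed.

Lemma dderive_eq (E : tvsType R) (U : set E) (f g : E -> W) x v :
  open U -> (forall x, U x -> f x = g x) -> U x -> dderive v f x = dderive v g x.
Proof.
move=> oU fg Ux; rewrite /dderive; congr xget.
apply/seteqP; split=> l /= H; first exact: (diff_quot_eq oU fg Ux H).
exact: (diff_quot_eq oU (fun y Uy => esym (fg y Uy)) Ux H).
Qed.

(** Limits being unique, the tangent map hidden in [Ck_on] agrees on [U] with a canonical one. Being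
    C^k thereby becomes a local property, as no choice of tangent maps has to be glued. *)
Lemma Ck_on_tan k (E : tvsType R) (U : set E) (f : E -> W) : open U ->
  Ck_on k.+1 U f ->
  (forall x v, U x -> diff_quot f x v @ 0^' --> dderive v f x) /\
  @Ck_on R W k (E * E)%type (U `*` setT) (fun p => dderive p.2 f p.1).
Proof.
move=> oU /Ck_on_succ[_ [df [dfE dfk]]]; have dd x v : U x -> df (x, v) = dderive v f x.
  by move=> Ux; rewrite (cvg_dderive (dfE x v Ux)).
split; first by move=> x v Ux; rewrite -dd//; exact: dfE.
apply: Ck_on_eq dfk; first exact: open_setX oU openT.
by move=> [x v] [/= Ux _]; exact: dd.
Qed.

Lemma Ck_on_local k (E : tvsType R) (U : set E) (f : E -> W) :
  (forall x, U x -> exists2 V, open V /\ V x & Ck_on k V f) -> Ck_on k U f.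
Proof.
elim: k E U f => [|k IH] E U f H.
  by move=> x /H[V [oV Vx]] h; exact: (h x Vx).
split; first by move=> x /H[V [oV Vx]] [h _]; exact: h.
exists (fun p => dderive p.2 f p.1); split.
  by move=> x v /H[V [oV Vx]] /(Ck_on_tan oV)[h _]; exact: h.
apply: IH => -[x v] [/= /H[V [oV Vx]] /(Ck_on_tan oV)[_ h] _].
by exists (V `*` setT) => //; split => //; exact: open_setX oV openT.
Qed.

Lemma smooth_on_local (E : tvsType R) (U : set E) (f : E -> W) :
  (forall x, U x -> exists2 V, open V /\ V x & smooth_on V f) -> smooth_on U f.
Proof.
by move=> H k; apply: Ck_on_local => x /H[V oV sV]; exists V.
Qed.

Variables (E : tvsType R) (U : set E) (f : E -> W).
Hypotheses (oU : open U) (sf : smooth_on U f).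

Lemma smooth_cvg x v : U x -> diff_quot f x v @ 0^' --> dderive v f x.
Proof. by move=> Ux; apply: (Ck_on_tan oU (sf 1)).1. Qed.

Lemma smooth_tan :
  @smooth_on R (E * E)%type W (U `*` setT) (fun p => dderive p.2 f p.1).
Proof. by move=> k; apply: (Ck_on_tan oU (sf k.+1)).2. Qed.

Lemma affine_pairv (v : E) : affine (fun x : E => (x, v)) (fun x => (x, 0)).
Proof.
move=> x w h; split; (apply/pair_equal_spec; split=> //=); by rewrite scaler0 addr0.
Qed.

Lemma smooth_dderive v : smooth_on U (dderive v f).
Proof.
move=> k; have := smooth_tan k.
apply: (@Ck_on_affine _ _ _ _ (E * E)%type _ _ _ (fun x => (x, v)) (fun x => (x, 0))).
- exact: affine_pairv.
- by move=> x; apply: cvg_pair; [exact: cvg_id|exact: cvg_cst].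
- by move=> x; apply: cvg_pair; [exact: cvg_id|exact: cvg_cst].
- by [].
Qed.

Lemma smooth_cont x : U x -> {for x, continuous f}.
Proof. exact: (sf 0). Qed.

End Hausdorff.

Lemma smooth_on_dderives (W : preTopologicalLmodType R) (E : tvsType R)
    (U : set E) (f : E -> W) (s : seq E) : hausdorff_space W ->
  open U -> smooth_on U f -> smooth_on U (dderives s f).
Proof.
by move=> hW oU sf; elim: s => [//|v s IH]; apply: smooth_dderive.
Qed.

Section Linearity.
Variables (E W : tvsType R).
Hypothesis hW : hausdorff_space W.

Lemma diff_quot_scale (f : E -> W) x v (a : R) (l : W) :
  diff_quot f x v @ 0^' --> l -> diff_quot f x (a *: v) @ 0^' --> a *: l.
Proof.
move=> fl; have [->|a0] := eqVneq a 0.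
  rewrite !scale0r; apply: cvg_near_cst; apply: filterS filterT => h _.
  by rewrite /diff_quot scaler0 addr0 subrr scaler0.
have := cvg_comp _ _ (scale_dnbhs0 a0) fl.
move=> /(@scalev_cvg _ W _ _ _ (fun=> a) _ a l (cvg_cst _)).
apply: cvg_trans; apply: near_eq_cvg; near=> h => /=.
rewrite /diff_quot !scalerA; congr (_ *: _).
by rewrite invfM mulrCA mulfV// mulr1.
Unshelve. all: by end_near. Qed.

(** Continuous partial derivatives suffice: one moves along one vector at a time, from a base point
    that depends on [h], as [strong_quot] allows. The [e i] may be any vectors, so that two of them
    already give additivity of the derivative. *)
Lemma partial_sum_cvg (I : Type) (e : I -> E) (U : set E) (f : E -> W)
    (g : I -> E -> W) (c : I -> R) (s : seq I) x :
  open U -> (forall x, U x -> {for x, continuous f}) ->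
  (forall i x, U x -> {for x, continuous (g i)}) ->
  (forall i x, U x -> diff_quot f x (e i) @ 0^' --> g i x) -> U x ->
  diff_quot f x (\sum_(i <- s) c i *: e i) @ 0^' --> \sum_(i <- s) c i *: g i x.
Proof.
move=> oU fc gc fg Ux; elim: s => [|j s IH].
  rewrite !big_nil; apply: cvg_near_cst; apply: filterS filterT => h _.
  by rewrite /diff_quot scaler0 addr0 subrr scaler0.
rewrite !big_cons; set w := \sum_(i <- s) _ in IH *.
have H : (fun h : R => h^-1 *: (f ((x + h *: w) + h *: (c j *: e j)) - f (x + h *: w)))
    @ 0^' --> c j *: g j x.
  apply: (@strong_quot R E W U [set c j *: e j] f (fun p => c j *: g j p.1) x
    (c j *: e j) _ _ _ (fun h => x + h *: w) (fun=> c j *: e j) id oU Ux).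
  - by move=> z v Uz ->; apply: diff_quot_scale; exact: fg.
  - apply: (@scalev_cvg _ _ _ _ _ (fun=> c j)); first exact: cvg_cst.
    by apply: (@cvg_comp _ _ _ fst (g j) _ (nbhs x)); [exact: cvg_fst|exact: gc].
  - exact: line_cvg.
  - exact: cvg_cst.
  - exact: nbhs_dnbhs.
  - exact: nbhs_dnbhs_neq.
  - exact: filterS filterT.
apply: cvg_eq_near (addv_cvg H IH); near=> h => /=.
rewrite /diff_quot -scalerDr addrA subrK; congr (_ *: (f _ - _)).
by rewrite -addrA -scalerDr [w + _]addrC.
Unshelve. all: by end_near. Qed.

Lemma dderive_linear (U : set E) (f : E -> W) x : open U -> smooth_on U f ->
  U x -> linear (fun v => dderive v f x).
Proof.
move=> oU sf Ux a u v.
have := @partial_sum_cvg bool (fun b => if b then u else v) U f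
  (fun b => if b then dderive u f else dderive v f)
  (fun b => if b then a else 1) [:: true; false] x oU (sf 0).
rewrite !big_cons !big_nil !addr0 !scale1r => H; apply: cvg_dderive => //.
apply: H => //; case=> y Uy.
- exact: (smooth_dderive hW oU sf u 0).
- exact: (smooth_dderive hW oU sf v 0).
- exact: (smooth_cvg hW oU sf Uy).
- exact: (smooth_cvg hW oU sf Uy).
Qed.

(** The second difference quotient [Q] is symmetric in its two directions. The mean value inclusion
    in one direction shows that it tends to the iterated derivative, in either order. *)
Lemma dderiveC (U : set E) (f : E -> W) x u v : open U -> smooth_on U f ->
  U x -> dderive u (dderive v f) x = dderive v (dderive u f) x.
Proof.
move=> oU sf Ux.
pose Q u v h := h^-1 *: (h^-1 *: (f (x + h *: u + h *: v) - f (x + h *: u) -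
  (f (x + h *: v) - f x))).
suff H a b : Q a b @ 0^' --> dderive b (dderive a f) x.
  have h1 := H v u; have QC : Q v u = Q u v.
    apply/funext => h; rewrite /Q [x + h *: v + _]addrAC; congr (_ *: (_ *: _)).
    exact: subrACA.
  by rewrite QC in h1; exact: (cvg_unique hW h1 (H u v)).
apply: cvgv_disk => D dD.
set L := dderive b (dderive a f) x.
pose N := [set w | D (w - L)].
have cN : cvx N by apply: cvx_translate; case: dD.
have Nn : nbhs L N.
  apply/nbhs_translate; case: dD => D0 _ _; apply: filterS D0 => w /=.
  by rewrite /N /= addrAC subrr add0r.
have dnF : Filter (0 : R)^' by exact: _.
have cx (z : E) : (fun _ : R => z) @ (0 : R)^' --> z by exact: cvg_cst.
(* The step [h] tends to 0 uniformly in the position [s] on the segment. *)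
pose F : set_system (R * R) := filter_prod (0 : R)^' (globally [set s : R | 0 <= s <= 1]).
have FF : Filter F by exact: filter_prod_filter.
have sa := smooth_dderive hW oU sf a.
have yF : (fun p : R * R => x + (p.2 * p.1) *: a) @ F --> x.
  move=> A xA; have := @segment_cvg R E x a R (0 : R)^' dnF (fun=> x) (fun=> a) id A
    (cx _) (cx _) (@nbhs_dnbhs _ _) xA.
  move=> hA; exists ([set h | forall s, 0 <= s <= 1 -> A (x + (s * h) *: a)], [set s : R | 0 <= s <= 1]) => /=.
    by split; first exact: hA.
  by move=> [h s] /= [hh s01]; apply: hh.
have F1 (P : set R) : (\forall h \near (0 : R)^', P h) -> \forall p \near F, P p.1.
  by move=> HP; exists (P, setT) => [|[? ?] []//]; split.
have := @strong_quot R E W U setT (dderive a f) (fun p => dderive p.2 (dderive a f) p.1)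
  x b _ F FF (fun p => x + (p.2 * p.1) *: a) (fun=> b) fst oU Ux.
move=> /(_ (fun z w Uz _ => smooth_cvg hW oU sa Uz)).
move=> /(_ (smooth_tan hW oU sa 0 (x, b) (conj Ux I)) yF (cvg_cst _)).
move=> /(_ (fun A hA => F1 _ (nbhs_dnbhs hA)) (F1 _ (@nbhs_dnbhs_neq _ _))).
move=> /(_ (filterS (fun _ _ => I) filterT)).
move=> /(_ _ (nbhs_interior Nn)) [[P1 P2] /= [P1h P2s] P12].
have Uab : \forall h \near (0 : R)^', forall s, 0 <= s <= 1 ->
    U (x + (s * h) *: a) /\ U (x + h *: b + (s * h) *: a).
  have h1 := @segment_cvg R E x a R (0 : R)^' dnF (fun=> x) (fun=> a) id U
    (cx _) (cx _) (@nbhs_dnbhs _ _) (open_nbhs_nbhs (conj oU Ux)).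
  have h2 := @segment_cvg R E x a R (0 : R)^' dnF (fun h => x + h *: b) (fun=> a) id U
    (line_cvg b) (cx _) (@nbhs_dnbhs _ _) (open_nbhs_nbhs (conj oU Ux)).
  by apply: filterS2 h1 h2 => h h1 h2 s s01; split; [exact: h1|exact: h2].
near=> h.
have h0 : h != 0 by near: h; exact: nbhs_dnbhs_neq.
have P1h' : P1 h by near: h.
have Uh : forall s, 0 <= s <= 1 -> U (x + (s * h) *: a) /\ U (x + h *: b + (s * h) *: a).
  by near: h.
pose gam s := h^-1 *: (h^-1 *: (f (x + h *: b + (s * h) *: a) - f (x + (s * h) *: a))).
have := @mvt_cvx R W gam (fun s => h^-1 *: (dderive a f (x + (s * h) *: a + h *: b) -
  dderive a f (x + (s * h) *: a))) N cN.
rewrite /gam !mul1r !mul0r !scale0r !addr0 -!scalerBr /N /Q /=.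
rewrite [x + h *: b + h *: a]addrAC; apply.
move=> s s01; have [U1 U2] := Uh s s01; split; last by apply: (P12 (h, s)); split => //; exact: P2s.
rewrite [x + h *: b + (s * h) *: a]addrAC in U2 *.
apply: cvg_eq_near (@scalev_cvg _ _ _ _ _ (fun=> h^-1) _ (h^-1) _ (cvg_cst _)
  (subv_cvg (cvg_comp _ _ (scale_dnbhs0 h0) (smooth_cvg hW oU sf U2))
  (cvg_comp _ _ (scale_dnbhs0 h0) (smooth_cvg hW oU sf U1)))); near=> k => /=.
have e1 : x + (s * h) *: a + h *: b + (k * h) *: a = x + h *: b + ((s + k) * h) *: a.
  by rewrite mulrDl scalerDl addrA [x + h *: b + _]addrAC.
have e2 : x + (s * h) *: a + (k * h) *: a = x + ((s + k) * h) *: a.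
  by rewrite mulrDl scalerDl addrA.
rewrite /diff_quot e1 e2 -!scalerBr !scalerA; congr (_ *: _).
  by rewrite invfM mulrCA mulrA.
exact: subrACA.
Unshelve. all: by end_near. Qed.

End Linearity.

Section Criterion.
Variables (E W : tvsType R).

(** Finite dimension in the form used below: every vector is expanded along the [e i] with
    continuous linear coefficients. *)
Definition fdim (I : finType) (e : I -> E) (phi : I -> E -> R^o) : Prop :=
  [/\ forall i, linear (phi i), forall i, continuous (phi i) &
      forall x, x = \sum_i phi i x *: e i].

(* A coinduction principle for smoothness. *)
Lemma smooth_crit (I : finType) (e : I -> E) (phi : I -> E -> R^o) (U : set E)
    (S : set (E -> W)) :
  fdim e phi -> open U ->
  (forall f, S f -> (forall x, U x -> {for x, continuous f}) /\
     forall i, exists2 g, S g & forall x, U x -> diff_quot f x (e i) @ 0^' --> g x) ->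
  forall f, S f -> smooth_on U f.
Proof.
move=> [lphi cphi xE] oU HS f Sf k; elim: k f Sf => [|k IH] f Sf; first exact: (HS f Sf).1.
have [fc fg] := HS f Sf; split=> //.
have /choice[g gP] : forall i, exists g, S g /\
    forall x, U x -> diff_quot f x (e i) @ 0^' --> g x.
  by move=> i; have [g ? ?] := fg i; exists g.
(* The tangent map expanded in partial derivatives. The [g i] belong to [S], so the induction
   hypothesis makes it C^k. *)
exists (fun p => \sum_i phi i p.2 *: g i p.1); split.
  move=> x v Ux; rewrite /= {1}[v]xE.
  apply: (@partial_sum_cvg E W I e U f g (fun i => phi i v)) => //.
  - by move=> i y; apply: (HS _ (gP i).1).1.
  - by move=> i; apply: (gP i).2.
rewrite -[Ck_on _ _ _]/(@Ck_on R W k (E * E)%type _ _).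
have -> : (fun p : E * E => \sum_i phi i p.2 *: g i p.1) =
    (\sum_i (fun p : E * E => phi i p.2 *: g i p.1)).
  by apply/funext => p; rewrite fct_sumE.
elim/big_ind: _ => [|F G Fk Gk|i _]; first exact: Ck_on_cst.
  exact: Ck_on_add.
apply: Ck_on_scale; first exact: open_setX oU openT.
  apply: (@Ck_on_linear _ R^o _ _ _ _ (fun p : E * E => phi i p.2)).
  - have L0 : phi i 0 = 0.
      by have := lphi i (-1) 0 0; rewrite !scaleN1r !addNr.
    by move=> [x1 x2] [v1 v2] h /=; rewrite addrC lphi addrC.
  - by move=> x; apply: (@cvg_comp _ _ _ snd (phi i) _ (nbhs x.2)); [exact: cvg_snd|exact: cphi].
  - by move=> x; apply: (@cvg_comp _ _ _ snd (phi i) _ (nbhs x.2)); [exact: cvg_snd|exact: cphi].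
by apply: Ck_on_fst; apply: IH; case: (gP i).
Qed.

End Criterion.

Lemma derive_dderive (E : normedModType R) (W : normedModType R) (U : set E)
    (f : E -> W) x v : open U -> smooth_on U f -> U x -> 'D_v f x = dderive v f x.
Proof.
move=> oU sf Ux; rewrite /derive; apply: cvg_lim; first exact: norm_hausdorff.
apply: cvg_eq_near (@smooth_cvg W (@norm_hausdorff _ W) E U f oU sf x v Ux).
apply: filterS filterT => h _.
by rewrite /diff_quot /= [x + _]addrC.
Qed.

End Canonical.

(** * Plots *)

Section Matrices.
Context {R : realType}.

Lemma mx_entry_continuous m n (i : 'I_m) (j : 'I_n) :
  continuous (fun y : 'M[R]_(m, n) => y i j : R^o).
Proof. exact: coord_continuous. Qed.

Lemma mx_entry_linear m n (i : 'I_m) (j : 'I_n) :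
  linear (fun y : 'M[R]_(m, n) => y i j : R^o).
Proof. by move=> a u v; rewrite !mxE. Qed.

Lemma fdim_mx m n : @fdim R 'M[R]_(m, n) _
  (fun p : 'I_m * 'I_n => delta_mx p.1 p.2) (fun p y => y p.1 p.2).
Proof.
split.
- by move=> p; exact: mx_entry_linear.
- by move=> p; exact: mx_entry_continuous.
- move=> y; rewrite {1}[y]matrix_sum_delta pair_big /=.
  by apply: eq_bigr => p _.
Qed.

Lemma fdim_R : @fdim R R^o unit (fun=> 1) (fun _ t => t).
Proof.
split=> [i|i|x]; first by move=> a u v.
- by move=> x; exact: cvg_id.
- by rewrite (big_pred1 tt) ?/GRing.scale /= ?mulr1// => -[].
Qed.

Lemma fdim_prod (E E' : tvsType R) I I' e phi e' phi' :
  @fdim R E I e phi -> @fdim R E' I' e' phi' ->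
  @fdim R (E * E')%type (I + I')%type
    (fun s => match s with inl i => (e i, 0) | inr i => (0, e' i) end)
    (fun s x => match s with inl i => phi i x.1 | inr i => phi' i x.2 end).
Proof.
move=> [l1 c1 x1] [l2 c2 x2]; split.
- by case=> i a [u1 u2] [v1 v2] /=; [exact: l1|exact: l2].
- case=> i x /=.
    by apply: (@cvg_comp _ _ _ fst (phi i) _ (nbhs x.1)); [exact: cvg_fst|exact: c1].
  by apply: (@cvg_comp _ _ _ snd (phi' i) _ (nbhs x.2)); [exact: cvg_snd|exact: c2].
- move=> [u v]; rewrite big_sumType /=.
  have -> : \sum_i phi i u *: ((e i, 0) : E * E') = (u, 0).
    rewrite {2}[u]x1; elim/big_ind2: _ => // [? ? ? ? -> ->|i _].
      by apply/pair_equal_spec; rewrite /= addr0.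
    by apply/pair_equal_spec; rewrite /= scaler0.
  have -> : \sum_i phi' i v *: ((0, e' i) : E * E') = (0, v).
    rewrite {2}[v]x2; elim/big_ind2: _ => // [? ? ? ? -> ->|i _].
      by apply/pair_equal_spec; rewrite /= addr0.
    by apply/pair_equal_spec; rewrite /= scaler0.
  by apply/pair_equal_spec; rewrite /= addr0 add0r.
Qed.

Lemma Ck_on_mx k (E : tvsType R) (U : set E) m n (f : E -> 'M[R]_(m, n)) :
  open U -> (forall i j, Ck_on k U (fun x => f x i j : R^o)) ->
  @Ck_on R ('M[R]_(m, n) : tvsType R) k E U f.
Proof.
move=> oU H.
have -> : f = \sum_(p : 'I_m * 'I_n) (fun x => f x p.1 p.2 *: delta_mx p.1 p.2).
  apply/funext => x; rewrite fct_sumE {1}[f x]matrix_sum_delta pair_big /=.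
  by apply: eq_bigr.
elim/big_ind: _ => [|F G Fk Gk|i _]; first exact: Ck_on_cst.
  exact: Ck_on_add.
by apply: Ck_on_scale => //; apply: Ck_on_cst.
Qed.

Lemma Ck_on_mx_entry k (E : tvsType R) (U : set E) m n (f : E -> 'M[R]_(m, n)) i j :
  @Ck_on R ('M[R]_(m, n) : tvsType R) k E U f -> Ck_on k U (fun x => f x i j : R^o).
Proof.
move=> fk; have := @Ck_on_lincomp R ('M[R]_(m, n) : tvsType R) R^o k E U f
  (fun y : 'M[R]_(m, n) => y i j) (@mx_entry_linear m n i j).
by apply => //; exact: mx_entry_continuous.
Qed.

Lemma linear_affine (E E' : lmodType R) (L : E -> E') : linear L -> affine L L.
Proof.
move=> lL x v h; suff : L (x + h *: v) = L x + h *: L v by [].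
by rewrite addrC lL addrC.
Qed.

Lemma row_linear m n (i : 'I_m) : linear (@row R m n i).
Proof. by move=> a u v; apply/matrixP => p q; rewrite !mxE. Qed.

Lemma row_continuous m n (i : 'I_m) : continuous (@row R m n i).
Proof.
move=> y; apply: (@Ck_on_mx 0 _ setT _ _ (row i) openT) => // p q.
move=> x _; have -> : (fun z : 'M[R]_(m, n) => row i z p q : R^o) = fun z => z i q.
  by apply/funext => z; rewrite mxE.
exact: mx_entry_continuous.
Qed.

End Matrices.

Section Plots.
Context {R : realType}.

(** The manifold axioms without countability, separation and smooth transitions. This part passes to
    products at once and is what most lemmas on plots require. *)
Definition chart_cover (T : topologicalType) (E : tvsType R) (A : set (chart T E)) :=
  (forall x, exists2 c, A c & dom c x) /\ (forall c, A c -> is_chart c).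

Lemma manifold_cover (T : topologicalType) (E : tvsType R) (A : set (chart T E)) :
  smooth_manifold A -> chart_cover A.
Proof. by case. Qed.

Lemma open_preim (T T' : topologicalType) (U : set T) (p : T -> T') (O : set T') :
  open U -> (forall x, U x -> {for x, continuous p}) -> open O ->
  open (U `&` p @^-1` O).
Proof.
move=> oU cp oO; rewrite openE => x [Ux Ox].
apply: filterI; first exact: open_nbhs_nbhs.
by apply: (cp x Ux); apply: open_nbhs_nbhs.
Qed.

Lemma img_dom (T E : Type) (c : chart T E) x : dom c x -> img c (crd c x).
Proof. by move=> cx; exists x. Qed.

Section ChartFacts.
Variables (T : topologicalType) (E : tvsType R) (c : chart T E).
Hypothesis hc : is_chart c.

Lemma chart_openD : open (dom c). Proof. by case: hc. Qed.
Lemma chart_openI : open (img c). Proof. by case: hc. Qed.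
Lemma chartK x : dom c x -> prm c (crd c x) = x. Proof. by move=> cx; case: hc => _ _ h _ _; exact: h. Qed.
Lemma dom_prm y : img c y -> dom c (prm c y).
Proof. by move=> [x cx <-]; rewrite chartK. Qed.
Lemma prmK y : img c y -> crd c (prm c y) = y.
Proof. by move=> [x cx <-]; rewrite chartK. Qed.
Lemma crd_cont x : dom c x -> {for x, continuous (crd c)}.
Proof. by move=> cx; case: hc => _ _ _ h _; exact: h. Qed.
Lemma prm_cont y : img c y -> {for y, continuous (prm c)}.
Proof. by move=> cx; case: hc => _ _ _ _ h; exact: h. Qed.

Lemma crd_imageE (P : set T) : crd c @` (dom c `&` P) = img c `&` prm c @^-1` P.
Proof.
apply/seteqP; split=> y /=.
  by move=> [x [cx Px] <-]; split; [exact: img_dom|rewrite /= chartK].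
by move=> [cy Py]; exists (prm c y); [split=> //; exact: dom_prm|exact: prmK].
Qed.

End ChartFacts.

(** A smooth map from an open set of a vector space to a manifold. Maps built from multiplication,
    inversion and the action are recognized as smooth by composing plots, without computing in
    charts. *)
Definition plot (T : topologicalType) (E : tvsType R) (A : set (chart T E))
    (E0 : tvsType R) (U : set E0) (p : E0 -> T) : Prop :=
  (forall x, U x -> {for x, continuous p}) /\
  forall d, A d -> smooth_on (U `&` p @^-1` dom d) (crd d \o p).

Section OneManifold.
Variables (T : topologicalType) (E : tvsType R) (A : set (chart T E)).

Lemma plot_prm c : smooth_manifold A -> A c -> plot A (img c) (prm c).
Proof.
move=> [_ _ _ hA hcd] Ac; split; first exact: prm_cont (hA _ Ac).
by move=> d Ad; rewrite -crd_imageE; [exact: hcd|exact: hA].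
Qed.

Lemma plot_precomp (E0 E1 : tvsType R) (U : set E0) (U' : set E1) (p : E0 -> T)
    (g : E1 -> E0) : open U -> open U' -> chart_cover A ->
  (forall x, U' x -> U (g x)) -> smooth_on U' g -> plot A U p -> plot A U' (p \o g).
Proof.
move=> oU oU' [_ hA] gU sg [pc ps]; split.
  move=> x Ux; apply: continuous_comp; first exact: (sg 0 x Ux).
  by apply: pc; exact: gU.
move=> d Ad k.
have pgc x : U' x -> {for x, continuous (p \o g)}.
  by move=> Ux; apply: continuous_comp; [exact: (sg 0 x Ux)|apply: pc; exact: gU].
apply: (@Ck_on_comp _ k _ _ _ _ (U `&` p @^-1` dom d) g (crd d \o p)).
- by apply: open_preim => //; apply: chart_openD; exact: hA.
- by apply: open_preim => //; apply: chart_openD; exact: hA.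
- by move=> x [/gU].
- by apply: Ck_on_sub (sg k) => x [].
- exact: ps.
Qed.

Lemma plot_sub (E0 : tvsType R) (U U' : set E0) (p : E0 -> T) :
  U' `<=` U -> plot A U p -> plot A U' p.
Proof.
move=> UU [pc ps]; split; first by move=> x /UU /pc.
by move=> d Ad k; apply: Ck_on_sub (ps d Ad k) => x [/UU].
Qed.

Lemma plot_cst (E0 : tvsType R) (U : set E0) t : plot A U (fun=> t).
Proof.
split; first by move=> x _; exact: cvg_cst.
by move=> d Ad k; apply: Ck_on_cst.
Qed.

Lemma plot_fun (W : tvsType R) (E0 : tvsType R) (U : set E0) (p : E0 -> T)
    (f : T -> W) : hausdorff_space W -> chart_cover A -> open U -> plot A U p ->
  smooth_fun A f -> smooth_on U (f \o p).
Proof.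
move=> hW [hcov hA] oU [pc ps] sf; apply: smooth_on_local => // x Ux.
have [d Ad dx] := hcov (p x).
have oV : open (U `&` p @^-1` dom d).
  by apply: open_preim => //; apply: chart_openD; exact: hA.
exists (U `&` p @^-1` dom d) => // k.
apply: (@Ck_on_eq _ _ _ _ _ ((f \o prm d) \o (crd d \o p))) => //.
  by move=> y [_ dy] /=; rewrite chartK//; exact: hA.
apply: (@Ck_on_comp _ k _ _ _ _ (img d)) => //.
- by apply: chart_openI; exact: hA.
- by move=> y [_ dy]; exact: img_dom.
- exact: ps.
- exact: sf.
Qed.

Lemma plot_map (T' : topologicalType) (E' : tvsType R) (A' : set (chart T' E'))
    (E0 : tvsType R) (U : set E0) (p : E0 -> T) (f : T -> T') :
  hausdorff_space E' -> chart_cover A -> chart_cover A' -> open U -> plot A U p ->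
  smooth_map A A' f -> plot A' U (f \o p).
Proof.
move=> hE' [hcov hA] [_ hA'] oU [pc ps] [fc sf].
have fpc x : U x -> {for x, continuous (f \o p)}.
  by move=> Ux; apply: continuous_comp; [exact: pc|exact: fc].
split=> // d' Ad'; apply: smooth_on_local => // x [Ux dx'].
have [d Ad dx] := hcov (p x).
pose V := (U `&` p @^-1` dom d) `&` (U `&` (f \o p) @^-1` dom d').
have oV : open V.
  apply: openI; apply: open_preim => //; apply: chart_openD; first exact: hA.
  exact: hA'.
exists V => // k.
apply: (@Ck_on_eq _ _ _ _ _ ((crd d' \o f \o prm d) \o (crd d \o p))) => //.
  by move=> y [[_ dy] _] /=; rewrite chartK//; exact: hA.
have hd := hA _ Ad; have hd' := hA' _ Ad'.
apply: (@Ck_on_comp _ k _ _ _ _ (crd d @` (dom d `&` f @^-1` dom d'))) => //.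
- rewrite crd_imageE//; apply: (@open_preim _ _ (img d) (prm d)).
  + exact: chart_openI.
  + exact: prm_cont.
  + by apply: open_comp => [y _|]; [exact: fc|exact: chart_openD].
- by move=> y [[_ dy] [_ dy']]; exists (p y).
- by apply: Ck_on_sub (ps d Ad k) => y [].
- exact: sf.
Qed.

Lemma smooth_map_plot (T' : topologicalType) (E' : tvsType R) (A' : set (chart T' E'))
    (f : T -> T') : hausdorff_space E' -> smooth_manifold A -> continuous f ->
  (forall c, A c -> plot A' (img c) (f \o prm c)) -> smooth_map A A' f.
Proof.
move=> hE' [_ _ _ hA _] fc H; split=> // c d Ac Ad.
by rewrite crd_imageE; [exact: (H c Ac).2|exact: hA].
Qed.

End OneManifold.

Section Products.
Variables (T T' : topologicalType) (E E' : tvsType R).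
Variables (A : set (chart T E)) (A' : set (chart T' E')).

Lemma prod_cover : chart_cover A -> chart_cover A' -> chart_cover (prod_atlas A A').
Proof.
move=> [cA hA] [cA' hA']; split.
  move=> [x y]; have [c Ac cx] := cA x; have [d Ad dy] := cA' y.
  by eexists; [exists c => //; exists d|].
move=> _ [c Ac [d Ad <-]]; have hc := hA _ Ac; have hd := hA' _ Ad.
have imE : forall u v, (exists2 x, (dom c `*` dom d) x & (crd c x.1, crd d x.2) = (u, v)) ->
    img c u /\ img d v.
  by move=> u v [[x y] [/= cx dy] [<- <-]]; split; exact: img_dom.
split.
- by apply: open_setX; exact: chart_openD.
- rewrite /img /=; have -> : (fun p : T * T' => (crd c p.1, crd d p.2)) @` (dom c `*` dom d) = img c `*` img d.
    apply/seteqP; split; first by move=> [u v] /imE.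
    by move=> [u v] [[x cx /= <-] [y dy <-]]; exists (x, y).
  by apply: open_setX; exact: chart_openI.
- by move=> [x y] [/= cx dy]; rewrite !chartK.
- move=> [x y] [/= cx dy]; apply: cvg_pair => /=.
    by apply: (@cvg_comp _ _ _ fst (crd c) _ (nbhs x)); [exact: cvg_fst|exact: crd_cont].
  by apply: (@cvg_comp _ _ _ snd (crd d) _ (nbhs y)); [exact: cvg_snd|exact: crd_cont].
- move=> [u v] /imE[/= cu dv]; apply: cvg_pair => /=.
    by apply: (@cvg_comp _ _ _ fst (prm c) _ (nbhs u)); [exact: cvg_fst|exact: prm_cont].
  by apply: (@cvg_comp _ _ _ snd (prm d) _ (nbhs v)); [exact: cvg_snd|exact: prm_cont].
Qed.

Lemma plot_pair (E0 : tvsType R) (U : set E0) (p : E0 -> T) (q : E0 -> T') :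
  plot A U p -> plot A' U q -> plot (prod_atlas A A') U (fun x => (p x, q x)).
Proof.
move=> [pc ps] [qc qs]; split.
  by move=> x Ux; apply: cvg_pair; [exact: pc|exact: qc].
move=> _ [c Ac [d Ad <-]] k /=.
apply: Ck_on_pair.
  by apply: Ck_on_sub (ps c Ac k) => x [Ux []].
by apply: Ck_on_sub (qs d Ad k) => x [Ux []].
Qed.

End Products.

Section Powers.
Variables (T : topologicalType) (n : nat) (A : set (chart T 'rV[R]_n)) (r : nat).
Hypothesis cA : chart_cover A.

Lemma pow_chartP (c : 'I_r -> chart T 'rV[R]_n) : (forall i, A (c i)) ->
  crd (Chart [set x : 'I_r -> T | forall i, dom (c i) (x i)]
             (fun x => \matrix_(i, j) crd (c i) (x i) 0 j)
             (fun y i => prm (c i) (row i y))) @` [set x | forall i, dom (c i) (x i)]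
  = [set y | forall i, img (c i) (row i y)].
Proof.
move=> Ac; have hc i := cA.2 _ (Ac i); apply/seteqP; split=> y /=.
  move=> [x cx <-] i; exists (x i) => //.
  by apply/rowP => j; rewrite !mxE.
move=> cy; exists (fun i => prm (c i) (row i y)).
  by move=> i; apply: dom_prm.
by apply/matrixP => i j; rewrite mxE prmK// mxE.
Qed.

Lemma pow_img_open (c : 'I_r -> chart T 'rV[R]_n) : (forall i, A (c i)) ->
  open [set y : 'M[R]_(r, n) | forall i, img (c i) (row i y)].
Proof.
move=> Ac.
rewrite openE => y cy.
have H (i : 'I_r) : nbhs y [set z | img (c i) (row i z)].
  apply: (@row_continuous R r n i y); apply: open_nbhs_nbhs; split; last exact: cy.
  by apply: chart_openI; apply: cA.2.
exact: (@filter_forall _ _ (fun i => [set z | img (c i) (row i z)]) (nbhs y) _ H).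
Qed.

Definition pow_chart (c : 'I_r -> chart T 'rV[R]_n) : chart ('I_r -> T) 'M[R]_(r, n) :=
  Chart [set x : 'I_r -> T | forall i, dom (c i) (x i)]
        (fun x => \matrix_(i, j) crd (c i) (x i) 0 j)
        (fun y i => prm (c i) (row i y)).

(** Charts chosen at the finitely many points [p i x] remain valid near [x], so that locally a tuple
    of plots has smooth coordinates in a single chart of the power. *)
Lemma plot_pow_local (E0 : tvsType R) (U : set E0) (p : 'I_r -> E0 -> T) x :
  open U -> (forall i, plot A U (p i)) -> U x ->
  exists (c : 'I_r -> chart T 'rV[R]_n) (V : set E0), [/\ forall i, A (c i), open V /\ V `<=` U, V x,
    @smooth_on R E0 ('M[R]_(r, n) : tvsType R) V (fun y => crd (pow_chart c) (fun i => p i y)) &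
    forall y, V y -> img (pow_chart c) (crd (pow_chart c) (fun i => p i y)) /\
      prm (pow_chart c) (crd (pow_chart c) (fun i => p i y)) = (fun i => p i y)].
Proof.
move=> oU pp Ux.
have /choice[c cP] : forall i, exists d, A d /\ dom d (p i x).
  by move=> i; have [d ? ?] := cA.1 (p i x); exists d.
have Ac i := (cP i).1; have hc i := cA.2 _ (Ac i).
pose V := U `&` [set y | forall i, dom (c i) (p i y)].
have oV : open V.
  rewrite openE => y [Uy cy]; apply: filterI; first exact: open_nbhs_nbhs.
  apply: filter_forall => i; apply: ((pp i).1 y Uy); apply: open_nbhs_nbhs.
  by split; [exact: chart_openD|exact: cy].
exists c, V; split=> //.
- by split=> // y [].
- by split=> // i; exact: (cP i).2.
- move=> k; apply: Ck_on_mx => // i j /=.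
  apply: (@Ck_on_eq _ _ _ _ _ (fun x => crd (c i) (p i x) 0 j : R^o)) => //.
    by move=> y _; rewrite mxE.
  apply: (@Ck_on_mx_entry _ _ _ _ 1 n (crd (c i) \o p i)).
  by apply: Ck_on_sub ((pp i).2 _ (Ac i) k) => y [Uy cy]; split=> //; exact: cy.
- move=> y [Uy cy]; split; first by exists (fun i => p i y).
  apply/funext => i; rewrite /= -[RHS](chartK (hc i))//.
  by congr prm; apply/rowP => j; rewrite !mxE.
Qed.

Lemma plot_pow_prm (c : 'I_r -> chart T 'rV[R]_n) i : smooth_manifold A ->
  (forall i, A (c i)) ->
  plot A [set y : 'M[R]_(r, n) | forall i, img (c i) (row i y)]
    (fun y => prm (c i) (row i y)).
Proof.
move=> hA Ac; apply: (plot_precomp _ _ cA _ _ (plot_prm hA (Ac i))).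
- by apply: chart_openI; apply: cA.2.
- exact: pow_img_open.
- by move=> y; apply.
- move=> k; apply: (Ck_on_linear _ _ (linear_affine (@row_linear _ _ _ i))); exact: row_continuous.
Qed.

End Powers.

End Plots.

(** * Invariant integration *)

Section CompactTools.

Lemma compact_fin (T I : topologicalType) (K : set T) (O : I -> set T) :
  compact K -> (forall x, K x -> exists i, nbhs x (O i)) ->
  exists s : seq I, forall x, K x -> exists2 i, i \in s & O i x.
Proof.
(* Finite sets of indices ordered by inclusion: along this filter every index eventually belongs to
   the sequence, and a near-covering produces a single sequence for all of [K]. *)
move=> cK HO; pose F : set_system (seq I) :=
  filter_from [set: seq I] (fun s0 => [set s : seq I | forall i, i \in s0 -> i \in s]).
have FF : Filter F.
  apply: filter_from_filter; first by exists [::].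
  move=> s1 s2 _ _; exists (s1 ++ s2) => // s /= Hs.
  by split=> i Hi; apply: Hs; rewrite mem_cat Hi ?orbT.
have := (compact_near_coveringP K).1 cK (seq I) F
  (fun s x => exists2 i, i \in s & O i x) FF.
case.
  move=> x /HO[i Oi]; exists (O i, [set s : seq I | i \in s]) => /=.
    by split=> //; exists [:: i] => // s; apply; rewrite inE.
  by move=> [y s] /= [Oy si]; exists i.
by move=> s0 _ H; exists s0; apply: H.
Qed.

Lemma ultra_compact_cvg (T : Type) (T' : topologicalType) (F : set_system T) (f : T -> T') (K : set T') :
  UltraFilter F -> compact K -> (\forall x \near F, K (f x)) ->
  exists2 y, K y & f @ F --> y.
Proof.
move=> UF cK FK; have [y [Ky fy]] := cK (f @ F) _ FK.
exists y => // A yA; rewrite /= nbhs_simpl /=.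
have [//|nA] := in_ultra_setVsetC (f @^-1` A) UF.
by have [x [/= ]] := fy (~` A) A nA yA.
Qed.

End CompactTools.

Section Haar.
Context {R : realType} (G : preTopologicalGroupType).
Local Open Scope group_scope.
Hypothesis mulG_cont : continuous (fun p : G * G => p.1 * p.2).
Hypothesis invG_cont : continuous (fun g : G => g^-1).
Variable A0 : set G.
Hypothesis cA0 : compact A0.
Hypothesis nA0 : nbhs 1 A0.

Lemma mulG_cvg (T : Type) (F : set_system T) {FF : Filter F} (p q : T -> G) (a b : G) :
  p @ F --> a -> q @ F --> b -> (fun t => p t * q t) @ F --> a * b.
Proof.
move=> pa qb; apply: (@continuous2_cvg T G G G F FF p q (fun x y => x * y) a b _ pa qb).
have H := @mulG_cont (a, b).
rewrite /continuous_at /= in H; exact: H.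
Qed.

Lemma invG_cvg (T : Type) (F : set_system T) {FF : Filter F} (p : T -> G) (a : G) :
  p @ F --> a -> (fun t => (p t)^-1) @ F --> a^-1.
Proof. by move=> pa; apply: continuous_cvg pa; exact: invG_cont. Qed.

Lemma lmul_cont (h : G) : continuous (fun g : G => h * g).
Proof. by move=> g; apply: mulG_cvg; [exact: cvg_cst|exact: cvg_id]. Qed.

Lemma nbhs_lmul (h : G) (O : set G) : nbhs 1 O -> nbhs h [set g | O (h^-1 * g)].
Proof. by move=> O1; apply: (@lmul_cont h^-1 h); rewrite mulVg. Qed.

Lemma mul3_cont : continuous (fun p : G * G * G => p.1.1 * p.1.2 * p.2^-1).
Proof.
move=> x; apply: mulG_cvg; last by apply: invG_cvg; exact: cvg_snd.
apply: mulG_cvg.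
  by apply: (@cvg_comp _ _ _ fst fst _ (nbhs x.1)); exact: cvg_fst.
by apply: (@cvg_comp _ _ _ fst snd _ (nbhs x.1)); [exact: cvg_fst|exact: cvg_snd].
Qed.

Lemma nbhs_mul3 (g : G) (O : set G) : nbhs g O -> exists B U : set G,
  [/\ nbhs g B, nbhs 1 U & forall b u v, B b -> U u -> U v -> O (b * u * v^-1)].
Proof.
move=> gO; have := @mul3_cont (g, 1, 1) O; rewrite /= invg1 !mulg1 => /(_ gO).
move=> [[P U1] /= [[[B U2] /= [gB U21] BP] U11] PO].
exists B, (U1 `&` U2); split=> //; first exact: filterI.
move=> b u v Bb [_ Uu] [Uv _]; apply: (PO (b, u, v)); split=> //=.
exact: (BP (b, u)).
Qed.

Definition cnt (P : set G) (S : seq G) : nat := count (fun s => `[< P s >]) S.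

Definition covers (U L : set G) (S : seq G) : Prop :=
  forall x, L x -> exists2 s, s \in S & U (s^-1 * x).

Definition mincov (U L : set G) (S : seq G) : Prop :=
  covers U L S /\ forall S', covers U L S' -> (size S <= size S')%N.

(* Otherwise, replacing the part of [S] in [A] by the nearby part of [h S] would
   give a smaller cover. *)
Lemma mincov_exchange (U L A A' : set G) (h : G) S : mincov U L S ->
  (forall a u, A a -> U u -> L (h^-1 * (a * u))) ->
  (forall a u v, A a -> U u -> U v -> A' (a * u * v^-1)) ->
  (cnt A S <= cnt [set s : G | A' (h * s)%g] S)%N.
Proof.
move=> [cS mS] AL AA'.
pose S1 := [seq s <- S | ~~ `[< A s >]].
pose S2 := [seq h * s | s <- S & `[< A' (h * s) >]].
have : covers U L (S1 ++ S2).
  move=> x Lx; have [s sS Us] := cS x Lx.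
  have [As|nAs] := pselect (A s); last first.
    exists s => //; rewrite mem_cat mem_filter sS andbT.
    by apply/orP; left; apply/asboolPn.
  have [s' s'S Us'] : exists2 s', s' \in S & U (s'^-1 * (h^-1 * x)).
    apply: cS; have -> : x = s * (s^-1 * x) by rewrite mulVKg.
    exact: AL.
  exists (h * s'); last by rewrite invgM -mulgA.
  rewrite mem_cat; apply/orP; right; apply: map_f; rewrite mem_filter s'S andbT.
  apply/asboolP; have := AA' s (s^-1 * x) (s'^-1 * (h^-1 * x)) As Us Us'.
  by rewrite mulVKg !invgM !invgK mulgA mulVKg.
move=> /mS; rewrite size_cat size_map !size_filter -/(cnt _ _).
have -> : size S = (cnt A S + count (fun s => ~~ `[< A s >]) S)%N.
  by rewrite -(count_predC (fun s => `[< A s >])).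
by rewrite [X in (X <= _)%N]addnC leq_add2l.
Qed.

Lemma mincov_ex (U L : set G) : nbhs 1 U -> compact L -> exists S, mincov U L S.
Proof.
move=> U1 cL.
have [S0 S0P] := @compact_fin G G L (fun s => [set x | U (s^-1 * x)]) cL
  (fun x _ => ex_intro _ x (nbhs_lmul x U1)).
pose P n := `[< exists2 S, covers U L S & size S = n >].
have exP : exists n, P n by exists (size S0); apply/asboolP; exists S0.
case: (ex_minnP exP) => n /asboolP[S cS Sn] nmin; exists S; split=> // S' cS'.
by rewrite Sn; apply: nmin; apply/asboolP; exists S'.
Qed.

(** Two limits at once: the translated neighbourhood shrinks to 1 while the covered set grows beyond
    every compact set. *)
Definition cover_filter : set_system (seq G) :=
  filter_from [set p : set G * set G | nbhs 1 p.1 /\ compact p.2]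
    (fun p => [set S | exists U L, [/\ U `<=` p.1, p.2 `<=` L & mincov U L S]]).

Lemma cover_filter_proper : ProperFilter cover_filter.
Proof.
apply: filter_from_proper.
  apply: filter_from_filter.
    by exists (setT, set0); split; [exact: filterT|exact: compact0].
  move=> [U1 L1] [U2 L2] /= [nU1 cL1] [nU2 cL2].
  exists (U1 `&` U2, L1 `|` L2) => /=.
    by split; [exact: filterI|exact: compactU].
  move=> S [U [L [UU LL mS]]]; split; exists U, L; split=> //.
  - by move=> x /UU[].
  - by move=> x ?; apply: LL; left.
  - by move=> x /UU[].
  - by move=> x ?; apply: LL; right.
move=> [U L] /= [nU cL]; have [S mS] := mincov_ex nU cL.
by exists S; exists U, L; split=> // x.
Qed.

Local Existing Instance cover_filter_proper.

Lemma near_cover (U L : set G) : nbhs 1 U -> compact L ->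
  \forall S \near cover_filter,
    exists U' L', [/\ U' `<=` U, L `<=` L' & mincov U' L' S].
Proof. by move=> nU cL; exists (U, L). Qed.

Lemma cnt_le (P Q : set G) S : P `<=` Q -> (cnt P S <= cnt Q S)%N.
Proof. by move=> PQ; apply: sub_count => s /asboolP/PQ ?; apply/asboolP. Qed.

Lemma cnt_bigcup (I : eqType) (P : set G) (Q : I -> set G) (t : seq I) S :
  (forall x, P x -> exists2 i, i \in t & Q i x) ->
  (cnt P S <= \sum_(i <- t) cnt (Q i) S)%N.
Proof.
move=> PQ; elim: S => [//|s S IH]; rewrite /cnt /= -/(cnt _ _).
under eq_bigr do rewrite -/(cnt _ _).
rewrite big_split /=; apply: leq_add => //.
case: asboolP => // /PQ[i it Qi].
by rewrite (big_rem i it) /= (asboolT Qi).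
Qed.

(** [K] is covered by finitely many translates of a small neighbourhood [B] of a point of [O], and
    [mincov_exchange] bounds the count in each translate by the count in [O]. For this the covered
    set must contain [g0 A0], where the exchanged points land. *)
Lemma cnt_dominated (K O : set G) : compact K -> open O -> O !=set0 ->
  exists C : nat, \forall S \near cover_filter, (cnt K S <= C * cnt O S)%N.
Proof.
move=> cK oO [g0 Og0].
have g0A : nbhs g0 (O `&` [set x | A0 (g0^-1 * x)]).
  by apply: filterI; [exact: open_nbhs_nbhs|exact: nbhs_lmul].
have [B [U [nB nU BUO]]] := nbhs_mul3 g0A.
pose Bk (k : G) : set G := [set x | B (g0 * k^-1 * x)].
have g0K x : g0 * x^-1 * x = g0 by rewrite -mulgA mulVg mulg1.
have [t tP] := @compact_fin G G K Bk cK
  (fun x _ => ex_intro _ x (@lmul_cont (g0 * x^-1) x B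
    (eq_ind_r (fun z => nbhs z B) nB (g0K x)))).
exists (size t).
have cL : compact [set g0 * x | x in A0].
  by apply: continuous_compact => //; apply: continuous_subspaceT; exact: lmul_cont.
have := near_cover nU cL; apply: filterS => S [U' [L' [UU LL mS]]].
apply: leq_trans (@cnt_bigcup _ _ _ _ S tP) _.
rewrite -sum1_size big_distrl /=; apply: leq_sum => k _; rewrite mul1n.
have := @mincov_exchange U' L' (Bk k) [set y | O ((k * g0^-1)^-1 * y)] (k * g0^-1) S mS.
have kg : (k * g0^-1)^-1 = g0 * k^-1 by rewrite invgM invgK.
rewrite kg => H; apply: leq_trans (H _ _) _.
- move=> a u Ba Uu; apply: LL; rewrite mulgA.
  have [_ ] := BUO _ u 1 Ba (UU _ Uu) (nbhs_singleton nU).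
  by rewrite /= invg1 mulg1 => A0a; exists (g0^-1 * (g0 * k^-1 * a * u)) => //; rewrite mulVKg.
- move=> a u v Ba Uu Uv /=.
  by have [] := BUO _ u v Ba (UU _ Uu) (UU _ Uv); rewrite !mulgA.
- by apply: cnt_le => s /=; rewrite !mulgA -(mulgA g0) mulVg mulg1 mulgV mul1g.
Qed.

(** The point 1 is covered from an element of [A0], and the count of [A0] is dominated by that of
    [O]. Counts can thus serve as denominators. *)
Lemma cnt_pos (O : set G) : open O -> O !=set0 ->
  \forall S \near cover_filter, (0 < cnt O S)%N.
Proof.
move=> oO O0; have [C HC] := cnt_dominated cA0 oO O0.
have nU : nbhs 1 (A0 `&` [set x | A0 x^-1]).
  by apply: filterI => //; apply: (@invG_cont 1); rewrite invg1.
have := near_cover nU (@compact_set1 G 1).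
apply: filterS2 HC => S SC [U [L [UU LL [cS _]]]].
have [s sS Us] := cS 1 (LL _ erefl).
have /UU[_ /=] := Us; rewrite mulg1 invgK => A0s.
have : (0 < cnt A0 S)%N.
  by rewrite -has_count; apply/hasP; exists s => //; apply/asboolP.
by case: (cnt O S) SC => //; rewrite muln0 leqn0 => /eqP ->.
Qed.

End Haar.

Lemma near_gt (R : realType) (T : topologicalType) (f : T -> R^o) (x : T) (a : R) :
  {for x, continuous f} -> a < f x -> nbhs x [set y | a < f y].
Proof. by move=> fx ax; exact: (@cvgr_gt R T (nbhs x) _ f (f x) fx a ax). Qed.

Lemma near_lt (R : realType) (T : topologicalType) (f : T -> R^o) (x : T) (a : R) :
  {for x, continuous f} -> f x < a -> nbhs x [set y | f y < a].
Proof. by move=> fx ax; exact: (@cvgr_lt R T (nbhs x) _ f (f x) fx a ax). Qed.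

Lemma lim_ge (R : realType) (T : Type) (F : set_system T) {FF : ProperFilter F}
    (q : T -> R^o) (l c : R) :
  q @ F --> (l : R^o) -> (\forall t \near F, c <= q t) -> c <= l.
Proof.
move=> ql cq; rewrite leNgt; apply/negP => lc.
have [t [ct]] := filter_ex (filterI cq (@cvgr_lt R T F _ q l ql c lc)).
by rewrite /= ltNge ct.
Qed.

Section LayerCake.
Context {R : realType}.

(** Counting the multiples of [e] below [t] recovers [t] up to [e]. Summed over a cover, this
    converts inequalities between counts of superlevel sets into inequalities between sums of
    values. *)
Lemma layer_le (t e : R) n : 0 < e -> 0 <= t <= n%:R * e ->
  t <= e * \sum_(k < n) (k%:R * e < t)%R%:R.
Proof.
move=> e0; elim: n t => [|n IH] t.
  by rewrite mul0r big_ord0 mulr0 => /andP[].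
move=> /andP[t0 tn]; rewrite big_ord_recr /= mulrDr.
have [nt|tn'] := ltP (n%:R * e) t; last first.
  by rewrite mulr0 addr0; apply: IH; rewrite t0.
rewrite mulr1 (eq_bigr (fun=> 1)); last first.
  move=> k _; suff -> : k%:R * e < t by [].
  by apply: le_lt_trans nt; rewrite ler_pM2r// ler_nat ltnW.
rewrite sumr_const card_ord (le_trans tn)// -natr1 mulrDl mul1r lerD2r.
by rewrite mulrC.
Qed.

Lemma layer_ge (t e : R) n : 0 < e -> 0 <= t ->
  e * \sum_(k < n) (k%:R * e < t)%R%:R <= t + e.
Proof.
move=> e0 t0; elim: n => [|n IH]; first by rewrite big_ord0 mulr0 addr_ge0// ltW.
rewrite big_ord_recr /= mulrDr; have [nt|tn'] := ltP (n%:R * e) t; last first.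
  by rewrite mulr0 addr0.
rewrite mulr1 lerD2r; apply: le_trans (ltW nt); rewrite mulrC ler_pM2r//.
rewrite -[X in _ <= X%:R]card_ord -sumr_const; apply: ler_sum => k _.
by case: (_ < _).
Qed.

End LayerCake.

Section DiskSums.
Context {R : realType} (V : tvsType R).

Lemma disk_wsum (D : set V) (I : Type) (s : seq I) (w : I -> R) (d : I -> V) :
  disk D -> (forall i, 0 <= w i) -> (forall i, w i != 0 -> D (d i)) ->
  exists2 e, D e & \sum_(i <- s) w i *: d i = (\sum_(i <- s) w i) *: e.
Proof.
move=> dD w0 wD; elim: s => [|i s [e De IH]].
  by exists 0; [exact: disk0|rewrite !big_nil scaler0].
rewrite !big_cons IH; have [wi0|wi0] := eqVneq (w i) 0.
  by exists e => //; rewrite wi0 scale0r !add0r.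
have S0 : 0 <= \sum_(j <- s) w j by apply: sumr_ge0.
have [||||||e' De' ->] := @cvx_wadd _ _ D (w i) (\sum_(j <- s) w j) (d i) e; last by exists e'.
- by case: dD.
- exact: w0.
- exact: S0.
- by rewrite ltr_pwDl// lt_neqAle eq_sym wi0 w0.
- exact: wD.
- exact: De.
Qed.

(** Scaling by a small factor sends [f] into [D] near each point of [K]; compactness makes the
    factor uniform. *)
Lemma compact_absorb (G : topologicalType) (K : set G) (f : G -> V) (D : set V) :
  compact K -> (forall g, K g -> {for g, continuous f}) -> disk D ->
  exists2 r : R, 0 < r & forall g, K g -> D (r^-1 *: f g).
Proof.
move=> cK fc dD.
have FF : Filter (at_right (0 : R)) by exact: _.
have := (compact_near_coveringP K).1 cK R (at_right (0 : R)) (fun r g => D (r *: f g)) FF.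
case.
  move=> g Kg; have : (fun p : G * R => p.2 *: f p.1) @ (filter_prod (nbhs g) (at_right (0 : R))) --> (0 : V).
    rewrite -[X in _ --> X](scale0r (f g)); apply: scalev_cvg.
      by move=> A A0; exists (setT, A) => [|[x y] []//]; split; [exact: filterT|exact: cvg_within A0].
    apply: (@cvg_comp _ _ _ fst f _ (nbhs g)); last exact: fc.
    by move=> A A0; exists (A, setT) => [|[x y] []//]; split => //; exact: filterT.
  by case: dD => D0 _ _ /(_ _ D0).
move=> e /= e0 He; exists (2 / e); first by rewrite divr_gt0.
have e2 : 0 < e / 2 by rewrite divr_gt0.
move=> g Kg; rewrite invf_div; apply: He => //=.
  by rewrite sub0r normrN gtr0_norm// ltr_pdivrMr// ltr_pMr// ltr1n.
Qed.

End DiskSums.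

Lemma disk_unit (R : realType) : disk [set x : R^o | `|x| <= 1].
Proof.
split.
- by apply/nbhs_ballP; exists 1 => //= z; rewrite -ball_normE /= sub0r normrN => /ltW.
- move=> u v t /= Dx Dy /andP[t0 t1]; rewrite (le_trans (ler_normD _ _))// !normrM.
  rewrite (ger0_norm t0) (@ger0_norm _ (1 - t)) ?subr_ge0//.
  have := ler_wpM2l t0 Dx; have := @ler_wpM2l _ (1 - t) _ _ _ Dy; rewrite subr_ge0 => /(_ t1).
  lra.
- by move=> u /=; rewrite normrN.
Qed.

Lemma disk_preim (R : realType) (V : tvsType R) (D : set V) (c : R) : c != 0 ->
  disk D -> disk [set v | D (c *: v)].
Proof.
move=> c0 [D0 cD sD]; split.
- exact: nbhs0_scale.
- move=> x y t /= Dx Dy t01; rewrite scalerDr !scalerA ![c * _]mulrC -!scalerA.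
  exact: cD.
- by move=> x /= /sD; rewrite scalerN.
Qed.

Lemma hausdorff_disk0 (R : realType) (V : tvsType R) (z : V) : hausdorff_space V ->
  (forall D, disk D -> D z) -> z = 0.
Proof.
move=> hV H; apply: (@cvg_unique _ hV ((fun _ : nat => z) @ \oo) _).
  exact: cvg_cst.
by apply: cvgv_disk => D /H Dz; apply: filterS filterT => n _ /=; rewrite subr0.
Qed.

(** * Vector-valued averages over minimal covers, their limits and their invariance *)

Section VectorHaar.
Context {R : realType} (G : preTopologicalGroupType).
Hypothesis mulG_cont : continuous (fun p : G * G => (p.1 * p.2)%g).
Hypothesis invG_cont : continuous (fun g : G => g^-1)%g.
Variable A0 : set G.
Hypothesis cA0 : compact A0.
Hypothesis nA0 : nbhs (1%g : G) A0.
Hypothesis bump : forall (x : G) (O : set G), nbhs x O ->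
  exists b : G -> R^o, exists K, [/\ continuous b, forall g, 0 <= b g, 0 < b x,
    compact K /\ K `<=` O & forall g, ~ K g -> b g = 0].
Variable F : set_system (seq G).
Hypothesis UF : UltraFilter F.
Hypothesis HF : @cover_filter G `<=` F.

Local Notation O0 := (A0°).

Let O00 : O0 !=set0. Proof. by exists 1%g. Qed.

(** The normalization gives the interior of [A0] mass one. *)
Definition avg (V : lmodType R) (f : G -> V) (S : seq G) : V :=
  (cnt O0 S)%:R^-1 *: \sum_(s <- S) f s.

Lemma avgD (V : lmodType R) (f g : G -> V) S :
  avg (fun x => f x + g x) S = avg f S + avg g S.
Proof. by rewrite /avg big_split scalerDr. Qed.

Lemma avgB (V : lmodType R) (f g : G -> V) S :
  avg (fun x => f x - g x) S = avg f S - avg g S.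
Proof. by rewrite /avg sumrB scalerBr. Qed.

Lemma avgZ (V : lmodType R) (a : R) (f : G -> V) S :
  avg (fun x => a *: f x) S = a *: avg f S.
Proof. by rewrite /avg -scaler_sumr !scalerA mulrC. Qed.

Lemma avg_comb (V : lmodType R) (t : seq ((G -> R^o) * V)) S :
  avg (fun x => \sum_(p <- t) p.1 x *: p.2) S = \sum_(p <- t) avg p.1 S *: p.2.
Proof.
rewrite /avg exchange_big /= scaler_sumr; apply: eq_bigr => p _.
by rewrite -scaler_suml scalerA.
Qed.

Lemma avg_lin (V V' : lmodType R) (L : V -> V') (f : G -> V) S : linear L ->
  avg (L \o f) S = L (avg f S).
Proof.
move=> lL; have L0 : L 0 = 0 by have := lL (-1) 0 0; rewrite !scaleN1r !addNr.
have LD a b : L (a + b) = L a + L b by have := lL 1 a b; rewrite !scale1r.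
rewrite /avg; have -> : \sum_(s <- S) (L \o f) s = L (\sum_(s <- S) f s).
  elim: S => [|s S IH]; first by rewrite !big_nil L0.
  by rewrite !big_cons IH LD.
by have := lL (cnt O0 S)%:R^-1 (\sum_(s <- S) f s) 0; rewrite !addr0 L0 addr0.
Qed.

Lemma cntE (P : set G) S : (cnt P S)%:R = \sum_(s <- S) (`[< P s >])%:R :> R.
Proof.
elim: S => [|s S IH]; first by rewrite big_nil.
by rewrite big_cons -IH -natrD.
Qed.

Lemma disk_avg (V : tvsType R) (D : set V) (P : set G) (f : G -> V) S (C : R) :
  disk D -> (forall s, P s -> D (f s)) -> (forall s, ~ P s -> f s = 0) -> 0 < C ->
  (cnt P S)%:R <= C * (cnt O0 S)%:R -> (0 < cnt O0 S)%N -> D (C^-1 *: avg f S).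
Proof.
move=> dD PD P0 C0 CP N0.
have [|s /=|e De] := @disk_wsum R V D G S (fun s => (`[< P s >])%:R) f dD.
- by move=> s; exact: ler0n.
- by case: asboolP => [/PD//|_]; rewrite eqxx.
rewrite -cntE => E.
have -> : avg f S = (cnt O0 S)%:R^-1 *: ((cnt P S)%:R *: e).
  rewrite /avg -E; congr (_ *: _); apply: eq_bigr => s _.
  by case: asboolP => [_|/P0 ->]; rewrite ?scale1r ?scaler0.
have n0 : 0 < (cnt O0 S)%:R :> R by rewrite ltr0n.
rewrite !scalerA; apply: disk_scale => //.
rewrite ger0_norm; last by rewrite !mulr_ge0 ?invr_ge0 ?ler0n// ltW.
by rewrite -invfM mulrC ler_pdivrMr ?mulr_gt0// mul1r.
Qed.

Lemma near_mass (K : set G) : compact K -> exists2 C : R, 0 < C &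
  \forall S \near F, (cnt K S)%:R <= C * (cnt O0 S)%:R /\ (0 < cnt O0 S)%N.
Proof.
move=> cK; have [n Hn] := cnt_dominated mulG_cont invG_cont cA0 nA0 cK (@open_interior _ A0) O00.
exists (n%:R + 1); first by rewrite ltr_wpDl.
have h1 := HF Hn; have h2 := HF (cnt_pos mulG_cont invG_cont cA0 nA0 (@open_interior _ A0) O00).
apply: filterS2 h1 h2 => S h1 h2; split=> //.
rewrite (@le_trans _ _ (n%:R * (cnt O0 S)%:R))//; first by rewrite -natrM ler_nat.
by rewrite ler_wpM2r// lerDl.
Qed.

Definition csupp (V : tvsType R) (K : set G) (f : G -> V) : Prop :=
  [/\ compact K, continuous f & forall g, ~ K g -> f g = 0].

(** The averages stay in a compact interval, so the ultrafilter supplies the limit. Bounded closed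
    sets of a general [V] are not compact, which is why vector-valued functions are reduced to
    scalar ones by [pou_approx]. *)
Lemma scal_cvg (f : G -> R^o) K : csupp K f -> exists x : R^o, avg f @ F --> x.
Proof.
move=> [cK fc f0].
have dD := @disk_unit R; set D := [set x : R^o | _] in dD.
have [r r0 Hr] := compact_absorb cK (fun g _ => fc g) dD.
have [C C0 HC] := near_mass cK.
have [|y _ ?] := @ultra_compact_cvg _ _ F (avg f) `[- (C * r), C * r]%classic UF (@segment_compact _ _ _).
  apply: filterS HC => S [HC N0].
  have := @disk_avg R^o D K (fun g => r^-1 *: f g) S C dD Hr _ C0 HC N0.
  rewrite avgZ => H; have : D (C^-1 *: (r^-1 *: avg f S)).
    by apply: H => s /f0 ->; rewrite scaler0.
  have Cr0 : 0 < C * r by rewrite mulr_gt0.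
  rewrite /D /= scalerA normrZ -invfM ger0_norm ?invr_ge0 ?(ltW Cr0)//.
  by rewrite mulrC ler_pdivrMr// mul1r ler_norml /= in_itv.
by exists y.
Qed.

Lemma compact_nbhd (K : set G) : compact K ->
  exists2 K1, compact K1 & forall g, K g -> nbhs g K1.
Proof.
move=> cK.
have [t tP] := @compact_fin G G K (fun h => [set g | O0 (h^-1 * g)%g]) cK
  (fun x _ => ex_intro _ x (nbhs_lmul mulG_cont x (nbhs_interior nA0))).
exists (\big[setU/set0]_(h <- t) [set (h * g)%g | g in A0]).
  apply: bigsetU_compact => h _; apply: continuous_compact => //.
  by apply: continuous_subspaceT; exact: (lmul_cont mulG_cont).
move=> g /tP[h ht Og].
have : nbhs g [set (h * g)%g | g in A0].
  have := @lmul_cont G mulG_cont h^-1%g g A0 Og; rewrite /= nbhs_simpl /=; apply: filterS => x /= A0x.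
  by exists (h^-1 * x)%g => //; rewrite mulVKg.
by apply: filterS => x; rewrite -bigcup_seq => ?; exists h.
Qed.

(** A partition of unity subordinate to sets on which [f] varies by less than [D]. The error at [g]
    is a combination of differences [f g - f x] lying in [D], with weights of sum at most one. *)
Lemma pou_approx (V : tvsType R) (K K1 : set G) (f : G -> V) (D : set V) :
  csupp K f -> compact K1 -> (forall g, K g -> nbhs g K1) -> disk D ->
  exists2 t : seq ((G -> R^o) * V),
    (forall p, List.In p t -> csupp K1 p.1 /\ forall g, 0 <= p.1 g) &
    forall g, D (f g - \sum_(p <- t) p.1 g *: p.2).
Proof.
move=> [cK fc f0] cK1 KK1 dD.
have ex_b (x : G) : exists b : G -> R^o, K x -> [/\ csupp K1 b, forall g, 0 <= b g, 0 < b x &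
    forall g, b g != 0 -> D (f g - f x)].
  have [Kx|nKx] := pselect (K x); last by exists (fun=> 0).
  have nO : nbhs x (K1 `&` [set g | D (f g - f x)]).
    apply: filterI; first exact: KK1.
    have : (fun g => f g - f x) @ x --> f x - f x by apply: subv_cvg; [exact: fc|exact: cvg_cst].
    by rewrite subrr; case: dD => D0 _ _ /(_ _ D0).
  have [b [K' [bc b0 bx [cK' K'O] bK']]] := bump nO.
  exists b => _; split=> //; first by split=> // g nK1; apply: bK' => /K'O[].
  by move=> g bg; have /K'O[] // : K' g; apply: contrapT => /bK' bg0; rewrite bg0 eqxx in bg.
have /choice[b bP] := ex_b.
have [s0 s0P] := @compact_fin G G K (fun x => [set g | K x /\ 0 < b x g]) cK
  (fun x Kx => ex_intro _ x (let: And4 bc _ bx _ := bP x Kx in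
    filterS (fun g h => conj Kx h) (near_gt ((let: And3 _ c _ := bc in c) x) bx))).
pose s := [seq x <- s0 | `[< K x >]].
have sK x : x \in s -> K x by rewrite mem_filter => /andP[/asboolP].
pose B g := \sum_(x <- s) b x g.
have Bc : continuous B.
  move=> g; rewrite /B; elim: (s) sK => [|x s' IH] sK'.
    rewrite (_ : (fun g => _) = fun=> 0); first exact: cvg_cst.
    by apply/funext => h; rewrite big_nil.
  rewrite (_ : (fun g => _) = fun g => b x g + \sum_(y <- s') b y g); last first.
    by apply/funext => h; rewrite big_cons.
  apply: addv_cvg; last by apply: IH => y ys; apply: sK'; rewrite inE ys orbT.
  by have [[_ c _] _ _ _] := bP x (sK' x (mem_head _ _)); exact: c.
have bge0 x g : x \in s -> 0 <= b x g by move=> /sK /bP[].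
have B0 g : 0 <= B g by rewrite /B big_seq; apply: sumr_ge0 => x /bge0.
have Bpos g : K g -> 0 < B g.
  move=> /s0P[x xs [Kx bxg]]; have xs' : x \in s by rewrite mem_filter xs andbT; exact/asboolP.
  rewrite lt_neqAle B0 andbT eq_sym; apply/negP; rewrite /B big_seq psumr_eq0; last first.
    by move=> y /bge0.
  by move=> /allP/(_ x xs'); rewrite xs' /= gt_eqF.
have [dl dl0 Hdl] : exists2 dl : R, 0 < dl & forall g, K g -> dl <= B g.
  have FF : Filter (at_right (0 : R)) by exact: _.
  have := (compact_near_coveringP K).1 cK R (at_right (0 : R)) (fun d g => d <= B g) FF.
  case.
    move=> g Kg; exists ([set g' | B g / 2 < B g'], [set d | d < B g / 2]) => /=.
      split; first by apply: near_gt; [exact: Bc|rewrite ltr_pdivrMr// ltr_pMr ?Bpos// ltr1n].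
      by apply: nbhs_right_lt; rewrite divr_gt0// Bpos.
    by move=> [g' d] /= [h1 h2]; apply: ltW; apply: lt_trans h1.
  move=> e /= e0 He; have e2 : 0 < e / 2 by rewrite divr_gt0.
  exists (e / 2) => // g Kg; apply: He => //=.
  by rewrite sub0r normrN gtr0_norm// ltr_pdivrMr// ltr_pMr// ltr1n.
(* On [K] this is [B], so the weights sum to one there. Elsewhere it keeps the quotients continuous
   and their sum at most one, which is enough because [f] vanishes off [K]. *)
pose W g := Num.max (B g) dl.
have W0 g : 0 < W g by rewrite /W lt_max dl0 orbT.
exists [seq ((fun g => b x g / W g : R^o), f x) | x <- s].
  have Ls x : List.In x s -> x \in s.
    elim: (s) => [//|y s' IH] /= [->|/IH]; rewrite inE ?eqxx// => ->.
    by rewrite orbT.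
  move=> p /List.in_map_iff[x [<- /Ls xs]] /=; have [[_ bc bK1] bge _ _] := bP x (sK x xs).
  split; last by move=> g; rewrite divr_ge0 ?bge// ltW.
  split=> //; last by move=> g /bK1 ->; rewrite mul0r.
  move=> g; apply: cvgM; first exact: bc.
  apply: cvgV; first by rewrite gt_eqF.
  by apply: (@continuous_max _ _ B (fun=> dl)); [exact: Bc|exact: cvg_cst].
move=> g; rewrite big_map /=.
have -> : f g = \sum_(x <- s) (b x g / W g) *: f g.
  rewrite -scaler_suml -mulr_suml -/(B g).
  have [Kg|nKg] := pselect (K g); last by rewrite (f0 _ nKg) scaler0.
  by rewrite /W max_l ?Hdl// divff ?scale1r// gt_eqF// Bpos.
rewrite -sumrB; under eq_bigr do rewrite -scalerBr.
have [||e De E] := @disk_wsum R V D G s (fun x => if x \in s then b x g / W g else 0) (fun x => f g - f x) dD.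
- by move=> x; case: ifP => // xs; rewrite divr_ge0 ?bge0// ltW.
- move=> x; case: ifP => [xs|_]; last by rewrite eqxx.
  have [_ _ _ H] := bP x (sK x xs) => bW; apply: H; apply: contra_neq bW => ->.
  by rewrite mul0r.
rewrite big_seq (eq_bigr (fun x => (if x \in s then b x g / W g else 0) *: (f g - f x))); last first.
  by move=> x ->.
rewrite -big_seq E; apply: disk_scale => //.
rewrite big_seq (eq_bigr (fun x => b x g / W g)); last by move=> x ->.
rewrite -big_seq -mulr_suml -/(B g) ger0_norm; last by rewrite divr_ge0 ?B0 ?(ltW (W0 g)).
by rewrite ler_pdivrMr// mul1r /W le_max lexx.
Qed.

(** Superlevel sets of the translate are compared with those of [f] by exchanging parts of a minimal
    cover, and the layers are then summed. The reverse inequality is the same statement for the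
    translate and [h^-1]. *)
Lemma scal_translate_le (K : set G) (f : G -> R^o) (h : G) (x y : R^o) :
  csupp K f -> (forall g, 0 <= f g) -> avg f @ F --> x ->
  avg (fun g => f (h * g)%g) @ F --> y -> y <= x.
Proof.
move=> [cK fc f0] fge fx fy; have [K2 cK2 KK2] := compact_nbhd cK.
have [C C0 HC] := near_mass cK2.
have [r r0 fr] : exists2 r : R, 0 < r & forall g, f g <= r.
  have dD := @disk_unit R.
  have [r r0 Hr] := compact_absorb cK (fun g _ => fc g) dD; exists r => // g.
  have [/Hr /=|/f0 ->] := pselect (K g); last exact: ltW.
  rewrite normrM normfV (gtr0_norm r0) ler_pdivrMl// mulr1.
  by apply: le_trans; rewrite ler_norm.
apply/ler_addgt0Pr => e e0.
(* Discretization and uniform continuity together cost [2 * d] for each element of the cover lying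
   in [K2]. These number at most [C] times the normalizing count, so the total loss stays below
   [e]. *)
pose d := e / (3 * C + 1).
have d0 : 0 < d by rewrite divr_gt0// addr_gt0// mulr_gt0.
have [U nU HU] : exists2 U : set G, nbhs 1%g U & forall g u v, K g -> U u -> U v ->
    f g <= f (g * u * v^-1)%g + d /\ K2 (g * u * v^-1)%g.
  have := (compact_near_coveringP K).1 cK (G * G)%type (nbhs (1%g, 1%g) : set_system (G * G))
    (fun p g => f g <= f (g * p.1 * p.2^-1)%g + d /\ K2 (g * p.1 * p.2^-1)%g) _.
  case.
    move=> g Kg.
    have m3 := @mul3_cont G mulG_cont invG_cont (g, 1%g, 1%g).
    rewrite /continuous_at /= invg1 !mulg1 in m3.
    have n1 : nbhs g [set z | f g - d / 2 < f z /\ K2 z].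
      apply: filterI; last exact: KK2.
      by apply: near_gt; [exact: fc|rewrite ltrBlDr ltrDl divr_gt0].
    have n2 : nbhs g [set z | f z < f g + d / 2].
      by apply: near_lt; [exact: fc|rewrite ltrDl divr_gt0].
    have [[P U0] /= [[[B U1] /= [gB U11] BP] U01] PO] := m3 _ n1.
    exists (B `&` [set z | f z < f g + d / 2], U1 `*` U0) => /=.
      by split; [exact: filterI|exact: nbhs_setX].
    move=> [g' [u v]] /= [[Bg' fg'] [U1u U0v]].
    have /= [h1 h2] := PO (g', u, v) (conj (BP (g', u) (conj Bg' U1u)) U0v).
    by split=> //; lra.
  move=> [U1 U2] /= [nU1 nU2] H; exists (U1 `&` U2); first exact: filterI.
  by move=> g u v Kg [Uu _] [_ Uv]; exact: (H (u, v) (conj Uu Uv) g Kg).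
have [n rn] : exists n : nat, r <= n%:R * d.
  exists (Num.trunc (r / d)).+1; rewrite -ler_pdivrMr//.
  by apply: ltW; apply: truncnS_gt.
suff H : \forall S \near F, avg (fun g => f (h * g)%g) S <= avg f S + e.
  have fxe : (fun S => avg f S + e) @ F --> x + e by apply: addv_cvg => //; exact: cvg_cst.
  have q : (fun S => avg f S + e - avg (fun g => f (h * g)%g) S) @ F --> x + e - y.
    exact: subv_cvg.
  rewrite -subr_ge0; apply: (lim_ge q).
  by apply: filterS H => S; rewrite subr_ge0.
have := HF (near_cover nU cK2).
apply: filterS2 HC => S [HC N0] [U' [L' [UU LL mS]]].
have n0 : 0 < (cnt O0 S)%:R :> R by rewrite ltr0n.
have U1 : U 1%g by exact: nbhs_singleton.
(* The exchange moves the superlevel set by [h] into [K]. The cover elements found there lie in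
   [K2], and [f] is larger than the level minus [d] at them. *)
have Hk (k : nat) : (cnt [set s | (k%:R * d < f (h * s)%g)%R] S <=
    cnt [set s | (k%:R * d < f s + d)%R /\ K2 s] S)%N.
  have := @mincov_exchange G U' L' [set s | (k%:R * d < f (h * s)%g)%R]
    [set s | (k%:R * d < f (h * s)%g + d)%R /\ K2 (h * s)%g] h^-1%g S mS.
  have Kk z : k%:R * d < f z -> K z.
    move=> kz; apply: contrapT => /f0 fz; move: kz; rewrite fz ltNge.
    by rewrite mulr_ge0// ltW.
  move=> H; apply: leq_trans (H _ _) _.
  - move=> a u /= /Kk Ka /UU Uu; apply: LL; rewrite invgK mulgA.
    by have [_] := HU _ _ _ Ka Uu U1; rewrite invg1 mulg1.
  - move=> a u v /= ka /UU Uu /UU Uv; have [h1 h2] := HU _ _ _ (Kk _ ka) Uu Uv.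
    by rewrite !mulgA; split=> //; exact: lt_le_trans h1.
  - by apply: cnt_le => s /=; rewrite mulVKg.
have L1 : \sum_(s <- S) f (h * s)%g <= \sum_(s <- S) f s + (2 * d) * (cnt K2 S)%:R.
  apply: (@le_trans _ _ (\sum_(s <- S) d * \sum_(k < n) (k%:R * d < f (h * s)%g)%R%:R)).
    by apply: ler_sum => s _; apply: layer_le; rewrite ?fge//= (le_trans (fr _)).
  apply: (@le_trans _ _ (\sum_(s <- S) d * \sum_(k < n) (`[< (k%:R * d < f s + d)%R /\ K2 s >])%:R)).
    rewrite -!mulr_sumr ler_pM2l// exchange_big [leRHS]exchange_big /=.
    apply: ler_sum => k _; rewrite -!cntE; apply: le_trans (_ : _ <= (cnt _ S)%:R) _; last first.
      by rewrite ler_nat; exact: Hk.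
    by rewrite cntE; apply: ler_sum => s _; rewrite asboolb.
  rewrite cntE mulr_sumr -big_split /=; apply: ler_sum => s _.
  have [K2s|nK2s] := pselect (K2 s); last first.
    rewrite (asboolF nK2s) mulr0 addr0 big1 ?mulr0 ?fge// => k _.
    by rewrite asboolF// => -[].
  rewrite (asboolT K2s) mulr1; have := @layer_ge R (f s + d) d n d0 (addr_ge0 (fge s) (ltW d0)).
  rewrite (_ : f s + d + d = f s + 2 * d); last by ring.
  apply: le_trans; rewrite ler_pM2l//; apply: ler_sum => k _.
  by case: asboolP => [[->]//|_]; rewrite ler0n.
rewrite /avg.
apply: (@le_trans _ _ ((cnt O0 S)%:R^-1 * (\sum_(s <- S) f s + (2 * d) * (cnt K2 S)%:R))).
  by rewrite ler_pM2l ?invr_gt0.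
rewrite mulrDr lerD2l ler_pdivrMl//.
have := ler_wpM2l (ltW d0) HC.
have -> : e = d * (3 * C + 1) by rewrite /d divfK// gt_eqF// addr_gt0// mulr_gt0.
have := mulr_gt0 d0 n0; have := mulr_gt0 C0 (mulr_gt0 d0 n0).
move: (cnt K2 S)%:R (cnt O0 S)%:R n0 d0 C0 => a b; nra.
Qed.

Lemma csupp_translate (V : tvsType R) (K : set G) (f : G -> V) (h : G) :
  csupp K f -> csupp [set g | K (h * g)%g] (fun g => f (h * g)%g).
Proof.
move=> [cK fc f0]; split.
- have -> : [set g | K (h * g)%g] = [set (h^-1 * g)%g | g in K].
    apply/seteqP; split=> g /=; first by move=> Kg; exists (h * g)%g; rewrite ?mulKg.
    by move=> [g' Kg' <-]; rewrite mulVKg.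
  apply: continuous_compact => //.
  by apply: continuous_subspaceT; exact: (lmul_cont mulG_cont).
- move=> g; apply: (@cvg_comp _ _ _ (fun g => (h * g)%g) f _ (nbhs (h * g)%g)).
    exact: (@lmul_cont G mulG_cont h g).
  exact: fc.
- by move=> g /= /f0.
Qed.

Lemma scal_translate (K : set G) (f : G -> R^o) (h : G) (x : R^o) :
  csupp K f -> (forall g, 0 <= f g) -> avg f @ F --> x ->
  avg (fun g => f (h * g)%g) @ F --> x.
Proof.
move=> sf f0 fx; have sfh := csupp_translate h sf.
have [y fy] := scal_cvg sfh.
suff -> : x = y by [].
apply/eqP; rewrite eq_le (scal_translate_le sf f0 fx fy) andbT.
apply: (@scal_translate_le _ (fun g => f (h * g)%g) h^-1%g y x sfh) => //.
by rewrite (_ : (fun g => _) = f)//; apply/funext => g; rewrite mulVKg.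
Qed.

(** The averages of [f] and of its translate are both close to one vector [w], the limit for an
    approximation by scalar functions, whose averages are already invariant. This gives the Cauchy
    property as well as invariance. *)
Lemma near_translates (V : tvsType R) (K : set G) (f : G -> V) (D : set V) h :
  csupp K f -> disk D -> exists w : V, \forall S \near F,
    D (avg f S - w) /\ D (avg (fun g => f (h * g)%g) S - w).
Proof.
move=> sf dD; have [cK fc f0] := sf; have [K1 cK1 KK1] := compact_nbhd cK.
have K1f g : ~ K1 g -> f g = 0 by move=> nK1; apply: f0 => /KK1/nbhs_singleton.
have [N dN ND] := disk_half (let: And3 D0 _ _ := dD in D0).
have cK1h : compact [set g | K1 (h * g)%g].
  have sf1 : csupp K1 f by [].
  by case: (csupp_translate h sf1).
have [C1 C10 HC1] := near_mass cK1; have [C2 C20 HC2] := near_mass cK1h.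
(* A common bound for the masses of [K1] and of its translate. *)
pose C := C1 + C2; have C0 : 0 < C by rewrite addr_gt0.
have dN' := disk_preim (negbT (gt_eqF C0)) dN.
have [t tP tD] := pou_approx sf cK1 KK1 dN'.
have [w Hw Hwh] : exists2 w : V, (fun S => \sum_(p <- t) avg p.1 S *: p.2) @ F --> w &
    (fun S => \sum_(p <- t) avg (fun g => p.1 (h * g)%g) S *: p.2) @ F --> w.
  elim: (t) tP => [|p t' IH] tP'.
    by exists 0; rewrite (_ : (fun=> _) = fun=> 0); try exact: cvg_cst; apply/funext => S; rewrite big_nil.
  have [|w Hw Hwh] := IH; first by move=> q qt; apply: tP'; right.
  have [sp p0] := tP' p (or_introl erefl); have [x px] := scal_cvg sp.
  have pxh := scal_translate h sp p0 px.
  exists (x *: p.2 + w).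
    rewrite (_ : (fun S => _) = fun S => avg p.1 S *: p.2 + \sum_(q <- t') avg q.1 S *: q.2); last first.
      by apply/funext => S; rewrite big_cons.
    by apply: addv_cvg => //; apply: scalev_cvg => //; exact: cvg_cst.
  rewrite (_ : (fun S => _) = fun S => avg (fun g => p.1 (h * g)%g) S *: p.2 +
    \sum_(q <- t') avg (fun g => q.1 (h * g)%g) S *: q.2); last first.
    by apply/funext => S; rewrite big_cons.
  by apply: addv_cvg => //; apply: scalev_cvg => //; exact: cvg_cst.
exists w.
have nN : nbhs 0 N by case: dN.
have cw (q : seq G -> V) : q @ F --> w -> \forall S \near F, N (q S - w).
  move=> qw; have : (fun S => q S - w) @ F --> w - w by apply: subv_cvg => //; exact: cvg_cst.
  by rewrite subrr => /(_ _ nN).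
have h1 := cw _ Hw; have h2 := cw _ Hwh.
have t0 g : ~ K1 g -> \sum_(p <- t) p.1 g *: p.2 = 0.
  move=> nK1; elim: (t) tP => [|p t' IH] tP'; first by rewrite big_nil.
  rewrite big_cons IH ?addr0; last by move=> q qt; apply: tP'; right.
  by have [[_ _ ->]] := tP' p (or_introl erefl); rewrite ?scale0r.
have CC S C' : C' <= C -> (cnt K1 S)%:R <= C' * (cnt O0 S)%:R -> (cnt K1 S)%:R <= C * (cnt O0 S)%:R.
  by move=> CC' /le_trans; apply; rewrite ler_wpM2r.
have Cv v : N (C *: (C^-1 *: v)) = N v by rewrite scalerA mulfV ?scale1r// gt_eqF.
have e1 : \forall S \near F, N (avg f S - \sum_(p <- t) avg p.1 S *: p.2).
  apply: filterS HC1 => S [HC N0]; rewrite -avg_comb -avgB -Cv.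
  apply: (@disk_avg V [set v | N (C *: v)] K1) => //.
    by move=> g nK; rewrite K1f// t0// subrr.
  by apply: le_trans HC _; rewrite ler_wpM2r// lerDl ltW.
have e2 : \forall S \near F, N (avg (fun g => f (h * g)%g) S -
    \sum_(p <- t) avg (fun g => p.1 (h * g)%g) S *: p.2).
  apply: filterS HC2 => S [HC N0].
  have -> : \sum_(p <- t) avg (fun g => p.1 (h * g)%g) S *: p.2 =
      avg (fun g => \sum_(p <- t) p.1 (h * g)%g *: p.2) S.
    rewrite /avg exchange_big /= scaler_sumr; apply: eq_bigr => p _.
    by rewrite -scaler_suml scalerA.
  rewrite -avgB -Cv.
  apply: (@disk_avg V [set v | N (C *: v)] [set g | K1 (h * g)%g]) => //.
    by move=> g nK; rewrite K1f// t0// subrr.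
  by apply: le_trans HC _; rewrite ler_wpM2r// lerDr ltW.
near=> S.
have h1' : N (\sum_(p <- t) avg p.1 S *: p.2 - w) by near: S; exact: h1.
have h2' : N (\sum_(p <- t) avg (fun g => p.1 (h * g)%g) S *: p.2 - w).
  by near: S; exact: h2.
have e1' : N (avg f S - \sum_(p <- t) avg p.1 S *: p.2) by near: S; exact: e1.
have e2' : N (avg (fun g => f (h * g)%g) S -
    \sum_(p <- t) avg (fun g => p.1 (h * g)%g) S *: p.2) by near: S; exact: e2.
split.
  by rewrite -[avg f S](subrK (\sum_(p <- t) avg p.1 S *: p.2)) -addrA; exact: ND.
rewrite -[avg (fun g => f (h * g)%g) S](subrK (\sum_(p <- t) avg (fun g => p.1 (h * g)%g) S *: p.2)).
by rewrite -addrA; exact: ND.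
Unshelve. all: by end_near. Qed.

(** The averages over covers whose count in [K] is controlled form a bounded set, and almost all
    averages are of this kind. Its closure is bounded and closed, which is what quasi-completeness
    asks for. *)
Lemma quasi_cvg (V : tvsType R) (K : set G) (f : G -> V) : quasi_complete V ->
  csupp K f -> exists x : V, avg f @ F --> x.
Proof.
move=> qV sf; have [cK fc f0] := sf; have [C C0 HC] := near_mass cK.
pose X := [set avg f S | S in [set S | (cnt K S)%:R <= C * (cnt O0 S)%:R /\ (0 < cnt O0 S)%N]].
have bX : vn_bounded (closure X).
  move=> U nU; have [D dD DU] := disk_half nU.
  have [r r0 Hr] := compact_absorb cK (fun g _ => fc g) dD.
  (* A point of the closure is an average plus an error in [D]: the bound 1 absorbs the error, the
     bound [C * r] the average. *)
  exists (Num.max 1 (C * r)) => t; rewrite gt_max => /andP[t1 tCr] x Xx.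
  have t0 : t != 0 by rewrite -normr_gt0 (lt_trans ltr01).
  have [v [[S [HS N0] <-] /= Dv]] : X `&` [set v | D (x - v)] !=set0.
    apply: Xx; apply/nbhs_translate; case: dD => D0 _ sD.
    by apply: filterS D0 => y /sD /=; rewrite opprD addrA subrr add0r.
  exists (t^-1 *: x); last by rewrite scalerA mulfV ?scale1r.
  rewrite -[x](subrK (avg f S)) scalerDr; apply: DU.
    by apply: disk_scale => //; rewrite normfV invf_le1 ?normr_gt0// ltW.
  have := @disk_avg V D K (fun g => r^-1 *: f g) S C dD Hr _ C0 HS N0.
  rewrite avgZ => H; have : D (C^-1 *: (r^-1 *: avg f S)).
    by apply: H => s /f0 ->; rewrite scaler0.
  move=> /(@disk_scale _ _ _ (t^-1 * (C * r)) _ dD).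
  have -> : (t^-1 * (C * r)) *: (C^-1 *: (r^-1 *: avg f S)) = t^-1 *: avg f S.
    have C1 : C != 0 by rewrite gt_eqF.
    have r1 : r != 0 by rewrite gt_eqF.
    have E : C * (r * (C^-1 * r^-1)) = 1 by rewrite mulrA -invfM mulfV// mulf_neq0.
    by move: (avg f S) => z; rewrite !scalerA -!mulrA E mulr1.
  apply; rewrite normrM normfV mulrC ler_pdivrMr ?normr_gt0// mul1r.
  by rewrite ger0_norm ?ltW// mulr_gt0.
have [||x _ fx] := @qV _ bX (@closed_closure _ X) (avg f @ F).
- by apply: filterS HC => S HS; apply: subset_closure; exists S.
- move=> U nU; have [N dN NU] := disk_half nU.
  have [w Hw] := near_translates 1%g sf dN.
  exists [set v | N (v - w)]; first by apply: filterS Hw => S [].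
  move=> u v /= Nu Nv; have -> : u - v = (u - w) + - (v - w).
    by rewrite opprB addrA subrK.
  by apply: NU => //; case: dN => _ _; apply.
by exists x.
Qed.

(** Both averages converge, and both are eventually close to the vector of [near_translates]; the
    Hausdorff property identifies the limits. *)
Lemma avg_translate (V : tvsType R) (K : set G) (f : G -> V) (h : G) (x : V) :
  hausdorff_space V -> quasi_complete V -> csupp K f -> avg f @ F --> x ->
  avg (fun g => f (h * g)%g) @ F --> x.
Proof.
move=> hV qV sf fx; have [y fy] := quasi_cvg qV (csupp_translate h sf).
suff /eqP : x - y = 0 by rewrite subr_eq0 => /eqP ->.
apply: hausdorff_disk0 => // D dD.
have [N dN ND] := disk_half (let: And3 D0 _ _ := dD in D0).
have [P dP PN] := disk_half (let: And3 D0 _ _ := dN in D0).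
have nP : nbhs 0 P by case: dP.
have sP v : P v -> P (- v) by case: dP => _ _; apply.
have [w Hw] := near_translates h sf dP.
have cw (q : seq G -> V) z : q @ F --> z -> \forall S \near F, P (q S - z).
  move=> qw; have : (fun S => q S - z) @ F --> z - z by apply: subv_cvg => //; exact: cvg_cst.
  by rewrite subrr => /(_ _ nP).
have [S [[Sx Sy] [Sw Swh]]] := filter_ex (filterI (filterI (cw _ _ fx) (cw _ _ fy)) Hw).
have -> : x - y = (- (avg f S - x) + (avg f S - w)) +
    (- (avg (fun g => f (h * g)%g) S - w) + (avg (fun g => f (h * g)%g) S - y)).
  rewrite !opprB !addrA subrK; congr (_ - _).
  by rewrite -!addrA addKr addrA subrK.
by apply: ND; apply: PN => //; apply: sP.
Qed.

(** Continuity of the integral at 0 for uniform convergence: [D] depends on [K] and [U] only and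
    works for every function that vanishes off [K]. *)
Lemma avg_small (V : tvsType R) (K : set G) (U : set V) : compact K -> nbhs 0 U ->
  exists2 D, disk D & forall f x, (forall g, ~ K g -> f g = 0) -> avg f @ F --> x ->
    (forall g, K g -> D (f g)) -> U x.
Proof.
move=> cK nU; have [N dN NU] := disk_half nU; have [C C0 HC] := near_mass cK.
have dD := disk_preim (negbT (gt_eqF C0)) dN.
exists [set v | N (C *: v)] => // f x f0 fx fN.
have nN : nbhs 0 N by case: dN.
have : (fun S => x - avg f S) @ F --> x - x by apply: subv_cvg => //; exact: cvg_cst.
rewrite subrr => /(_ _ nN) Hx.
have [S [[HS N0] /= Nx]] := filter_ex (filterI HC Hx).
rewrite -[x](subrK (avg f S)); apply: NU => //.
have := @disk_avg V [set v | N (C *: v)] K f S C dD fN f0 C0 HS N0.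
by rewrite /= scalerA mulfV ?scale1r// gt_eqF.
Qed.

(** The set where [f] exceeds half of [f g0] is open and nonempty, hence carries a fixed fraction of
    the mass of [A0]. *)
Lemma avg_pos (K : set G) (f : G -> R^o) g0 x : csupp K f -> (forall g, 0 <= f g) ->
  0 < f g0 -> avg f @ F --> x -> 0 < x.
Proof.
move=> [cK fc f0] fge fg0 fx.
have oO : open [set g | f g0 / 2 < f g].
  by rewrite openE => g /= Hg; apply: near_gt => //; exact: fc.
have g0O : f g0 / 2 < f g0 by rewrite ltr_pdivrMr// ltr_pMr// ltr1n.
have [n Hn] := cnt_dominated mulG_cont invG_cont cA0 nA0 cA0 oO (ex_intro _ g0 g0O).
have [C C0 HC] := near_mass cA0.
apply: (@lt_le_trans _ _ (f g0 / 2 / (n%:R + 1))).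
  by rewrite !divr_gt0// ltr_wpDl.
have fle : \forall S \near F, f g0 / 2 / (n%:R + 1) <= avg f S.
  apply: filterS2 (HF Hn) HC => S Sn [_ N0].
  have n0 : 0 < (cnt O0 S)%:R :> R by rewrite ltr0n.
  rewrite /avg ler_pdivlMl// mulrA ler_pdivrMr ?ltr_wpDl//.
  apply: (@le_trans _ _ ((n * cnt [set g | (f g0 / 2 < f g)%R] S)%N%:R * (f g0 / 2))).
    rewrite ler_wpM2r ?divr_ge0 ?fge// ler_nat (leq_trans _ Sn)//.
    by apply: cnt_le; exact: interior_subset.
  rewrite natrM cntE -mulrA mulr_suml mulrC.
  apply: ler_pM => //; last by rewrite lerDl.
    by apply: sumr_ge0 => s _; rewrite mulr_ge0 ?ler0n ?divr_ge0// ltW.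
  apply: ler_sum => s _; case: asboolP => [/ltW|_]; first by rewrite mul1r.
  by rewrite mul0r.
exact: (lim_ge fx fle).
Qed.

End VectorHaar.

(** * Spaces of smooth functions *)

Section LocallyCompact.
Context {R : realType}.

Lemma compact_nbhs_rV n (y : 'rV[R]_n) (O : set 'rV[R]_n) : nbhs y O ->
  exists K, [/\ compact K, K `<=` O & nbhs y K].
Proof.
move=> /nbhs_closedballP[e eO]; exists (closed_ball y e%:num); split=> //.
  apply: bounded_closed_compact; last exact: closed_ball_closed.
  have -> : closed_ball y e%:num = closed_ball_ [eta Num.Def.normr] y e%:num by rewrite closed_ballE.
  exists (`|y| + e%:num); split; first exact: num_real.
  move=> r yr z /= yz; apply: ltW; apply: le_lt_trans yr.
  by rewrite -[z](subrK y) addrC (le_trans (ler_normD _ _))// lerD2l distrC.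
apply: filterS (nbhsx_ballx y e%:num _) => //; exact: subset_closure.
Qed.

End LocallyCompact.

Lemma continuous_pair (T T1 T2 : topologicalType) (f : T -> T1) (g : T -> T2) (x : T) :
  {for x, continuous f} -> {for x, continuous g} ->
  {for x, continuous (fun y => (f y, g y))}.
Proof. by move=> fx gx; exact: (cvg_pair fx gx). Qed.

Lemma pairl_continuous (T T' : topologicalType) (a : T) :
  continuous (fun y : T' => (a, y)).
Proof. by move=> y; apply: continuous_pair; [exact: cvg_cst|exact: cvg_id]. Qed.

Section SmoothFunctions.
Context {R : realType} (n : nat) (T : topologicalType).
Local Notation E := 'rV[R]_n.
Variable A : set (chart T E).
Hypothesis hA : smooth_manifold A.
Variable V : tvsType R.
Hypothesis hV : hausdorff_space V.

Let cov := manifold_cover hA.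

Lemma Cinf_smooth (f : Cinf A V) : smooth_fun A f.
Proof. by case: f => f /= /asboolP. Qed.

Lemma to_CinfK (f : T -> V) : smooth_fun A f -> to_Cinf A f = f :> (T -> V).
Proof. by move=> sf; rewrite /to_Cinf insubdK//; apply/asboolP. Qed.

Lemma Cinf_eq (f g : Cinf A V) : (forall x, f x = g x) -> f = g.
Proof. by move=> fg; apply: val_inj; apply/funext. Qed.

Lemma CinfD (f g : Cinf A V) x : (f + g) x = f x + g x. Proof. by []. Qed.
Lemma CinfZ a (f : Cinf A V) x : (a *: f) x = a *: f x. Proof. by []. Qed.

Lemma Cinf_cvg (X : Type) (F : set_system X) {FF : Filter F} (P : X -> Cinf A V) (l : Cinf A V) :
  (forall c K (s : seq E) (O : set V), A c -> compact K -> K `<=` img c -> open O ->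
    (forall y, K y -> O (dderives s (l \o prm c) y)) ->
    \forall x \near F, forall y, K y -> O (dderives s (P x \o prm c) y)) ->
  P @ F --> l.
Proof.
move=> H B; rewrite nbhsE => -[B' [oB' B'l] B'B].
apply: (filterS B'B); rewrite nbhs_simpl /=.
case: oB' B'l => D' sD' <- [i D'i il].
suff : F (P @^-1` i) by apply: filterS => x ?; exists i.
have [D sD iE] := sD' _ D'i; rewrite -iE in il *.
rewrite preimage_bigcap; apply: filter_bigI => j jD.
have := sD _ jD; rewrite inE => -[c [K [s [Q1 [Ac cK Kc oO jE]]]]].
have := il j jD; rewrite {}jE /= => lO.
exact: (H c K s Q1).
Qed.

Lemma Cinf_open c K (s : seq E) (O : set V) : A c -> compact K -> K `<=` img c -> open O ->
  open [set f : Cinf A V | forall y, K y -> O (dderives s (f \o prm c) y)].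
Proof.
move=> Ac cK Kc oO; set B := [set f : Cinf A V | _].
have BF : finI_from (@Cinf_subbase R T E A V) id B.
  by apply: (@finI_from1 _ _ (@Cinf_subbase R T E A V) id B); exists c, K, s, O.
by exists [set B]; [move=> _ ->|rewrite bigcup_set1].
Qed.

Lemma Cinf_hausdorff : hausdorff_space (Cinf A V).
Proof.
rewrite open_hausdorff => f g fg.
have [x fgx] : exists x, f x != g x.
  apply: contrapT => /forallNP H; move/eqP: fg; apply; apply: Cinf_eq => x.
  by apply/eqP; apply/negP => /negP; exact: H.
have [c Ac cx] := cov.1 x; have hc := cov.2 _ Ac.
have := hV; rewrite open_hausdorff => /(_ _ _ fgx) [[P Q] /= [fP gQ] [oP oQ /eqP PQ]].
(* A subbasic set for a single point and no derivative, so that evaluation at [x] separates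
   functions. *)
pose B (O : set V) : set (Cinf A V) :=
  [set f : Cinf A V | forall y, [set crd c x] y -> O (dderives [::] (f \o prm c) y)].
have BE O (h : Cinf A V) : B O h <-> O (h x).
  split=> [/(_ _ erefl)|Oh y ->] /=; rewrite /= chartK//.
have oB O : open O -> open (B O).
  move=> oO; apply: Cinf_open => //; first exact: compact_set1.
  by move=> _ ->; exact: img_dom.
exists (B P, B Q) => /=; first by rewrite !inE; split; apply/BE; rewrite -inE.
split; [exact: oB|exact: oB|].
apply/eqP/seteqP; split=> // h [/BE Ph /BE Qh].
by have : (P `&` Q) (h x) by []; rewrite PQ.
Qed.

Section Slices.
Variables (E0 : tvsType R).

Lemma diff_quot_fst (F : E0 * E -> V) u y v :
  diff_quot F (u, y) ((v, 0) : E0 * E) = diff_quot (fun u => F (u, y)) u v.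
Proof.
apply/funext => h; rewrite /diff_quot; congr (_ *: (F _ - _)).
by apply/pair_equal_spec; rewrite /= scaler0 addr0.
Qed.

Lemma diff_quot_snd (F : E0 * E -> V) u y v :
  diff_quot F (u, y) ((0, v) : E0 * E) = diff_quot (fun y => F (u, y)) y v.
Proof.
apply/funext => h; rewrite /diff_quot; congr (_ *: (F _ - _)).
by apply/pair_equal_spec; rewrite /= scaler0 addr0.
Qed.

Lemma dderive_fst (F : E0 * E -> V) u y v :
  dderive ((v, 0) : E0 * E) F (u, y) = dderive v (fun u => F (u, y)) u.
Proof. by rewrite /dderive diff_quot_fst. Qed.

Lemma dderive_snd (F : E0 * E -> V) u y v :
  dderive ((0, v) : E0 * E) F (u, y) = dderive v (fun y => F (u, y)) y.
Proof. by rewrite /dderive diff_quot_snd. Qed.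

Definition dsnd (s : seq E) : seq (E0 * E) := [seq ((0, v) : E0 * E) | v <- s].

Lemma dderives_snd (F : E0 * E -> V) u y s :
  dderives (dsnd s) F (u, y) = dderives s (fun y => F (u, y)) y.
Proof.
elim: s y => [//|v s IH] y /=; rewrite dderive_snd; congr (dderive v _ y).
by apply/funext => z; exact: IH.
Qed.

End Slices.

Lemma dderive_scaleB (E1 : tvsType R) (U : set E1) (f g : E1 -> V) a v x : open U ->
  smooth_on U f -> smooth_on U g -> U x ->
  dderive v (fun y => a *: (f y - g y)) x = a *: (dderive v f x - dderive v g x).
Proof.
move=> oU sf sg Ux; apply: cvg_dderive => //.
apply: cvg_eq_near (@scalev_cvg _ _ _ _ _ (fun=> a) _ a _ (cvg_cst _)
  (subv_cvg (smooth_cvg hV oU sf Ux) (smooth_cvg hV oU sg Ux))).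
apply: filterS filterT => h _.
by rewrite /diff_quot -!scalerBr [LHS]scalerA mulrC -scalerA subrACA.
Qed.

Lemma dderives_scaleB (E1 : tvsType R) (U : set E1) (f g : E1 -> V) a s x : open U ->
  smooth_on U f -> smooth_on U g -> U x ->
  dderives s (fun y => a *: (f y - g y)) x = a *: (dderives s f x - dderives s g x).
Proof.
move=> oU sf sg; elim: s x => [//|v s IH] x Ux /=.
rewrite (dderive_eq v oU IH Ux) (dderive_scaleB _ _ oU)//; exact: smooth_on_dderives.
Qed.

Lemma dderive_dderives (E1 : tvsType R) (U : set E1) (f : E1 -> V) v s x : open U ->
  smooth_on U f -> U x ->
  dderives s (dderive v f) x = dderive v (dderives s f) x.
Proof.
move=> oU sf; elim: s x => [//|w s IH] x Ux /=.
rewrite (dderive_eq w oU IH Ux); apply: (dderiveC hV _ _ oU) => //.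
exact: smooth_on_dderives.
Qed.

(** A tube argument: over a compact set of chart points, joint continuity of the chart derivatives
    becomes uniform. *)
Lemma Cinf_curry_cont (E0 : tvsType R) (U : set E0) (P : E0 -> Cinf A V) : open U ->
  (forall c, A c -> @smooth_on R (E0 * E)%type V (U `*` img c)
     (fun p => P p.1 (prm c p.2))) -> Ck_on 0 U P.
Proof.
move=> oU sP u Uu; apply: Cinf_cvg => c K s O Ac cK Kc oO HO.
have oUc : open (U `*` img c) by apply: open_setX => //; apply: chart_openI; exact: cov.2.
have := (compact_near_coveringP K).1 cK E0 (nbhs u)
  (fun u y => O (dderives s (P u \o prm c) y)) _.
apply=> y Ky.
have := smooth_on_dderives (dsnd E0 s) hV oUc (sP c Ac).
move=> /(_ 0 (u, y) (conj Uu (Kc _ Ky))) /(_ O).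
rewrite dderives_snd /=; case; first by apply: open_nbhs_nbhs; split=> //; exact: HO.
move=> [B1 B2] /= [uB1 yB2] BO; exists (B2, B1) => //= -[y' u'] [/= By Bu].
by have := BO (u', y') (conj Bu By); rewrite /= dderives_snd.
Qed.

(* The two halves of the exponential law
   C^oo(U, C^oo(T, V)) = C^oo(U x T, V). *)
Lemma Cinf_curry k (E0 : tvsType R) (U : set E0) (P : E0 -> Cinf A V) : open U ->
  (forall c, A c -> @smooth_on R (E0 * E)%type V (U `*` img c)
     (fun p => P p.1 (prm c p.2))) -> Ck_on k U P.
Proof.
elim: k E0 U P => [|k IH] E0 U P oU sP; first exact: Cinf_curry_cont.
(* The derivative of [P], taken pointwise in [t]. It is a partial derivative of a jointly smooth
   function, hence smooth in [t] and again an instance of the lemma. *)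
pose Xi (p : E0 * E0) (t : T) := dderive p.2 (fun u => P u t) p.1.
have oUc c : A c -> open (U `*` img c).
  by move=> Ac; apply: open_setX => //; apply: chart_openI; exact: cov.2.
have XiE c p y : A c -> Xi p (prm c y) =
    dderive ((p.2, 0) : E0 * E) (fun q => P q.1 (prm c q.2)) (p.1, y).
  by move=> Ac; rewrite dderive_fst.
have cpair (a : E0) : continuous (fun y : E => (a, y) : E0 * E).
  exact: pairl_continuous.
have sXi p : U p.1 -> smooth_fun A (Xi p).
  move=> Up c Ac k'; apply: (@Ck_on_eq _ _ _ _ _ ((dderive ((p.2, 0) : E0 * E)
    (fun q => P q.1 (prm c q.2))) \o (fun y => (p.1, y)))).
  - by apply: chart_openI; exact: cov.2.
  - by move=> y _; rewrite /= XiE.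
  apply: (@Ck_on_affine _ _ _ _ (E0 * E)%type (U `*` img c) _ _ _ (fun y => (0, y))).
  - by move=> y v h; split; apply/pair_equal_spec; rewrite /= scaler0 addr0.
  - exact: cpair.
  - exact: cpair.
  - by [].
  - by apply: (smooth_dderive hV (oUc c Ac)); exact: sP.
split; first exact: Cinf_curry_cont.
exists (fun p => to_Cinf A (Xi p)); split; last first.
  apply: (IH _ (U `*` setT)); first exact: open_setX oU openT.
  move=> c Ac k'.
  apply: (@Ck_on_eq _ _ _ _ _ ((fun q : (E0 * E) * (E0 * E) =>
     dderive q.2 (fun q => P q.1 (prm c q.2)) q.1) \o
     (fun r : (E0 * E0) * E => ((r.1.1, r.2), (r.1.2, 0))))).
  - by apply: open_setX; [exact: open_setX oU openT|apply: chart_openI; exact: cov.2].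
  - by move=> [p y] [/= [Up _] _]; rewrite to_CinfK ?XiE//; exact: sXi.
  have aL : @affine R ((E0 * E0) * E)%type ((E0 * E) * (E0 * E))%type
      (fun r => ((r.1.1, r.2), (r.1.2, 0))) (fun r => ((r.1.1, r.2), (r.1.2, 0))).
    by move=> [[a1 a2] y1] [[b1 b2] y2] h; split; (do ![apply/pair_equal_spec; split=> //=]; rewrite scaler0 addr0).
  have cL : continuous (fun r : (E0 * E0) * E => (((r.1.1, r.2), (r.1.2, 0)) : (E0 * E) * (E0 * E))).
    move=> r; apply: continuous_pair; apply: continuous_pair.
    - by apply: (@cvg_comp _ _ _ fst fst _ (nbhs r.1)); exact: cvg_fst.
    - exact: cvg_snd.
    - by apply: (@cvg_comp _ _ _ fst snd _ (nbhs r.1)); [exact: cvg_fst|exact: cvg_snd].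
    - exact: cvg_cst.
  apply: (Ck_on_affine aL cL cL _ (smooth_tan hV (oUc c Ac) (sP c Ac) k')).
  by move=> [[a1 a2] y] [[/= ? _] ?].
move=> u v Uu; apply: Cinf_cvg => c K s O Ac cK Kc oO HO.
rewrite to_CinfK in HO; last exact: sXi.
pose F q := P q.1 (prm c q.2).
pose Q := dderives (dsnd E0 s) F.
have oc : open (img c) by apply: chart_openI; exact: cov.2.
have sF := sP c Ac; have sQ := smooth_on_dderives (dsnd E0 s) hV (oUc c Ac) sF.
have HOE y : K y -> O (dderive ((v, 0) : E0 * E) Q (u, y)).
  move=> Ky; have := HO y Ky.
  rewrite -(dderive_dderives _ _ (oUc c Ac) sF); last by split=> //; exact: Kc.
  rewrite dderives_snd; congr (O (dderives s _ y)).
  by apply/funext => z; rewrite /= XiE.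
have FF : Filter (0 : R)^' by exact: _.
(* [Q] already contains the chart derivatives, which commute with the derivative along [v]. Its
   quotients converge uniformly on [K], because [strong_quot] lets the chart point move. *)
have H1 : \forall h \near (0 : R)^', forall y, K y -> O (h^-1 *: (Q (u + h *: v, y) - Q (u, y))).
  apply: ((compact_near_coveringP K).1 cK R (0 : R)^'
    (fun h y => O (h^-1 *: (Q (u + h *: v, y) - Q (u, y)))) FF) => y Ky.
  pose F2 := filter_prod (nbhs y) (0 : R)^'.
  have FF2 : Filter F2 by exact: filter_prod_filter.
  have P2 (P' : set R) : (\forall h \near (0 : R)^', P' h) -> \forall p \near F2, P' p.2.
    by move=> HP; exists (setT, P') => [|[? ?] []//]; split=> //; exact: filterT.
  have SQ : (fun p : E * R => p.2^-1 *: (Q ((u, p.1) + p.2 *: (v, 0)) - Q (u, p.1))) @ F2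
      --> dderive ((v, 0) : E0 * E) Q (u, y).
    apply: (@strong_quot R (E0 * E)%type V (U `*` img c) setT Q (fun p => dderive p.2 Q p.1)
      (u, y) (v, 0) _ F2 FF2 (fun p => (u, p.1)) (fun=> (v, 0)) snd (oUc c Ac)).
    - by split=> //; exact: Kc.
    - by move=> z w Uz _; exact: (smooth_cvg hV (oUc c Ac) sQ Uz).
    - apply: (smooth_tan hV (oUc c Ac) sQ 0 ((u, y), (v, 0))).
      by split=> //; split=> //; exact: Kc.
    - apply: (@cvg_comp _ _ _ fst (pair u) F2 (nbhs y)); last exact: pairl_continuous.
      by move=> B yB; exists (B, setT) => [|[? ?] []//]; split=> //; exact: filterT.
    - exact: cvg_cst.
    - by move=> B /nbhs_dnbhs/P2.
    - exact: (P2 (fun h => h != 0) (@nbhs_dnbhs_neq _ _)).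
    - exact: filterS filterT.
  have [|[B1 B2] /= [yB1 B20] BO] := SQ O; first by apply: open_nbhs_nbhs; split=> //; exact: HOE.
  exists (B1, B2) => //= -[y' h] /= [By' Bh].
  have := BO (y', h) (conj By' Bh); congr (O (_ *: (Q _ - _))).
  by apply/pair_equal_spec; rewrite /= scaler0 addr0.
have H2 : \forall h \near (0 : R)^', U (u + h *: v).
  by apply: near_line; exact: open_nbhs_nbhs.
apply: filterS2 H1 H2 => h H1 Uh y Ky; have := H1 y Ky.
rewrite /Q !dderives_snd -(dderives_scaleB _ _ oc)//; last exact: Kc.
- exact: (Cinf_smooth (P (u + h *: v)) Ac).
- exact: (Cinf_smooth (P u) Ac).
Qed.

Lemma ev_cvg c s y (X : Type) (F : set_system X) {FF : Filter F} (P : X -> Cinf A V)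
    (l : Cinf A V) : A c -> img c y -> P @ F --> l ->
  (fun x => dderives s (P x \o prm c) y) @ F --> dderives s (l \o prm c) y.
Proof.
move=> Ac cy Pl O; rewrite nbhsE => -[Q1 [oQ1 Q1l] Q1O].
have oB := @Cinf_open c [set y] s Q1 Ac (@compact_set1 _ y) (fun z (e : z = y) => eq_ind_r _ cy e) oQ1.
have /Pl : nbhs l [set f : Cinf A V | forall z, [set y] z -> Q1 (dderives s (f \o prm c) z)].
  by apply: open_nbhs_nbhs; split=> // z ->.
by rewrite /= !nbhs_simpl /=; apply: filterS => x /= /(_ y erefl)/Q1O.
Qed.

(** Coinduction over the functions [(u, y) |-> dderives s (Q u) y] in the chart: a derivative in [u]
    replaces [Q] by its derivative, a derivative in [y] lengthens [s]. *)
Lemma Cinf_uncurry (E0 : tvsType R) (I : finType) (e : I -> E0) phi (U : set E0)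
    (P : E0 -> Cinf A V) c : fdim e phi -> open U -> smooth_on U P -> A c ->
  @smooth_on R (E0 * E)%type V (U `*` img c) (fun p => P p.1 (prm c p.2)).
Proof.
move=> fE0 oU sP Ac; have oc : open (img c) by apply: chart_openI; exact: cov.2.
have hC := Cinf_hausdorff.
pose S : set (E0 * E -> V) := [set F | exists Q s, @smooth_on R E0 (Cinf A V) U Q /\
  F = fun p => dderives s (Q p.1 \o prm c) p.2].
apply: (@smooth_crit R _ _ _ _ _ _ S (fdim_prod fE0 (@fdim_mx R 1 n))).
- exact: open_setX.
- move=> _ [Q [s [sQ ->]]]; split.
    move=> [u y] [/= Uu cy] O; rewrite nbhsE => -[Q1 [oQ1 Q1l] Q1O].
    have sQu : smooth_on (img c) (Q u \o prm c) by exact: Cinf_smooth.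
    have nQ1 : nbhs y (img c `&` [set z | Q1 (dderives s (Q u \o prm c) z)]).
      apply: filterI; first exact: open_nbhs_nbhs.
      apply: (smooth_on_dderives s hV oc sQu 0 y cy); exact: open_nbhs_nbhs.
    (* The topology of the function space controls the derivatives on all of [K] at once, hence also
       at a moving point; local compactness of the chart thus gives joint continuity. *)
    have [K [cK KO yK]] := compact_nbhs_rV nQ1.
    have oB := @Cinf_open c K s Q1 Ac cK (fun z Kz => (KO z Kz).1) oQ1.
    have : nbhs u (Q @^-1` [set f : Cinf A V | forall z, K z -> Q1 (dderives s (f \o prm c) z)]).
      by apply: (sQ 0 u Uu); apply: open_nbhs_nbhs; split=> // z /KO[].
    move=> nB; exists ([set u | forall z, K z -> Q1 (dderives s (Q u \o prm c) z)], K) => //=.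
    by move=> [u' y'] [/= Hu Ky']; apply: Q1O; exact: Hu.
  case=> i.
    exists (fun p => dderives s (dderive (e i) Q p.1 \o prm c) p.2).
      by exists (dderive (e i) Q), s; split=> //; exact: smooth_dderive.
    move=> [u y] [/= Uu cy].
    rewrite diff_quot_fst.
    apply: cvg_eq_near (ev_cvg (s := s) Ac cy (smooth_cvg hC oU sQ Uu (v := e i))); apply: filterS filterT => h _.
    have sQu u' : smooth_on (img c) (Q u' \o prm c) by exact: Cinf_smooth.
    by rewrite /diff_quot /= -(dderives_scaleB _ _ oc).
  exists (fun p => dderives (delta_mx i.1 i.2 :: s) (Q p.1 \o prm c) p.2).
    by exists Q, (delta_mx i.1 i.2 :: s).
  move=> [u y] [/= Uu cy]; rewrite diff_quot_snd.
  have sQu : smooth_on (img c) (Q u \o prm c) by exact: Cinf_smooth.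
  exact: (smooth_cvg hV oc (smooth_on_dderives s hV oc sQu) cy).
- by exists P, [::].
Qed.

End SmoothFunctions.

(** * Bump functions and cutoffs *)

Section FlatFunction.
Context {R : realType}.

Lemma real_quot_cvg (f : R^o -> R^o) (x l : R) : is_derive x (1 : R) f l ->
  diff_quot f x 1 @ 0^' --> (l : R^o).
Proof.
move=> [df fl]; have := df; rewrite /derivable => /cvg_ex[y fy].
have -> : l = y.
  rewrite -fl /derive; apply: (cvg_lim (@norm_hausdorff _ R^o)); exact: fy.
apply: cvg_eq_near fy; apply: filterS filterT => h _.
by rewrite /diff_quot /= [x + _]addrC.
Qed.

(** Polynomials in 1/t times exp(-1/t), extended by 0, form a class stable under differentiation, as
    coinduction requires. *)
Definition flat (p : {poly R}) (t : R^o) : R^o :=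
  if 0 < t then p.[t^-1] * expR (- t^-1) else 0.

Lemma flat_bound (p : {poly R}) : exists2 C : R, 0 < C &
  forall t, 0 < t <= 1 -> `|flat p t| <= C * t ^+ 2.
Proof.
have [B B0 HB] : exists2 B : R, 0 < B & forall s, 1 <= s -> `|p.[s]| <= B * s ^+ size p.
  exists (\sum_(i < size p) `|p`_i| + 1).
    by apply: ltr_wpDl => //; apply: sumr_ge0.
  move=> s s1; have s0 : 0 <= s by apply: le_trans s1.
  rewrite horner_coef mulrDl mul1r mulr_suml.
  apply: (le_trans (ler_norm_sum _ _ _)); apply: ler_wpDr; first exact: exprn_ge0.
  apply: ler_sum => i _; rewrite normrM ler_wpM2l// normrX (ger0_norm s0).
  by apply: ler_weXn2l => //; exact: ltnW.
(* From [exp s >= (s / k)^k] at s = 1/t: [size p] powers of [t] compensate the polynomial, and two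
   remain, which makes the derivative at 0 vanish. *)
pose k := (size p).+2; pose K : R := k%:R ^+ k.
have K0 : 0 < K by rewrite exprn_gt0// ltr0n.
have HE t : 0 < t <= 1 -> expR (- t^-1) <= K * (t ^+ size p * t ^+ 2).
  move=> /andP[t0 t1]; have s0 : 0 < t^-1 by rewrite invr_gt0.
  have tp : 0 < t ^+ k by rewrite exprn_gt0.
  rewrite -exprD addn2 expRN -lef_pV2 ?invrK ?posrE ?invr_gt0 ?expR_gt0 ?(mulr_gt0 K0 tp)//.
  have -> : t^-1 = k%:R * (t^-1 / k%:R).
    by rewrite mulrC divfK// pnatr_eq0.
  rewrite mulrC expRM_natl -exprMn -exprVn invfM.
  have tk0 : 0 <= t^-1 / k%:R by rewrite divr_ge0// ltW.
  rewrite -[leLHS]/((t^-1 / k%:R) ^+ k) lerXn2r// ?nnegrE ?expR_ge0//.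
  by apply: le_trans (expR_ge1Dx _); rewrite lerDr.
clearbody K; exists (B * K); first exact: mulr_gt0.
move=> t t01; have /andP[t0 t1] := t01; rewrite /flat t0.
have s1 : 1 <= t^-1 by rewrite invf_ge1.
rewrite normrM (ger0_norm (expR_ge0 _)).
apply: le_trans (ler_pM _ _ (HB _ s1) (HE t t01)) _ => //.
rewrite -!mulrA ler_pM2l// mulrCA ler_pM2l// mulrA -exprMn mulVf ?gt_eqF//.
by rewrite expr1n mul1r.
Qed.

Lemma flat_smooth (p : {poly R}) : smooth_on setT (flat p).
Proof.
apply: (@smooth_crit R R^o R^o unit _ _ setT [set f | exists q, f = flat q] (@fdim_R R) openT); last by exists p.
(* With s = 1/t, so that ds/dt = -s^2, the derivative of q(s) exp(-s) is s^2 (q - q')(s) exp(-s). *)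
move=> _ [q ->]; suff H x : diff_quot (flat q) x 1 @ 0^' --> (flat ('X^2 * (q - q^`())) x : R^o).
  split; last by move=> _; exists (flat ('X^2 * (q - q^`()))) => //; exists ('X^2 * (q - q^`())).
  move=> x _.
  have := H x; move=> /(@scalev_cvg R R^o R (0 : R)^' _ id _ (0 : R^o) _ (@nbhs_dnbhs _ _)).
  rewrite scale0r => Hx.
  have : (fun h => flat q x + h *: diff_quot (flat q) x 1 h) @ (0 : R)^' --> flat q x.
    by rewrite -[X in _ --> X]addr0; apply: addv_cvg => //; exact: cvg_cst.
  move=> Hx'; have : (fun h => flat q (x + h)) @ (0 : R)^' --> flat q x.
    apply: cvg_eq_near Hx'; apply: filterS (@nbhs_dnbhs_neq R 0) => h h0.
    rewrite /diff_quot scalerA mulfV// scale1r addrC subrK; congr (flat q (x + _)).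
    by rewrite /GRing.scale /= mulr1.
  move=> Hq O xO; have := Hq O xO; rewrite /= !nbhs_simpl /= => /nbhs_ballP[e /= e0 eO].
  apply/nbhs_ballP; exists e => //= y xy; have [->|yx] := eqVneq y x.
    exact: nbhs_singleton xO.
  have := eO (y - x); rewrite /= [x + _]addrC subrK; apply; last by rewrite subr_eq0.
  by move: xy; rewrite -!ball_normE /= sub0r normrN distrC.
have [x0|x0|x0] := ltgtP 0 x.
- have D : is_derive x (1 : R) (fun t : R^o => q.[t^-1] * expR (- t^-1) : R^o) (('X^2 * (q - q^`())).[x^-1] * expR (- x^-1)).
    have xn0 : x != 0 by rewrite gt_eqF.
    have dV : is_derive x (1 : R) (fun t : R => t^-1 : R) (- x ^- 2).
      have := @is_deriveV R id x 1 1 xn0 (is_derive_id _ _).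
      by rewrite /GRing.scale /= mulr1.
    have dN : is_derive x (1 : R) (fun t : R => - t^-1 : R) (x ^- 2).
      by rewrite -[x ^- 2]opprK; exact: (is_deriveN dV).
    have dE : is_derive x (1 : R) (fun t : R => expR (- t^-1) : R) (x ^- 2 * expR (- x^-1)).
      by rewrite mulrC; exact: (@is_derive1_comp R expR (fun t => - t^-1) x _ _ (is_derive_expR _) dN).
    have dQ : is_derive x (1 : R) (fun t : R => q.[t^-1] : R) (- x ^- 2 * q^`().[x^-1]).
      rewrite mulrC; apply: (@is_derive1_comp R (horner q) (fun t => t^-1) x _ _ _ dV).
    have := is_deriveM dQ dE; congr is_derive.
    rewrite /GRing.scale /= hornerM hornerXn hornerD hornerN exprVn.
    by move: q.[x^-1] q^`().[x^-1] (expR _) (x ^- 2) => ? ? ? ?; ring.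
  have : diff_quot (fun t : R^o => q.[t^-1] * expR (- t^-1) : R^o) x 1 @ 0^' --> (flat ('X^2 * (q - q^`())) x : R^o).
    by rewrite /flat x0; exact: real_quot_cvg.
  apply: (@diff_quot_eq _ R^o R^o [set t | 0 < t] _ _ _ _ _ (@open_gt R 0)) => //.
  by move=> t /= t0; rewrite /flat t0.
- have -> : flat ('X^2 * (q - q^`())) x = 0 by rewrite /flat ltNge ltW.
  have : diff_quot (fun t : R^o => 0 : R^o) x 1 @ 0^' --> (0 : R^o).
    by apply: cvg_near_cst; apply: filterS filterT => h _; rewrite /diff_quot subrr scaler0.
  apply: (@diff_quot_eq _ R^o R^o [set t | t < 0] _ _ _ _ _ (@open_lt R 0)) => //.
  by move=> t /= t0; rewrite /flat ltNge ltW.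
- rewrite -x0; have f00 q' : flat q' 0 = 0 by rewrite /flat ltxx.
  rewrite f00; have [C C0 HC] := flat_bound q.
  apply: cvgv_disk => D [D0 _ _]; have [e /= e0 eD] := (nbhs_ballP _ _).1 D0.
  near=> h; apply: eD; rewrite -ball_normE /= sub0r normrN subr0.
  rewrite /diff_quot f00 subr0 add0r /GRing.scale /= mulr1.
  have h0 : h != 0 by near: h; exact: nbhs_dnbhs_neq.
  have [hp|hn] := ltP 0 h; last by rewrite /flat (le_gtF hn) mulr0 normr0.
  have h1 : h <= 1.
    near: h; apply: nbhs_dnbhs; apply/nbhs_ballP; exists 1 => //= z.
    by rewrite -ball_normE /= sub0r normrN => /ltW; apply: le_trans; rewrite ler_norm.
  have he : h < e / C.
    near: h; apply: nbhs_dnbhs; apply/nbhs_ballP; exists (e / C) => /=; first by rewrite divr_gt0.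
    by move=> z; rewrite -ball_normE /= sub0r normrN; apply: le_lt_trans; rewrite ler_norm.
  rewrite normrM normfV (gtr0_norm hp) ltr_pdivrMl//.
  apply: le_lt_trans (HC h _) _; first by rewrite hp.
  by rewrite expr2 mulrCA ltr_pM2l// mulrC -ltr_pdivlMr.
Unshelve. all: by end_near. Qed.

Definition bumpf : R^o -> R^o := flat 1.

Lemma bumpf_ge0 t : 0 <= bumpf t.
Proof. by rewrite /bumpf /flat hornerC mul1r; case: ifP => // _; exact: expR_ge0. Qed.

Lemma bumpf_gt0 t : (0 < bumpf t) = (0 < t).
Proof.
rewrite /bumpf /flat hornerC mul1r; case: ifP => // _; first by rewrite expR_gt0.
Qed.

End FlatFunction.

Lemma compact_image (T T' : topologicalType) (K : set T) (f : T -> T') :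
  compact K -> (forall x, K x -> {for x, continuous f}) -> compact (f @` K).
Proof.
move=> cK cf; apply: continuous_compact cK; apply: continuous_in_subspaceT => x.
by rewrite inE => /cf.
Qed.

Lemma Ck_on_sum (R : realType) (W : topologicalLmodType R) k (E : tvsType R) (U : set E)
    (I : Type) (s : seq I) (f : I -> E -> W) :
  (forall i, Ck_on k U (f i)) -> Ck_on k U (fun x => \sum_(i <- s) f i x).
Proof.
move=> hf; elim: s => [|i s IH].
  by have := Ck_on_0 W k U; congr Ck_on; apply/funext => x; rewrite big_nil.
have := Ck_on_add (hf i) IH; congr Ck_on; apply/funext => x; by rewrite big_cons.
Qed.

Section ManifoldTopology.
Context {R : realType} (n : nat) (T : topologicalType).
Local Notation E := 'rV[R]_n.
Variable A : set (chart T E).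
Hypothesis hA : smooth_manifold A.

Let cov := manifold_cover hA.

Lemma smooth_fun_cont (W : topologicalLmodType R) (f : T -> W) : smooth_fun A f -> continuous f.
Proof.
move=> sf x; have [c Ac cx] := cov.1 x; have hc := cov.2 _ Ac.
have H : {for crd c x, continuous (f \o prm c)} := sf c Ac 0 _ (img_dom cx).
have : {for x, continuous ((f \o prm c) \o crd c)}.
  by apply: continuous_comp; [exact: (crd_cont hc cx)|].
apply: continuous_eq_near; apply: filterS (open_nbhs_nbhs (conj (chart_openD hc) cx)).
by move=> y cy /=; rewrite (chartK hc cy).
Qed.

Lemma locally_compact (x : T) (O : set T) : nbhs x O ->
  exists K, [/\ compact K, K `<=` O & nbhs x K].
Proof.
move=> xO; have [c Ac cx] := cov.1 x; have hc := cov.2 _ Ac.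
have nO : nbhs (crd c x) (img c `&` prm c @^-1` O).
  apply: filterI; first by apply: open_nbhs_nbhs; split; [exact: chart_openI|exact: img_dom].
  by apply: (prm_cont hc (img_dom cx)); rewrite (chartK hc cx).
have [K [cK KO nK]] := compact_nbhs_rV nO; exists (prm c @` K); split.
- by apply: compact_image => // y /KO[iy _]; exact: (prm_cont hc iy).
- by move=> _ [y /KO[_ ?] <-].
- have nK' : nbhs x (dom c `&` crd c @^-1` K).
    apply: filterI; first by apply: open_nbhs_nbhs; split; [exact: chart_openD|].
    exact: (crd_cont hc cx).
  by apply: filterS nK' => y [cy Ky]; exists (crd c y) => //; rewrite (chartK hc cy).
Qed.

(** Each stage is a compact neighbourhood of the previous one together with an envelope of the i-th
    basic open set. Starting from the empty set gives later minimality arguments a first stage that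
    no orbit meets. *)
Lemma exhaustion : exists Q : nat -> set T, [/\ Q 0%N = set0, forall i, compact (Q i),
  forall i, Q i `<=` (Q i.+1)° & forall x, exists i, Q i x].
Proof.
have [_ [B cB [Bo Bb]] _ _ _] := hA.
have /countable_injP[f finj] := cB.
(* Basic sets without compact envelope get the empty set. The remaining ones still cover, by local
   compactness. *)
have /choice[KB KBP] : forall b : set T, exists K : set T, compact K /\
    ((exists2 K', compact K' & b `<=` K') -> b `<=` K).
  move=> b; have [[K' cK' bK']|nK] := pselect (exists2 K', compact K' & b `<=` K').
    by exists K'.
  by exists set0; split=> //; exact: compact0.
pose C (i : nat) : set T := [set x | exists b, [/\ B b, f b = i & KB b x]].
have cC i : compact (C i).
  have [[b [Bb' fb]]|nb] := pselect (exists b, B b /\ f b = i).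
    have -> : C i = KB b.
      apply/seteqP; split=> x; last by exists b.
      move=> [b' [Bb'' fb' Kx]]; suff <- : b' = b by [].
      by apply: finj; rewrite ?inE// fb fb'.
    exact: (KBP b).1.
  have -> : C i = set0; last exact: compact0.
  by apply/seteqP; split=> // x [b [Bb' fb _]]; apply: nb; exists b.
have nb K : exists K1 : set T, compact K -> compact K1 /\ K `<=` K1°.
  have [cK|nK] := pselect (compact K); last by exists set0.
  have /choice[N NP] : forall x : T, exists N, compact N /\ nbhs x N.
    by move=> x; have [N [cN _ xN]] := locally_compact (@filterT _ (nbhs x) _); exists N.
  have [t tP] := @compact_fin T T K (fun x => (N x)°) cK
    (fun x _ => ex_intro _ x (nbhs_interior (NP x).2)).
  exists (\big[setU/set0]_(x <- t) N x) => _; split.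
    by apply: bigsetU_compact => x _; case: (NP x).
  move=> x /tP[y yt Ny]; apply: filterS Ny => z Nz.
  by rewrite -bigcup_seq; exists y.
have /choice[nbK nbKP] := nb.
pose Q := fix Q i := match i with 0%N => set0 | i'.+1 => nbK (Q i' `|` C i') end.
have cQ i : compact (Q i).
  elim: i => [|i IH] /=; first exact: compact0.
  by apply: (nbKP _ _).1; exact: compactU.
have Qs i : Q i `|` C i `<=` (Q i.+1)° by apply: (nbKP _ _).2; exact: compactU.
exists Q; split=> //; first by move=> i x Qx; apply: Qs; left.
move=> x; have [K [cK _ xK]] := locally_compact (@filterT _ (nbhs x) _).
have [b [/= Bb' bx] bK] := Bb x _ xK.
exists (f b).+1; apply: interior_subset; apply: Qs; right; exists b; split=> //.
by apply: (KBP b).2 => //; exists K.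
Qed.

Lemma manifold_bump (x : T) (O : set T) : nbhs x O ->
  exists b : T -> R^o, exists K, [/\ smooth_fun A b, forall t, 0 <= b t, 0 < b x,
    compact K /\ K `<=` O & forall t, ~ K t -> b t = 0].
Proof.
move=> xO; have [c Ac cx] := cov.1 x; have hc := cov.2 _ Ac.
have [hT _ _ _ trans] := hA.
have nO : nbhs (crd c x) (img c `&` prm c @^-1` O).
  apply: filterI; first by apply: open_nbhs_nbhs; split; [exact: chart_openI|exact: img_dom].
  by apply: (prm_cont hc (img_dom cx)); rewrite (chartK hc cx).
have [K0 [cK0 K0O /nbhs_ballP[e /= e0 eK0]]] := compact_nbhs_rV nO.
(* The Euclidean distance is used because its square is smooth; where [psi] is nonzero, [y] lies in
   the ball of radius [e] for the maximum norm, hence in [K0]. *)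
pose a := crd c x; pose psi (y : E) : R^o := bumpf (e ^+ 2 - \sum_j (y 0 j - a 0 j) ^+ 2).
have spsi : smooth_on setT psi.
  move=> k; apply: (@Ck_on_comp R k E R^o R^o setT setT (fun y : E => e ^+ 2 - \sum_j (y 0 j - a 0 j) ^+ 2 : R^o) bumpf).
  - exact: openT.
  - exact: openT.
  - by [].
  - have H j : Ck_on k setT (fun y : E => y 0 j - a 0 j : R^o).
      apply: Ck_on_add; last exact: Ck_on_cst.
      by apply: (Ck_on_linear _ _ (linear_affine (@mx_entry_linear R 1 n 0 j))); exact: mx_entry_continuous.
    have H2 j : Ck_on k setT (fun y : E => -1 *: ((y 0 j - a 0 j) ^+ 2) : R^o).
      by apply: Ck_on_scale; [exact: openT|exact: Ck_on_cst|exact: (Ck_on_scale openT (H j) (H j))].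
    have := Ck_on_add (Ck_on_cst k setT (e ^+ 2 : R^o)) (Ck_on_sum (index_enum _) H2).
    by congr Ck_on; apply/funext => y; rewrite -scaler_sumr scaleN1r.
  - exact: flat_smooth.
have psi0 y : psi y != 0 -> K0 y.
  move=> py; have {}py : 0 < psi y by rewrite lt_neqAle eq_sym py bumpf_ge0.
  move: py; rewrite /psi bumpf_gt0 subr_gt0 => sy; apply: eK0; split=> // i j; rewrite ord1.
  rewrite -ball_normE /= distrC -ltr_sqr ?nnegrE ?normr_ge0 ?(ltW e0)// real_normK ?num_real//.
  by apply: le_lt_trans sy; rewrite (bigD1 j)//= lerDl sumr_ge0// => k _; exact: sqr_ge0.
pose K := prm c @` K0.
have cK : compact K by apply: compact_image => // y /K0O[iy _]; exact: (prm_cont hc iy).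
have clK : closed K by exact: compact_closed.
pose b t : R^o := if `[< dom c t >] then psi (crd c t) else 0.
have bE t : dom c t -> b t = psi (crd c t) by move=> ct; rewrite /b; case: asboolP.
have b0 t : ~ K t -> b t = 0.
  rewrite /b => nK; case: asboolP => // ct; apply/eqP/negPn/negP => /psi0 kt; apply: nK.
  by exists (crd c t) => //; rewrite (chartK hc ct).
exists b, K; split=> //.
- move=> d Ad; have hd := cov.2 _ Ad; apply: smooth_on_local; [exact: (@norm_hausdorff _ R^o)|move=> y iy].
  have [Kt|nKt] := pselect (K (prm d y)).
    have ct : dom c (prm d y) by case: Kt => z /K0O[iz _] <-; exact: (dom_prm hc iz).
    exists (img d `&` prm d @^-1` dom c).
      split; last by [].
      apply: open_preim; [exact: chart_openI|exact: (prm_cont hd)|exact: chart_openD].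
    have := trans d c Ad Ac; rewrite (crd_imageE hd) => H k.
    apply: (@Ck_on_eq _ _ _ _ _ (psi \o (crd c \o prm d))).
    - apply: open_preim; [exact: chart_openI|exact: (prm_cont hd)|exact: chart_openD].
    - by move=> z [_ cz] /=; rewrite bE.
    - apply: (@Ck_on_comp R k E E R^o _ setT).
      + by apply: open_preim; [exact: chart_openI|exact: (prm_cont hd)|exact: chart_openD].
      + exact: openT.
      + by [].
      + exact: H.
      + exact: spsi.
  exists (img d `&` prm d @^-1` (~` K)).
    split; last by [].
    by apply: open_preim; [exact: chart_openI|exact: (prm_cont hd)|exact: closed_openC].
  move=> k; apply: (@Ck_on_eq _ _ _ _ _ (fun=> 0)); last exact: Ck_on_cst.
    by apply: open_preim; [exact: chart_openI|exact: (prm_cont hd)|exact: closed_openC].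
  by move=> z [_ nz] /=; rewrite b0.
- by move=> t; rewrite /b; case: ifP => // _; exact: bumpf_ge0.
- rewrite bE// /psi bumpf_gt0 big1 ?subr0 ?exprn_gt0// => j _.
  by rewrite subrr expr0n.
- by split=> // _ [y /K0O[_ ?] <-].
Qed.

End ManifoldTopology.

(** * Cutoff functions for proper actions *)

Section Cutoff.
Context {R : realType} (n : nat) (M : topologicalType).
Local Notation E := 'rV[R]_n.
Variable A : set (chart M E).
Hypothesis hM : smooth_manifold A.
Let cov := manifold_cover hM.

Lemma smooth_fun_local (W : tvsType R) (f : M -> W) : hausdorff_space W ->
  (forall x, exists O g, [/\ open O, O x, smooth_fun A g & forall y, O y -> f y = g y :> W]) ->
  smooth_fun A f.
Proof.
move=> hW H c Ac; have hc := cov.2 _ Ac; apply: smooth_on_local => // y iy.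
have [U [g [oU' Ux sg fg]]] := H (prm c y).
have oU : open (img c `&` prm c @^-1` U).
  by apply: open_preim; [exact: chart_openI|exact: (prm_cont hc)|].
exists (img c `&` prm c @^-1` U) => // k; apply: (@Ck_on_eq _ _ _ _ _ (g \o prm c)) => //.
  by move=> z [_ Oz] /=; rewrite fg.
by apply: Ck_on_sub (sg c Ac k) => z [].
Qed.

Lemma smooth_fun_sum (W : topologicalLmodType R) (I : Type) (s : seq I) (f : I -> M -> W) :
  (forall i, smooth_fun A (f i)) -> smooth_fun A (fun x => \sum_(i <- s) f i x).
Proof. by move=> sf c Ac k; apply: Ck_on_sum => i; exact: sf. Qed.

Variables (G : preTopologicalGroupType) (act : G -> M -> M).
Hypothesis invG_cont : continuous (fun g : G => g^-1)%g.
Hypothesis act_cont : continuous (fun p : G * M => act p.1 p.2).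
Hypothesis act1 : forall x, act 1%g x = x.
Hypothesis actM : forall g h x, act (g * h)%g x = act g (act h x).
Hypothesis prop : proper_action act.

Lemma actK g x : act g^-1%g (act g x) = x.
Proof. by rewrite -actM mulVg act1. Qed.

Lemma actVK g x : act g (act g^-1%g x) = x.
Proof. by rewrite -actM mulgV act1. Qed.

Lemma act_continuous g : continuous (act g).
Proof.
by move=> x; apply: (@continuous_comp _ _ _ (fun y => (g, y)) (fun p : G * M => act p.1 p.2));
  [exact: pairl_continuous|exact: act_cont].
Qed.

Definition transporter (K L : set M) : set G := [set g | exists2 x, K x & L (act g x)].

Lemma transporter_compact K L : compact K -> compact L -> compact (transporter K L).
Proof.
move=> cK cL; have := prop (compact_setX cL cK).
move=> /(@compact_image _ _ _ fst) H.
have -> : transporter K L = fst @` [set p : G * M | (L `*` K) (act p.1 p.2, p.2)].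
  apply/seteqP; split=> [g [x Kx Lx]|_ [[g x] /= [Lx Kx] <-]]; last by exists x.
  by exists (g, x).
by apply: H => x _; exact: cvg_fst.
Qed.

Definition saturation (Q : set M) : set M := [set y | exists g, Q (act g y)].

(** Inside a compact neighbourhood [N] of [y], the points whose orbit meets [Q] form the projection
    of a set that properness makes compact. *)
Lemma saturation_closed Q : compact Q -> closed (saturation Q).
Proof.
move=> cQ y cy; have [hT _ _ _ _] := hM.
have [N [cN _ yN]] := locally_compact hM (@filterT _ (nbhs y) _).
pose S := [set p : G * M | (Q `*` N) (act p.1 p.2, p.2)].
have cS : compact (snd @` S).
  apply: compact_image => [|x _]; last exact: cvg_snd.
  exact: prop (compact_setX cQ cN).
have clS := compact_closed hT cS.
have [|[g x] [/= Qx _] <-] := clS y; last by exists g.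
move=> O yO; have [z [[g Qz] [Oz Nz]]] := cy _ (filterI yO yN).
by exists z; split=> //; exists (g, z).
Qed.

Lemma saturation_open Q : open Q -> open (saturation Q).
Proof.
move=> oQ; have -> : saturation Q = \bigcup_g (act g @^-1` Q).
  by apply/seteqP; split=> y [g]; exists g.
by apply: bigcup_open => g _; apply: open_comp => // x _; exact: act_continuous.
Qed.

Lemma bump_compact (P O : set M) : compact P -> open O -> P `<=` O ->
  exists f : M -> R^o, exists S, [/\ smooth_fun A f, forall x, 0 <= f x,
    forall x, P x -> 0 < f x, compact S /\ S `<=` O & forall x, ~ S x -> f x = 0].
Proof.
move=> cP oO PO.
have /choice[bK bKP] : forall x, exists bK : (M -> R^o) * set M, 
    [/\ smooth_fun A bK.1, forall t, 0 <= bK.1 t, O x -> 0 < bK.1 x,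
    compact bK.2 /\ bK.2 `<=` O & forall t, ~ bK.2 t -> bK.1 t = 0].
  move=> x; have [Ox|nO] := pselect (O x).
    have [b [K [sb b0 bx KO bK]]] := manifold_bump hM (open_nbhs_nbhs (conj oO Ox)).
    by exists (b, K).
  exists (fun=> 0, set0); split=> //=; first by move=> c Ac k; exact: Ck_on_cst.
  by split=> //; exact: compact0.
have [t tP] := @compact_fin M M P (fun x => [set y | 0 < (bK x).1 y]) cP
  (fun x Px => ex_intro _ x (near_gt (smooth_fun_cont hM (let: And5 s _ _ _ _ := bKP x in s) (x:=x))
      (let: And5 _ _ p _ _ := bKP x in p (PO x Px)))).
exists (fun y => \sum_(x <- t) (bK x).1 y), (\big[setU/set0]_(x <- t) (bK x).2); split.
- by apply: smooth_fun_sum => x; case: (bKP x).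
- by move=> y; apply: sumr_ge0 => x _; case: (bKP x).
- move=> y /tP[x xt /= xy]; rewrite (big_rem x)//=; apply: ltr_wpDr => //.
  by apply: sumr_ge0 => z _; case: (bKP z).
- split; first by apply: bigsetU_compact => x _; case: (bKP x) => _ _ _ [].
  by rewrite -bigcup_seq => y [x _]; case: (bKP x) => _ _ _ [_ KO] _; exact: KO.
- move=> y; rewrite -bigcup_seq => ny; rewrite big_seq big1// => x xt.
  by case: (bKP x) => _ _ _ _; apply=> Ky; apply: ny; exists x.
Qed.

(** Each orbit has a first stage whose interior it meets, and therefore meets the corresponding
    shell [P i]. A bump around [P i] can be supported off the saturation of the stage before [i], so
    that on the saturation of a given stage only finitely many bumps are nonzero. *)
Lemma cutoff : exists f : M -> R^o, [/\ smooth_fun A f, forall x, 0 <= f x,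
  forall x, exists g, 0 < f (act g^-1%g x) &
  forall Q, compact Q -> exists2 C : set G, compact C &
    forall x g, Q x -> ~ C g -> f (act g^-1%g x) = 0].
Proof.
have [Q [Q0 cQ Qs Qe]] := exhaustion hM.
have Qle i j : (i <= j)%N -> Q i `<=` Q j.
  move=> /subnK <-; elim: (j - i)%N => [|k IH] //.
  by apply: subset_trans IH _; rewrite addSn; apply: subset_trans (Qs _) (@interior_subset _ _).
have satle P P' : P `<=` P' -> saturation P `<=` saturation P'.
  by move=> PP y [g Py]; exists g; exact: PP.
pose P i := Q i.+1 `\` saturation (Q i)°.
have cP i : compact (P i).
  rewrite /P setDE; apply: compact_closedI => //; apply: open_closedC.
  by apply: saturation_open; exact: open_interior.
have PO i : P i `<=` ~` saturation (Q i.-1).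
  move=> x [_ nx] sx; apply: nx; case: i sx => [|i] [g]; first by rewrite /= Q0.
  by move=> /Qs ?; exists g.
have /choice[f fP] : forall i, exists fS : (M -> R^o) * set M, [/\ smooth_fun A fS.1,
    forall x, 0 <= fS.1 x, forall x, P i x -> 0 < fS.1 x,
    compact fS.2 /\ fS.2 `<=` ~` saturation (Q i.-1) & forall x, ~ fS.2 x -> fS.1 x = 0].
  move=> i; have oS : open (~` saturation (Q i.-1)).
    by apply: closed_openC; exact: saturation_closed.
  by have [f [S H]] := bump_compact (cP i) oS (@PO i); exists (f, S).
have f0 i j x : saturation (Q j) x -> (j < i)%N -> (f i).1 x = 0.
  move=> sx ji; case: (fP i) => _ _ _ [_ So]; apply=> /So; apply.
  by apply: satle sx; apply: Qle; rewrite -ltnS (ltn_predK ji).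
pose s N x : R^o := \sum_(i < N) (f i).1 x.
have sE N j x : saturation (Q j) x -> (j < N)%N -> s N x = s j.+1 x.
  move=> sx jN; rewrite /s -!(big_mkord predT (fun i => (f i).1 x)).
  rewrite (big_cat_nat (n := j.+1))//= [X in _ + X]big_nat_cond [X in _ + X]big1 ?addr0//.
  by move=> i /andP[/andP[ji _] _]; exact: f0 sx ji.
have satQ j x : Q j x -> saturation (Q j) x by move=> Qx; exists 1%g; rewrite act1.
have /choice[N NP] := Qe.
(* The sum of all bumps, truncated at a stage containing [x], beyond which they vanish at [x]. *)
pose F x : R^o := s (N x).+1 x.
have FE j x : saturation (Q j) x -> F x = s j.+1 x.
  move=> sx; have [jN|Nj] := leqP j (N x); first by rewrite /F (sE _ j).
  apply/esym; apply: (sE j.+1 (N x)); [apply: satQ; exact: NP|exact: ltnW].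
have F0 x : 0 <= F x by apply: sumr_ge0 => i _; case: (fP i).
exists F; split=> //.
- apply: smooth_fun_local => [|x]; first exact: (@norm_hausdorff _ R^o).
  have [j Qx] := Qe x; exists (Q j.+1)°, (s j.+2); split.
  + exact: open_interior.
  + exact: Qs.
  + by apply: smooth_fun_sum => i; case: (fP i).
  + by move=> y /interior_subset Qy; apply: FE; exact: satQ.
- move=> x; have ex : exists i, `[< saturation (Q i)° x >].
    have [j /Qs Qx] := Qe x; exists j.+1; apply/asboolP; exists 1%g; by rewrite act1.
  case: (ex_minnP ex) => -[|i] /asboolP[g Qg] imin.
    by move: Qg => /interior_subset; rewrite Q0.
  exists g^-1%g; rewrite invgK; set y := act g x.
  have Py : P i y.
    split; first exact: interior_subset.
    move=> [h Qh]; suff /imin : `[< saturation (Q i)° x >] by rewrite ltnn.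
    by apply/asboolP; exists (h * g)%g; rewrite actM.
  rewrite (FE i.+1); last by apply: satQ; case: Py.
  rewrite /s (bigD1 (widen_ord (leqnSn _) ord_max))//=; apply: ltr_wpDr.
    by apply: sumr_ge0 => k _; case: (fP k).
  by case: (fP i) => _ _ + _ _; apply.
- move=> K cK.
  have [j KQ] : exists j, K `<=` Q j.
    have [t tP] := @compact_fin M nat K (fun j => (Q j)°) cK
      (fun x _ => let: ex_intro j Qx := Qe x in ex_intro _ j.+1 (open_nbhs_nbhs (conj (@open_interior _ _) (Qs j x Qx)))).
    exists (\max_(i <- t) i) => x /tP[i it /interior_subset].
    by apply: Qle; exact: (@leq_bigmax_seq _ _ predT id).
  pose S := \big[setU/set0]_(i < j.+1) (f i).2.
  have cS : compact S by apply: bigsetU_compact => i _; case: (fP i) => _ _ _ [].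
  exists ((fun g => g^-1)%g @` transporter K S).
    apply: compact_image => [|g _]; last exact: invG_cont.
    exact: transporter_compact.
  move=> x g Kx nC; rewrite (FE j); last by exists g; rewrite actVK; exact: KQ.
  rewrite /s big1// => i _; case: (fP i) => _ _ _ _; apply=> Si.
  apply: nC; exists g^-1%g; last by rewrite invgK.
  by exists x => //; rewrite /S (bigD1 i)//=; left.
Qed.

End Cutoff.

(** * Parametric integrals and the averaging homotopy *)

Lemma pair_cvg (X : Type) (F : set_system X) {FF : Filter F} (T1 T2 : topologicalType)
    (f : X -> T1) (g : X -> T2) (a : T1) (b : T2) :
  f @ F --> a -> g @ F --> b -> (fun x => (f x, g x)) @ F --> (a, b).
Proof. by move=> fa gb; exact: cvg_pair. Qed.

Section Integral.
Context {R : realType} (G : preTopologicalGroupType) (m : nat).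
Local Notation E := 'rV[R]_m.
Variable AG : set (chart G E).
Hypothesis hG : smooth_manifold AG.
Hypothesis mulG_cont : continuous (fun p : G * G => (p.1 * p.2)%g).
Hypothesis invG_cont : continuous (fun g : G => g^-1)%g.
Variable A0 : set G.
Hypothesis cA0 : compact A0.
Hypothesis nA0 : nbhs (1%g : G) A0.
Variable F : set_system (seq G).
Hypothesis UF : UltraFilter F.
Hypothesis HF : @cover_filter G `<=` F.

Let cov := manifold_cover hG.

Lemma group_bump (x : G) (O : set G) : nbhs x O ->
  exists b : G -> R^o, exists K, [/\ continuous b, forall g, 0 <= b g, 0 < b x,
    compact K /\ K `<=` O & forall g, ~ K g -> b g = 0].
Proof.
move=> xO; have [b [K [sb b0 bx KO bK]]] := manifold_bump hG xO.
by exists b, K; split=> //; exact: smooth_fun_cont sb.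
Qed.

Variable V : tvsType R.
Hypotheses (hV : hausdorff_space V) (qV : quasi_complete V).

Definition intg (f : G -> V) : V := xget 0 [set x | avg A0 f @ F --> x].

Lemma intg_eq f x : avg A0 f @ F --> x -> intg f = x.
Proof. by move=> fx; rewrite /intg; case: xgetP => [y _ /= fy|/(_ x)//]; exact: (cvg_unique hV fy fx). Qed.

Lemma intgP C f : csupp C f -> avg A0 f @ F --> intg f.
Proof.
move=> Cf; have [x fx] := quasi_cvg mulG_cont invG_cont cA0 nA0 group_bump UF HF qV Cf.
by rewrite (intg_eq fx).
Qed.

(** Convergence jointly in the group element and the parameter is uniform over the compact set [C],
    and [avg_small] then bounds the integral of the difference. *)
Lemma intg_cvg (X : Type) (FX : set_system X) {FF : Filter FX} C (P : X -> G -> V) (Q : G -> V) :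
  (\forall x \near FX, csupp C (P x)) -> csupp C Q ->
  (forall g, C g -> (fun p : G * X => P p.2 p.1) @ filter_prod (nbhs g) FX --> Q g) ->
  (fun x => intg (P x)) @ FX --> intg Q.
Proof.
move=> CP CQ PQ; apply: cvgv_disk => D [D0 _ _].
have [cC cQ Q0] := CQ.
have [D' dD' HD'] := avg_small mulG_cont invG_cont cA0 nA0 UF HF cC D0.
have ncov : \forall x \near FX, C `<=` [set g | D' (P x g - Q g)].
  have /compact_near_coveringP := cC; apply=> g Cg.
  have H : (fun p : G * X => P p.2 p.1 - Q p.1) @ filter_prod (nbhs g) FX --> Q g - Q g.
    apply: subv_cvg; first exact: PQ.
    by apply: (@cvg_comp _ _ _ fst Q _ (nbhs g)); [exact: cvg_fst|exact: cQ].
  by case: dD' => D'0 _ _; apply: (H D'); rewrite subrr.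
apply: filterS2 CP ncov => x CPx Px /=; apply: (HD' (fun g => P x g - Q g)) => //.
  by move=> g nC; case: CPx => _ _ ->//; rewrite Q0// subr0.
rewrite -/(_ @ F); have -> : avg A0 (fun g => P x g - Q g) = fun S => avg A0 (P x) S - avg A0 Q S.
  by apply/funext => S; rewrite avgB.
by apply: subv_cvg; [exact: intgP CPx|exact: intgP CQ].
Qed.

Section ParametricIntegral.
Variables (E0 : tvsType R) (I : finType) (e : I -> E0) (phi : I -> E0 -> R^o).
Hypothesis hE0 : fdim e phi.
Variable U : set E0.
Hypothesis oU : open U.
Variable C : set G.
Hypothesis cC : compact C.

Definition smooth_family (P : E0 -> G -> V) : Prop :=
  (forall c, AG c -> @smooth_on R (E0 * E)%type V (U `*` img c)
     (fun p => P p.1 (prm c p.2))) /\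
  forall u g, U u -> ~ C g -> P u g = 0.

Lemma smooth_family_cvg P u g : smooth_family P -> U u ->
  (fun p : G * E0 => P p.2 p.1) @ filter_prod (nbhs g) (nbhs u) --> P u g.
Proof.
move=> [sP _] Uu; have [c Ac cg] := cov.1 g; have hc := cov.2 _ Ac.
have H : (fun p : E0 * E => P p.1 (prm c p.2)) @ nbhs (u, crd c g) --> P u g.
  rewrite -[X in P u X](chartK hc cg).
  by apply: (sP c Ac 0%N (u, crd c g)); split=> //; exact: img_dom.
have H2 : (fun p : G * E0 => (p.2, crd c p.1)) @ filter_prod (nbhs g) (nbhs u) --> (u, crd c g).
  apply: pair_cvg; first exact: cvg_snd.
  by apply: (@cvg_comp _ _ _ fst (crd c) _ (nbhs g)); [exact: cvg_fst|exact: (crd_cont hc cg)].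
apply: cvg_eq_near (cvg_comp _ _ H2 H).
have : filter_prod (nbhs g) (nbhs u) (dom c `*` setT).
  by apply: filter_prod1 || exists (dom c, setT) => //=; split=> //; [exact: open_nbhs_nbhs (conj (chart_openD hc) cg)|exact: filterT].
by apply: filterS => -[g' u'] [/= cg' _]; rewrite (chartK hc cg').
Qed.

Lemma smooth_family_csupp P u : smooth_family P -> U u -> csupp C (P u).
Proof.
move=> sP Uu; split=> //; last by move=> g nC; exact: sP.2.
move=> g; have := smooth_family_cvg (g:=g) sP Uu.
move=> H; apply: (@cvg_comp _ _ _ (fun g' => (g', u)) (fun p : G * E0 => P p.2 p.1) _ (nbhs (g, u)) _ _ H).
by apply: pair_cvg; [exact: cvg_id|exact: cvg_cst].
Qed.

(** Coinduction by differentiating under the integral: the parameter derivative of a smooth family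
    is a smooth family vanishing off the same compact set. *)
Lemma intg_smooth P : smooth_family P -> smooth_on U (fun u => intg (P u)).
Proof.
move=> sP; pose S := [set f : E0 -> V | exists2 P, smooth_family P & f = fun u => intg (P u)].
apply: (@smooth_crit R E0 V I e phi U S hE0 oU); last by exists P.
move=> _ [{sP}P sP ->]; split.
  move=> u Uu; apply: (@intg_cvg _ _ _ C); last by move=> g _; exact: smooth_family_cvg.
    by apply: filterS (open_nbhs_nbhs (conj oU Uu)) => u' Uu'; exact: smooth_family_csupp.
  exact: smooth_family_csupp.
move=> i; pose Q u g := dderive (e i) (fun u => P u g) u.
have oUI c : AG c -> open (U `*` img c).
  by move=> /cov.2 hc; apply: open_setX => //; exact: chart_openI.
have sQ : smooth_family Q.
  split=> [c Ac|u g Uu nC].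
    have -> : (fun p : E0 * E => Q p.1 (prm c p.2)) =
        dderive ((e i, 0) : E0 * E) (fun p => P p.1 (prm c p.2)).
      by apply/funext => -[u y]; rewrite dderive_fst.
    by apply: smooth_dderive => //; [exact: oUI|exact: sP.1].
  apply: (cvg_dderive hV); apply: (@diff_quot_eq _ V E0 U (fun=> 0)) => //.
    by move=> u' Uu'; rewrite sP.2.
  by apply: cvg_near_cst; apply: filterS filterT => h _; rewrite /diff_quot subrr scaler0.
exists (fun u => intg (Q u)); first by exists Q.
move=> u Uu.
have nU : \forall h \near (0 : R)^', U (u + h *: e i).
  by apply: near_line; exact: open_nbhs_nbhs.
have H : (fun h : R => intg (fun g => diff_quot (fun u => P u g) u (e i) h)) @ (0 : R)^' --> intg (Q u).
  apply: (@intg_cvg _ _ _ C).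
  - apply: filterS nU => h Uh; split=> //.
      move=> g; apply: scalev_cvg; first exact: cvg_cst.
      apply: subv_cvg; first by have [_ + _] := smooth_family_csupp sP Uh; exact.
      by have [_ + _] := smooth_family_csupp sP Uu; exact.
    by move=> g nC; rewrite /diff_quot !sP.2// subrr scaler0.
  - exact: smooth_family_csupp.
  - move=> g Cg; have [c Ac cg] := cov.1 g; have hc := cov.2 _ Ac.
    pose f (p : E0 * E) := P p.1 (prm c p.2); pose v : E0 * E := (e i, 0).
    have sf : smooth_on (U `*` img c) f := sP.1 c Ac.
    have Ug : (U `*` img c) (u, crd c g) by split=> //; exact: img_dom.
    have fstn (O : set G) : nbhs g O -> \forall p \near filter_prod (nbhs g) (0 : R)^', O p.1.
      by move=> gO; exists (O, setT) => [|p []//]; split=> //; exact: filterT.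
    have sndn (O : set R) : (0 : R)^' O -> \forall p \near filter_prod (nbhs g) (0 : R)^', O p.2.
      by move=> gO; exists (setT, O) => [|p []//]; split=> //; exact: filterT.
    have := @strong_quot R (E0 * E)%type V (U `*` img c) [set v] f
      (fun q => dderive v f q.1) (u, crd c g) v (G * R)%type
      (filter_prod (nbhs g) (0 : R)^') _ (fun p => (u, crd c p.1)) (fun=> v) snd (oUI c Ac) Ug.
    have -> : dderive v f (u, crd c g) = Q u g by rewrite dderive_fst /f /= (chartK hc cg).
    move=> HH; apply: cvg_eq_near (HH _ _ _ _ _ _ _ _).
    + apply: filterS (fstn _ (open_nbhs_nbhs (conj (chart_openD hc) cg))) => -[g' h] /= cg'.
      by rewrite /diff_quot /f /= scaler0 addr0 (chartK hc cg').
    + by move=> z w Uz ->; have := smooth_cvg hV (oUI c Ac) sf (v:=v) Uz; exact.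
    + apply: (@continuous_comp _ _ _ fst (dderive v f)); first exact: cvg_fst.
      exact: (smooth_cont (smooth_dderive hV (oUI c Ac) sf v) Ug).
    + apply: pair_cvg; first exact: cvg_cst.
      by apply: (@cvg_comp _ _ _ fst (crd c) _ (nbhs g)); [exact: cvg_fst|exact: (crd_cont hc cg)].
    + exact: cvg_cst.
    + apply: (@cvg_trans _ ((0 : R)^')); first exact: cvg_snd.
      exact: nbhs_dnbhs.
    + have := sndn _ (@nbhs_dnbhs_neq R 0); exact.
    + by apply: filterS filterT.
apply: cvg_eq_near H; apply: filterS nU => h Uh; apply: intg_eq.
rewrite /diff_quot; set f := fun g => _.
have -> : avg A0 f = fun S => h^-1 *: (avg A0 (P (u + h *: e i)) S - avg A0 (P u) S).
  by apply/funext => T; rewrite /f avgZ avgB.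
apply: scalev_cvg; first exact: cvg_cst.
by apply: subv_cvg; apply: intgP; exact: smooth_family_csupp.
Qed.

End ParametricIntegral.
End Integral.

(** * Tuples of group elements and the faces of a cochain *)

Section Tuples.
Variable G : preTopologicalGroupType.
Local Notation contract := Defs.contract.
Local Open Scope group_scope.

(** Appends [g] as the last entry, which is the argument over which cochains are averaged. *)
Definition ext (r : nat) (a : 'I_r -> G) (g : G) : 'I_r.+1 -> G :=
  fun i => if insub (i : nat) is Some j then a j else g.

Definition tl (r : nat) (a : 'I_r.+1 -> G) : 'I_r -> G := fun j => a (lift ord0 j).
Definition ini (r : nat) (a : 'I_r.+1 -> G) : 'I_r -> G :=
  fun j => a (widen_ord (leqnSn r) j).

Lemma ext_lt r (a : 'I_r -> G) g (i : 'I_r.+1) (lt_ir : (i < r)%N) :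
  ext a g i = a (Ordinal lt_ir).
Proof. by rewrite /ext insubT. Qed.

Lemma ext_ge r (a : 'I_r -> G) g (i : 'I_r.+1) : (r <= i)%N -> ext a g i = g.
Proof. by move=> ri; rewrite /ext insubF// ltnNge ri. Qed.

Lemma ext_ini r (a : 'I_r -> G) g : ini (ext a g) = a.
Proof.
apply/funext => j; rewrite /ini (ext_lt _ _ (i:=widen_ord _ j) (ltn_ord j)).
by congr a; apply/val_inj.
Qed.

Lemma ext0 r (a : 'I_r.+1 -> G) g : ext a g ord0 = a ord0.
Proof. by rewrite (ext_lt _ _ (i:=ord0) (ltn0Sn r)); congr a; apply/val_inj. Qed.

Lemma ext_tl r (a : 'I_r.+1 -> G) g : tl (ext a g) = ext (tl a) g.
Proof.
apply/funext => j; rewrite /tl; have [jr|rj] := ltnP j r.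
  have jr' : (lift ord0 j < r.+1)%N by rewrite lift0.
  by rewrite (ext_lt _ _ jr) (ext_lt _ _ jr'); congr a; apply/val_inj.
by rewrite !ext_ge// lift0.
Qed.

Lemma contract_ext_widen r (a : 'I_r.+1 -> G) g (i : 'I_r) :
  contract (widen_ord (leqnSn r) i) (ext a g) = ext (contract i a) g.
Proof.
apply/funext => j; have [jr|rj] := ltnP j r; last first.
  rewrite (ext_ge _ _ rj) /Defs.contract /= ltnNge (leq_trans (ltnW (ltn_ord i)) rj) /=.
  rewrite -val_eqE /= gtn_eqF ?(leq_trans (ltn_ord i) rj)//.
  by rewrite ext_ge// lift0.
rewrite (ext_lt _ _ jr) /Defs.contract -!val_eqE /=.
have E (k : 'I_r.+2) (l : 'I_r.+1) : val k = val l -> ext a g k = a l.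
  move=> kl; have kr : (k < r.+1)%N by rewrite (kl : k = l :> nat).
  by rewrite (ext_lt _ _ kr); congr a; apply/val_inj.
case: ltnP => ji; first exact: E.
case: eqP => ji'; last exact: E.
by congr (_ * _); exact: E.
Qed.

Lemma contract_ext_max r (a : 'I_r.+1 -> G) g :
  contract ord_max (ext a g) = ext (ini a) (a ord_max * g).
Proof.
apply/funext => j; rewrite /Defs.contract -!val_eqE /=.
have [jr|rj] := ltnP j r.
  have jr' : (j < r.+1)%N by apply: ltn_trans jr _.
  rewrite (ext_lt _ _ jr) (ext_lt _ _ (i:=widen_ord _ j) jr') /ini.
  by congr a; apply/val_inj.
have jE : val j = r by apply/eqP; rewrite eqn_leq rj -ltnS ltn_ord.
rewrite jE eqxx (ext_ge _ _ rj); congr (_ * _); last by rewrite ext_ge// lift0.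
by rewrite (ext_lt _ _ (i:=widen_ord _ ord_max) (ltnSn r)); congr a; apply/val_inj.
Qed.

Definition tprod (r : nat) (a : 'I_r -> G) : G := \prod_(i < r) a i.

Lemma tprod_tl r (a : 'I_r.+1 -> G) : tprod a = a ord0 * tprod (tl a).
Proof. by rewrite /tprod big_ord_recl. Qed.

Lemma tprod_ini r (a : 'I_r.+1 -> G) : tprod a = tprod (ini a) * a ord_max.
Proof. by rewrite /tprod big_ord_recr. Qed.

Lemma tprod_contract r (i : 'I_r) (a : 'I_r.+1 -> G) : tprod (contract i a) = tprod a.
Proof.
elim: r i a => [[]//|r IH] i a; rewrite tprod_tl [RHS]tprod_tl.
have [->|i0] := eqVneq i ord0.
  have -> : tl (contract ord0 a) = tl (tl a) by apply/funext => j.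
  rewrite [tprod (tl a)]tprod_tl mulgA /Defs.contract /= ?eqxx; congr (_ * _ * _).
  by congr a; apply/val_inj.
have [k ik] : exists k : 'I_r, i = lift ord0 k.
  by case: (unliftP ord0 i) i0 => [k ->|->]; [exists k|rewrite eqxx].
have -> : contract i a ord0 = a ord0.
  by rewrite ik /Defs.contract /=; congr a; apply/val_inj.
congr (_ * _); rewrite -(IH k (tl a)); congr tprod; apply/funext => j.
rewrite ik /tl /Defs.contract (inj_eq (@lift_inj _ _)) !lift0 ltnS.
case: ifP => _; first by congr a; apply/val_inj; rewrite /= /bump.
case: ifP => _; last by congr a; apply/val_inj.
by congr (_ * _); congr a; apply/val_inj.
Qed.

End Tuples.

Section RealLine.
Context {R : realType}.

Lemma quasi_complete_R : quasi_complete (R^o : tvsType R).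
Proof.
move=> B _ clB F PF FB cF.
have : cvg (F : set_system R^o).
  apply: (@cauchy_cvg R^o); apply: cauchy_exP => e e0.
  have [C FC HC] := cF _ (nbhsx_ballx (0 : R^o) e e0).
  have [x Cx] := filter_ex FC; exists x; apply: filterS FC => y Cy.
  by have := HC _ _ Cx Cy; rewrite -!ball_normE /= sub0r opprB distrC.
move=> /cvg_ex[x Fx]; exists x => //.
by apply: clB => O xO; exact: (filter_ex (filterI FB (Fx _ xO))).
Qed.

Lemma inv_smooth : @smooth_on R R^o R^o [set t | 0 < t] (fun t : R^o => t^-1).
Proof.
apply: (@smooth_crit R R^o R^o unit _ _ _ [set f | exists a k, f = (fun t : R^o => a * t ^- k : R^o)]
  (@fdim_R R) (@open_gt R 0)); last first.
  by exists 1, 1%N; apply/funext => t; rewrite mul1r expr1.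
move=> _ [a [k ->]]; have D (x : R) : 0 < x -> is_derive x (1 : R) (fun t : R => a * t ^- k : R) (- a * k%:R * x ^- k.+1).
  move=> x0; have xn0 : x ^+ k != 0 by rewrite expf_neq0// gt_eqF.
  have dX : is_derive x (1 : R) (fun t : R => t ^+ k : R) (k%:R * x ^+ k.-1).
    have := derivableP (@derivable_horner R 'X^k x).
    rewrite -derive1E -derivE derivXn hornerMn hornerXn mulr_natl; congr is_derive.
    by apply/funext => t; rewrite hornerXn.
  have dV := @is_deriveV R _ x _ _ xn0 dX.
  have := is_deriveZ a dV; congr is_derive.
  rewrite /GRing.scale /=; case: k {xn0 dX dV} => [|k]; first by rewrite !(mul0r, mulr0).
  have xn0 : x != 0 by rewrite gt_eqF.
  have : x ^+ k != 0 by rewrite expf_neq0.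
  rewrite /= [x ^+ k.+2]exprS [x ^+ k.+1]exprS.
  by move: (x ^+ k) k.+1%:R => y z y0; field; rewrite ?y0 ?xn0 ?y0.
split=> [x x0|_].
  have [dv _] := D x x0; apply: (@differentiable_continuous R R^o R^o).
  exact/derivable1_diffP.
exists (fun t : R^o => - a * k%:R * t ^- k.+1) => [|x x0]; first by exists (- a * k%:R), k.+1.
exact: (real_quot_cvg (D x x0)).
Qed.

End RealLine.

Lemma smooth_linear (R : realType) (E E' : tvsType R) (U : set E) (L : E -> E') :
  linear L -> continuous L -> smooth_on U L.
Proof. by move=> lL cL k; exact: (Ck_on_linear _ _ (linear_affine lL)). Qed.

Lemma pow_chart_openI (R : realType) (T : topologicalType) (n : nat)
    (A : set (chart T 'rV[R]_n)) (r : nat) (c : 'I_r -> chart T 'rV[R]_n) :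
  chart_cover A -> (forall i, A (c i)) -> open (img (pow_chart c)).
Proof. by move=> cA Ac; have := pow_img_open cA Ac; rewrite -(pow_chartP cA Ac). Qed.

Section GroupPlots.
Context {R : realType} (G : preTopologicalGroupType) (m : nat) (AG : set (chart G 'rV[R]_m)).
Context (M : topologicalType) (n : nat) (A : set (chart M 'rV[R]_n)).
Variable act : G -> M -> M.
Hypothesis hM : smooth_manifold A.
Hypothesis hG : lie_group_of_diffeos AG A act.

Lemma lie_manifold : smooth_manifold AG.
Proof. by case: hG => [[]]. Qed.

Lemma lie_mulG : continuous (fun p : G * G => (p.1 * p.2)%g).
Proof. by case: hG => -[_ [] + _ _ _ _ _]. Qed.

Lemma lie_invG : continuous (fun g : G => g^-1)%g.
Proof. by case: hG => -[_ _ [] + _ _ _ _]. Qed.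

Lemma lie_act : continuous (fun p : G * M => act p.1 p.2).
Proof. by case: hG => _ _ _ []. Qed.

Lemma lie_act1 x : act 1%g x = x.
Proof. by case: hG => _ [] + _ _ _; exact. Qed.

Lemma lie_actM g h x : act (g * h)%g x = act g (act h x).
Proof. by case: hG => _ [] _ + _ _; exact. Qed.

Let covG := manifold_cover lie_manifold.
Let covM := manifold_cover hM.

Section Plots.
Variables (E0 : tvsType R) (U : set E0).
Hypothesis oU : open U.

Lemma plot_mul (p q : E0 -> G) :
  plot AG U p -> plot AG U q -> plot AG U (fun u => (p u * q u)%g).
Proof.
move=> pp qq; case: hG => -[_ sm _] _ _ _.
exact: (plot_map (@norm_hausdorff _ _) (prod_cover covG covG) covG oU (plot_pair pp qq) sm).
Qed.

Lemma plot_inv (p : E0 -> G) : plot AG U p -> plot AG U (fun u => (p u)^-1)%g.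
Proof.
move=> pp; case: hG => -[_ _ sm] _ _ _.
exact: (plot_map (@norm_hausdorff _ _) covG covG oU pp sm).
Qed.

Lemma plot_act (p : E0 -> G) (q : E0 -> M) :
  plot AG U p -> plot A U q -> plot A U (fun u => act (p u) (q u)).
Proof.
move=> pp qq; case: hG => _ _ _ sm.
exact: (plot_map (@norm_hausdorff _ _) (prod_cover covG covM) covM oU (plot_pair pp qq) sm).
Qed.

Lemma plot_tprod r (p : 'I_r -> E0 -> G) :
  (forall i, plot AG U (p i)) -> plot AG U (fun u => tprod (fun i => p i u)).
Proof.
elim: r p => [|r IH] p hp.
  have -> : (fun u => tprod (fun i => p i u)) = fun=> 1%g.
    by apply/funext => u; rewrite /tprod big_ord0.
  exact: plot_cst.
have -> : (fun u => tprod (fun i => p i u)) =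
    fun u => (tprod (fun i => p (widen_ord (leqnSn r) i) u) * p ord_max u)%g.
  by apply/funext => u; rewrite tprod_ini.
by apply: plot_mul => //; apply: IH.
Qed.

Lemma plot_ext r (p : 'I_r -> E0 -> G) (w : E0 -> G) i :
  (forall i, plot AG U (p i)) -> plot AG U w ->
  plot AG U (fun u => ext (fun i => p i u) (w u) i).
Proof. by move=> hp hw; rewrite /ext; case: insubP. Qed.

(** The values of [l] are functions on [M]. Joint smoothness in the group arguments and the point
    comes from [Cinf_uncurry], applied in a chart of the power of [G]. *)
Lemma plot_cochain (V : tvsType R) r (l : ('I_r -> G) -> Cinf A V)
    (p : 'I_r -> E0 -> G) (q : E0 -> M) : hausdorff_space V ->
  (forall i, plot AG U (p i)) -> plot A U q -> smooth_cochain AG l ->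
  smooth_on U (fun u => l (fun i => p i u) (q u)).
Proof.
move=> hV hp hq sl; apply: smooth_on_local => // u Uu.
have [cs [W [Acs [oW WU] Wu sY YP]]] := plot_pow_local covG oU hp Uu.
have [d Ad dq] := covM.1 (q u); have hd := covM.2 _ Ad.
pose W' := W `&` (U `&` q @^-1` dom d).
have oW' : open W'.
  by apply: openI => //; apply: open_preim; [|case: hq|exact: chart_openD].
exists W'; first by split=> //; split.
pose Y u := crd (pow_chart cs) (fun i => p i u).
pose f u : 'M[R]_(r, m) * 'rV[R]_n := (Y u, crd d (q u)).
pose L (z : 'M[R]_(r, m) * 'rV[R]_n) := l (prm (pow_chart cs) z.1) (prm d z.2).
have oI := pow_chart_openI covG Acs.
have sL : @smooth_on R ('M[R]_(r, m) * 'rV[R]_n)%type V (img (pow_chart cs) `*` img d) L.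
  have := @Cinf_uncurry R n M A hM V hV 'M[R]_(r, m) _ _ _ (img (pow_chart cs))
    (l \o prm (pow_chart cs)) d (@fdim_mx R r m) oI.
  by apply=> //; apply: sl; exists cs.
move=> k; apply: (@Ck_on_eq _ _ _ _ _ (L \o f)) => //.
  move=> v [Wv [_ dv]]; change (l (prm (pow_chart cs) (Y v)) (prm d (crd d (q v))) = l (p^~ v) (q v)).
  by rewrite (chartK hd dv) /Y (YP v Wv).2.
apply: (@Ck_on_comp R k E0 ('M[R]_(r, m) * 'rV[R]_n)%type V W' (img (pow_chart cs) `*` img d)) => //.
- by apply: open_setX => //; exact: chart_openI.
- by move=> v [Wv [_ dv]]; split; [exact: (YP v Wv).1|exact: img_dom].
- apply: Ck_on_pair.
    by apply: Ck_on_sub (sY k) => v [].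
  by apply: Ck_on_sub (hq.2 d Ad k) => v [].
Qed.

End Plots.

Lemma plot_linear (T : topologicalType) (E E0 E1 : tvsType R) (B : set (chart T E))
    (U : set E0) (U' : set E1) (p : E0 -> T) (L : E1 -> E0) : open U -> open U' ->
  chart_cover B -> (forall x, U' x -> U (L x)) -> linear L -> continuous L ->
  plot B U p -> plot B U' (p \o L).
Proof. by move=> oU oU' cB UU lL cL; apply: plot_precomp => //; exact: smooth_linear. Qed.

Variables (V : tvsType R) (aV : G -> V -> V).
Hypothesis hV : hausdorff_space V.

(** The translated function is smooth, so [to_Cinf] does not fall back on its default value 0. *)
Lemma Cinf_actE g (f : Cinf A V) x : linear (aV g) -> continuous (aV g) ->
  Cinf_act act aV g f x = aV g (f (act g^-1%g x)) :> V.
Proof.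
move=> laV caV; rewrite /Cinf_act to_CinfK// => c Ac k; have hc := covM.2 _ Ac.
apply: (@Ck_on_lincomp R V V k _ (img c) (f \o (fun y => act g^-1%g (prm c y))) (aV g)) => //.
have pl : plot A (img c) (fun y => act g^-1%g (prm c y)).
  by apply: plot_act; [exact: chart_openI|exact: plot_cst|exact: plot_prm].
exact: (plot_fun hV covM (chart_openI hc) pl (Cinf_smooth f) k).
Qed.

End GroupPlots.

(** * Jets of isometries *)

Section ChainRule.
Context {R : realType}.

Lemma diff_quot_comp (E E' W : tvsType R) (U' : set E') (f : E -> E') (g : E' -> W) x v l :
  hausdorff_space W -> open U' -> smooth_on U' g -> U' (f x) ->
  diff_quot f x v @ 0^' --> l -> diff_quot (g \o f) x v @ 0^' --> dderive l g (f x).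
Proof.
move=> hW oU' sg Ufx fd.
have FF : Filter (0 : R)^' by exact: _.
have H := @strong_quot R E' W U' setT g (fun p => dderive p.2 g p.1) (f x) l
  R (0 : R)^' FF (fun=> f x) (diff_quot f x v) id oU' Ufx.
apply: cvg_eq_near (H _ _ _ _ _ _ _).
- apply: filterS (nbhs_dnbhs_neq _) => h h0; rewrite /diff_quot /= scalerA mulfV// scale1r.
  by rewrite [X in g X](addrC (f x)) subrK.
- by move=> z w Uz _; have := smooth_cvg hW oU' sg Uz (v:=w); exact.
- by apply: (smooth_tan hW oU' sg 0%N (f x, l)); split.
- exact: cvg_cst.
- exact: fd.
- exact: nbhs_dnbhs.
- exact: nbhs_dnbhs_neq.
- exact: filterS filterT.
Qed.

Lemma diff_quot_pair (E W W' : tvsType R) (f : E -> W) (g : E -> W') x v l l' :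
  diff_quot f x v @ 0^' --> l -> diff_quot g x v @ 0^' --> l' ->
  diff_quot (fun y => (f y, g y) : W * W') x v @ 0^' --> ((l, l') : W * W').
Proof. by move=> fl gl; exact: (pair_cvg fl gl). Qed.

Lemma diff_quot_linear (E W W' : tvsType R) (f : E -> W) (L : W -> W') x v l :
  linear L -> continuous L -> diff_quot f x v @ 0^' --> l ->
  diff_quot (L \o f) x v @ 0^' --> L l.
Proof.
move=> lL cL fl; have := @cvg_comp _ _ _ (diff_quot f x v) L _ (nbhs l) (nbhs (L l)) fl (cL l).
apply: cvg_trans; apply: near_eq_cvg; apply: filterS filterT => h _ /=.
have LB a b : L (a - b) = L a - L b.
  by rewrite addrC -scaleN1r lL scaleN1r addrC.
have L0 : L 0 = 0 by have := LB 0 0; rewrite !subrr.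
have LZ c a : L (c *: a) = c *: L a by have := lL c a 0; rewrite !addr0 L0 addr0.
by rewrite /diff_quot LZ LB.
Qed.

Lemma diff_quot_id (E : tvsType R) (x v : E) : diff_quot id x v @ 0^' --> v.
Proof.
apply: cvg_near_cst; apply: filterS (@nbhs_dnbhs_neq R 0) => h h0.
by rewrite /diff_quot addrC addrA addNr add0r scalerA mulVf// scale1r.
Qed.

Lemma diff_quot_continuous (E W : tvsType R) (f : E -> W) x v (l : W) :
  diff_quot f x v @ 0^' --> l -> (fun h : R => f (x + h *: v)) @ (0 : R)^' --> f x.
Proof.
move=> fl; have H : (fun h => h *: diff_quot f x v h + f x) @ (0 : R)^' --> f x.
  rewrite -[X in _ --> X]add0r -[X in _ --> X + _](scale0r l).
  apply: addv_cvg; last exact: cvg_cst.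
  by apply: scalev_cvg => //; exact: nbhs_dnbhs.
apply: cvg_eq_near H; apply: filterS (@nbhs_dnbhs_neq R 0) => h h0.
by rewrite /diff_quot scalerA mulfV// scale1r subrK.
Qed.

Lemma mx_cvg (T : Type) (F : set_system T) {FF : Filter F} m n (f : T -> 'M[R]_(m, n)) (l : 'M[R]_(m, n)) :
  (forall i j, (fun t => f t i j : R^o) @ F --> (l i j : R^o)) -> f @ F --> l.
Proof.
move=> H A [P Pl PA]; rewrite /= nbhs_simpl /=.
have : \forall t \near F, forall i j, P i j (f t i j).
  apply: filter_forall => i; apply: filter_forall => j.
  by have := H i j _ (Pl i j); rewrite /= nbhs_simpl.
by apply: filterS => t Pt; exact: PA.
Qed.

Lemma mx_entry_cvg (T : Type) (F : set_system T) {FF : Filter F} m n (f : T -> 'M[R]_(m, n)) (l : 'M[R]_(m, n)) i j :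
  f @ F --> l -> (fun t => f t i j : R^o) @ F --> (l i j : R^o).
Proof. move=> fl.
exact: (@cvg_comp _ _ _ f (fun y : 'M[R]_(m, n) => y i j : R^o) F (nbhs l)
  (nbhs (l i j : R^o)) fl (@mx_entry_continuous R m n i j l)). Qed.

Lemma sum_cvg (W : tvsType R) (T : Type) (F : set_system T) {FF : Filter F} (I : Type) (s : seq I)
    (u : I -> T -> W) y :
  (forall i, u i @ F --> y i) -> (fun t => \sum_(i <- s) u i t) @ F --> \sum_(i <- s) y i.
Proof.
move=> Hu; elim: s => [|i s IH].
  by rewrite big_nil; under eq_fun do rewrite big_nil; exact: cvg_cst.
by rewrite big_cons; under eq_fun do rewrite big_cons; exact: addv_cvg.
Qed.

Lemma mulmx_cvg (T : Type) (F : set_system T) {FF : Filter F} m n p (f : T -> 'M[R]_(m, n))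
    (g : T -> 'M[R]_(n, p)) (l : 'M[R]_(m, n)) (l' : 'M[R]_(n, p)) :
  f @ F --> l -> g @ F --> l' -> (fun t => f t *m g t) @ F --> l *m l'.
Proof.
move=> fl gl; apply: mx_cvg => i j; rewrite mxE; under eq_fun do rewrite mxE.
apply: (@sum_cvg R^o) => k; apply: (@scalev_cvg R R^o); exact: mx_entry_cvg.
Qed.

Lemma diff_quot_mulmx (E : tvsType R) m n p (f : E -> 'M[R]_(m, n)) (g : E -> 'M[R]_(n, p)) x v
    (l : 'M[R]_(m, n)) (l' : 'M[R]_(n, p)) :
  diff_quot f x v @ 0^' --> l -> diff_quot g x v @ 0^' --> l' ->
  diff_quot (fun y => f y *m g y) x v @ 0^' --> l *m g x + f x *m l'.
Proof.
move=> fl gl; have fc := diff_quot_continuous fl.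
have H : (fun h => diff_quot f x v h *m g x + f (x + h *: v) *m diff_quot g x v h) @ (0 : R)^' -->
    l *m g x + f x *m l'.
  apply: (@addv_cvg R 'M[R]_(m, p)); last exact: mulmx_cvg.
  by apply: mulmx_cvg => //; exact: cvg_cst.
apply: cvg_eq_near H; apply: filterS filterT => h _.
rewrite /diff_quot -scalemxAl -scalemxAr -scalerDr; congr (_ *: _).
by rewrite mulmxBl mulmxBr addrC addrA subrK.
Qed.

Lemma trmx_linear m n : linear (@trmx R m n : 'M[R]_(m, n) -> 'M[R]_(n, m)).
Proof. by move=> a A B; rewrite linearP. Qed.

Lemma trmx_continuous m n : continuous (@trmx R m n : 'M[R]_(m, n) -> 'M[R]_(n, m)).
Proof.
move=> A; apply: (@mx_cvg _ (nbhs A) _ n m) => i j; rewrite mxE; under eq_fun do rewrite mxE.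
exact: mx_entry_continuous.
Qed.

Section Algebra.
Variables (E : tvsType R) (U : set E).
Hypothesis oU : open U.

Lemma Ck_on_prod k (I : Type) (s : seq I) (f : I -> E -> R^o) :
  (forall i, Ck_on k U (f i)) -> Ck_on k U (fun x => \prod_(i <- s) f i x : R^o).
Proof.
move=> hf; elim: s => [|i s IH].
  by under eq_fun do rewrite big_nil; exact: Ck_on_cst.
by under eq_fun do rewrite big_cons; exact: (Ck_on_scale oU (hf i) IH).
Qed.

Lemma Ck_on_mulmx k m n p (f : E -> 'M[R]_(m, n)) (g : E -> 'M[R]_(n, p)) :
  @Ck_on R ('M[R]_(m, n) : tvsType R) k E U f -> @Ck_on R ('M[R]_(n, p) : tvsType R) k E U g ->
  @Ck_on R ('M[R]_(m, p) : tvsType R) k E U (fun x => f x *m g x).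
Proof.
move=> hf hg; apply: Ck_on_mx => // i j; under eq_fun do rewrite mxE.
apply: Ck_on_sum => l; exact: (Ck_on_scale oU (Ck_on_mx_entry i l hf) (Ck_on_mx_entry l j hg)).
Qed.

Lemma Ck_on_trmx k m n (f : E -> 'M[R]_(m, n)) :
  @Ck_on R ('M[R]_(m, n) : tvsType R) k E U f ->
  @Ck_on R ('M[R]_(n, m) : tvsType R) k E U (fun x => (f x)^T).
Proof.
move=> hf; apply: Ck_on_mx => // i j; under eq_fun do rewrite mxE; exact: Ck_on_mx_entry.
Qed.

Lemma Ck_on_det k n (f : E -> 'M[R]_n) :
  @Ck_on R ('M[R]_(n, n) : tvsType R) k E U f -> Ck_on k U (fun x => \det (f x) : R^o).
Proof.
move=> hf; apply: (@Ck_on_sum R R^o) => s.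
have H := @Ck_on_prod k _ (index_enum _) (fun i x => f x i (perm.fun_of_perm.body s i))
  (fun i => Ck_on_mx_entry i _ hf).
exact: (Ck_on_scale oU (Ck_on_cst k U ((-1) ^+ perm.odd_perm s : R^o)) H).
Qed.

Lemma Ck_on_invr k (f : E -> R^o) : (forall x, U x -> f x != 0) ->
  Ck_on k U f -> Ck_on k U (fun x => (f x)^-1 : R^o).
Proof.
(* The reciprocal is known to be smooth on positive numbers, so 1/f is written as f / f^2. *)
move=> f0 hf; have H : Ck_on k U (fun x => (f x ^+ 2)^-1 : R^o).
  apply: (@Ck_on_comp R k E R^o R^o U [set t | 0 < t] (fun x => f x ^+ 2 : R^o) (fun t : R^o => t^-1)) => //.
  - by move=> x Ux /=; rewrite lt_neqAle eq_sym sqrf_eq0 f0//= sqr_ge0.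
  - exact: (Ck_on_scale oU hf hf).
  - exact: inv_smooth.
apply: (@Ck_on_eq _ _ _ _ _ (fun x => f x *: (f x ^+ 2)^-1 : R^o)) => //.
  by move=> x Ux; rewrite /GRing.scale /= expr2 invfM mulrA mulfV ?mul1r// f0.
exact: (Ck_on_scale oU hf H).
Qed.

Lemma Ck_on_invmx k n (f : E -> 'M[R]_n) : (forall x, U x -> f x \in unitmx) ->
  @Ck_on R ('M[R]_(n, n) : tvsType R) k E U f ->
  @Ck_on R ('M[R]_(n, n) : tvsType R) k E U (fun x => invmx (f x)).
Proof.
move=> fU hf.
suff H : @Ck_on R ('M[R]_(n, n) : tvsType R) k E U (fun x => (\det (f x))^-1 *: \adj (f x)).
  by apply: Ck_on_eq H => // x Ux; rewrite /invmx fU.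
apply: Ck_on_mx => // i j; under eq_fun do rewrite mxE.
have Hd : Ck_on k U (fun x => (\det (f x))^-1 : R^o).
  apply: Ck_on_invr; last exact: Ck_on_det.
  by move=> x Ux; have := fU x Ux; rewrite unitmxE unitfE.
have Ha : Ck_on k U (fun x => cofactor (f x) j i : R^o).
  apply: (Ck_on_scale oU (Ck_on_cst k U ((-1) ^+ (j + i) : R^o))).
  apply: (@Ck_on_det k n.-1 (fun x => row' j (col' i (f x)))).
  by apply: Ck_on_mx => // a b; under eq_fun do rewrite !mxE; exact: Ck_on_mx_entry.
by under eq_fun do rewrite mxE; exact: (Ck_on_scale oU Hd Ha).
Qed.

End Algebra.
End ChainRule.

(** * Vanishing of the cohomology by averaging *)

Section Vanishing.
Context {R : realType} (G : preTopologicalGroupType) (m : nat) (AG : set (chart G 'rV[R]_m)).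
Context (M : topologicalType) (n : nat) (A : set (chart M 'rV[R]_n)).
Variable act : G -> M -> M.
Hypothesis hM : smooth_manifold A.
Hypothesis hG : lie_group_of_diffeos AG A act.

Let mG := lie_manifold hG.
Let covG := manifold_cover mG.
Let covM := manifold_cover hM.
Let actM := lie_actM hG.
Let act1 := lie_act1 hG.

Variable A0 : set G.
Hypothesis cA0 : compact A0.
Hypothesis nA0 : nbhs (1%g : G) A0.
Variable F : set_system (seq G).
Hypothesis UF : UltraFilter F.
Hypothesis HF : @cover_filter G `<=` F.

Definition fiberwise_compact (f : M -> R^o) : Prop := forall Q, compact Q ->
  exists2 C : set G, compact C & forall x g, Q x -> ~ C g -> f (act g^-1%g x) = 0.

Lemma fiber_csupp (f : M -> R^o) x : smooth_fun A f -> fiberwise_compact f ->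
  exists C, csupp C (fun g => f (act g^-1%g x)).
Proof.
move=> sf /(_ [set x] (@compact_set1 _ x)) [C cC fC]; exists C; split=> //.
  apply: (smooth_fun_cont mG) => c Ac; have hc := covG.2 _ Ac.
  apply: (plot_fun (@norm_hausdorff _ R^o) covM (chart_openI hc) _ sf).
  apply: (plot_act hM hG (chart_openI hc)); last exact: plot_cst.
  by apply: (plot_inv hG (chart_openI hc)); exact: plot_prm.
by move=> g; exact: fC.
Qed.

Lemma fdim_rV k : @fdim R 'rV[R]_k _
  (fun p : 'I_1 * 'I_k => delta_mx p.1 p.2) (fun p y => y p.1 p.2).
Proof. exact: fdim_mx. Qed.

(** Division by the orbit integral [s] keeps the support condition, and since [s] is invariant it
    leaves the integrand by a constant factor along each orbit. [s] is smooth because, for points in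
    a compact set, the integrands vanish off a common compact set. *)
Lemma normalized_cutoff : proper_action act -> exists f : M -> R^o,
  [/\ smooth_fun A f, fiberwise_compact f &
      forall x, avg A0 (fun g => f (act g^-1%g x)) @ F --> (1 : R^o)].
Proof.
move=> prop; have [f [sf f0 fp fC]] := cutoff hM (lie_invG hG) (lie_act hG) act1 actM prop.
have hR : hausdorff_space (R^o : tvsType R) := @norm_hausdorff _ R^o.
pose s (x : M) : R^o := intg A0 F (fun g : G => f (act g^-1%g x)).
have sP x : avg A0 (fun g => f (act g^-1%g x)) @ F --> s x.
  have [C Cf] := fiber_csupp x sf fC.
  exact: (intgP mG (lie_mulG hG) (lie_invG hG) cA0 nA0 UF HF hR (@quasi_complete_R R) Cf).
have s0 x : 0 < s x.
  have [C Cf] := fiber_csupp x sf fC; have [g g0] := fp x.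
  exact: (avg_pos (lie_mulG hG) (lie_invG hG) cA0 nA0 UF HF Cf (fun g => f0 _) g0 (sP x)).
have sG h x : s (act h x) = s x.
  apply: (intg_eq UF hR); have [C Cf] := fiber_csupp x sf fC.
  have := avg_translate (lie_mulG hG) (lie_invG hG) cA0 nA0 (group_bump mG) UF HF h^-1%g hR
    (@quasi_complete_R R) Cf (sP x).
  apply: cvg_trans; apply: near_eq_cvg; apply: filterS filterT => S _.
  by congr avg; apply/funext => g; rewrite invgM invgK actM.
have ss : smooth_fun A s.
  move=> c Ac; have hc := covM.2 _ Ac; apply: smooth_on_local => // y iy.
  have [K [cK _ nK]] := locally_compact hM (@filterT _ (nbhs (prm c y)) _).
  have [C cC fC'] := fC K cK.
  pose W := img c `&` prm c @^-1` K°.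
  have oW : open W by apply: open_preim; [exact: chart_openI|exact: (prm_cont hc)|exact: open_interior].
  exists W; first by split.
  have Wc : W `<=` img c by move=> z [].
  apply: (intg_smooth mG (lie_mulG hG) (lie_invG hG) cA0 nA0 UF HF hR (@quasi_complete_R R)
    (fdim_rV n) oW cC (P := fun z g => f (act g^-1%g (prm c z)))); split.
    move=> d Ad; have hd := covG.2 _ Ad.
    have oWd : open (W `*` img d) by apply: open_setX => //; exact: chart_openI.
    apply: (plot_fun hR covM oWd _ sf); apply: (plot_act hM hG oWd).
      apply: (plot_inv hG oWd).
      apply: (plot_linear (L := snd) (chart_openI hd) oWd covG) => [[] ? ? []//|||].
      - by move=> ? [? ?] [? ?].
      - by move=> z; exact: cvg_snd.
      - exact: plot_prm.
    apply: (plot_linear (L := fst) oW oWd covM) => [[] ? ? []//|||].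
    - by move=> ? [? ?] [? ?].
    - by move=> z; exact: cvg_fst.
    - by apply: plot_sub Wc _; exact: plot_prm.
  by move=> z g [_ /interior_subset Kz] nC; apply: fC' Kz nC.
exists (fun x => (s x)^-1 *: f x); split.
- move=> c Ac k; have hc := covM.2 _ Ac.
  apply: (@Ck_on_scale R R^o k _ (img c) (fun y => (s (prm c y))^-1)); first exact: chart_openI.
    apply: (@Ck_on_comp R k 'rV[R]_n R^o R^o (img c) [set t | 0 < t] (s \o prm c) (fun t : R^o => t^-1)).
    + exact: chart_openI.
    + exact: (@open_gt R 0).
    + by move=> y _; exact: s0.
    + exact: ss.
    + exact: inv_smooth.
  exact: sf.
- by move=> Q /fC[C cC HC]; exists C => // x g Qx nC; rewrite HC// scaler0.
- move=> x; have -> : avg A0 (fun g => (s (act g^-1%g x))^-1 *: f (act g^-1%g x)) =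
      fun S => (s x)^-1 *: avg A0 (fun g => f (act g^-1%g x)) S.
    by apply/funext => S; rewrite -avgZ; congr avg; apply/funext => g; rewrite sG.
  have -> : (1 : R^o) = (s x)^-1 *: s x by rewrite /GRing.scale /= mulVf// gt_eqF.
  by apply: scalev_cvg; first exact: cvg_cst.
Qed.

Variables (V : tvsType R) (aV : G -> V -> V).
Hypothesis dmV : differentiable_module AG aV.

Let hV : hausdorff_space V. Proof. by case: dmV => -[]. Qed.
Let qV : quasi_complete V. Proof. by case: dmV => -[]. Qed.
Let aV_linear g : linear (aV g). Proof. by case: dmV => _ [_ +] _ _ _; exact. Qed.
Let aV_cont g : continuous (aV g).
Proof.
case: dmV => _ _ caV _ _ v.
by apply: (@continuous_comp _ _ _ (fun w => (g, w)) (fun p : G * V => aV p.1 p.2));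
  [exact: pairl_continuous|exact: caV].
Qed.

Variables (f : M -> R^o) (r : nat) (l : ('I_r.+1 -> G) -> Cinf A V).
Hypothesis sf : smooth_fun A f.
Hypothesis fC : fiberwise_compact f.
Hypothesis f1 : forall x, avg A0 (fun g => f (act g^-1%g x)) @ F --> (1 : R^o).
Hypothesis sl : smooth_cochain AG l.

(** Weighting with the full product [tprod a * g] makes the weight insensitive to the contraction of
    two entries and compatible with both outer faces of the coboundary. *)
Let h (a : 'I_r -> G) (x : M) (g : G) : V :=
  f (act (tprod a * g)^-1%g x) *: l (ext a g) x.

Lemma integrand_smooth (E0 : tvsType R) (U : set E0) (p : 'I_r -> E0 -> G) q w : open U ->
  (forall i, plot AG U (p i)) -> plot A U q -> plot AG U w ->
  smooth_on U (fun u => h (fun i => p i u) (q u) (w u)).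
Proof.
move=> oU hp hq hw k.
apply: (@Ck_on_scale R V k _ U (fun u => f (act (tprod (fun i => p i u) * w u)^-1%g (q u)))) => //.
  have hR : hausdorff_space (R^o : tvsType R) := @norm_hausdorff _ R^o.
  apply: (plot_fun (p := fun u => act (tprod (fun i => p i u) * w u)^-1%g (q u)) hR covM oU _ sf).
  apply: (plot_act hM hG oU) => //; apply: (plot_inv hG oU); apply: (plot_mul hG oU) => //.
  exact: (plot_tprod hG oU).
by apply: (plot_cochain hM hG oU) => // i; apply: plot_ext.
Qed.

Lemma integrand_csupp a x : exists C, csupp C (h a x).
Proof.
have [C cC HC] := fC (@compact_set1 _ (act (tprod a)^-1%g x)); exists C; split=> //.
  apply: (smooth_fun_cont mG) => c Ac; have hc := covG.2 _ Ac.
  apply: (integrand_smooth (p := fun i _ => a i) (q := fun=> x)); first exact: chart_openI.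
  - by move=> i; exact: plot_cst.
  - exact: plot_cst.
  - exact: plot_prm.
by move=> g nC; rewrite /h invgM actM HC// scale0r.
Qed.

Let k0 (a : 'I_r -> G) (x : M) : V := intg A0 F (h a x).

Lemma k0P a x : avg A0 (h a x) @ F --> k0 a x.
Proof.
have [C Ch] := integrand_csupp a x.
exact: (intgP mG (lie_mulG hG) (lie_invG hG) cA0 nA0 UF HF hV qV Ch).
Qed.

Lemma k0_smooth (cs : 'I_r -> chart G 'rV[R]_m) d : (forall i, AG (cs i)) -> A d ->
  @smooth_on R ('M[R]_(r, m) * 'rV[R]_n)%type V (img (pow_chart cs) `*` img d)
    (fun z => k0 (prm (pow_chart cs) z.1) (prm d z.2)).
Proof.
move=> Acs Ad; have hd := covM.2 _ Ad.
have imgE : img (pow_chart cs) = [set y | forall i, img (cs i) (row i y)] := pow_chartP covG Acs.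
have oI := pow_chart_openI covG Acs.
pose E1 : tvsType R := ('M[R]_(r, m) * 'rV[R]_n)%type.
pose UU : set E1 := img (pow_chart cs) `*` img d.
have oUU : open UU by apply: open_setX => //; exact: chart_openI.
have linfst : linear (fst : E1 -> 'M[R]_(r, m)) by move=> ? [? ?] [? ?].
have linsnd : linear (snd : E1 -> 'rV[R]_n) by move=> ? [? ?] [? ?].
have pl1 i : plot AG UU (fun z : E1 => prm (cs i) (row i z.1)).
  apply: (plot_linear (p := fun y => prm (cs i) (row i y)) (L := (fst : E1 -> 'M[R]_(r, m))) oI oUU covG) => //.
  - by move=> z [].
  - by move=> z; exact: cvg_fst.
  - by rewrite imgE; exact: (plot_pow_prm covG i mG Acs).
have pl2 : plot A UU (fun z : E1 => prm d z.2).
  apply: (plot_linear (L := (snd : E1 -> 'rV[R]_n)) (chart_openI hd) oUU covM) => //.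
  - by move=> z [].
  - by move=> z; exact: cvg_snd.
  - exact: plot_prm.
apply: smooth_on_local => // z0 Uz0.
(* The point at which [f] is evaluated, apart from [g]. While it stays in the compact set [K], the
   integrand vanishes off one compact set of group elements. *)
pose om (z : E1) := act (tprod (prm (pow_chart cs) z.1))^-1%g (prm d z.2).
have pom : plot A UU om.
  apply: (plot_act hM hG oUU) => //; apply: (plot_inv hG oUU).
  exact: (plot_tprod hG oUU pl1).
have [K [cK _ nK]] := locally_compact hM (@filterT _ (nbhs (om z0)) _).
have [C cC HC] := fC cK.
pose W := UU `&` om @^-1` K°.
have oW : open W by apply: open_preim; [|case: pom|exact: open_interior].
exists W; first by split.
apply: (intg_smooth mG (lie_mulG hG) (lie_invG hG) cA0 nA0 UF HF hV qV
  (fdim_prod (@fdim_mx R r m) (fdim_rV n)) oW cC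
  (P := fun z : E1 => h (prm (pow_chart cs) z.1) (prm d z.2))); split.
  move=> c Ac; have hc := covG.2 _ Ac.
  have oWc : open (W `*` img c) by apply: open_setX => //; exact: chart_openI.
  have lift (T : topologicalType) (E : tvsType R) (B : set (chart T E)) (p : E1 -> T) : chart_cover B -> plot B UU p ->
      plot B (W `*` img c) (fun z : E1 * 'rV[R]_m => p z.1).
    move=> cB pB; apply: (plot_linear (L := fst) oUU oWc cB) => //.
    - by move=> [z y] [[? _] _].
    - by move=> z; exact: cvg_fst.
  apply: (integrand_smooth (p := fun i (z : E1 * 'rV[R]_m) => prm (cs i) (row i z.1.1))
     (q := fun z : E1 * 'rV[R]_m => prm d z.1.2) (w := fun z : E1 * 'rV[R]_m => prm c z.2) oWc).
  - by move=> i; apply: (lift _ _ AG (fun z : E1 => prm (cs i) (row i z.1))).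
  - exact: (lift _ _ A (fun z : E1 => prm d z.2)).
  - apply: (plot_linear (L := snd) (chart_openI hc) oWc covG).
    + by move=> [z y] [].
    + by move=> ? [? ?] [? ?].
    + by move=> z; exact: cvg_snd.
    + exact: plot_prm.
by move=> z g [_ /interior_subset Kz] nC; rewrite /h invgM actM (HC _ _ Kz)// scale0r.
Qed.

Lemma k0_smooth_fun a : smooth_fun A (k0 a).
Proof.
move=> d Ad k; have hd := covM.2 _ Ad.
have /choice[cs csP] : forall i, exists c, AG c /\ dom c (a i).
  by move=> i; have [c Ac cx] := covG.1 (a i); exists c.
have Acs i : AG (cs i) by case: (csP i).
have dcs : dom (pow_chart cs) a by move=> i; case: (csP i).
pose z0 := crd (pow_chart cs) a.
have prmz0 : prm (pow_chart cs) z0 = a.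
  apply/funext => i; have [_ da] := csP i.
  rewrite -[RHS](chartK (covG.2 _ (Acs i)) da) /=; congr prm.
  by apply/rowP => j; rewrite !mxE.
have oI := pow_chart_openI covG Acs.
have H := @Ck_on_comp R k 'rV[R]_n ('M[R]_(r, m) * 'rV[R]_n)%type V (img d)
  (img (pow_chart cs) `*` img d) (fun y => (z0, y)) _ (chart_openI hd)
  (open_setX oI (chart_openI hd)) _ _ (k0_smooth Acs Ad k).
rewrite -prmz0; apply: H; first by move=> y iy; split=> //; exact: img_dom.
apply: Ck_on_pair; first exact: Ck_on_cst.
have si : @smooth_on R 'rV[R]_n ('rV[R]_n : tvsType R) (img d) id.
  by apply: smooth_linear => // y; exact: cvg_id.
exact: si.
Qed.

Let k (a : 'I_r -> G) : Cinf A V := to_Cinf A (fun x => (-1) ^+ r.+1 *: k0 a x).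

Lemma smooth_signed a : smooth_fun A (fun x => (-1) ^+ r.+1 *: k0 a x).
Proof.
move=> d Ad j; have hd := covM.2 _ Ad.
apply: (@Ck_on_scale R V j _ (img d) (fun=> (-1) ^+ r.+1)); first exact: chart_openI.
- exact: Ck_on_cst.
- exact: k0_smooth_fun.
Qed.

Lemma kE a x : k a x = (-1) ^+ r.+1 *: k0 a x.
Proof. by rewrite /k to_CinfK//; exact: smooth_signed. Qed.

Lemma k_smooth : smooth_cochain AG k.
Proof.
move=> _ [cs Acs <-] j; rewrite -/(pow_chart cs).
have oI := pow_chart_openI covG Acs.
apply: (Cinf_curry hM hV) => // d Ad i; have hd := covM.2 _ Ad.
have oU := open_setX oI (chart_openI hd).
apply: (@Ck_on_eq _ _ _ _ _ (fun z => (-1) ^+ r.+1 *: k0 (prm (pow_chart cs) z.1) (prm d z.2))) => //.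
  by move=> z _; rewrite /= kE.
apply: (@Ck_on_scale R V i _ _ (fun=> (-1) ^+ r.+1)) => //; first exact: Ck_on_cst.
exact: k0_smooth.
Qed.

Lemma Cinf_sum (I : Type) (s : seq I) (u : I -> Cinf A V) x :
  (\sum_(i <- s) u i) x = \sum_(i <- s) u i x.
Proof. by elim: s => [|i s IH]; rewrite ?big_nil ?big_cons// CinfD IH. Qed.

Lemma avg_sum (W : lmodType R) (I : Type) (s : seq I) (u : I -> G -> W) S :
  avg A0 (fun g => \sum_(i <- s) u i g) S = \sum_(i <- s) avg A0 (u i) S.
Proof.
elim: s => [|i s IH].
  rewrite big_nil /avg; under eq_bigr do rewrite big_nil.
  by rewrite big1// scaler0.
rewrite big_cons -IH -avgD; congr avg; apply/funext => g; by rewrite big_cons.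
Qed.

Lemma sumv_cvg (I : Type) (s : seq I) (u : I -> seq G -> V) (y : I -> V) :
  (forall i, u i @ F --> y i) -> (fun S => \sum_(i <- s) u i S) @ F --> \sum_(i <- s) y i.
Proof.
move=> H; elim: s => [|i s IH].
  by rewrite big_nil; under eq_fun do rewrite big_nil; exact: cvg_cst.
rewrite big_cons; under eq_fun do rewrite big_cons.
exact: addv_cvg.
Qed.

(* The averaging homotopy
   k(a_1, .., a_r)(x) = (-1)^(r+1) \int f((a_1 .. a_r g)^-1 x) l(a_1, .., a_r, g)(x) dg;
   integrating the cocycle identity at (a_1, .., a_(r+1), g) against f gives l = dk. *)
Lemma cocycle_coboundary :
  (forall a, coboundary (Cinf_act act aV) l a = 0) ->
  is_coboundary AG (Cinf_act act aV) l.
Proof.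
move=> dl; exists k; first exact: k_smooth.
move=> a; apply: Cinf_eq => x.
(* The terms of the cocycle identity at [ext a g], multiplied by this weight: [T0] for the first
   face, [Ti] for the inner contractions, [Tm] for the contraction with [g], [Te] for the last
   face. *)
pose ph g := f (act (tprod a * g)^-1%g x).
pose T0 g := ph g *: aV (a ord0) (l (ext (tl a) g) (act (a ord0)^-1%g x)).
pose Ti (i : 'I_r) g := ph g *: l (ext (Defs.contract i a) g) x.
pose Tm g := ph g *: l (ext (ini a) (a ord_max * g)%g) x.
pose Te g := ph g *: l a x.
have sc c v : aV (a ord0) (c *: v) = c *: aV (a ord0) v.
  have a00 : aV (a ord0) 0 = 0.
    by have := aV_linear (a ord0) (-1) 0 0; rewrite scaler0 addr0 scaleN1r addNr.
  by have := aV_linear (a ord0) c v 0; rewrite !addr0 a00 addr0.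
have T0P : avg A0 T0 @ F --> aV (a ord0) (k0 (tl a) (act (a ord0)^-1%g x)).
  have := @cvg_comp _ _ _ (avg A0 (h (tl a) (act (a ord0)^-1%g x))) (aV (a ord0)) F (nbhs _) (nbhs _)
    (@k0P (tl a) (act (a ord0)^-1%g x)) (@aV_cont (a ord0) _).
  apply: cvg_trans; apply: near_eq_cvg; apply: filterS filterT => S _.
  rewrite /= -(avg_lin A0 _ _ (aV_linear (a ord0))).
  congr avg; apply/funext => g; rewrite /T0 /ph /h /= -actM -invgM mulgA -tprod_tl.
  by rewrite sc.
have TiP i : avg A0 (Ti i) @ F --> k0 (Defs.contract i a) x.
  have := @k0P (Defs.contract i a) x.
  apply: cvg_trans; apply: near_eq_cvg; apply: filterS filterT => S _.
  by congr avg; apply/funext => g; rewrite /Ti /ph /h tprod_contract.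
(* The one term in which invariance is used: [g] occurs as [a ord_max * g]. *)
have TmP : avg A0 Tm @ F --> k0 (ini a) x.
  have [C Ch] := integrand_csupp (ini a) x.
  have := avg_translate (lie_mulG hG) (lie_invG hG) cA0 nA0 (group_bump mG) UF HF (a ord_max) hV qV
    Ch (@k0P (ini a) x).
  apply: cvg_trans; apply: near_eq_cvg; apply: filterS filterT => S _.
  by congr avg; apply/funext => g; rewrite /Tm /ph /h mulgA -tprod_ini.
have TeP : avg A0 Te @ F --> l a x.
  have H1 := f1 (act (tprod a)^-1%g x).
  have : (fun S => avg A0 (fun g => f (act g^-1%g (act (tprod a)^-1%g x))) S *: l a x) @ F --> l a x.
    by rewrite -[X in _ --> X]scale1r; apply: scalev_cvg => //; exact: cvg_cst.
  apply: cvg_trans; apply: near_eq_cvg; apply: filterS filterT => S _.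
  have lin : linear (fun c : R^o => c *: l a x).
    by move=> c u v; rewrite scalerDl scalerA.
  have /= <- := avg_lin A0 (fun g => f (act g^-1%g (act (tprod a)^-1%g x))) S lin.
  by congr avg; apply/funext => g; rewrite /Te /ph /= invgM actM.
have lim0 : aV (a ord0) (k0 (tl a) (act (a ord0)^-1%g x)) +
    \sum_(i < r) (-1) ^+ i.+1 *: k0 (Defs.contract i a) x +
    (-1) ^+ r.+1 *: k0 (ini a) x + (-1) ^+ r.+2 *: l a x = 0.
  have H : (fun S => avg A0 T0 S + \sum_(i < r) (-1) ^+ i.+1 *: avg A0 (Ti i) S +
      (-1) ^+ r.+1 *: avg A0 Tm S + (-1) ^+ r.+2 *: avg A0 Te S) @ F -->
    aV (a ord0) (k0 (tl a) (act (a ord0)^-1%g x)) +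
    \sum_(i < r) (-1) ^+ i.+1 *: k0 (Defs.contract i a) x +
    (-1) ^+ r.+1 *: k0 (ini a) x + (-1) ^+ r.+2 *: l a x.
    apply: addv_cvg; last by apply: scalev_cvg => //; exact: cvg_cst.
    apply: addv_cvg; last by apply: scalev_cvg => //; exact: cvg_cst.
    apply: addv_cvg; first exact: T0P.
    apply: (@sumv_cvg _ _ (fun (i : 'I_r) S => (-1) ^+ i.+1 *: avg A0 (Ti i) S)
      (fun i => (-1) ^+ i.+1 *: k0 (Defs.contract i a) x)) => i.
    by apply: scalev_cvg => //; exact: cvg_cst.
  apply: (cvg_unique hV H).
  apply: cvg_near_cst; apply: filterS filterT => S _.
  under eq_bigr do rewrite -avgZ.
  rewrite -!avgZ -avg_sum -!avgD /avg big1 ?scaler0// => g _.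
  have := dl (ext a g); rewrite /coboundary big_ord_recr.
  move=> /(congr1 (fun u : Cinf A V => u x : V)).
  rewrite CinfD CinfZ CinfD CinfD CinfZ Cinf_sum (Cinf_actE hM hG hV)//.
  rewrite -[fun j => _]/(tl (ext a g)) -[fun j => ext a g (widen_ord _ j)]/(ini (ext a g)).
  rewrite ext0 ext_tl ext_ini contract_ext_max => H0.
  have := congr1 (GRing.scale (ph g)) (H0 : _ = (0 : V)).
  rewrite scaler0 !scalerDr => {}H0; rewrite -[RHS]H0 addrA; congr (_ + _ + _ + _).
  - rewrite scaler_sumr; apply: eq_bigr => i _.
    by rewrite CinfZ contract_ext_widen /Ti !scalerA mulrC.
  - by rewrite /Tm !scalerA mulrC.
  - by rewrite /Te !scalerA mulrC.
rewrite /coboundary CinfD CinfD CinfZ Cinf_sum (Cinf_actE hM hG hV)//.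
rewrite -[fun j => a (lift _ j)]/(tl a) -[fun j => a (widen_ord _ j)]/(ini a) !kE.
under eq_bigr do rewrite CinfZ kE scalerA mulrC -scalerA.
rewrite sc -scaler_sumr -!scalerDr.
(* The last face carries the opposite of the sign [(-1) ^+ r.+1]. Solving for it and multiplying by
   that sign once more gives [l a x]. *)
move: lim0; rewrite [in X in _ + X *: _]exprS mulN1r scaleNr => /subr0_eq ->.
by rewrite scalerA -expr2 sqrr_sign scale1r.
Qed.

End Vanishing.

Section EasyImplications.
Context {R : realType} (G : preTopologicalGroupType) (m : nat) (AG : set (chart G 'rV[R]_m)).
Context (M : topologicalType) (n : nat) (A : set (chart M 'rV[R]_n)).
Variable act : G -> M -> M.
Hypothesis hM : smooth_manifold A.
Hypothesis hG : lie_group_of_diffeos AG A act.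

Lemma proper_vanishing : proper_action act ->
  forall r : nat, (0 < r)%N -> forall (V : tvsType R) (aV : G -> V -> V),
  differentiable_module AG aV ->
  Hd_vanishes AG (Cinf_act act aV : G -> Cinf A V -> Cinf A V) r.
Proof.
move=> prop [//|r] _ V aV dm l sl dl.
have [A0 [cA0 _ nA0]] := locally_compact (lie_manifold hG) (@filterT _ (nbhs (1%g : G)) _).
have [F [UF HF]] := ultraFilterLemma (cover_filter_proper (lie_mulG hG)).
have [f [sf fC f1]] := normalized_cutoff hM hG cA0 nA0 UF HF prop.
exact: (cocycle_coboundary hM hG cA0 nA0 UF HF dm sf fC f1 sl dl).
Qed.

Lemma trivial_module : differentiable_module AG (fun (_ : G) (t : R^o) => t).
Proof.
have mG := lie_manifold hG.
split.
- by split; [exact: (@norm_hausdorff _ R^o)|exact: quasi_complete_R].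
- by split=> // g c u v.
- by move=> p; exact: cvg_snd.
- by move=> v c Ac k; exact: Ck_on_cst.
- move=> k; have hR : hausdorff_space (R^o : tvsType R) := @norm_hausdorff _ R^o.
  apply: (Cinf_curry mG hR); first exact: openT.
  move=> c Ac; have -> : (fun p : R^o * 'rV[R]_m => to_Cinf AG (fun _ : G => p.1) (prm c p.2)) = fst.
    by apply/funext => p; rewrite to_CinfK// => d Ad j; exact: Ck_on_cst.
  by apply: smooth_linear => [a [? ?] [? ?]//|z]; exact: cvg_fst.
Qed.

End EasyImplications.

(** * Limits of solutions of first order systems *)

Section JetLimits.
Context {R : realType} (n : nat).
Local Notation E := 'rV[R]_n.
Variables (E1 : tvsType R) (O : set E1) (X : E -> E1 -> E1).
Hypotheses (oO : open O) (sX : forall w, @smooth_on R E1 (E1 : tvsType R) O (X w)).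
Variables (B : set E) (I : Type) (F : set_system I) (J : I -> E -> E1) (J0 : E -> E1).
Hypotheses (oB : open B) (PF : ProperFilter F).
Hypothesis HJ : \forall g \near F, forall u, B u -> O (J g u) /\
  forall w, diff_quot (J g) u w @ 0^' --> X w (J g u).
Hypothesis HO : forall u, B u -> O (J0 u).
Hypothesis joint : forall u, B u ->
  (fun p : E * I => J p.2 p.1) @ filter_prod (nbhs u) F --> J0 u.

Lemma joint_slice (Y : topologicalType) (K : I -> E -> Y) (y : Y) u :
  (fun p : E * I => K p.2 p.1) @ filter_prod (nbhs u) F --> y ->
  (fun g => K g u) @ F --> y.
Proof.
move=> H N yN; have [[V G] /= [Vu FG] VG] := H N yN; rewrite /= nbhs_simpl /=.
by apply: filterS FG => g Gg; apply: (VG (u, g)); split=> //; exact: nbhs_singleton.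
Qed.

Section Functional.
Variable W : tvsType R.
Hypothesis hW : hausdorff_space W.

Implicit Type (T : E1 -> W).

(** Along a solution [J g], differentiating [T \o J g] in direction [w] amounts to replacing [T] by
    [lie w T]. All derivatives of a solution are therefore fixed smooth functions of the solution
    itself, and its convergence entails theirs. *)
Definition lie (w : E) (T : E1 -> W) : E1 -> W := fun j => dderive (X w j) T j.

Lemma lie_smooth w T : smooth_on O T -> smooth_on O (lie w T).
Proof.
move=> sT k; apply: (@Ck_on_comp R k E1 (E1 * E1)%type W O (O `*` setT) (fun j => (j, X w j))
  (fun p => dderive p.2 T p.1)) => //.
- by apply: open_setX => //; exact: openT.
- apply: Ck_on_pair; last exact: sX.
  by apply: (smooth_linear (E' := E1)) => // y; exact: cvg_id.
- exact: smooth_tan.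
Qed.

Lemma lie_quot T g u w : smooth_on O T -> O (J g u) ->
  diff_quot (J g) u w @ 0^' --> X w (J g u) ->
  diff_quot (T \o J g) u w @ 0^' --> lie w T (J g u).
Proof. by move=> sT OJ JX; have := diff_quot_comp hW oO sT OJ JX; exact. Qed.

Lemma joint_comp T u : smooth_on O T -> B u ->
  (fun p : E * I => T (J p.2 p.1)) @ filter_prod (nbhs u) F --> T (J0 u).
Proof.
move=> sT Bu; apply: (@cvg_comp _ _ _ _ T _ (nbhs (J0 u))); first exact: joint.
exact: (smooth_cont sT (HO Bu)).
Qed.

Lemma limit_cont T u : smooth_on O T -> B u -> {for u, continuous (T \o J0)}.
Proof.
move=> sT Bu; apply: (@cvgv_disk R W E (nbhs u) _) => D' [D'0 _ _].
have [D dD DD] := disk_half D'0; have [D0 _ DN] := dD.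
have H : (fun p : E * I => T (J p.2 p.1) - T (J0 u)) @ filter_prod (nbhs u) F --> (0 : W).
  by rewrite -(subrr (T (J0 u))); apply: subv_cvg; [exact: joint_comp|exact: cvg_cst].
have [[V G] /= [Vu FG] VG] := H D D0.
apply: filterS2 Vu (open_nbhs_nbhs (conj oB Bu)) => u' Vu' Bu'.
have H' : (fun g => T (J g u') - T (J0 u')) @ F --> (0 : W).
  by rewrite -(subrr (T (J0 u'))); apply: subv_cvg; [exact: (joint_slice (K := fun g u => T (J g u)) (joint_comp sT Bu'))|exact: cvg_cst].
have FD := H' D D0; rewrite /= nbhs_simpl /= in FD.
have [g [Gg Dg]] := filter_ex (filterI FG FD).
rewrite /=; have -> : T (J0 u') - T (J0 u) = - (T (J g u') - T (J0 u')) + (T (J g u') - T (J0 u)).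
  by rewrite opprB addrA subrK.
by apply: DD; [exact: DN|exact: (VG (u', g))].
Qed.

(** For fixed [h], the quotient of the limit is approximated by that of some [J g], with [g]
    depending on [h]. The mean value inclusion places the latter near [lie w T (J0 u)] uniformly in
    [g], since joint convergence controls the derivative on the whole segment. *)
Lemma limit_quot T u w : smooth_on O T -> B u ->
  diff_quot (T \o J0) u w @ 0^' --> lie w T (J0 u).
Proof.
move=> sT Bu; set L := lie w T (J0 u); apply: cvgv_disk => D' [D'0 _ _].
have [D dD DD] := disk_half D'0; have [D0 cD DN] := dD.
have H : (fun p : E * I => lie w T (J p.2 p.1) - L) @ filter_prod (nbhs u) F --> (0 : W).
  by rewrite -(subrr L); apply: subv_cvg; [exact: (joint_comp (lie_smooth w sT) Bu)|exact: cvg_cst].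
have [[V G] /= [Vu FG] VG] := H _ (nbhs_interior D0).
have FF : Filter (0 : R)^' by exact: _.
have cu : (fun=> u) @ (0 : R)^' --> u by exact: cvg_cst.
have cw : (fun=> w) @ (0 : R)^' --> w by exact: cvg_cst.
have ci : id @ (0 : R)^' --> (0 : R) by exact: nbhs_dnbhs.
have seg := @segment_cvg R E u w R (0 : R)^' FF (fun=> u) (fun=> w) id (V `&` B)
  cu cw ci (filterI Vu (open_nbhs_nbhs (conj oB Bu))).
have Fu : Filter (nbhs u) by exact: _.
apply: filterS2 (seg Fu) (@nbhs_dnbhs_neq R 0) => h hseg h0.
have slice x : B x -> (fun g => T (J g x)) @ F --> T (J0 x).
  by move=> Bx; exact: (joint_slice (K := fun g u => T (J g u)) (joint_comp sT Bx)).
have Bh : B (u + h *: w) by have [_] := hseg 1 (introT andP (conj ler01 (lexx _))); rewrite mul1r.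
have H' : (fun g => diff_quot (T \o J g) u w h - diff_quot (T \o J0) u w h) @ F --> (0 : W).
  rewrite -(subrr (diff_quot (T \o J0) u w h)); apply: subv_cvg; last exact: cvg_cst.
  by apply: scalev_cvg; [exact: cvg_cst|apply: subv_cvg; exact: slice].
have FD := H' D D0; rewrite /= nbhs_simpl /= in FD.
have [g [[Gg Jg] Dg]] := filter_ex (filterI (filterI FG HJ) FD).
suff: D' (diff_quot (T \o J0) u w h - L) by [].
have -> : diff_quot (T \o J0) u w h - L =
    - (diff_quot (T \o J g) u w h - diff_quot (T \o J0) u w h) + (diff_quot (T \o J g) u w h - L).
  by rewrite opprB addrA subrK.
apply: DD; first exact: DN.
pose f (t : R) : W := h^-1 *: T (J g (u + (t * h) *: w)) - t *: L.
have -> : diff_quot (T \o J g) u w h - L = f 1 - f 0.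
  by rewrite /f mul1r mul0r !scale0r addr0 subr0 scale1r /diff_quot scalerBr addrAC.
apply: (mvt_cvx (g' := fun t => lie w T (J g (u + (t * h) *: w)) - L)) => // t t01.
have [Vt Bt] := hseg t t01; have [Ot Xt] := Jg _ Bt.
split; last exact: (VG (u + (t * h) *: w, g)).
have Q := diff_quot_scale (a := h) (lie_quot sT Ot (Xt w)).
have -> : lie w T (J g (u + (t * h) *: w)) = h^-1 *: (h *: lie w T (J g (u + (t * h) *: w))).
  by rewrite scalerA mulVf// scale1r.
have Q2 : (fun k => h^-1 *: diff_quot (T \o J g) (u + (t * h) *: w) (h *: w) k - L) @ (0 : R)^' -->
   h^-1 *: (h *: lie w T (J g (u + (t * h) *: w))) - L.
  by apply: subv_cvg; [apply: scalev_cvg => //; exact: cvg_cst|exact: cvg_cst].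
apply: cvg_eq_near Q2; apply: filterS (@nbhs_dnbhs_neq R 0) => k k0.
have e1 : u + (t * h) *: w + k *: (h *: w) = u + ((t + k) * h) *: w.
  by rewrite -addrA scalerA -scalerDl mulrDl.
have e2 : f (t + k) - f t = h^-1 *: (T (J g (u + ((t + k) * h) *: w)) - T (J g (u + (t * h) *: w))) - k *: L.
  by rewrite /f scalerDl scalerBr !opprD !opprK addrACA [- (t *: L) - _ + _]addrAC addNr add0r.
rewrite e2 scalerBr (scalerA k^-1 k) mulVf// scale1r /diff_quot /= e1.
by rewrite !scalerA mulrC.
Qed.

Lemma limit_smooth T : smooth_on O T -> smooth_on B (T \o J0).
Proof.
move=> sT; apply: (@smooth_crit R E W _ _ _ B [set f | exists2 T, smooth_on O T & f = T \o J0]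
  (@fdim_mx R 1 n) oB); last by exists T.
move=> _ [{sT}T sT ->]; split; first by move=> u Bu; exact: limit_cont.
move=> i; exists (lie (delta_mx i.1 i.2) T \o J0); first by exists (lie (delta_mx i.1 i.2) T) => //; exact: lie_smooth.
by move=> u Bu; exact: limit_quot.
Qed.

Definition lies (s : seq E) (T : E1 -> W) : E1 -> W := foldr lie T s.

Lemma lies_smooth s T : smooth_on O T -> smooth_on O (lies s T).
Proof. by move=> sT; elim: s => //= w s IH; exact: lie_smooth. Qed.

Lemma dderives_lies s T K u : smooth_on O T -> B u ->
  (forall T u w, smooth_on O T -> B u -> diff_quot (T \o K) u w @ 0^' --> lie w T (K u)) ->
  dderives s (T \o K) u = lies s T (K u).
Proof.
move=> sT Bu HK; elim: s u Bu => [//|w s IH] u Bu /=.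
rewrite (@dderive_eq R W E B _ (lies s T \o K) u w oB)//.
by apply: (cvg_dderive hW); apply: HK => //; exact: lies_smooth.
Qed.

Lemma joint_dderives s T u : smooth_on O T -> B u ->
  (fun p : E * I => dderives s (T \o J p.2) p.1) @ filter_prod (nbhs u) F -->
  dderives s (T \o J0) u.
Proof.
move=> sT Bu; rewrite (dderives_lies s (K := J0) sT Bu); last by move=> *; exact: limit_quot.
apply: cvg_eq_near (joint_comp (lies_smooth s sT) Bu).
exists (B, [set g | forall u, B u -> O (J g u) /\
  forall w, diff_quot (J g) u w @ 0^' --> X w (J g u)]); first by split=> //; exact: open_nbhs_nbhs.
move=> [u' g] [/= Bu' Jg]; apply/esym; apply: dderives_lies => // T' v w sT' Bv.
by have [Ov Xv] := Jg v Bv; exact: lie_quot.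
Qed.

End Functional.
End JetLimits.

(** * The first order system satisfied by jets of isometries *)

Section IsometryJets.
Context {R : realType} (n : nat).
Local Notation E := 'rV[R]_n.
Local Notation Mx := 'M[R]_(n, n).
Local Notation DE := (@dderive R E (E : tvsType R)).
Local Notation DM := (@dderive R E (Mx : tvsType R)).
Variables (UH : set E) (H : E -> Mx) (VH : set E) (K : E -> Mx).
Hypotheses (oU : open UH) (oV : open VH).
Hypotheses (sH : @smooth_on R E (Mx : tvsType R) UH H) (sK : @smooth_on R E (Mx : tvsType R) VH K).
Hypothesis Hunit : forall u, UH u -> H u \in unitmx.
Hypothesis Ksym : forall v, VH v -> (K v)^T = K v.

Let hMx : hausdorff_space (Mx : tvsType R). Proof. exact: (@norm_hausdorff _ Mx). Qed.
Let hE : hausdorff_space (E : tvsType R). Proof. exact: (@norm_hausdorff _ E). Qed.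

(** Tangent vectors are rows, on which the differential acts as multiplication by [jac] from the
    right; a Gram matrix [K] pulls back to [P *m K *m P^T]. *)
Definition jac (f : E -> E) (u : E) : Mx := \matrix_(i, j) DE (delta_mx 0 i) f u 0 j.

(** The part of the differentiated isometry equation [H = P K(f) P^T] that involves second
    derivatives of [f], expressed through the jet. *)
Definition chris_B (k : 'I_n) (u v : E) (P : Mx) : Mx :=
  DM (delta_mx 0 k) H u - P *m DM (row k P) K v *m P^T.

(** The cyclic permutation that produces Christoffel symbols of the first kind, solved for the
    derivative of the Jacobian: by the isometry equation, multiplying by [invmx (H u)] and [P]
    undoes multiplication by [K P^T]. *)
Definition chris (k : 'I_n) (u v : E) (P : Mx) : Mx :=
  (\matrix_(i, j) (2^-1 * (chris_B k u v P i j + chris_B i u v P k j - chris_B j u v P k i)))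
    *m invmx (H u) *m P.

(* An isometry f between the metrics H and K is a solution of the first order system
   that prescribes the derivative of its jet (u, f u, Df u). *)
Definition jet_field (w : E) (j : E * E * Mx) : E * E * Mx :=
  (w, w *m j.2, \sum_k w 0 k *: chris k j.1.1 j.1.2 j.2).

Definition jets : set (E * E * Mx) := (UH `*` VH) `*` setT.

Lemma open_jets : open jets.
Proof. by apply: open_setX; [exact: open_setX|exact: openT]. Qed.

Lemma chris_smooth i0 :
  @smooth_on R (E * E * Mx)%type (Mx : tvsType R) jets (fun j => chris i0 j.1.1 j.1.2 j.2).
Proof.
move=> k; have oj := open_jets.
have p1 : @Ck_on R (E : tvsType R) k (E * E * Mx)%type jets (fun j => j.1.1).
  apply: (smooth_linear (E := (E * E * Mx)%type) (E' := E)) => [a [[? ?] ?] [[? ?] ?]//|[z y]].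
  by apply: (@cvg_comp _ _ _ fst fst _ (nbhs z)); exact: cvg_fst.
have p2 : @Ck_on R (E : tvsType R) k (E * E * Mx)%type jets (fun j => j.1.2).
  apply: (smooth_linear (E := (E * E * Mx)%type) (E' := E)) => [a [[? ?] ?] [[? ?] ?]//|[z y]].
  by apply: (@cvg_comp _ _ _ fst snd _ (nbhs z)); [exact: cvg_fst|exact: cvg_snd].
have p3 : @Ck_on R (Mx : tvsType R) k (E * E * Mx)%type jets (fun j => j.2).
  apply: (smooth_linear (E := (E * E * Mx)%type) (E' := Mx)) => [a [[? ?] ?] [[? ?] ?]//|z].
  exact: cvg_snd.
have pB i : @Ck_on R (Mx : tvsType R) k (E * E * Mx)%type jets (fun j => chris_B i j.1.1 j.1.2 j.2).
  have c1 : @Ck_on R (Mx : tvsType R) k (E * E * Mx)%type jets (fun j => DM (delta_mx 0 i) H j.1.1).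
    apply: (@Ck_on_comp R k _ E Mx jets UH (fun j => j.1.1) (DM (delta_mx 0 i) H)) => //.
      by move=> j [[]].
    exact: (smooth_dderive hMx oU sH).
  have c2 : @Ck_on R (Mx : tvsType R) k (E * E * Mx)%type jets (fun j => DM (row i j.2) K j.1.2).
    apply: (@Ck_on_comp R k _ (E * E)%type Mx jets (VH `*` setT) (fun j => (j.1.2, row i j.2))
      (fun p => DM p.2 K p.1)) => //.
    - by apply: open_setX => //; exact: openT.
    - by move=> j [[]].
    - apply: Ck_on_pair => //.
      exact: (@Ck_on_lincomp R (Mx : tvsType R) (E : tvsType R) k _ jets (fun j => j.2) (row i)
        (row_linear i) (@row_continuous R n n i) p3).
    - exact: smooth_tan.
  have c3 := Ck_on_mulmx oj (Ck_on_mulmx oj p3 c2) (Ck_on_trmx oj p3).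
  have := Ck_on_lin (-1) c3 c1; congr Ck_on; apply/funext => j.
  by rewrite scaleN1r addrC.
have pC i : @Ck_on R (Mx : tvsType R) k (E * E * Mx)%type jets (fun j => chris i j.1.1 j.1.2 j.2).
  apply: Ck_on_mulmx => //; apply: Ck_on_mulmx => //.
    apply: Ck_on_mx => // a b; under eq_fun do rewrite mxE.
    have q : Ck_on k jets (fun j => chris_B i j.1.1 j.1.2 j.2 a b + chris_B a j.1.1 j.1.2 j.2 i b
        - chris_B b j.1.1 j.1.2 j.2 i a : R^o).
      have := Ck_on_lin (-1) (Ck_on_mx_entry i a (pB b)) (Ck_on_add (Ck_on_mx_entry a b (pB i)) (Ck_on_mx_entry i b (pB a))).
      by congr Ck_on; apply/funext => j; rewrite scaleN1r addrC.
    exact: (Ck_on_scale oj (Ck_on_cst k jets (2^-1 : R^o)) q).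
  apply: (@Ck_on_comp R k _ E Mx jets UH (fun j => j.1.1) (fun u => invmx (H u))) => //.
    by move=> j [[]].
  exact: Ck_on_invmx.
exact: pC.
Qed.

Lemma jet_field_smooth w :
  @smooth_on R (E * E * Mx)%type ((E * E * Mx)%type : tvsType R) jets (jet_field w).
Proof.
move=> k; have oj := open_jets.
have p3 : @Ck_on R (Mx : tvsType R) k (E * E * Mx)%type jets (fun j => j.2).
  apply: (smooth_linear (E := (E * E * Mx)%type) (E' := Mx)) => [a [[? ?] ?] [[? ?] ?]//|z].
  exact: cvg_snd.
have pS : @Ck_on R (Mx : tvsType R) k (E * E * Mx)%type jets
    (fun j => \sum_i w 0 i *: chris i j.1.1 j.1.2 j.2).
  apply: (@Ck_on_sum R Mx) => i.
  by apply: (@Ck_on_scale R Mx k _ jets (fun=> w 0 i)); [|exact: Ck_on_cst|exact: chris_smooth].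
apply: (@Ck_on_pair R (E * E)%type Mx) => //.
apply: (@Ck_on_pair R E E); first exact: Ck_on_cst.
by apply: Ck_on_mulmx => //; exact: Ck_on_cst.
Qed.

(** Short directions give small values, locally uniformly in the jet. This is what makes families of
    isometry jets equicontinuous. *)
Lemma jet_field_cvg0 (j : E * E * Mx) : jets j ->
  (fun p : (E * E * Mx) * E => jet_field p.2 p.1) @ filter_prod (nbhs j) (nbhs (0 : E)) --> (0 : E * E * Mx).
Proof.
move=> jj; have c2 : (fun p : (E * E * Mx) * E => p.2) @ filter_prod (nbhs j) (nbhs (0 : E)) --> (0 : E).
  exact: cvg_snd.
apply: (@pair_cvg _ _ _ (E * E)%type Mx _ _ (0 : E * E) (0 : Mx)).
  apply: (@pair_cvg _ _ _ E E _ _ (0 : E) (0 : E)) => //.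
  rewrite -[X in _ --> X](mul0mx 1 j.2); apply: mulmx_cvg => //.
  apply: (@cvg_comp _ _ _ fst snd _ (nbhs j)); first exact: cvg_fst.
  by case: j {jj c2} => ? ?; exact: cvg_snd.
have e0 : \sum_(k < n) (0 : R) *: chris k j.1.1 j.1.2 j.2 = 0.
  by rewrite big1// => k _; rewrite scale0r.
rewrite -[X in _ --> X]e0.
apply: (@sum_cvg R Mx) => k; apply: (@scalev_cvg R Mx).
  suff : (fun p : (E * E * Mx) * E => p.2 0 k : R^o) @ filter_prod (nbhs j) (nbhs (0 : E)) --> ((0 : E) 0 k : R^o).
    by rewrite mxE.
  exact: (@mx_entry_cvg R _ _ _ 1 n (fun p : (E * E * Mx) * E => p.2) 0 0 k c2).
apply: (@cvg_comp _ _ _ fst (fun j => chris k j.1.1 j.1.2 j.2) _ (nbhs j)); first exact: cvg_fst.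
exact: (smooth_cont (chris_smooth k) jj).
Qed.

Variables (B : set E) (f : E -> E).
Hypotheses (oB : open B) (BU : B `<=` UH) (fV : forall u, B u -> VH (f u)).
Hypothesis sf : @smooth_on R E (E : tvsType R) B f.
Hypothesis iso : forall u, B u -> H u = jac f u *m K (f u) *m (jac f u)^T.

Lemma rV_sum (w : E) : w = \sum_k w 0 k *: (delta_mx 0 k : E).
Proof. by rewrite {1}[w]row_sum_delta. Qed.

Lemma jac_mul u w : B u -> DE w f u = w *m jac f u.
Proof.
move=> Bu; have L := dderive_linear hE oB sf Bu.
pose Lf := HB.pack_for {linear E -> E} (fun v : E => DE v f u) (GRing.isLinear.Build _ _ _ _ _ L).
rewrite {1}[w]rV_sum -[LHS]/(Lf _) linear_sum mulmx_sum_row; apply: eq_bigr => k _.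
rewrite linearZ /=; congr (_ *: _); apply/rowP => j; by rewrite !mxE.
Qed.

Lemma jac_smooth : @smooth_on R E (Mx : tvsType R) B (jac f).
Proof.
move=> k; apply: Ck_on_mx => // i j; under eq_fun do rewrite mxE.
exact: (Ck_on_mx_entry 0 j (smooth_dderive hE oB sf (delta_mx 0 i) k)).
Qed.

Lemma mx_dderive m p (g : E -> 'M[R]_(m, p)) u w i j : @smooth_on R E ('M[R]_(m, p) : tvsType R) B g -> B u ->
  @dderive R E ('M[R]_(m, p) : tvsType R) w g u i j = dderive w (fun v => g v i j : R^o) u.
Proof.
move=> sg Bu; apply/esym; apply: (cvg_dderive (@norm_hausdorff _ R^o)).
have hm : hausdorff_space ('M[R]_(m, p) : tvsType R) by exact: (@norm_hausdorff _ 'M[R]_(m, p)).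
exact: (diff_quot_linear (@mx_entry_linear R m p i j) (@mx_entry_continuous R m p i j) (smooth_cvg hm oB sg Bu)).
Qed.

Lemma jac_row k u : row k (jac f u) = DE (delta_mx 0 k) f u.
Proof. by apply/rowP => j; rewrite !mxE. Qed.

Lemma row_entry m p (C : 'M[R]_(m, p)) k j : row k C 0 j = C k j.
Proof. by rewrite mxE. Qed.

(** With [A i] the product [G i *m K0 *m P^T], the three-index array is symmetric in its first two
    indices and [Bf] is its symmetrization in the last two. As for the Levi-Civita connection, an
    alternating sum of three permutations isolates it. *)
Lemma chris_solve (G Bf : 'I_n -> Mx) (K0 P Hi : Mx) :
  (forall i j a, G i j a = G j i a) -> P *m (K0 *m P^T *m Hi) = 1%:M ->
  (forall i, Bf i = G i *m K0 *m P^T + (G i *m K0 *m P^T)^T) ->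
  forall k, G k = (\matrix_(i, j) (2^-1 * (Bf k i j + Bf i k j - Bf j k i))) *m Hi *m P.
Proof.
move=> Gs PK BE k; pose A i := G i *m K0 *m P^T.
have As i j l : A i j l = A j i l.
  by rewrite /A -!mulmxA [LHS]mxE [RHS]mxE; apply: eq_bigr => a _; rewrite Gs.
have -> : (\matrix_(i, j) (2^-1 * (Bf k i j + Bf i k j - Bf j k i))) = A k.
  apply/matrixP => i j; rewrite mxE !BE -!/(A _) ![(_ + _ : Mx) _ _]mxE ![(_^T) _ _]mxE.
  rewrite (As i k j) (As j k i) (As j i k).
  have -> : A k i j + A k j i + (A k i j + A i j k) - (A k j i + A i j k) = A k i j + A k i j by ring.
  by move: (A k i j) => z; lra.
have KP := mulmx1C PK.
by rewrite /A -!mulmxA (mulmxA K0) (mulmxA _ _ P) KP mulmx1.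
Qed.

Lemma jac_sym (i k : 'I_n) u : B u ->
  row i (DM (delta_mx 0 k) (jac f) u) = row k (DM (delta_mx 0 i) (jac f) u).
Proof.
move=> Bu; apply/rowP => j.
have e (a b : 'I_n) : DM (delta_mx 0 a) (jac f) u b j = DE (delta_mx 0 a) (DE (delta_mx 0 b) f) u 0 j.
  rewrite (mx_dderive (delta_mx 0 a) b j jac_smooth Bu).
  rewrite (mx_dderive (delta_mx 0 a) 0 j (smooth_dderive hE oB sf (delta_mx 0 b)) Bu).
  have -> // : (fun v => jac f v b j : R^o) = (fun v => DE (delta_mx 0 b) f v 0 j).
  by apply/funext => v; rewrite mxE.
have eL : row i (DM (delta_mx 0 k) (jac f) u) 0 j = DE (delta_mx 0 k) (DE (delta_mx 0 i) f) u 0 j.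
  exact: (etrans (row_entry _ _ _) (e k i)).
have eR : row k (DM (delta_mx 0 i) (jac f) u) 0 j = DE (delta_mx 0 i) (DE (delta_mx 0 k) f) u 0 j.
  exact: (etrans (row_entry _ _ _) (e i k)).
have C := dderiveC hE (delta_mx 0 k) (delta_mx 0 i) oB sf Bu.
exact: (etrans eL (etrans (congr1 (fun v : E => v 0 j) C) (esym eR))).
Qed.

(** The isometry equation is differentiated in each coordinate direction. Symmetry of [K] pairs the
    two terms containing second derivatives, and symmetry of the second derivatives of [f] supplies
    the remaining hypothesis of [chris_solve]. *)
Lemma jac_dderive k u : B u ->
  DM (delta_mx 0 k) (jac f) u = chris k u (f u) (jac f u).
Proof.
move=> Bu; pose G i := DM (delta_mx 0 i) (jac f) u; pose P := jac f u.
pose A i := G i *m K (f u) *m P^T.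
have Ku := Ksym (fV Bu).
have BE i : chris_B i u (f u) P = A i + (A i)^T.
  have q1 : diff_quot (jac f) u (delta_mx 0 i : E) @ 0^' --> G i := smooth_cvg hMx oB jac_smooth Bu (v:=_).
  have q2 : diff_quot (K \o f) u (delta_mx 0 i : E) @ 0^' --> DM (row i P) K (f u).
    by rewrite jac_row; apply: (diff_quot_comp hMx oV sK (fV Bu)); exact: (smooth_cvg hE oB sf Bu).
  have q3 := diff_quot_linear (@trmx_linear R n n) (@trmx_continuous R n n) q1.
  have q := diff_quot_mulmx (diff_quot_mulmx q1 q2) q3.
  have qH : DM (delta_mx 0 i) H u = (G i *m K (f u) + P *m DM (row i P) K (f u)) *m P^T + P *m K (f u) *m (G i)^T.
    apply: (cvg_dderive hMx).
    apply: (@diff_quot_eq R (Mx : tvsType R) E B (fun u => jac f u *m K (f u) *m (jac f u)^T) H u _ _ oB _ Bu).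
      by move=> v Bv; rewrite -iso.
    exact: q.
  rewrite /chris_B qH /A !trmx_mul trmxK Ku mulmxDl mulmxA -/P.
  by rewrite [_ + _ + _ - _]addrAC addrK.
have Gs (i j a : 'I_n) : G i j a = G j i a.
  exact: (etrans (esym (row_entry (G i) j a))
    (etrans (congr1 (fun v : E => v 0 a) (jac_sym j i Bu)) (row_entry (G j) i a))).
have PK : P *m (K (f u) *m P^T *m invmx (H u)) = 1%:M.
  by rewrite !mulmxA /P -iso// mulmxV// Hunit//; exact: BU.
exact: (chris_solve Gs PK BE k).
Qed.

Lemma jet_quot u w : B u ->
  diff_quot (fun u => (u, f u, jac f u) : E * E * Mx) u w @ 0^' --> jet_field w (u, f u, jac f u).
Proof.
move=> Bu; apply: (@diff_quot_pair R E (E * E)%type Mx).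
  apply: (@diff_quot_pair R E E E); first exact: diff_quot_id.
  by rewrite /= -jac_mul//; exact: (smooth_cvg hE oB sf Bu).
have -> : (\sum_k w 0 k *: chris k u (f u) (jac f u)) = DM w (jac f) u.
  have L := dderive_linear hMx oB jac_smooth Bu.
  pose Lf := HB.pack_for {linear E -> Mx} (fun v : E => DM v (jac f) u) (GRing.isLinear.Build _ _ _ _ _ L).
  rewrite [in RHS](rV_sum w) -[RHS]/(Lf _) linear_sum; apply: eq_bigr => k _.
  by rewrite linearZ /= jac_dderive.
exact: (smooth_cvg hMx oB jac_smooth Bu).
Qed.

End IsometryJets.

(** * Local rigidity of isometries *)

Section LocalEstimates.
Context {R : realType} (n : nat).
Local Notation E := 'rV[R]_n.

Lemma compact_pos_lower (T : topologicalType) (K : set T) (q : T -> R^o) : compact K ->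
  (forall x, K x -> {for x, continuous q}) -> (forall x, K x -> 0 < q x) ->
  exists2 e : R, 0 < e & forall x, K x -> e <= q x.
Proof.
move=> cK cq q0.
have : compact ((fun x => (q x)^-1 : R^o) @` K).
  apply: compact_image => // x Kx.
  by apply: (@continuous_comp _ _ _ q (fun t : R^o => t^-1)); [exact: cq|exact: (smooth_cont inv_smooth (q0 x Kx))].
move=> /compact_bounded[N [Nr HN]].
have N1 : N < `|N| + 1 by rewrite ltr_pwDr// ler_norm.
exists (`|N| + 1)^-1; first by rewrite invr_gt0 ltr_wpDl.
move=> x Kx; have := HN _ N1 _ (ex_intro2 _ _ x Kx erefl).
have qx := q0 x Kx; have qV : 0 < (q x)^-1 by rewrite invr_gt0.
have N0 : 0 < `|N| + 1 by rewrite ltr_wpDl.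
rewrite /= (gtr0_norm qV) => H.
by rewrite -[q x]invrK lef_pV2 ?posrE.
Qed.

Lemma compact_upper (T : topologicalType) (K : set T) (q : T -> R^o) : compact K ->
  (forall x, K x -> {for x, continuous q}) ->
  exists2 e : R, 0 < e & forall x, K x -> q x <= e.
Proof.
move=> cK cq; have := compact_image cK cq; move=> /compact_bounded[N [Nr HN]].
have N1 : N < `|N| + 1 by rewrite ltr_pwDr// ler_norm.
exists (`|N| + 1); first by rewrite ltr_wpDl.
move=> x Kx; apply: le_trans (ler_norm _) _.
by have := HN _ N1 _ (ex_intro2 _ _ x Kx erefl).
Qed.

Lemma cball_compact (v : E) r : compact [set w : E | `|w - v| <= r].
Proof.
apply: bounded_closed_compact.
  exists (`|v| + r); split; first exact: num_real.
  move=> t vt w /= wv; apply: (le_trans _ (ltW vt)); rewrite -lerBlDl.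
  by apply: le_trans wv; exact: lerB_dist.
have -> : [set w : E | `|w - v| <= r] = (fun w : E => `|w - v|) @^-1` [set t | t <= r] by [].
apply: closed_comp; last exact: closed_le.
move=> w _; apply: (@continuous_comp _ _ _ (fun w : E => w - v) (fun w => `|w|)).
  by apply: (@subv_cvg R E E (nbhs w) _ id (fun=> v)); [exact: cvg_id|exact: cvg_cst].
exact: norm_continuous.
Qed.

(* The continuity argument along a curve: as long as the curve stays in the chart its
   coordinates move slowly, hence the curve cannot leave the ball in the chart. *)
Lemma curve_stays (M : topologicalType) (hM : hausdorff_space M) (d : chart M E) (hd : is_chart d)
    (gam : R -> M) (v : E) (r c : R) : 0 < c ->
  (forall t, 0 <= t <= 1 -> {for t, continuous gam}) ->
  [set w : E | `|w - v| <= r] `<=` img d ->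
  dom d (gam 0) -> `|crd d (gam 0) - v| + c <= r ->
  (forall t, 0 <= t <= 1 -> dom d (gam t) -> `|crd d (gam t) - v| <= r ->
     exists2 l : E, `|l| < c & (fun h => h^-1 *: (crd d (gam (t + h)) - crd d (gam t))) @ (0 : R)^' --> l) ->
  forall t, 0 <= t <= 1 -> dom d (gam t) /\ `|crd d (gam t) - crd d (gam 0)| <= c * t.
Proof.
move=> c0 cg Ld d0 r0 HD.
pose P t := dom d (gam t) /\ `|crd d (gam t) - crd d (gam 0)| <= c * t.
have PL t : 0 <= t <= 1 -> P t -> `|crd d (gam t) - v| <= r.
  move=> /andP[t0 t1] [_ Pt]; apply: le_trans r0.
  have -> : crd d (gam t) - v = (crd d (gam 0) - v) + (crd d (gam t) - crd d (gam 0)).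
    by rewrite [RHS]addrC subrKA.
  apply: le_trans (ler_normD _ _) _; apply: lerD => //.
  by apply: le_trans Pt _; rewrite ler_piMr// ltW.
apply: (@real_ind01 R P).
- by split=> //; rewrite subrr normr0 mulr0.
- move=> t /andP[t0 t1] Ps; have Pt : P t by apply: Ps; rewrite t0 lexx.
  have t01 : 0 <= t <= 1 by rewrite t0 ltW.
  have [l lc Hl] := HD t t01 Pt.1 (PL t t01 Pt).
  have nd : \forall h \near (0 : R)^', dom d (gam (t + h)).
    have H : (fun h => gam (t + h)) @ (0 : R)^' --> gam t.
      apply: (@cvg_comp _ _ _ (fun h => t + h) gam _ (nbhs t)); last exact: (cg t t01).
      have := @line_cvg R R^o t 1; apply: cvg_trans; apply: near_eq_cvg.
      by apply: filterS filterT => h _; rewrite /GRing.scale /= mulr1.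
    exact: (H _ (open_nbhs_nbhs (conj (chart_openD hd) Pt.1))).
  have nq : \forall h \near (0 : R)^', `|h^-1 *: (crd d (gam (t + h)) - crd d (gam t))| < c.
    have FF : Filter (0 : R)^' by exact: _.
    have H := cvg_norm Hl.
    exact: (H FF _ (open_nbhs_nbhs (conj (@open_lt R c) lc))).
  have nn : (0 : R)^' [set h | dom d (gam (t + h)) /\ `|h^-1 *: (crd d (gam (t + h)) - crd d (gam t))| < c].
    exact: (filterI nd nq).
  move: nn; rewrite /dnbhs /within /= => /nbhs_ballP[e /= e0 He].
  exists e => // s /andP[ts se].
  have st0 : 0 < s - t by rewrite subr_gt0.
  have [||ds qs] := He (s - t).
  + by rewrite -ball_normE /= sub0r normrN gtr0_norm// ltrBlDl.
  + by rewrite gt_eqF.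
  rewrite [t + _]addrC subrK in ds qs; split=> //.
  rewrite normrZ normfV (gtr0_norm st0) ltr_pdivrMl// in qs.
  have -> : crd d (gam s) - crd d (gam 0) = (crd d (gam s) - crd d (gam t)) + (crd d (gam t) - crd d (gam 0)).
    by rewrite subrKA.
  apply: le_trans (ler_normD _ _) _; rewrite -[s in c * s](subrK t) mulrDr.
  by apply: lerD; [rewrite mulrC; exact: ltW|exact: Pt.2].
- move=> t /andP[t0 t1] Ps.
  have t01 : 0 <= t <= 1 by rewrite ltW.
  (* In the Hausdorff space [M] this compact set is closed, so the curve cannot leave the chart at
     time [t]. *)
  pose K := prm d @` [set w : E | `|w - v| <= r].
  have cK : compact K by apply: compact_image; [exact: cball_compact|move=> y /Ld; exact: prm_cont].
  have clK := compact_closed hM cK.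
  have Kt : K (gam t).
    apply: clK => N gN; have := cg t t01 N gN; rewrite /= nbhs_simpl /= => /nbhs_ballP[e /= e0 He].
    pose s := Num.max 0 (t - e / 2).
    have st : s < t by rewrite gt_max t0 ltrBlDr ltrDl divr_gt0.
    have s0 : 0 <= s by rewrite le_max lexx.
    have s01 : 0 <= s <= 1 by rewrite s0 (le_trans (ltW st) t1).
    have Pss : P s by apply: Ps; rewrite s0 st.
    exists (gam s); split.
      by exists (crd d (gam s)); [exact: PL|exact: chartK Pss.1].
    apply: He; rewrite -ball_normE /= gtr0_norm ?subr_gt0// ltrBlDr.
    rewrite -ltrBlDl; apply: lt_le_trans (_ : t - e / 2 <= _); last by rewrite le_max lexx orbT.
    by rewrite ltrD2l ltrN2 ltr_pdivrMr// ltr_pMr// ltr1n.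
  have dt : dom d (gam t) by case: Kt => w /Ld iw <-; exact: dom_prm.
  split=> //; rewrite leNgt; apply/negP => lt.
  have cc : {for t, continuous (fun s => `|crd d (gam s) - crd d (gam 0)| - c * s : R^o)}.
    apply: (@subv_cvg R R^o R (nbhs t) _ (fun s => `|crd d (gam s) - crd d (gam 0)|) (fun s => c * s)).
      apply: cvg_norm; apply: (@subv_cvg R E); last exact: cvg_cst.
      by apply: (@cvg_comp _ _ _ gam (crd d) _ (nbhs (gam t))); [exact: (cg t t01)|exact: crd_cont].
    by apply: (@scalev_cvg R R^o); [exact: cvg_cst|exact: cvg_id].
  have lt' : 0 < `|crd d (gam t) - crd d (gam 0)| - c * t by rewrite subr_gt0.
  have := near_gt cc lt'; move=> /nbhs_ballP[e /= e0 He].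
  pose s := Num.max 0 (t - e / 2).
  have st : s < t by rewrite gt_max t0 ltrBlDr ltrDl divr_gt0.
  have s0 : 0 <= s by rewrite le_max lexx.
  have Pss : P s by apply: Ps; rewrite s0 st.
  have := He s; rewrite -ball_normE /= gtr0_norm ?subr_gt0// ltrBlDr -ltrBlDl.
  have -> : t - e < s.
    apply: lt_le_trans (_ : t - e / 2 <= _); last by rewrite le_max lexx orbT.
    by rewrite ltrD2l ltrN2 ltr_pdivrMr// ltr_pMr// ltr1n.
  by move=> /(_ isT); rewrite ltNge Pss.2.
Qed.

End LocalEstimates.

Section Isometries.
Context {R : realType} (n : nat) (M : topologicalType).
Local Notation E := 'rV[R]_n.
Local Notation Mx := 'M[R]_(n, n).
Variables (A : set (chart M E)) (h : chart M E -> E -> E -> E -> R).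
Hypothesis hM : smooth_manifold A.
Hypothesis hr : riemannian_metric A h.

Let cov := manifold_cover hM.
Let hE : hausdorff_space (E : tvsType R). Proof. exact: (@norm_hausdorff _ E). Qed.

Definition gram (c : chart M E) (y : E) : Mx := \matrix_(i, j) h c y (delta_mx 0 i) (delta_mx 0 j).

Section Gram.
Variable c : chart M E.
Hypothesis Ac : A c.

Lemma metric_linl y v : img c y -> linear (fun u => h c y u v : R^o).
Proof. by move=> iy; case: hr => H _ _; have [+ _ _] := H c y Ac iy; exact. Qed.

Lemma metric_sym y u v : img c y -> h c y u v = h c y v u.
Proof. by move=> iy; case: hr => H _ _; have [_ + _] := H c y Ac iy; exact. Qed.

Lemma metric_pos y u : img c y -> u != 0 -> 0 < h c y u u.
Proof. by move=> iy; case: hr => H _ _; have [_ _ +] := H c y Ac iy; exact. Qed.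

Lemma linear_rV_sum (L : E -> R^o) u : linear L -> L u = \sum_i u 0 i * L (delta_mx 0 i).
Proof.
move=> lL; pose Lf := HB.pack_for {linear E -> R^o} L (GRing.isLinear.Build _ _ _ _ _ lL).
rewrite {1}[u]rV_sum -[LHS]/(Lf _) linear_sum; apply: eq_bigr => i _.
by rewrite linearZ.
Qed.

Lemma gramE y u v : img c y -> h c y u v = (u *m gram c y *m v^T) 0 0.
Proof.
move=> iy; rewrite (linear_rV_sum u (metric_linl v iy)) -mulmxA mxE; apply: eq_bigr => i _.
congr (_ * _); rewrite metric_sym// (linear_rV_sum v (metric_linl _ iy)) mxE; apply: eq_bigr => j _.
by rewrite !mxE mulrC metric_sym.
Qed.

Lemma gram_sym y : img c y -> (gram c y)^T = gram c y.
Proof. by move=> iy; apply/matrixP => i j; rewrite !mxE metric_sym. Qed.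

Lemma gram_unit y : img c y -> gram c y \in unitmx.
Proof.
move=> iy; rewrite -row_free_unit -kermx_eq0.
apply/rowV0P => u /sub_kermxP uG; apply/eqP/negPn/negP => u0.
by have := metric_pos iy u0; rewrite gramE// uG mul0mx mxE ltxx.
Qed.

Lemma gram_smooth : @smooth_on R E (Mx : tvsType R) (img c) (gram c).
Proof.
have oI := chart_openI (cov.2 _ Ac); move=> k; apply: Ck_on_mx => // i j; under eq_fun do rewrite mxE.
by case: hr => _ + _; apply.
Qed.

End Gram.

Definition isometry (a : M -> M) : Prop := smooth_map A A a /\ pullback_scaled A h a (fun=> 1).

Definition locD (a : M -> M) (c d : chart M E) : set E := img c `&` (a \o prm c) @^-1` dom d.

Section SmoothRep.
Variables (a : M -> M) (c d : chart M E).
Hypotheses (sa : smooth_map A A a) (Ac : A c) (Ad : A d).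

Lemma rep_open : open (locD a c d).
Proof.
have hc := cov.2 _ Ac; have hd := cov.2 _ Ad.
apply: open_preim; [exact: chart_openI| |exact: chart_openD] => y iy.
by apply: continuous_comp; [exact: prm_cont|case: sa => + _; exact].
Qed.

Lemma rep_smooth : @smooth_on R E (E : tvsType R) (locD a c d) (loc a c d).
Proof. by have [_ /(_ c d Ac Ad)] := sa; rewrite (crd_imageE (cov.2 _ Ac)). Qed.

End SmoothRep.

Section LocalRep.
Variables (a : M -> M) (c d : chart M E).
Hypotheses (ia : isometry a) (Ac : A c) (Ad : A d).

Lemma locD_open : open (locD a c d). Proof. exact: (rep_open ia.1 Ac Ad). Qed.

Lemma loc_smooth : @smooth_on R E (E : tvsType R) (locD a c d) (loc a c d).
Proof. exact: (rep_smooth ia.1 Ac Ad). Qed.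

Lemma loc_img u : locD a c d u -> img d (loc a c d u).
Proof. by move=> [_ du]; exact: img_dom. Qed.

Lemma loc_metric u v w : locD a c d u ->
  h d (loc a c d u) (dderive v (loc a c d : E -> E : tvsType R) u) (dderive w (loc a c d : E -> E : tvsType R) u) = h c u v w.
Proof.
move=> Du; have [iu du] := Du; have hc := cov.2 _ Ac; have [_ /(_ c d (prm c u) v w Ac Ad (dom_prm hc iu) du)] := ia.
rewrite mul1r (prmK hc iu) => H.
rewrite -H; congr (h d _ _ _).
  by apply/esym; exact: (derive_dderive (W := E) v locD_open loc_smooth Du).
by apply/esym; exact: (derive_dderive (W := E) w locD_open loc_smooth Du).
Qed.

Lemma loc_gram u : locD a c d u ->
  gram c u = jac (loc a c d) u *m gram d (loc a c d u) *m (jac (loc a c d) u)^T.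
Proof.
move=> Du; have [iu _] := Du; apply/matrixP => i j; rewrite mxE -(loc_metric _ _ Du) (gramE Ad); last exact: loc_img.
rewrite -!jac_row; set P := jac _ _; set K := gram d _.
have -> : (row j P)^T = col j P^T by rewrite tr_row.
rewrite -row_mul [LHS]mxE [RHS]mxE; apply: eq_bigr => l _.
by rewrite row_entry [X in _ * X]mxE.
Qed.

End LocalRep.

(** On unit vectors over [L] the metric is at least [l], over [K] at most [m]. An isometry preserves
    the metric, so [|v|^2 l <= |w|^2 m] with constants that do not depend on it. *)
Lemma derivative_bound (c d : chart M E) (K L : set E) : A c -> A d -> compact K -> compact L ->
  K `<=` img c -> L `<=` img d -> exists2 C : R, 0 < C &
  forall a u w, isometry a -> locD a c d u -> K u -> L (loc a c d u) ->
    `|dderive w (loc a c d : E -> E : tvsType R) u| <= C * `|w|.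
Proof.
move=> Ac Ad cK cL Kc Ld.
pose S := [set w : E | `|w| = 1].
have cS : compact S.
  apply: (@subclosed_compact _ _ [set w : E | `|w - 0| <= 1]); last by move=> w; rewrite /S /= subr0 => ->.
    have -> : S = (fun w : E => `|w|) @^-1` [set t | t = 1] by [].
    apply: closed_comp; last exact: closed_eq.
    by move=> w _; exact: norm_continuous.
  exact: cball_compact.
have qc e : A e -> forall p : E * E, img e p.1 ->
    {for p, continuous (fun p : E * E => h e p.1 p.2 p.2 : R^o)}.
  move=> Ae [y w] /= iy; have he := cov.2 _ Ae.
  have H : (fun p : E * E => (p.2 *m gram e p.1 *m p.2^T) 0 0 : R^o) @ nbhs (y, w) -->
      ((w *m gram e y *m w^T) 0 0 : R^o).
    apply: mx_entry_cvg; apply: mulmx_cvg; last first.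
      by apply: (@cvg_comp _ _ _ snd trmx _ (nbhs w)); [exact: cvg_snd|exact: trmx_continuous].
    apply: mulmx_cvg; first exact: cvg_snd.
    apply: (@cvg_comp _ _ _ fst (gram e) _ (nbhs y)); first exact: cvg_fst.
    exact: (smooth_cont (gram_smooth Ae) iy).
  rewrite -(gramE Ae w w iy) in H; apply: cvg_eq_near H.
  have : nbhs (y, w) (img e `*` setT).
    by apply: nbhs_setX; [exact: (open_nbhs_nbhs (conj (chart_openI he) iy))|exact: filterT].
  by apply: filterS => -[y' w'] [/= iy' _]; rewrite (gramE Ae).
have w0 (w : E) : S w -> w != 0 by rewrite /S /= => w1; rewrite -normr_gt0 w1.
have [l l0 Hl] : exists2 l : R, 0 < l & forall p : E * E, (L `*` S) p -> l <= h d p.1 p.2 p.2.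
  apply: (@compact_pos_lower R _ (L `*` S) (fun p : E * E => h d p.1 p.2 p.2 : R^o)); first exact: compact_setX.
    by move=> p [/Ld id _]; exact: qc.
  by move=> p [/Ld id Sp]; apply: metric_pos => //; exact: w0.
have [m m0 Hm] : exists2 m : R, 0 < m & forall p : E * E, (K `*` S) p -> h c p.1 p.2 p.2 <= m.
  apply: (@compact_upper R _ (K `*` S) (fun p : E * E => h c p.1 p.2 p.2 : R^o)); first exact: compact_setX.
  by move=> p [/Kc id _]; exact: qc.
(* A bound for the square root of [m / l], since [(1 + q)^2 >= q]. *)
pose C := 1 + m / l; have ml : 0 < m / l by exact: divr_gt0.
have C0 : 0 < C by rewrite ltr_wpDl.
exists C => // a u w ia Du Ku Lu; have iu := Kc _ Ku; have il := Ld _ Lu.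
have hZ e y (t : R) v : A e -> img e y -> h e y (t *: v) (t *: v) = t ^+ 2 * h e y v v.
  move=> Ae iy; rewrite !(gramE Ae)// linearZ /= -!scalemxAl -scalemxAr !mxE expr2 mulrA.
  by rewrite -mulrA.
have nS (v : E) : v != 0 -> S (`|v|^-1 *: v).
  by move=> v0; rewrite /S /= normrZ normfV normr_id mulVf// normr_eq0.
have nE (v : E) : v != 0 -> v = `|v| *: (`|v|^-1 *: v).
  by move=> v0; rewrite scalerA mulfV ?scale1r// normr_eq0.
set v := dderive _ _ _.
have [->|v0] := eqVneq v 0; first by rewrite normr0 mulr_ge0// ltW.
have hv := loc_metric ia Ac Ad w w Du; rewrite -/v in hv.
have lo : `|v| ^+ 2 * l <= h d (loc a c d u) v v.
  have -> : h d (loc a c d u) v v = `|v| ^+ 2 * h d (loc a c d u) (`|v|^-1 *: v) (`|v|^-1 *: v).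
    by rewrite -hZ// -(nE v v0).
  rewrite ler_pM2l ?exprn_gt0 ?normr_gt0//.
  exact: (Hl (loc a c d u, `|v|^-1 *: v) (conj Lu (nS v v0))).
have up : h c u w w <= `|w| ^+ 2 * m.
  have [w00|wn0] := eqVneq w 0.
    by rewrite w00 normr0 expr0n mul0r -(scale0r (0 : E)) hZ// expr0n mul0r.
  have -> : h c u w w = `|w| ^+ 2 * h c u (`|w|^-1 *: w) (`|w|^-1 *: w).
    by rewrite -hZ// -(nE w wn0).
  rewrite ler_pM2l ?exprn_gt0 ?normr_gt0//.
  exact: (Hm (u, `|w|^-1 *: w) (conj Ku (nS w wn0))).
have le1 : `|v| ^+ 2 * l <= `|w| ^+ 2 * m by rewrite (le_trans lo)// hv.
have le2 : `|v| ^+ 2 <= `|w| ^+ 2 * (m / l) by rewrite mulrA ler_pdivlMr.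
rewrite -ler_sqr ?nnegrE ?mulr_ge0 ?(ltW C0)//.
apply: le_trans le2 _; rewrite exprMn [leRHS]mulrC ler_wpM2l ?exprn_ge0//.
rewrite /C; nra.
Qed.

(** If an isometry sends one point of the small ball near [y], it sends the whole ball into the
    chart at [y], with a common Lipschitz constant. The radii serve all isometries simultaneously,
    which replaces any control on an individual one. *)
Lemma local_rigidity (x y : M) (c d : chart M E) : A c -> A d -> dom c x -> dom d y ->
  exists rho r C : R, [/\ 0 < rho, 0 < r, 0 < C,
    (forall u : E, `|u - crd c x| <= rho -> img c u) /\ (forall v : E, `|v - crd d y| <= r -> img d v) &
    forall a, isometry a ->
      (exists u : E, [/\ `|u - crd c x| <= rho, dom d (a (prm c u)) & `|loc a c d u - crd d y| <= r / 4]) ->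
      forall u : E, `|u - crd c x| <= rho ->
        [/\ locD a c d u, `|loc a c d u - crd d y| <= r,
            forall w, `|dderive w (loc a c d : E -> E : tvsType R) u| <= C * `|w| &
            forall v : E, `|v - crd c x| <= rho -> `|loc a c d v - loc a c d u| <= C * `|v - u|]].
Proof.
move=> Ac Ad cx dy; have hc := cov.2 _ Ac; have hd := cov.2 _ Ad; have [hT _ _ _ _] := hM.
have cb e z : A e -> dom e z -> exists2 r : R, 0 < r & forall v : E, `|v - crd e z| <= r -> img e v.
  move=> Ae ez; have /nbhs_ballP[r /= r0 Hr] := open_nbhs_nbhs (conj (chart_openI (cov.2 _ Ae)) (img_dom ez)).
  exists (r / 2); first by rewrite divr_gt0.
  move=> v vr; apply: Hr; rewrite -ball_normE /= distrC; apply: le_lt_trans vr _.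
  by rewrite ltr_pdivrMr// ltr_pMr// ltr1n.
have [r r0 Hr] := cb d y Ad dy; have [s s0 Hs] := cb c x Ac cx.
have [C C0 HC] := derivative_bound Ac Ad (@cball_compact R n (crd c x) s) (@cball_compact R n (crd d y) r) Hs Hr.
(* Then [C * (2 * rho) <= r / 4]: crossing the ball moves the image by at most [r / 4], so an image
   starting within [r / 4] of the centre stays within [r / 2]. *)
pose rho := Num.min s (r / (8 * C)).
have rho0 : 0 < rho by rewrite lt_min s0 divr_gt0// mulr_gt0.
have rhos : rho <= s by rewrite ge_min lexx.
have rhoC : C * (2 * rho) <= r / 4.
  have : rho <= r / (8 * C) by rewrite ge_min lexx orbT.
  rewrite ler_pdivlMr ?mulr_gt0// => H; rewrite ler_pdivlMr//; nra.
exists rho, r, C; split=> //; first by split=> // u ur; apply: Hs; exact: le_trans rhos.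
move=> a ia.
(* [curve_stays] asks for a speed strictly below its bound; [eps] provides the room, and [move2]
   lets it tend to 0. *)
have move_ (u v : E) (eps : R) : 0 < eps <= r / 4 -> `|u - crd c x| <= rho -> `|v - crd c x| <= rho ->
    dom d (a (prm c u)) -> `|loc a c d u - crd d y| <= r / 2 ->
    dom d (a (prm c v)) /\ `|loc a c d v - loc a c d u| <= C * `|v - u| + eps.
  move=> /andP[e0 er] ur vr du lu.
  pose gam (t : R) := a (prm c (u + t *: (v - u))).
  have seg t : 0 <= t <= 1 -> `|u + t *: (v - u) - crd c x| <= rho.
    move=> /andP[t0 t1].
    have -> : u + t *: (v - u) - crd c x = (1 - t) *: (u - crd c x) + t *: (v - crd c x).
      by apply/rowP => j; rewrite !mxE; ring.
    apply: le_trans (ler_normD _ _) _; rewrite !normrZ (ger0_norm t0) ger0_norm ?subr_ge0//.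
    nra.
  have segi t : 0 <= t <= 1 -> img c (u + t *: (v - u)).
    by move=> t01; apply: Hs; apply: le_trans (seg t t01) rhos.
  have uv : C * `|v - u| <= r / 4.
    apply: le_trans rhoC; rewrite ler_pM2l//.
    have -> : v - u = (v - crd c x) - (u - crd c x) by rewrite opprB subrKA.
    by apply: le_trans (ler_normB _ _) _; rewrite mulr2n mulrDl mul1r; exact: lerD.
  have c0 : 0 < C * `|v - u| + eps by rewrite ltr_wpDl// mulr_ge0// ltW.
  have g0 : gam 0 = a (prm c u) by rewrite /gam scale0r addr0.
  have g1 : gam 1 = a (prm c v) by rewrite /gam scale1r addrC subrK.
  have H1 (t : R) : 0 <= t <= 1 -> {for t, continuous gam}.
    move=> t01; have ca : continuous a by case: ia => -[+ _] _; exact.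
    have cl : (fun s : R => u + s *: (v - u)) @ t --> u + t *: (v - u).
      apply: (@addv_cvg R E); first exact: cvg_cst.
      by apply: (@scalev_cvg R E); [exact: cvg_id|exact: cvg_cst].
    exact: (cvg_comp _ _ (cvg_comp _ _ cl (prm_cont hc (segi t t01))) (ca _)).
  have H3 : dom d (gam 0) by rewrite g0.
  have H4 : `|crd d (gam 0) - crd d y| + (C * `|v - u| + eps) <= r.
    rewrite g0; apply: le_trans (lerD lu (lerD uv er)) _; lra.
  have H5 (t : R) : 0 <= t <= 1 -> dom d (gam t) -> `|crd d (gam t) - crd d y| <= r ->
     exists2 l : E, `|l| < C * `|v - u| + eps &
       (fun e => e^-1 *: (crd d (gam (t + e)) - crd d (gam t))) @ (0 : R)^' --> l.
    move=> t01 dt lt; have Dt : locD a c d (u + t *: (v - u)) by split; [exact: segi|].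
    exists (dderive (v - u) (loc a c d : E -> E : tvsType R) (u + t *: (v - u))).
      apply: le_lt_trans (HC a _ (v - u) ia Dt _ _) _ => //; last by rewrite ltrDl.
      by apply: le_trans (seg t t01) rhos.
    have := smooth_cvg hE (locD_open ia Ac Ad) (loc_smooth ia Ac Ad) Dt (v := v - u).
    apply: cvg_trans; apply: near_eq_cvg; apply: filterS filterT => e _.
    by rewrite /diff_quot /loc /= /gam scalerDl addrA.
  have := curve_stays hT hd c0 H1 Hr H3 H4 H5 (introT andP (conj ler01 (lexx 1))).
  by rewrite g1 g0 mulr1.
have move2 (u v : E) : `|u - crd c x| <= rho -> `|v - crd c x| <= rho ->
    dom d (a (prm c u)) -> `|loc a c d u - crd d y| <= r / 2 ->
    dom d (a (prm c v)) /\ `|loc a c d v - loc a c d u| <= C * `|v - u|.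
  move=> ur vr du lu; have r4 : 0 < r / 4 by rewrite divr_gt0.
  split; first by have [] := move_ u v (r / 4) (introT andP (conj r4 (lexx _))) ur vr du lu.
  apply/ler_addgt0Pr => e e0.
  have e1 : 0 < Num.min e (r / 4) <= r / 4 by rewrite lt_min e0 r4 ge_min lexx orbT.
  have [_ H] := move_ u v _ e1 ur vr du lu; apply: le_trans H _.
  by rewrite lerD2l ge_min lexx.
move=> [u1 [u1r du1 lu1]] u ur.
have lu1' : `|loc a c d u1 - crd d y| <= r / 2 by apply: le_trans lu1 _; lra.
have [du lu] := move2 u1 u u1r ur du1 lu1'.
have iu : img c u by apply: Hs; exact: le_trans rhos.
have Du : locD a c d u by [].
have luy : `|loc a c d u - crd d y| <= r / 2.
  have -> : loc a c d u - crd d y = (loc a c d u - loc a c d u1) + (loc a c d u1 - crd d y) by rewrite subrKA.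
  apply: le_trans (ler_normD _ _) _.
  have : C * `|u - u1| <= r / 4.
    apply: le_trans rhoC; rewrite ler_pM2l//.
    have -> : u - u1 = (u - crd c x) - (u1 - crd c x) by rewrite opprB subrKA.
    by apply: le_trans (ler_normB _ _) _; rewrite mulr2n mulrDl mul1r; exact: lerD.
  move=> H; have := lerD (le_trans lu H) lu1; lra.
have luy' : `|loc a c d u - crd d y| <= r by apply: le_trans luy _; lra.
split=> //.
  by move=> w; apply: HC => //; exact: le_trans rhos.
by move=> v vr; have [] := move2 u v ur vr du luy.
Qed.

End Isometries.

(** * Tangent maps in charts and their dependence on parameters *)

Section Tangents.
Context {R : realType} (n : nat) (M : topologicalType).
Local Notation E := 'rV[R]_n.
Local Notation DE := (@dderive R E (E : tvsType R)).
Variable A : set (chart M E).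
Hypothesis hM : smooth_manifold A.

Let cov := manifold_cover hM.
Let hE : hausdorff_space (E : tvsType R). Proof. exact: (@norm_hausdorff _ E). Qed.

Section OneMap.
Variables (a : M -> M) (c d : chart M E).
Hypotheses (sa : smooth_map A A a) (Ac : A c) (Ad : A d).

Lemma rep_dom x : dom c x -> dom d (a x) -> locD a c d (crd c x).
Proof. by move=> cx dx; split; [exact: img_dom|rewrite /= (chartK (cov.2 _ Ac) cx)]. Qed.

Lemma tangentE x u : dom c x -> dom d (a x) ->
  'D_u (loc a c d) (crd c x) = DE u (loc a c d) (crd c x).
Proof. by move=> cx dx; apply: (derive_dderive (W := E) u (rep_open hM sa Ac Ad) (rep_smooth hM sa Ac Ad)); exact: rep_dom. Qed.

Lemma tangent_linear x : dom c x -> dom d (a x) -> linear (fun u => 'D_u (loc a c d) (crd c x)).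
Proof.
move=> cx dx t u v; rewrite !tangentE//.
exact: (dderive_linear (W := E) hE (rep_open hM sa Ac Ad) (rep_smooth hM sa Ac Ad) (rep_dom cx dx)).
Qed.

End OneMap.

Lemma id_smooth_map : smooth_map A A id.
Proof.
split; first by move=> x; exact: cvg_id.
by move=> c d Ac Ad; have [_ _ _ _ +] := hM; apply.
Qed.

Lemma tangent_comp a b c d e x u : smooth_map A A a -> smooth_map A A b -> A c -> A d -> A e ->
  dom c x -> dom d (a x) -> dom e (b (a x)) ->
  'D_u (loc (b \o a) c e) (crd c x) = 'D_('D_u (loc a c d) (crd c x)) (loc b d e) (crd d (a x)).
Proof.
move=> sa sb Ac Ad Ae cx dx ex.
have hc := cov.2 _ Ac; have hd := cov.2 _ Ad.
have sba : smooth_map A A (b \o a).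
  apply: (smooth_map_plot hE hM).
    move=> z; apply: continuous_comp; [by case: sa => + _; exact|by case: sb => + _; exact].
  move=> f Af; have of_ := chart_openI (cov.2 _ Af).
  apply: (plot_map hE cov cov of_ _ sb); apply: (plot_map hE cov cov of_ _ sa); exact: plot_prm.
rewrite (tangentE sba Ac Ae u cx ex) (tangentE sa Ac Ad u cx dx) (tangentE sb Ad Ae _ dx ex).
have la : loc a c d (crd c x) = crd d (a x) by rewrite /loc /= (chartK hc cx).
have H : diff_quot (loc b d e \o loc a c d : E -> (E : tvsType R)) (crd c x) u @ 0^' -->
    DE (DE u (loc a c d) (crd c x)) (loc b d e) (loc a c d (crd c x)).
  apply: (diff_quot_comp hE (rep_open hM sb Ad Ae) (rep_smooth hM sb Ad Ae)).
    by rewrite la; exact: rep_dom.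
  exact: (smooth_cvg hE (rep_open hM sa Ac Ad) (rep_smooth hM sa Ac Ad) (rep_dom Ac cx dx)).
rewrite la in H; apply: (cvg_dderive hE).
apply: (diff_quot_eq (rep_open hM sa Ac Ad) _ (rep_dom Ac cx dx) H) => y [iy dy].
by rewrite /loc /= (chartK hd).
Qed.

End Tangents.

Section TangentFamilies.
Context {R : realType} (G : preTopologicalGroupType) (m : nat) (AG : set (chart G 'rV[R]_m)).
Context (M : topologicalType) (n : nat) (A : set (chart M 'rV[R]_n)).
Local Notation E := 'rV[R]_n.
Local Notation DE := (@dderive R E (E : tvsType R)).
Variable act : G -> M -> M.
Hypothesis hM : smooth_manifold A.
Hypothesis hG : lie_group_of_diffeos AG A act.

Let cov := manifold_cover hM.
Let hE : hausdorff_space (E : tvsType R). Proof. exact: (@norm_hausdorff _ E). Qed.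
Let mG := lie_manifold hG.
Let covG := manifold_cover mG.

Lemma act_smooth_map g : smooth_map A A (act g).
Proof.
apply: (smooth_map_plot hE hM).
  exact: (act_continuous (lie_act hG) (g := g)).
move=> c Ac; have hc := cov.2 _ Ac.
by apply: (plot_act hM hG (chart_openI hc)); [exact: plot_cst|exact: plot_prm].
Qed.

(** An auxiliary vector is added to the coordinates of [q u], as in [sm]. The tangent map then
    becomes a partial derivative, at 0, of a plot in more variables. *)
Lemma tangent_smooth (E0 : tvsType R) (U : set E0) (p : E0 -> G) (q : E0 -> M) c d v :
  open U -> plot AG U p -> plot A U q -> A c -> A d ->
  (forall u, U u -> dom c (q u) /\ dom d (act (p u) (q u))) ->
  @smooth_on R E0 (E : tvsType R) U (fun u => 'D_v (loc (act (p u)) c d) (crd c (q u))).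
Proof.
move=> oU pU qU Ac Ad Ud; have hc := cov.2 _ Ac; have hd := cov.2 _ Ad.
have sq : @smooth_on R E0 (E : tvsType R) U (crd c \o q).
  move=> k; apply: Ck_on_sub (qU.2 c Ac k) => u Uu; split=> //.
  by case: (Ud u Uu).
pose UT : set (E0 * E)%type := U `*` setT.
have oUT : open UT by apply: open_setX => //; exact: openT.
pose sm (z : E0 * E) : E := (crd c \o q) z.1 + z.2.
have ssm : @smooth_on R (E0 * E)%type (E : tvsType R) UT sm.
  move=> k; apply: Ck_on_add; first exact: (Ck_on_fst setT (sq k)).
  apply: (smooth_linear (E := (E0 * E)%type) (E' := E)) => [t [? ?] [? ?]//|z]; exact: cvg_snd.
pose W0 : set (E0 * E)%type := UT `&` sm @^-1` img c.
have oW0 : open W0.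
  apply: open_preim; [exact: oUT| |exact: chart_openI].
  by move=> z Uz; exact: (smooth_cont ssm Uz).
have pr : plot A W0 (prm c \o sm).
  apply: (plot_precomp (chart_openI hc) oW0 cov _ _ (plot_prm hM Ac)); first by move=> z [].
  by move=> k; apply: Ck_on_sub (ssm k) => z [].
have pp : plot AG W0 (p \o fst).
  apply: (plot_linear (L := (fst : (E0 * E)%type -> E0)) oU oW0 covG) => //.
  - by move=> z [[]].
  - by move=> z; exact: cvg_fst.
have ps := plot_act hM hG oW0 pp pr.
pose s (z : E0 * E) := act (p z.1) (prm c (sm z)).
pose W := W0 `&` s @^-1` dom d.
have oW : open W by apply: open_preim => //; [exact: ps.1|exact: chart_openD].
have sPhi : @smooth_on R (E0 * E)%type (E : tvsType R) W (crd d \o s) := ps.2 d Ad.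
have W0u u : U u -> W (u, 0).
  move=> Uu; have [cu du] := Ud u Uu.
  by rewrite /W /W0 /UT /s /sm /= addr0; split; [split=> //; exact: img_dom|rewrite /= (chartK hc cu)].
have sD := smooth_dderive hE oW sPhi ((0, v) : E0 * E).
move=> k; apply: (Ck_on_eq (f := fun u => dderive ((0, v) : E0 * E) (crd d \o s : E0 * E -> (E : tvsType R)) (u, 0)) oU).
  move=> u Uu; have [cu du] := Ud u Uu.
  rewrite (tangentE hM (act_smooth_map (p u)) Ac Ad v cu du) (@dderive_snd R n (E : tvsType R) E0).
  have dq : diff_quot (fun y : E => (crd d \o s) (u, y) : E) 0 v = diff_quot (loc (act (p u)) c d : E -> E) (crd c (q u)) v.
    by apply/funext => t; rewrite /diff_quot /loc /s /sm /= add0r addr0.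
  by rewrite /dderive dq.
apply: (Ck_on_comp (f := fun u : E0 => ((u, 0) : E0 * E)) oU oW W0u _ (sD k)).
apply: Ck_on_pair; last exact: Ck_on_cst.
by apply: smooth_linear => [t ? ?//|z]; exact: cvg_id.
Qed.

End TangentFamilies.

(** * Limits of isometries and properness *)

Lemma rows_compact (R : realType) m n (K : 'I_m -> set 'rV[R]_n) : (forall i, compact (K i)) ->
  compact [set P : 'M[R]_(m, n) | forall i, K i (row i P)].
Proof.
move=> cK; rewrite compact_ultra => F UF FK.
have /choice[l lP] : forall i, exists l, K i l /\ (fun P : 'M[R]_(m, n) => row i P) @ F --> l.
  move=> i; have [l Kl Fl] := @ultra_compact_cvg _ _ F (fun P : 'M[R]_(m, n) => row i P) (K i) UF (cK i)
    (filterS (fun P H => H i) FK).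
  by exists l.
pose P : 'M[R]_(m, n) := \matrix_(i, j) l i 0 j.
have rP i : row i P = l i by apply/rowP => j; rewrite !mxE.
exists P; split; first by move=> i; rewrite rP; case: (lP i).
have : id @ F --> P.
  apply: mx_cvg => i j; rewrite mxE; have FF : Filter F by exact: _.
  have := @mx_entry_cvg R _ F FF 1 n (fun P => row i P) (l i) 0 j (lP i).2.
  by apply: cvg_trans; apply: near_eq_cvg; apply: filterS filterT => Q _; rewrite mxE.
by [].
Qed.

Section LocalLimits.
Context {R : realType} (n : nat) (M : topologicalType).
Local Notation E := 'rV[R]_n.
Local Notation Mx := 'M[R]_(n, n).
Variables (A : set (chart M E)) (h : chart M E -> E -> E -> E -> R).
Hypothesis hM : smooth_manifold A.
Hypothesis hr : riemannian_metric A h.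

Let cov := manifold_cover hM.
Let hE : hausdorff_space (E : tvsType R). Proof. exact: (@norm_hausdorff _ E). Qed.
Let hT : hausdorff_space M. Proof. by case: hM. Qed.

Variables (I : Type) (F : set_system I) (UF : UltraFilter F) (a : I -> M -> M).
Hypothesis ia : forall g, isometry A h (a g).

Lemma near_rigid x y c d : A c -> A d -> dom c x -> dom d y -> (fun g => a g x) @ F --> y ->
  exists rho r C : R, [/\ 0 < rho, 0 < r, 0 < C,
    (forall u : E, `|u - crd c x| <= rho -> img c u) /\ (forall v : E, `|v - crd d y| <= r -> img d v) &
    \forall g \near F, forall u : E, `|u - crd c x| <= rho ->
        [/\ locD (a g) c d u, `|loc (a g) c d u - crd d y| <= r,
            forall w, `|dderive w (loc (a g) c d : E -> E : tvsType R) u| <= C * `|w| &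
            forall v : E, `|v - crd c x| <= rho -> `|loc (a g) c d v - loc (a g) c d u| <= C * `|v - u|]].
Proof.
move=> Ac Ad cx dy ay; have hc := cov.2 _ Ac; have hd := cov.2 _ Ad.
have [rho [r [C [rho0 r0 C0 Hcd H]]]] := local_rigidity hM hr Ac Ad cx dy.
exists rho, r, C; split=> //.
have yN : nbhs y (dom d `&` crd d @^-1` (ball (crd d y) (r / 4))).
  apply: filterI; first exact: (open_nbhs_nbhs (conj (chart_openD hd) dy)).
  by apply: (crd_cont hd dy); apply: nbhsx_ballx; rewrite divr_gt0.
have := ay _ yN; rewrite /= nbhs_simpl /=; apply: filterS => g [dg bg]; apply: H => //.
exists (crd c x); rewrite subrr normr0 (ltW rho0) (chartK hc cx); split=> //.
by move: bg; rewrite -ball_normE /= /loc /= (chartK hc cx) distrC => /ltW.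
Qed.

Lemma rigid_cvg (c d : chart M E) (v : E) r u : A d -> (forall w : E, `|w - v| <= r -> img d w) ->
  (\forall g \near F, dom d (a g (prm c u)) /\ `|loc (a g) c d u - v| <= r) ->
  exists2 y, dom d y & (fun g => a g (prm c u)) @ F --> y.
Proof.
move=> Ad Hd Hn; have hd := cov.2 _ Ad.
pose K := prm d @` [set w : E | `|w - v| <= r].
have cK : compact K by apply: compact_image; [exact: cball_compact|move=> w /Hd; exact: prm_cont].
have nK : \forall g \near F, K (a g (prm c u)).
  by apply: filterS Hn => g [dg lg]; exists (loc (a g) c d u) => //; exact: (chartK hd dg).
have [y Ky ay] := @ultra_compact_cvg _ _ F (fun g => a g (prm c u)) K UF cK nK.
by exists y => //; case: Ky => w /Hd iw <-; exact: dom_prm.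
Qed.

(** Rigidity is applied to the inverses: [b g] sends [a g x], a point close to [y], to [x]. Hence it
    is Lipschitz near [y] with a constant independent of [g], and [b g y] approaches [x] as [a g x]
    approaches [y]. *)
Lemma inverse_cvg (b : I -> M -> M) x y : (forall g, isometry A h (b g)) ->
  (forall g z, b g (a g z) = z) -> (fun g => a g x) @ F --> y -> (fun g => b g y) @ F --> x.
Proof.
move=> ib ba ay; have [d Ad dy] := cov.1 y; have [c Ac cx] := cov.1 x.
have hc := cov.2 _ Ac; have hd := cov.2 _ Ad.
have [rho [r [C [rho0 r0 C0 _ H]]]] := local_rigidity hM hr Ad Ac dy cx.
have adx : (fun g => crd d (a g x)) @ F --> crd d y.
  by apply: (@cvg_comp _ _ _ (fun g => a g x) (crd d) _ (nbhs y)) => //; exact: crd_cont.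
have nd : \forall g \near F, dom d (a g x).
  by have := ay _ (open_nbhs_nbhs (conj (chart_openD hd) dy)); rewrite /= nbhs_simpl.
have near_ e : 0 < e -> \forall g \near F, `|crd d (a g x) - crd d y| <= e.
  move=> e0; have := adx _ (nbhsx_ballx (crd d y) e e0); rewrite /= nbhs_simpl /=.
  by apply: filterS => g; rewrite -ball_normE /= distrC => /ltW.
have key : \forall g \near F, dom c (b g y) /\ `|crd c (b g y) - crd c x| <= C * `|crd d y - crd d (a g x)|.
  apply: filterS2 nd (near_ rho rho0) => g dg lg.
  have yb : `|crd d y - crd d y| <= rho by rewrite subrr normr0 ltW.
  have ex : exists u : E, [/\ `|u - crd d y| <= rho, dom c (b g (prm d u)) & `|loc (b g) d c u - crd c x| <= r / 4].
    exists (crd d (a g x)); split=> //; first by rewrite (chartK hd dg) ba.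
    by rewrite /loc /= (chartK hd dg) ba subrr normr0 divr_ge0// ltW.
  have [Db _ _ Hb] := H (b g) (ib g) ex _ lg.
  have [Db' _ _ _] := H (b g) (ib g) ex _ yb.
  split; first by case: Db' => _; rewrite /= (chartK hd dy).
  by have := Hb _ yb; rewrite /loc /= (chartK hd dy) (chartK hd dg) ba.
have cb : (fun g => crd c (b g y)) @ F --> crd c x.
  move=> N /nbhs_ballP[e /= e0 eN]; rewrite /= nbhs_simpl /=.
  have eC : 0 < e / 2 / C by rewrite !divr_gt0.
  apply: filterS2 key (near_ _ eC) => g [_ kg] lg; apply: eN; rewrite -ball_normE /= distrC.
  apply: le_lt_trans kg _; rewrite distrC; apply: le_lt_trans (_ : e / 2 < _).
    by rewrite mulrC -ler_pdivlMr.
  by rewrite ltr_pdivrMr// ltr_pMr// ltr1n.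
have : (fun g => prm c (crd c (b g y))) @ F --> x.
  rewrite -[X in _ --> X](chartK hc cx).
  by apply: (@cvg_comp _ _ _ (fun g => crd c (b g y)) (prm c) _ (nbhs (crd c x))) => //; exact: (prm_cont hc (img_dom cx)).
by apply: cvg_eq_near; apply: filterS key => g [cg _]; rewrite (chartK hc cg).
Qed.

Variable phi : M -> M.
Hypothesis aphi : forall z, (fun g => a g z) @ F --> phi z.

(** The jets [J g] solve one first order system and stay in a compact set [KJ] of jets. Pointwise
    convergence then improves to joint convergence, and the limit lemmas for such systems give all
    derivatives. *)
Lemma limit_local (c d : chart M E) y : A c -> A d -> img c y -> dom d (phi (prm c y)) ->
  exists B : set E, [/\ open B, B y, forall u, B u -> img c u /\ dom d (phi (prm c u)),
    @smooth_on R E (E : tvsType R) B (loc phi c d) &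
    (\forall g \near F, forall u, B u -> dom d (a g (prm c u))) /\
    forall s, (fun p : E * I => dderives s (loc (a p.2) c d : E -> E : tvsType R) p.1) @ filter_prod (nbhs y) F -->
      dderives s (loc phi c d : E -> E : tvsType R) y].
Proof.
move=> Ac Ad iy dy; have hc := cov.2 _ Ac; have hd := cov.2 _ Ad.
have [rho [r [C [rho0 r0 C0 [Hc Hd] Hn]]]] := near_rigid Ac Ad (dom_prm hc iy) dy (@aphi _).
rewrite (prmK hc iy) in Hc Hn.
pose B : set E := [set u | `|u - y| < rho].
have Brho u : B u -> `|u - y| <= rho by move=> /ltW.
have oB : open B.
  have -> : B = (fun u : E => `|u - y|) @^-1` [set t | t < rho] by [].
  apply: open_comp; last exact: open_lt.
  move=> u _; apply: (@continuous_comp _ _ _ (fun u : E => u - y) (fun w => `|w|)).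
    by apply: (@subv_cvg R E E (nbhs u) _ id (fun=> y)); [exact: cvg_id|exact: cvg_cst].
  exact: norm_continuous.
have Bphi u : B u -> dom d (phi (prm c u)).
  move=> Bu; have [|y' dy' ay'] := @rigid_cvg c d _ _ u Ad Hd.
    by apply: filterS Hn => g /(_ u (Brho u Bu))[[_ Dg] lg _ _].
  by rewrite -(cvg_unique hT ay' (@aphi _)).
pose KM := [set P : Mx | forall i : 'I_n, `|row i P - 0| <= C * `|delta_mx 0 i : E|].
have cKM : compact KM by apply: (@rows_compact R n n (fun i => [set w : E | `|w - 0| <= C * `|delta_mx 0 i : E|])) => i; exact: cball_compact.
have jacK : \forall g \near F, forall u, B u -> KM (jac (loc (a g) c d) u).
  by apply: filterS Hn => g Hg u Bu i; have [_ _ + _] := Hg u (Brho u Bu); rewrite jac_row subr0; apply.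
(* The Jacobians are bounded, so the ultrafilter has a limit at each point. No regularity in [u] is
   known for it yet. *)
have /choice[P0 P0P] : forall u, exists P, B u -> KM P /\ (fun g => jac (loc (a g) c d) u) @ F --> (P : Mx).
  move=> u; have [Bu|nB] := pselect (B u); last by exists 0.
  have [P KP FP] := @ultra_compact_cvg _ _ F (fun g => jac (loc (a g) c d) u) KM UF cKM
    (filterS (fun g H => H u Bu) jacK).
  by exists P.
pose J g u : E * E * Mx := (u, loc (a g) c d u, jac (loc (a g) c d) u).
pose J0 u : E * E * Mx := (u, loc phi c d u, P0 u).
have oc := chart_openI hc; have od := chart_openI hd.
have sc := gram_smooth hM hr Ac; have sd := gram_smooth hM hr Ad.
have uc u : img c u -> gram h c u \in unitmx by exact: (gram_unit hr Ac).
have sy v : img d v -> (gram h d v)^T = gram h d v by exact: (gram_sym hr Ad).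
pose X := jet_field (gram h c) (gram h d).
pose O1 := jets (img c) (img d).
have oO : open O1 := open_jets oc od.
have sX w := jet_field_smooth oc od sc sd uc w.
have good : \forall g \near F, forall u, B u -> O1 (J g u) /\ forall w, diff_quot (J g) u w @ 0^' --> X w (J g u).
  apply: filterS Hn => g Hg u Bu; have [Dg _ _ _] := Hg u (Brho u Bu).
  split; first by split=> //; split; [case: Dg|exact: (loc_img Dg)].
  move=> w; exact: (jet_quot od sd uc sy (locD_open hM (ia g) Ac Ad) (fun u (H : locD _ _ _ u) => H.1)
    (fun u (H : locD _ _ _ u) => loc_img H) (loc_smooth hM (ia g) Ac Ad)
    (fun u H => loc_gram hM hr (ia g) Ac Ad H) Dg (w := w)).
have HO u : B u -> O1 (J0 u).
  move=> Bu; split=> //; split; first exact: Hc (Brho u Bu).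
  exact: (img_dom (Bphi u Bu)).
have ptw u : B u -> (fun g => J g u) @ F --> J0 u.
  move=> Bu; apply: (@pair_cvg _ F _ (E * E)%type Mx); last by case: (P0P u Bu).
  apply: (@pair_cvg _ F _ E E); first exact: cvg_cst.
  apply: (@cvg_comp _ _ _ (fun g => a g (prm c u)) (crd d) _ (nbhs (phi (prm c u)))).
    exact: (@aphi (prm c u)).
  exact: (crd_cont hd (Bphi u Bu)).
pose KJ := ([set u : E | `|u - y| <= rho] `*` [set v : E | `|v - crd d (phi (prm c y))| <= r]) `*` KM.
have cKJ : compact KJ by apply: compact_setX => //; apply: compact_setX; exact: cball_compact.
have KJO : KJ `<=` O1 by move=> [[u v] P] [/= [/Hc iu /Hd iv] _].
have JK : \forall g \near F, forall u, B u -> KJ (J g u).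
  apply: filterS2 Hn jacK => g Hg Kg u Bu; have [_ lg _ _] := Hg u (Brho u Bu).
  by split; [split=> //; exact: Brho|exact: Kg].
have joint u : B u -> (fun p : E * I => J p.2 p.1) @ filter_prod (nbhs u) F --> J0 u.
  move=> Bu; apply: cvgv_disk => D' [D'0 _ _].
  have [D dD DD] := disk_half D'0; have [D0 cD _] := dD.
  (* Uniform smallness of the field on [KJ], which bounds the increment of [J g] between nearby
     points independently of [g]. *)
  have nW : \forall w \near (0 : E), KJ `<=` [set j | nbhs (X w j) D].
    have nc := (compact_near_coveringP _).1 cKJ.
    apply: (nc E (nbhs (0 : E)) (fun w j => nbhs (X w j) D) _) => j Kj.
    exact: (jet_field_cvg0 oc od sc sd uc (KJO _ Kj) (nbhs_interior D0)).
  have nG : \forall g \near F, D (J g u - J0 u).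
    have H : (fun g => J g u - J0 u) @ F --> (0 : E * E * Mx).
      by rewrite -(subrr (J0 u)); apply: subv_cvg; [exact: ptw|exact: cvg_cst].
    by have := H D D0; rewrite /= nbhs_simpl.
  have nU : \forall u' \near u, B u' /\ KJ `<=` [set j | nbhs (X (u' - u) j) D].
    apply: filterI; first exact: (open_nbhs_nbhs (conj oB Bu)).
    have H : (fun u' => u' - u) @ nbhs u --> (0 : E).
      by rewrite -(subrr u); apply: (@subv_cvg R E E (nbhs u) _ id (fun=> u)); [exact: cvg_id|exact: cvg_cst].
    exact: H nW.
  exists ([set u' | B u' /\ KJ `<=` [set j | nbhs (X (u' - u) j) D]],
          [set g | [/\ D (J g u - J0 u), forall u, B u -> O1 (J g u) /\ (forall w, diff_quot (J g) u w @ 0^' --> X w (J g u)) &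
             forall u, B u -> KJ (J g u)]]).
    by split=> //=; apply: filterS3 nG good JK.
  move=> [u' g] [/= [Bu' Wu'] [Dg gg Kg]].
  have -> : J g u' - J0 u = (J g u' - J g u) + (J g u - J0 u) by rewrite subrKA.
  apply: DD => //.
  pose f (t : R) : E * E * Mx := J g (u + t *: (u' - u)).
  have -> : J g u' - J g u = f 1 - f 0.
    by rewrite /f scale1r scale0r addr0 [u + _]addrC subrK.
  apply: (mvt_cvx (g' := fun t => X (u' - u) (J g (u + t *: (u' - u))))) => // t /andP[t0 t1].
  have Bt : B (u + t *: (u' - u)).
    rewrite /B /=.
    have -> : u + t *: (u' - u) - y = (1 - t) *: (u - y) + t *: (u' - y).
      by apply/rowP => j; rewrite !mxE; ring.
    apply: le_lt_trans (_ : Num.max `|u - y| `|u' - y| < rho); last by rewrite gt_max Bu.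
    apply: le_trans (ler_normD _ _) _; rewrite !normrZ (ger0_norm t0) ger0_norm ?subr_ge0//.
    have H1 : `|u - y| <= Num.max `|u - y| `|u' - y| by rewrite le_max lexx.
    have H2 : `|u' - y| <= Num.max `|u - y| `|u' - y| by rewrite le_max lexx orbT.
    move: (Num.max _ _) H1 H2 => z H1 H2; nra.
  split; last exact: (Wu' _ (Kg _ Bt)).
  have [_ /(_ (u' - u))] := gg _ Bt.
  apply: cvg_trans; apply: near_eq_cvg; apply: filterS filterT => e _.
  by rewrite /diff_quot /f scalerDl addrA.
pose T (j : E * E * Mx) : E := j.1.2.
have sT : @smooth_on R (E * E * Mx)%type (E : tvsType R) O1 T.
  apply: (smooth_linear (E := (E * E * Mx)%type) (E' := E)) => [e [[? ?] ?] [[? ?] ?]//|[z z']].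
  by apply: (@cvg_comp _ _ _ fst snd _ (nbhs z)); [exact: cvg_fst|exact: cvg_snd].
exists B; split=> //.
- by rewrite /B /= subrr normr0.
- by move=> u Bu; split; [exact: Hc (Brho u Bu)|exact: Bphi].
- exact: (limit_smooth oO sX oB _ good HO joint hE sT).
split; first by apply: filterS Hn => g Hg u Bu; have [[]] := Hg u (Brho u Bu).
move=> s; have By : B y by rewrite /B /= subrr normr0.
exact: (joint_dderives oO sX oB _ good HO joint hE (s := s) sT By).
Qed.

Lemma limit_smooth_map : smooth_map A A phi.
Proof.
have local c d y := @limit_local c d y.
split.
  move=> z; have [c Ac cz] := cov.1 z; have [d Ad dz] := cov.1 (phi z).
  have hc := cov.2 _ Ac; have hd := cov.2 _ Ad.
  have dz' : dom d (phi (prm c (crd c z))) by rewrite (chartK hc cz).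
  have [B [oB By HB sB _]] := local c d _ Ac Ad (img_dom cz) dz'.
  have H : {for z, continuous (prm d \o loc phi c d \o crd c)}.
    apply: continuous_comp; first exact: (crd_cont hc cz).
    apply: (@continuous_comp _ _ _ (loc phi c d) (prm d)); first exact: (smooth_cont sB By).
    exact: (prm_cont hd (img_dom dz')).
  apply: continuous_eq_near H.
  have nB : nbhs z (crd c @^-1` B) := crd_cont hc cz (open_nbhs_nbhs (conj oB By)).
  apply: filterS2 nB (open_nbhs_nbhs (conj (chart_openD hc) cz)) => z' Bz' cz'.
  by rewrite /= /loc /= (chartK hc cz') (chartK hd)//; have [] := HB _ Bz'; rewrite (chartK hc cz').
move=> c d Ac Ad; have hc := cov.2 _ Ac; rewrite (crd_imageE hc).
apply: (smooth_on_local hE) => y [iy dy].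
have [B [oB By HB sB _]] := local c d y Ac Ad iy dy.
by exists B.
Qed.

(** A subbasic condition ranges over a compact subset of a chart. [limit_local] gives it near each
    point for almost all [g], and compactness makes it simultaneous. *)
Lemma limit_Diff (P : I -> Diff A) (l : Diff A) : (forall g, P g = a g :> (M -> M)) ->
  l = phi :> (M -> M) -> P @ F --> l.
Proof.
move=> Pa lphi N; rewrite nbhsE => -[B' [oB' B'l] B'B].
apply: (filterS B'B); rewrite nbhs_simpl /=.
case: oB' B'l => D' sD' <- [i D'i il].
suff : F (P @^-1` i) by apply: filterS => x ?; exists i.
have [D sD iE] := sD' _ D'i; rewrite -iE in il *.
rewrite preimage_bigcap; apply: filter_bigI => j jD.
have := sD _ jD; rewrite inE => -[c [d [K [s [Q1 [Ac Ad [cK Kc] oO jE]]]]]].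
have := il j jD; rewrite {}jE /= lphi => lO.
have : \forall g \near F, K `<=` [set y | dom d (a g (prm c y)) /\ Q1 (dderives s (loc (a g) c d : E -> E : tvsType R) y)].
  have /compact_near_coveringP := cK; apply=> y Ky; have [dy Oy] := lO y Ky.
  have [B [oB By HB sB [aB Hs]]] := limit_local Ac Ad (Kc _ Ky) dy.
  have H1 : filter_prod (nbhs y) F [set p : E * I | Q1 (dderives s (loc (a p.2) c d : E -> E : tvsType R) p.1)] :=
    Hs s _ (open_nbhs_nbhs (conj oO Oy)).
  have H2 : filter_prod (nbhs y) F [set p : E * I | dom d (a p.2 (prm c p.1))].
    exists (B, [set g | forall u, B u -> dom d (a g (prm c u))]); last by move=> [u g] [/= Bu]; exact.
    by split=> //; exact: (open_nbhs_nbhs (conj oB By)).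
  by apply: (@filterS _ (filter_prod (nbhs y) F) _ _ _ _ (filterI H2 H1)) => -[u g].
by apply: filterS => g HK y Ky; have := HK y Ky; rewrite /= Pa.
Qed.

End LocalLimits.

Lemma ultra_fmap (T U : Type) (f : T -> U) (F : set_system T) : UltraFilter F -> UltraFilter (f @ F).
Proof.
move=> UF; split; first exact: fmap_proper_filter.
move=> H PH FH; apply/seteqP; split=> // B HB.
have [//|nB] := in_ultra_setVsetC (f @^-1` B) UF.
have HC : H (~` B) by exact: FH.
by have [x []] := filter_ex (filterI HB HC).
Qed.

Section Properness.
Context {R : realType} (n : nat) (M : topologicalType) (A : set (chart M 'rV[R]_n)).
Local Notation E := 'rV[R]_n.
Context (G : preTopologicalGroupType) (m : nat) (AG : set (chart G 'rV[R]_m)) (act : G -> M -> M).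
Variable h : chart M E -> E -> E -> E -> R.
Hypothesis hM : smooth_manifold A.
Hypothesis cM : connected [set: M].
Hypothesis hG : lie_group_of_diffeos AG A act.
Hypothesis hr : riemannian_metric A h.
Hypothesis hinv : forall g, pullback_scaled A h (act g) (fun=> 1).
Hypothesis hclosed : closed_in_Diff A act.

Let cov := manifold_cover hM.
Let mG := lie_manifold hG.
Let hT : hausdorff_space M. Proof. by case: hM. Qed.
Let actM := lie_actM hG.
Let act1 := lie_act1 hG.
Let actK : forall g x, act g^-1%g (act g x) = x := actK act1 actM.
Let actVK : forall g x, act g (act g^-1%g x) = x := actVK act1 actM.
Let act_cont g : continuous (act g) := act_continuous (lie_act hG) (g := g).

Lemma act_isometry g : isometry A h (act g).
Proof.
by split; [exact: (act_smooth_map hM hG)|exact: hinv].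
Qed.

(** The points at which [act g] converges form a nonempty set that rigidity shows to be open and
    closed, and [M] is connected. *)
Lemma limit_everywhere (F : set_system G) (z0 y0 : M) : UltraFilter F ->
  (fun g => act g z0) @ F --> y0 -> exists phi : M -> M, forall z, (fun g => act g z) @ F --> phi z.
Proof.
move=> UF az0; pose S := [set z | exists y : M, (fun g => act g z) @ F --> y].
have oS : open S.
  rewrite openE => z [y ay]; have [c Ac cz] := cov.1 z; have [d Ad dy] := cov.1 y.
  have hc := cov.2 _ Ac.
  have [rho [r [C [rho0 r0 C0 [Hc Hd] Hn]]]] := near_rigid hM hr UF act_isometry Ac Ad cz dy ay.
  have nz : nbhs z (crd c @^-1` ball (crd c z) rho) := crd_cont hc cz (nbhsx_ballx _ _ rho0).
  apply: filterS2 nz (open_nbhs_nbhs (conj (chart_openD hc) cz)) => z' bz' cz'.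
  have ur : `|crd c z' - crd c z| <= rho by move: bz'; rewrite /= -ball_normE /= distrC => /ltW.
  have [|y' _] := @rigid_cvg R n M A hM G F UF act c d (crd d y) r (crd c z') Ad Hd.
    by apply: filterS Hn => g /(_ _ ur)[[_ Dg] lg _ _].
  by rewrite (chartK hc cz') => ay'; exists y'.
have clS : closed S.
  move=> z clz; have [c Ac cz] := cov.1 z; have hc := cov.2 _ Ac.
  have [rho [r [C [rho0 r0 C0 [Hc Hd] H]]]] := local_rigidity hM hr Ac Ac cz cz.
  pose e := Num.min rho (r / 4); have e0 : 0 < e by rewrite lt_min rho0 divr_gt0.
  have nz : nbhs z (dom c `&` crd c @^-1` ball (crd c z) e).
    apply: filterI; first exact: (open_nbhs_nbhs (conj (chart_openD hc) cz)).
    exact: (crd_cont hc cz (nbhsx_ballx _ _ e0)).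
  have [z1 [[y1 ay1] [/interior_subset[cz1 bz1] nz1]]] := clz _ (filterI (nbhs_interior nz) nz).
  have nz1' : nbhs z1 (dom c `&` crd c @^-1` ball (crd c z) e).
    apply: filterI; first exact: (open_nbhs_nbhs (conj (chart_openD hc) cz1)).
    apply: (crd_cont hc cz1); apply: open_nbhs_nbhs; split; first exact: ball_open.
    exact: bz1.
  (* No limit point for [z] is known in advance at which rigidity could be applied. Some [g0] in the
     filter brings the limit [y1] of the neighbour [z1] back close to [z], so that [g0^-1 * g] can
     be studied with the radii chosen at [z] itself. *)
  have iy1 := inverse_cvg hM hr UF (b := fun g => act g^-1%g) (fun g => act_isometry g^-1%g) actK ay1.
  have FN : F [set g | (dom c `&` crd c @^-1` ball (crd c z) e) (act g^-1%g y1)] := iy1 _ nz1'.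
  have [g0 [cg0 bg0]] := filter_ex FN.
  have bz : (fun g => act (g0^-1 * g)%g z1) @ F --> act g0^-1%g y1.
    have : (fun g => act g0^-1%g (act g z1)) @ F --> act g0^-1%g y1.
      by apply: (@cvg_comp _ _ _ (fun g => act g z1) (act g0^-1%g) _ (nbhs y1)) => //; exact: act_cont.
    by apply: cvg_trans; apply: near_eq_cvg; apply: filterS filterT => g _; rewrite actM.
  have ng0 : nbhs (act g0^-1%g y1) (dom c `&` crd c @^-1` ball (crd c z) e).
    apply: filterI; first exact: (open_nbhs_nbhs (conj (chart_openD hc) cg0)).
    apply: (crd_cont hc cg0); apply: open_nbhs_nbhs; split; first exact: ball_open.
    exact: bg0.
  have near1 : \forall g \near F, dom c (act (g0^-1 * g)%g (prm c (crd c z))) /\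
      `|loc (act (g0^-1 * g)%g) c c (crd c z) - crd c z| <= r.
    have FB : F [set g | (dom c `&` crd c @^-1` ball (crd c z) e) (act (g0^-1 * g)%g z1)] := bz _ ng0.
    apply: filterS FB => g [cg bg].
    have ex : exists u : E, [/\ `|u - crd c z| <= rho, dom c (act (g0^-1 * g)%g (prm c u)) &
        `|loc (act (g0^-1 * g)%g) c c u - crd c z| <= r / 4].
      have le1 : e <= rho by rewrite ge_min lexx.
      have le2 : e <= r / 4 by rewrite ge_min lexx orbT.
      exists (crd c z1); rewrite /loc /= (chartK hc cz1); split=> //.
        by apply: le_trans le1; move: bz1; rewrite /= -ball_normE /= distrC => /ltW.
      by apply: le_trans le2; move: bg; rewrite /= -ball_normE /= distrC => /ltW.
    have [|[_ Dg] lg _ _] := H _ (act_isometry (g0^-1 * g)%g) ex (crd c z).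
      by rewrite subrr normr0 ltW.
    by split.
  have [y' _] := @rigid_cvg R n M A hM G F UF (fun g => act (g0^-1 * g)%g) c c (crd c z) r (crd c z) Ac Hd near1.
  rewrite (chartK hc cz) => ay'; exists (act g0 y').
  have : (fun g => act g0 (act (g0^-1 * g)%g z)) @ F --> act g0 y'.
    by apply: (@cvg_comp _ _ _ (fun g => act (g0^-1 * g)%g z) (act g0) _ (nbhs y')) => //; exact: act_cont.
  by apply: cvg_trans; apply: near_eq_cvg; apply: filterS filterT => g _; rewrite -actM mulVKg.
have ST : S = setT.
  apply: cM; first by exists z0, y0.
  - by exists S => //; rewrite setTI.
  - by exists S => //; rewrite setTI.
have /choice[phi phiP] : forall z, exists y : M, (fun g => act g z) @ F --> y.
  by move=> z; have : S z by rewrite ST.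
by exists phi.
Qed.

Lemma act_diffeo g : diffeo A (act g).
Proof.
split; first by case: (act_isometry g).
by exists (act g^-1%g); split; [case: (act_isometry g^-1%g)|exact: actK|exact: actVK].
Qed.

Let toDiff g : Diff A := MkDiff (introT (asboolP _) (act_diffeo g)).

(** The inverses converge at one point as well, hence everywhere, and the two limits are mutually
    inverse smooth maps. The limit is thus a diffeomorphism in the closure of [G]. *)
Lemma limit_in_group (F : set_system G) (z0 y0 : M) : UltraFilter F ->
  (fun g => act g z0) @ F --> y0 ->
  exists g0, forall z, (fun g => act g z) @ F --> act g0 z.
Proof.
move=> UF az0; have [phi aphi] := limit_everywhere UF az0.
have iphi z : (fun g => act g^-1%g (phi z)) @ F --> z.
  exact: (inverse_cvg hM hr UF (b := fun g => act g^-1%g) (fun g => act_isometry g^-1%g) actK (@aphi z)).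
have UF' : UltraFilter ((fun g => g^-1)%g @ F) by apply: ultra_fmap.
have [psi apsi] := limit_everywhere UF' (iphi z0).
have apsi' z : (fun g => act g^-1%g z) @ F --> psi z := @apsi z.
have psiphi z : psi (phi z) = z by apply: (cvg_unique hT (@apsi' (phi z))); exact: iphi.
have phipsi z : phi (psi z) = z.
  have := inverse_cvg hM hr UF (a := fun g => act g^-1%g) (b := act) (fun g => act_isometry g) actVK (@apsi' z).
  by move=> H; exact: (cvg_unique hT (@aphi (psi z)) H).
have dphi : diffeo A phi.
  split; first exact: (limit_smooth_map hM hr UF act_isometry aphi).
  exists psi; split=> //.
  exact: (limit_smooth_map hM hr UF (fun g => act_isometry g^-1%g) apsi').
pose l : Diff A := MkDiff (introT (asboolP _) dphi).
have Fl : toDiff @ F --> l by apply: (limit_Diff hM hr UF act_isometry aphi).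
have [g0 g0P] : [set a : Diff A | exists g, forall x, a x = act g x] l.
  apply: hclosed => N lN; have FN := Fl N lN; rewrite /= nbhs_simpl /= in FN.
  by have [g Ng] := filter_ex FN; exists (toDiff g); split=> //; exists g.
exists g0 => z; rewrite -g0P; exact: aphi.
Qed.

(** Finitely many conditions on the values of [g]: neighbourhoods for pointwise convergence on [M],
    a topology that is a priori coarser than that of [G]. *)
Definition cell (l : seq (M * set M)) : set G := [set g | List.Forall (fun p => p.2 (act g p.1)) l].
Definition inner (l : seq (M * set M)) : set G := [set g | List.Forall (fun p => nbhs (act g p.1) p.2) l].
Definition compact_cell (l : seq (M * set M)) : Prop := List.Forall (fun p => compact p.2) l.

Lemma inner_cell l : inner l `<=` cell l.
Proof. by move=> g; apply: List.Forall_impl => p; exact: nbhs_singleton. Qed.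

Lemma evaluation_cont z : continuous (fun g => act g z).
Proof.
move=> g; apply: (@continuous_comp _ _ _ (fun g' => (g', z)) (fun p : G * M => act p.1 p.2)); last exact: (lie_act hG).
by apply: pair_cvg; [exact: cvg_id|exact: cvg_cst].
Qed.

(** By faithfulness, [g1] differs from each element of [C] at some point of [M], where a compact
    neighbourhood of the value separates them. Compactness leaves finitely many conditions. *)
Lemma cell_avoid (C : set G) g1 : compact C -> ~ C g1 ->
  exists l, [/\ compact_cell l, inner l g1 & forall g, cell l g -> ~ C g].
Proof.
move=> cC nC.
have /choice[lK lKP] : forall c : G, exists l, C c ->
    [/\ compact_cell l, inner l g1 & nbhs c [set g | ~ cell l g]].
  move=> c; have [Cc|] := pselect (C c); last by exists [::].
  have [z /eqP zn] : exists z, act g1 z <> act c z.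
    apply: contrapT => /forallNP H; apply: nC; rewrite (_ : g1 = c)//.
    by case: hG => _ _ faith _; apply: faith => z; apply: contrapT; exact: H.
  have H0 := hT; rewrite open_hausdorff in H0.
  have [[V1 V2] /= [/set_mem V1z /set_mem V2z] [oV1 oV2 /eqP V12]] := H0 _ _ zn.
  have [K [cK KO nK]] := locally_compact hM (open_nbhs_nbhs (conj oV1 V1z)).
  exists [:: (z, K)] => _; split; [by constructor|by constructor|].
  have nV : nbhs c [set g | V2 (act g z)] := @evaluation_cont z c _ (open_nbhs_nbhs (conj oV2 V2z)).
  apply: filterS nV => g V2g.
  move=> H; have K1 : K (act g z) by inversion H.
  by have : set0 (act g z) by rewrite -V12; split=> //; exact: KO.
have [t tP] := @compact_fin G G C (fun c => [set g | C c /\ ~ cell (lK c) g]) cC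
  (fun c Cc => ex_intro _ c (filterS (fun g H => conj Cc H) (let: And3 _ _ H := lKP c Cc in H))).
pose s := [seq c <- t | `[< C c >]].
exists (flatten [seq lK c | c <- s]).
have sC c : c \in s -> C c by rewrite mem_filter => /andP[/asboolP].
have st c : C c -> c \in t -> c \in s by move=> Cc ct; rewrite mem_filter ct andbT; exact/asboolP.
have allP (P : M * set M -> Prop) (q : seq G) : List.Forall P (flatten [seq lK c | c <- q]) <->
    forall c, c \in q -> List.Forall P (lK c).
  elim: q => [|c q IH] /=; first by split=> // _; constructor.
  rewrite List.Forall_app IH; split=> [[H1 H2] c'|H].
    by rewrite inE => /orP[/eqP->//|]; exact: H2.
  by split=> [|c' cq]; apply: H; rewrite inE ?eqxx ?cq ?orbT.
split.
- by apply/allP => c /sC /lKP[].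
- by apply/allP => c /sC /lKP[].
move=> g /allP H Cg; have [c ct [Cc]] := tP _ Cg; apply; exact: (H _ (st _ Cc ct)).
Qed.

(** Otherwise one builds a decreasing sequence of cells, the next one avoiding the k-th set of a
    compact exhaustion of [G]. Elements of these cells have a pointwise limit in [G] that lies in
    every cell, because the conditions are closed, and hence in no set of the exhaustion. *)
Lemma interior_cell (x0 : M) : exists C : set G, exists l g0,
  [/\ compact C, inner l g0 & inner l `<=` C].
Proof.
have [C [_ cC _ Ce]] := exhaustion mG.
apply: contrapT => N.
have N' k l g0 : inner l g0 -> exists g1, inner l g1 /\ ~ C k g1.
  move=> lg; apply: contrapT => H; apply: N; exists (C k), l, g0; split=> // g ig.
  by apply: contrapT => nC; apply: H; exists g.
pose P l := compact_cell l /\ exists g, inner l g.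
have /choice[step stepP] : forall kl : nat * seq (M * set M), exists l', P kl.2 ->
    [/\ P l', cell l' `<=` cell kl.2 & forall g, cell l' g -> ~ C kl.1 g].
  move=> [k l] /=; have [[cl [g lg]]|] := pselect (P l); last by exists [::].
  have [g1 [ig1 nC]] := N' k l g lg.
  have [l' [cl' il' H]] := cell_avoid (cC k) nC.
  exists (l ++ l') => _; split.
  - by split; [exact/List.Forall_app|exists g1; exact/List.Forall_app].
  - by move=> g' /List.Forall_app[].
  - by move=> g' /List.Forall_app[_]; exact: H.
(* The initial cell confines the images of [x0] to a compact set, which yields convergence at one
   point and so everywhere. *)
have [Q [cQ _ nQ]] := locally_compact hM (@filterT _ (nbhs (act 1%g x0)) _).
pose fix ls k := if k is k'.+1 then step (k', ls k') else [:: (x0, Q)].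
have Pls k : P (ls k).
  elim: k => [|k IH]; last by case: (stepP (k, ls k) IH).
  by split; [constructor|exists 1%g; constructor].
have sub k : cell (ls k.+1) `<=` cell (ls k) by case: (stepP (k, ls k) (Pls k)).
have subD (k j : nat) : cell (ls (j + k)%N) `<=` cell (ls k).
  by elim: j => [//|j IH]; apply: subset_trans IH; exact: sub.
have /choice[g gP] : forall k, exists g, cell (ls k) g.
  by move=> k; have [_ [g /inner_cell]] := Pls k; exists g.
have [U [UU sU]] := ultraFilterLemma (eventually_filter).
have UF : UltraFilter (g @ U) by apply: ultra_fmap.
have Fls k : (g @ U) (cell (ls k)).
  rewrite /= nbhs_simpl /=; apply: sU; exists k => // j /= kj.
  by have := subD k (j - k)%N; rewrite subnK//; apply; exact: gP.
have FQ : (g @ U) [set g | Q (act g x0)].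
  by apply: filterS (Fls 0%N) => g' H; inversion H.
have [y _ ay] := @ultra_compact_cvg _ _ (g @ U) (fun g => act g x0) Q UF cQ FQ.
have [gl glP] := limit_in_group UF ay.
have glc l : compact_cell l -> (g @ U) (cell l) -> cell l gl.
  elim: l => [|p l IH]; first by constructor.
  move=> cl Fl; inversion cl; constructor; last first.
    by apply: IH => //; apply: filterS Fl => g' H'; inversion H'.
  apply: (closed_cvg p.2 (compact_closed hT _) _ _ (@glP p.1)) => //.
  by apply: filterS Fl => g' H'; inversion H'.
have [k Ck] := Ce gl; have [_ _ H] := stepP (k, ls k) (Pls k).
by apply: (H gl) => //; apply: (glc (ls k.+1)); [case: (Pls k.+1)|exact: Fls].
Qed.

(** Left translation by [u] moves the pointwise limit to [g0], interior to a cell contained in a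
    compact set [C]. The translated elements eventually lie in [C], where the ultrafilter
    converges. *)
Lemma group_cvg (F : set_system G) (g1 : G) (x0 : M) : UltraFilter F ->
  (forall z, (fun g => act g z) @ F --> act g1 z) -> exists g' : G, F --> g'.
Proof.
move=> UF ag; have [C [l [g0 [cC ig0 lC]]]] := interior_cell x0.
pose u := (g0 * g1^-1)%g.
have au z : (fun g => act (u * g)%g z) @ F --> act g0 z.
  have : (fun g => act u (act g z)) @ F --> act u (act g1 z).
    by apply: (@cvg_comp _ _ _ (fun g => act g z) (act u) _ (nbhs (act g1 z))); [exact: ag|exact: act_cont].
  have -> : act u (act g1 z) = act g0 z by rewrite -actM /u -mulgA mulVg mulg1.
  by apply: cvg_trans; apply: near_eq_cvg; apply: filterS filterT => g _; rewrite actM.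
have Fl : \forall g \near F, C (u * g)%g.
  suff : \forall g \near F, inner l (u * g)%g by apply: filterS => g; exact: lC.
  elim: l ig0 {lC} => [|p l IH] il; first by apply: filterS filterT => g _; constructor.
  have H1 : nbhs (act g0 p.1) p.2 by inversion il.
  have H2 : inner l g0 by inversion il.
  have Hp : F [set g | p.2° (act (u * g)%g p.1)] := au p.1 _ (nbhs_interior H1).
  by apply: filterS2 Hp (IH H2) => g Hg Hl; constructor.
have [h' _ Fh] := @ultra_compact_cvg _ _ F (fun g => (u * g)%g) C UF cC Fl.
exists (u^-1 * h')%g.
have : (fun g => u^-1 * (u * g))%g @ F --> (u^-1 * h')%g.
  have L : {for (u^-1, h')%g, continuous (fun p : G * G => (p.1 * p.2)%g)} by exact: (lie_mulG hG).
  have P : (fun g => (u^-1, u * g)%g) @ F --> (u^-1, h')%g by apply: pair_cvg => //; exact: cvg_cst.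
  by move=> N /L /P.
by apply: cvg_trans; apply: near_eq_cvg; apply: filterS filterT => g _; rewrite mulKg.
Qed.

(** An ultrafilter on the preimage of [K] converges in both components of [K]. Rigidity transfers
    convergence from the moving points [p.2] to the fixed point [x0], after which the group
    components converge by [limit_in_group] and [group_cvg]. *)
Theorem isometric_proper : proper_action act.
Proof.
move=> K cK; rewrite compact_ultra => U UU UK.
have [[y0 x0] K0 cKU] := @ultra_compact_cvg _ _ U (fun p : G * M => (act p.1 p.2, p.2)) K UU cK UK.
have cx : (fun p : G * M => p.2) @ U --> x0.
  by apply: (@cvg_comp _ _ _ (fun p : G * M => (act p.1 p.2, p.2)) snd _ (nbhs (y0, x0))) => //; exact: cvg_snd.
have cy : (fun p : G * M => act p.1 p.2) @ U --> y0.
  by apply: (@cvg_comp _ _ _ (fun p : G * M => (act p.1 p.2, p.2)) fst _ (nbhs (y0, x0))) => //; exact: cvg_fst.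
have [c Ac cx0] := cov.1 x0; have [d Ad dy0] := cov.1 y0.
have hc := cov.2 _ Ac; have hd := cov.2 _ Ad.
have [rho [r [C [rho0 r0 C0 [Hc Hd] H]]]] := local_rigidity hM hr Ac Ad cx0 dy0.
have n1 : nbhs x0 (dom c `&` crd c @^-1` ball (crd c x0) rho).
  apply: filterI; first exact: (open_nbhs_nbhs (conj (chart_openD hc) cx0)).
  exact: (crd_cont hc cx0 (nbhsx_ballx _ _ rho0)).
have r4 : 0 < r / 4 by rewrite divr_gt0.
have n2 : nbhs y0 (dom d `&` crd d @^-1` ball (crd d y0) (r / 4)).
  apply: filterI; first exact: (open_nbhs_nbhs (conj (chart_openD hd) dy0)).
  exact: (crd_cont hd dy0 (nbhsx_ballx _ _ r4)).
have U1 : U [set p | (dom c `&` crd c @^-1` ball (crd c x0) rho) p.2] := cx _ n1.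
have U2 : U [set p | (dom d `&` crd d @^-1` ball (crd d y0) (r / 4)) (act p.1 p.2)] := cy _ n2.
have [|y' _] := @rigid_cvg R n M A hM _ U UU (fun p => act p.1) c d (crd d y0) r (crd c x0) Ad Hd.
  apply: filterS2 U1 U2 => p [c2 b2] [da ba].
  have [||[_ Dg] lg _ _] := H _ (act_isometry p.1) _ (crd c x0); last by split.
    exists (crd c p.2); rewrite /loc /= (chartK hc c2); split=> //.
      by move: b2; rewrite /= -ball_normE /= distrC => /ltW.
    by move: ba; rewrite /= -ball_normE /= distrC => /ltW.
  by rewrite subrr normr0 ltW.
rewrite (chartK hc cx0) => ay'.
have UF' : UltraFilter (fst @ U) by apply: ultra_fmap.
have [g1 g1P] := @limit_in_group (fst @ U) x0 y' UF' ay'.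
have [g' Fg'] := @group_cvg (fst @ U) g1 x0 UF' g1P.
have Ug : id @ U --> (g', x0).
  have : (fun p : G * M => (p.1, p.2)) @ U --> (g', x0) by apply: pair_cvg.
  by apply: cvg_trans; apply: near_eq_cvg; apply: filterS filterT => -[].
exists (g', x0); split; last exact: Ug.
rewrite /= (_ : act g' x0 = y0)//.
have : (fun p : G * M => act p.1 p.2) @ U --> act g' x0.
  have L : {for (g', x0), continuous (fun p : G * M => act p.1 p.2)} by exact: (lie_act hG).
  by move=> N /L /Ug.
by move=> /(cvg_unique hT)/(_ cy).
Qed.

End Properness.

(** * Invariant metrics *)

Section RealFunctions.
Context {R : realType}.

Lemma Ck_on_antideriv k (U : set R^o) (f f' : R^o -> R^o) : open U ->
  (forall x, U x -> is_derive x (1 : R) f (f' x)) -> Ck_on k U f' -> Ck_on k.+1 U f.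
Proof.
move=> oU df sf'; split.
  by move=> x /df[dx _]; apply: (@differentiable_continuous R R^o R^o); exact/derivable1_diffP.
exists (fun p : R^o * R^o => p.2 *: f' p.1); split.
  move=> x v Ux; rewrite -[X in diff_quot f x X]mulr1.
  by apply: (@diff_quot_scale R R^o R^o f x (1 : R^o) v); exact: (real_quot_cvg (df x Ux)).
apply: Ck_on_scale; first by apply: open_setX => //; exact: openT.
  apply: (smooth_linear (E := (R^o * R^o)%type) (E' := R^o)) => [a [? ?] [? ?]//|z]; exact: cvg_snd.
exact: (Ck_on_fst setT sf').
Qed.

Lemma ln_smooth : @smooth_on R R^o R^o [set t | 0 < t] (fun t : R^o => ln t).
Proof.
move=> k; apply: Ck_on_pred; apply: (Ck_on_antideriv (@open_gt R 0) _ (@inv_smooth R k)).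
Qed.

Lemma expR_smooth : @smooth_on R R^o R^o setT (fun t : R^o => expR t).
Proof.
elim=> [|k IH]; first by move=> x _; exact: continuous_expR.
apply: (Ck_on_antideriv (f' := fun t : R^o => expR t)) => //; exact: openT.
Qed.

End RealFunctions.

(** * From multiplicative cocycles to rescaling functions *)

Section MultiplicativeCocycles.
Context {R : realType} (G : preTopologicalGroupType) (m : nat) (AG : set (chart G 'rV[R]_m)).
Context (M : topologicalType) (n : nat) (A : set (chart M 'rV[R]_n)).
Variable act : G -> M -> M.
Hypothesis hM : smooth_manifold A.
Hypothesis hG : lie_group_of_diffeos AG A act.

(** Joint smoothness in [(g, x)], tested on plots. *)
Definition smooth_family_fun (F : G -> M -> R^o) : Prop :=
  forall (E0 : tvsType R) (U : set E0) (p : E0 -> G) (q : E0 -> M), open U ->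
    plot AG U p -> plot A U q -> smooth_on U (fun u => F (p u) (q u)).

(** The group acts on functions through [g^-1], so it is [ln F(g^-1, .)^2] that satisfies the
    additive cocycle identity. The square admits factors of either sign. *)
Lemma cocycle_splits (F : G -> M -> R^o) : smooth_family_fun F ->
  (forall g x, F g x != 0) -> (forall g h x, F (g * h)%g x = F g (act h x) * F h x) ->
  Hd_vanishes AG (Cinf_act act (fun (_ : G) (t : R^o) => t) : G -> Cinf A R^o -> Cinf A R^o) 1 ->
  exists2 k : M -> R^o, smooth_fun A k &
    forall g x, (F g x) ^+ 2 * expR (k x) = expR (k (act g x)).
Proof.
move=> sF F0 FM H1; have hR : hausdorff_space (R^o : tvsType R) := @norm_hausdorff _ R^o.
have mG := lie_manifold hG.
have covG := manifold_cover mG; have covM := manifold_cover hM.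
have F2 g x : 0 < F g x ^+ 2 by rewrite exprn_even_gt0//= F0.
pose L g x : R^o := ln (F g^-1%g x ^+ 2).
have sL (E0 : tvsType R) (U : set E0) (p : E0 -> G) (q : E0 -> M) : open U ->
    plot AG U p -> plot A U q -> smooth_on U (fun u => L (p u) (q u)).
  move=> oU Up Uq k; have sFu := sF _ _ _ _ oU (plot_inv hG oU Up) Uq.
  apply: (Ck_on_comp (g := fun t : R^o => ln t) (f := fun u => F (p u)^-1%g (q u) ^+ 2 : R^o) oU (@open_gt R 0) _ _ (ln_smooth k)).
    by move=> u _; exact: F2.
  apply: (Ck_on_eq oU (f := fun u => F (p u)^-1%g (q u) *: F (p u)^-1%g (q u))) => [u _|].
    by rewrite /GRing.scale /= expr2.
  exact: (Ck_on_scale oU (sFu k) (sFu k)).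
have sLg g : smooth_fun A (L g).
  move=> c Ac; apply: (sL _ _ (fun=> g)); first exact: (chart_openI (covM.2 _ Ac)).
    exact: plot_cst.
  exact: plot_prm.
pose l (a : 'I_1 -> G) : Cinf A R^o := to_Cinf A (L (a ord0)).
have lE a x : l a x = L (a ord0) x by rewrite /l to_CinfK.
have sl : smooth_cochain AG l.
  move=> _ [c Ac <-] k; have oP := pow_chart_openI covG Ac; apply: (Cinf_curry hM hR); first exact: oP.
  move=> d Ad j; have oU : open (img (pow_chart c) `*` img d).
    by apply: open_setX; [exact: (pow_chart_openI covG Ac)|exact: (chart_openI (covM.2 _ Ad))].
  have -> : (fun p : 'M[R]_(1, m) * 'rV[R]_n => l (prm (pow_chart c) p.1) (prm d p.2)) =
     (fun p => L (prm (c ord0) (row ord0 p.1)) (prm d p.2)).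
    by apply/funext => p; rewrite lE.
  apply: (sL _ _ (fun p : 'M[R]_(1, m) * 'rV[R]_n => prm (c ord0) (row ord0 p.1)) (fun p => prm d p.2) oU).
    apply: (plot_linear (p := fun y => prm (c ord0) (row ord0 y)) (L := (fst : ('M[R]_(1, m) * 'rV[R]_n)%type -> 'M[R]_(1, m))) oP oU covG) => //.
    - by move=> z [].
    - by move=> z; exact: cvg_fst.
    - by rewrite /img (pow_chartP covG Ac); exact: (plot_pow_prm covG ord0 mG Ac).
  apply: (plot_linear (L := (snd : ('M[R]_(1, m) * 'rV[R]_n)%type -> 'rV[R]_n)) (chart_openI (covM.2 _ Ad)) oU covM) => //.
  - by move=> z [].
  - by move=> z; exact: cvg_snd.
  - exact: plot_prm.
have actE g (f : Cinf A R^o) x : Cinf_act act (fun (_ : G) (t : R^o) => t) g f x = f (act g^-1%g x).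
  by rewrite (Cinf_actE hM hG hR)//; move=> z; exact: cvg_id.
have dl a : coboundary (Cinf_act act (fun (_ : G) (t : R^o) => t) : G -> Cinf A R^o -> Cinf A R^o) l a = 0.
  apply: Cinf_eq => x; rewrite /coboundary big_ord1 !CinfD !CinfZ actE !lE /L.
  rewrite expr1 scaleN1r (_ : (-1 : R) ^+ 2 = 1) ?scale1r; last by rewrite expr2 mulrNN mulr1.
  have -> : Defs.contract ord0 a ord0 = (a ord0 * a (lift ord0 ord0))%g.
    by rewrite /Defs.contract /=; congr (a _ * _)%g; exact: val_inj.
  have -> : widen_ord (leqnSn 1) ord0 = ord0 :> 'I_2 by exact: val_inj.
  rewrite invgM FM exprMn [ln (_ * F (a ord0)^-1%g x ^+ 2)]lnM ?posrE ?F2//.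
  by rewrite opprD addrA subrr add0r addNr /=.
have [k0 sk0 Hk] := H1 l sl dl.
pose k : Cinf A R^o := k0 (fun i : 'I_0 => 1%g).
have k0E a : k0 a = k by congr k0; apply/funext => -[].
exists k; first exact: Cinf_smooth.
move=> g x; have := congr1 (fun f : Cinf A R^o => f x) (Hk (fun=> g^-1%g)).
rewrite lE /L /coboundary big_ord0 !k0E !CinfD CinfZ actE !invgK => H.
have {}H : ln (F g x ^+ 2) = k (act g x) - k x.
  by rewrite H expr1 scaleN1r; congr (_ + _); rewrite addr0.
have -> : k (act g x) = ln (F g x ^+ 2) + k x by rewrite H subrK.
by rewrite expRD lnK// posrE.
Qed.

End MultiplicativeCocycles.

Lemma linear_zero (R : realType) (V W : lmodType R) (f : V -> W) : linear f -> f 0 = 0.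
Proof. by move=> lf; have := lf (-1) 0 0; rewrite scaler0 add0r scaleN1r addNr. Qed.

Section Weights.
Context {R : realType} (n : nat) (M : topologicalType).
Local Notation E := 'rV[R]_n.
Variable A : set (chart M E).
Hypothesis hM : smooth_manifold A.

Let cov := manifold_cover hM.

(** The half in the exponent compensates for the square in the cocycle. *)
Definition weight (k : M -> R^o) (x : M) : R^o := expR (- 2^-1 * k x).

Lemma weight_gt0 k x : 0 < weight k x. Proof. exact: expR_gt0. Qed.

Lemma weight_smooth k : smooth_fun A k -> smooth_fun A (weight k).
Proof.
move=> sk c Ac j; have oc := chart_openI (cov.2 _ Ac).
apply: (Ck_on_comp (f := fun y => - 2^-1 *: k (prm c y) : R^o) (g := fun t : R^o => expR t) oc openT) => //.
  by apply: Ck_on_scale => //; [exact: Ck_on_cst|exact: sk].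
exact: expR_smooth.
Qed.

(* Hence multiplication by the weight turns the factor f of a pullback into a sign. *)
Lemma weight_sqr (k : M -> R^o) (f : R) x y : f ^+ 2 * expR (k x) = expR (k y) ->
  (weight k y * f) ^+ 2 = weight k x ^+ 2.
Proof.
have e2 t : expR (- 2^-1 * t) ^+ 2 = (expR t)^-1 :> R.
  by rewrite -expRM_natl mulrA mulrN divff ?pnatr_eq0// mulN1r expRN.
move=> H; rewrite /weight exprMn !e2 -H invfM mulrAC mulVf ?mul1r//.
by apply/eqP => f0; have := expR_gt0 (k y); rewrite -H f0 mul0r ltxx.
Qed.

Lemma scale_metric (s : M -> R^o) h : smooth_fun A s -> (forall x, 0 < s x) ->
  riemannian_metric A h -> riemannian_metric A (fun c y u v => s (prm c y) * h c y u v).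
Proof.
move=> ss s0 [hl hs hp]; split.
- move=> c y Ac iy; have [l sy p] := hl c y Ac iy; split.
  + by move=> v t u u'; rewrite l mulrDr /GRing.scale /= mulrCA.
  + by move=> u v; rewrite sy.
  + by move=> u u0; rewrite mulr_gt0// p.
- move=> c u v Ac j.
  exact: (Ck_on_scale (chart_openI (cov.2 _ Ac)) (ss c Ac j) (hs c u v Ac j)).
move=> c d x u v Ac Ad cx dx; have := hp c d x u v Ac Ad cx dx; rewrite !mul1r => ->.
by rewrite (chartK (cov.2 _ Ac) cx) (chartK (cov.2 _ Ad) dx).
Qed.

End Weights.

(** * Invariant metrics in the conformal case *)

Section Conformal.
Context {R : realType} (G : preTopologicalGroupType) (m : nat) (AG : set (chart G 'rV[R]_m)).
Context (M : topologicalType) (n : nat) (A : set (chart M 'rV[R]_n)).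
Local Notation E := 'rV[R]_n.
Variable act : G -> M -> M.
Hypothesis hM : smooth_manifold A.
Hypothesis hG : lie_group_of_diffeos AG A act.

Let cov := manifold_cover hM.
Let hR : hausdorff_space (R^o : tvsType R). Proof. exact: (@norm_hausdorff _ R^o). Qed.

(* Smoothness of a function of (g, x) may be checked where x and g x lie in fixed charts. *)
Lemma smooth_family_local (F : G -> M -> R^o) :
  (forall (E0 : tvsType R) (O : set E0) (p : E0 -> G) (q : E0 -> M) c d u, open O ->
     plot AG O p -> plot A O q -> A c -> A d -> O u ->
     (forall u, O u -> dom c (q u) /\ dom d (act (p u) (q u))) ->
     exists2 V, open V /\ V u & smooth_on V (fun u => F (p u) (q u))) ->
  smooth_family_fun AG A F.
Proof.
move=> H E0 U p q oU pU qU; apply: (smooth_on_local hR) => u Uu.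
have pq := plot_act hM hG oU pU qU.
have [c Ac cu] := cov.1 (q u); have [d Ad du] := cov.1 (act (p u) (q u)).
pose O := (U `&` q @^-1` dom c) `&` (fun u => act (p u) (q u)) @^-1` dom d.
have oO1 : open (U `&` q @^-1` dom c).
  by apply: open_preim => //; [exact: qU.1|exact: (chart_openD (cov.2 _ Ac))].
have oO : open O.
  apply: open_preim => //; [|exact: (chart_openD (cov.2 _ Ad))].
  by move=> z [Uz _]; exact: pq.1.
have OU : O `<=` U by move=> z [[]].
have Hd z : O z -> dom c (q z) /\ dom d (act (p z) (q z)) by move=> [[]].
exact: (H E0 O p q c d u oO (plot_sub OU pU) (plot_sub OU qU) Ac Ad (conj (conj Uu cu) du) Hd).
Qed.

Lemma plot_crd (E0 : tvsType R) (O : set E0) (q : E0 -> M) c : plot A O q -> A c ->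
  (forall u, O u -> dom c (q u)) -> @smooth_on R E0 (E : tvsType R) O (fun u => crd c (q u)).
Proof. by move=> qO Ac cO k; apply: Ck_on_sub (qO.2 c Ac k) => u Ou; split=> //; exact: cO. Qed.

Lemma conformal_invariant gm : riemannian_metric A gm ->
  (forall g, preserves_conformal A gm (act g)) ->
  Hd_vanishes AG (Cinf_act act (fun (_ : G) (t : R^o) => t) : G -> Cinf A R^o -> Cinf A R^o) 1 ->
  exists2 h, riemannian_metric A h & forall g, pullback_scaled A h (act g) (fun=> 1).
Proof.
move=> hr pres H1; have [[u0 u00]|nz] := pselect (exists u0 : E, u0 != 0); last first.
  (* In dimension zero the factors are not determined by the metric, but every metric vanishes
     identically and is invariant. *)
  exists gm => // g c d x u v Ac Ad cx dx.
  have z (w : E) : w = 0 by apply: contrapT => /eqP w0; apply: nz; exists w.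
  have gz c' y p q : A c' -> img c' y -> gm c' y p q = 0.
    by move=> Ac' iy; rewrite (z p); exact: (linear_zero (metric_linl hr Ac' q iy)).
  by rewrite mul1r !gz//; exact: img_dom.
have /choice[F FP] : forall g, exists f : M -> R^o, (forall x, 0 < f x) /\ pullback_scaled A gm (act g) f.
  by move=> g; have [f [_ f0 pf]] := pres g; exists f.
have F0 g x : 0 < F g x by case: (FP g).
have FM g h x : F (g * h)%g x = F g (act h x) * F h x.
  have [c Ac cx] := cov.1 x; have [d Ad dx] := cov.1 (act h x); have [e Ae ex] := cov.1 (act g (act h x)).
  have q0 : gm c (crd c x) u0 u0 != 0 by rewrite gt_eqF// (metric_pos hr Ac (img_dom cx) u00).
  have ex' : dom e (act (g * h)%g x) by rewrite (lie_actM hG).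
  apply: (mulIf q0); rewrite -((FP (g * h)%g).2 c e x u0 u0 Ac Ae cx ex').
  have -> : act (g * h)%g = act g \o act h by apply/funext => z; exact: (lie_actM hG).
  rewrite (tangent_comp hM u0 (act_smooth_map hM hG h) (act_smooth_map hM hG g) Ac Ad Ae cx dx ex).
  by rewrite /comp ((FP g).2 d e _ _ _ Ad Ae dx ex) ((FP h).2 c d x u0 u0 Ac Ad cx dx) mulrA.
(* The hypothesis gives smoothness of each factor on [M] but not in [g]. Joint smoothness is read
   off from [F] as the ratio of the squared lengths of a fixed vector [u0] after and before applying
   [g]. *)
have sF : smooth_family_fun AG A F.
  apply: smooth_family_local => E0 O p q c d u oO pO qO Ac Ad Ou HO; exists O => //.
  have sX := plot_crd qO Ac (fun u Hu => (HO u Hu).1).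
  have sY := plot_crd (plot_act hM hG oO pO qO) Ad (fun u Hu => (HO u Hu).2).
  have sw := tangent_smooth hM hG u0 oO pO qO Ac Ad HO.
  set Y := fun u => crd d _ in sY; set X := fun u => crd c _ in sX; set w := fun u => 'D_u0 _ _ in sw.
  have iX z : O z -> img c (X z) by move=> /HO[cz _]; exact: img_dom.
  have iY z : O z -> img d (Y z) by move=> /HO[_ dz]; exact: img_dom.
  have p0 z : O z -> gm c (X z) u0 u0 != 0.
    by move=> Oz; rewrite gt_eqF// (metric_pos hr Ac (iX z Oz) u00).
  have FE z : O z -> (w z *m gram gm d (Y z) *m (w z)^T) 0 0 *: ((gm c (X z) u0 u0)^-1 : R^o) = F (p z) (q z).
    move=> Oz; have [cz dz] := HO z Oz.
    rewrite -(gramE hr Ad _ _ (iY z Oz)) /w /Y ((FP (p z)).2 c d _ _ _ Ac Ad cz dz).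
    by rewrite /GRing.scale /= mulfK//; exact: p0.
  move=> k; apply: (Ck_on_eq oO FE).
  have [_ sgm _] := hr.
  have oc := chart_openI (cov.2 _ Ac); have od := chart_openI (cov.2 _ Ad).
  apply: (Ck_on_scale oO); last first.
    apply: (Ck_on_invr oO p0).
    exact: (Ck_on_comp (g := fun y => gm c y u0 u0 : R^o) oO oc iX (sX k) (sgm c u0 u0 Ac k)).
  apply: (@Ck_on_mx_entry R k E0 O 1 1 (fun z => w z *m gram gm d (Y z) *m (w z)^T) 0 0).
  have sG := Ck_on_comp (g := gram gm d : E -> ('M[R]_(n, n) : tvsType R)) oO od iY (sY k) (gram_smooth hM hr Ad k).
  by apply: (Ck_on_mulmx oO); [apply: (Ck_on_mulmx oO)|apply: (Ck_on_trmx oO)]; [exact: sw|exact: sG|exact: sw].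
have [k sk kP] := cocycle_splits hM hG sF (fun g x => lt0r_neq0 (F0 g x)) FM H1.
exists (fun c y u v => weight k (prm c y) * gm c y u v).
  by apply: (scale_metric hM) => //; [exact: (weight_smooth hM)|exact: weight_gt0].
move=> g c d x u v Ac Ad cx dx.
rewrite (chartK (cov.2 _ Ac) cx) (chartK (cov.2 _ Ad) dx) mul1r ((FP g).2 c d x u v Ac Ad cx dx) mulrA.
congr (_ * _); apply/eqP; rewrite -(eqrXn2 (n := 2))//; first by rewrite (weight_sqr (kP g x)).
  by rewrite mulr_ge0// ltW// weight_gt0.
by rewrite ltW// weight_gt0.
Qed.

End Conformal.

(** * Linear algebra of a contact form and its Reeb vector *)

Section ContactAlgebra.
Context {R : realType} (n : nat).
Local Notation E := 'rV[R]_n.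

Lemma skew_quadratic (Om : 'M[R]_n) (x : E) : Om^T = - Om -> x *m Om *m x^T = 0.
Proof.
move=> sk; set t := _ *m _; have tt : t^T = t by rewrite [t]mx11_scalar tr_scalar_mx.
have : t = - t by rewrite -{1}tt /t !trmx_mul trmxK sk mulNmx mulmxN mulmxA.
move=> /eqP; rewrite -addr_eq0 -mulr2n -scaler_nat scaler_eq0 pnatr_eq0 /=.
by move/eqP.
Qed.

Definition contact_pair (al : E) (Om : 'M[R]_n) : Prop :=
  [/\ al != 0, Om^T = - Om &
      forall u : E, u *m al^T = 0 -> (forall v : E, v *m al^T = 0 -> u *m Om *m v^T = 0) -> u = 0].

(** An invertible matrix combining the form and its differential. The value [t = 1] defines the Reeb
    vector; a sign [t] arises by pulling back along a map that changes the form by that sign. *)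
Definition contact_mx (t : R) (al : E) (Om : 'M[R]_n) : 'M[R]_n := al^T *m al + t *: Om.

Lemma contact_mxE t al Om (u : E) : u *m contact_mx t al Om = u *m al^T *m al + t *: (u *m Om).
Proof. by rewrite /contact_mx mulmxDr mulmxA -scalemxAr. Qed.

(** Pairing a kernel vector with itself kills the skew part, so [al] vanishes on it; then [Om] does
    too, and non-degeneracy applies. *)
Lemma contact_mx_unit t al Om : t != 0 -> contact_pair al Om -> contact_mx t al Om \in unitmx.
Proof.
move=> t0 [al0 sk nd]; rewrite -row_free_unit -kermx_eq0; apply/eqP/row_matrixP => i; rewrite row0.
set u := row i _; have uB : u *m contact_mx t al Om = 0 by apply/sub_kermxP; exact: row_sub.
have u1 : u *m al^T = 0.
  have : (u *m al^T) *m (u *m al^T)^T = 0.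
    have := congr1 (fun X => X *m u^T) uB; rewrite contact_mxE mulmxDl -scalemxAl skew_quadratic// scaler0 addr0 mul0mx.
    by rewrite trmx_mul trmxK mulmxA.
  rewrite [u *m _]mx11_scalar tr_scalar_mx -scalar_mxM => /(congr1 (fun X : 'M[R]_1 => X 0 0)).
  rewrite [LHS]mxE [RHS]mxE eqxx mulr1n => /eqP; rewrite mulf_eq0 orbb => /eqP ->; exact: raddf0.
apply: nd => // v _; move: uB; rewrite contact_mxE u1 mul0mx add0r => /eqP.
by rewrite scaler_eq0 (negPf t0) => /eqP ->; rewrite mul0mx.
Qed.

(** Solving one linear system, instead of the two conditions on a Reeb vector, makes smooth
    dependence on the data immediate. *)
Definition reeb (al : E) (Om : 'M[R]_n) : E := al *m invmx (contact_mx 1 al Om).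

Lemma reeb_unique al Om (x : E) : contact_pair al Om ->
  x *m al^T = 1%:M -> x *m Om = 0 -> x = reeb al Om.
Proof.
move=> cp xa xO; have uB := contact_mx_unit (oner_neq0 R) cp.
rewrite /reeb -{1}(mulmxK uB x); congr (_ *m _).
by rewrite contact_mxE xa mul1mx scale1r xO addr0.
Qed.

(** Pairing the defining equation with [x] shows that [s], the value of the form on [x], is
    idempotent. If it were 0, then [x] would be in the kernel and [x *m Om] equal to [al], so that
    [x] and with it [al] would vanish. *)
Lemma reebP al Om : contact_pair al Om -> reeb al Om *m al^T = 1%:M /\ reeb al Om *m Om = 0.
Proof.
move=> cp; have uB := contact_mx_unit (oner_neq0 R) cp; have [al0 sk nd] := cp.
set x := reeb al Om; have xB : x *m al^T *m al + x *m Om = al.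
  by rewrite -[X in _ + X]scale1r -contact_mxE mulmxKV.
set s := x *m al^T in xB *; have sT : al *m x^T = s.
  by rewrite -[LHS]trmxK trmx_mul trmxK -/s [s]mx11_scalar tr_scalar_mx.
have ss : s *m s = s.
  have := congr1 (fun X => X *m x^T) xB; rewrite mulmxDl skew_quadratic// addr0.
  by rewrite -mulmxA !sT.
have s1 : s = 1%:M.
  move: ss; rewrite [s]mx11_scalar -scalar_mxM => /(congr1 (fun X : 'M[R]_1 => X 0 0)).
  rewrite [LHS]mxE [RHS]mxE eqxx !mulr1n => /eqP; rewrite -subr_eq0 -{3}[s 0 0]mulr1 -mulrBr mulf_eq0.
  move=> /orP[/eqP s0|]; last by rewrite subr_eq0 => /eqP ->.
  have s00 : s = 0 by rewrite [s]mx11_scalar s0 raddf0.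
  case/negP: al0; apply/eqP; have x0 : x = 0.
    apply: nd => // v va; rewrite -[x *m Om]add0r -{1}(mul0mx _ al) -{1}s00 xB.
    by rewrite -[LHS]trmxK trmx_mul trmxK va trmx0.
  by rewrite -xB s00 x0 !mul0mx addr0.
by split=> //; move: xB; rewrite s1 mul1mx => /(canRL (addKr _)); rewrite addNr.
Qed.

(** The contact matrix of the target pulls back to [contact_mx e al Om], which is invertible; hence
    so is [P], and uniqueness of the Reeb vector gives the formula. *)
Lemma reeb_natural al Om al' Om' (P : 'M[R]_n) (e : R) : e ^+ 2 = 1 ->
  contact_pair al Om -> contact_pair al' Om' -> P *m al'^T = e *: al^T ->
  P *m Om' *m P^T = e *: Om -> P \in unitmx /\ reeb al' Om' = e *: (reeb al Om *m P).
Proof.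
move=> e2 cp cp' Pa PO; have e0 : e != 0.
  by apply/eqP => e0; move: e2; rewrite e0 expr0n => /esym/eqP; rewrite oner_eq0.
have aP : al' *m P^T = e *: al by rewrite -[LHS]trmxK trmx_mul trmxK Pa linearZ /= trmxK.
have uP : P \in unitmx.
  have : P *m contact_mx 1 al' Om' *m P^T \in unitmx.
    rewrite /contact_mx mulmxDr mulmxDl scale1r PO mulmxA -mulmxA aP Pa -scalemxAl -scalemxAr scalerA -expr2 e2 scale1r.
    exact: contact_mx_unit.
  by rewrite -mulmxA unitmx_mul => /andP[].
have [xa xO] := reebP cp; move: (reeb al Om) xa xO => x xa xO.
split=> //; apply/esym/(reeb_unique cp').
  by rewrite -scalemxAl -mulmxA Pa -scalemxAr scalerA -expr2 e2 scale1r.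
have uPT : P^T \in unitmx by rewrite unitmx_tr.
have H : e *: (x *m P) *m Om' *m P^T = 0.
  by rewrite -!scalemxAl -!mulmxA [P *m (_ *m _)]mulmxA PO -scalemxAr xO !scaler0.
by rewrite -[LHS](mulmxK uPT) H mul0mx.
Qed.

End ContactAlgebra.

(** * One-forms and their exterior derivative in coordinates *)

Section OneForms.
Context {R : realType} (n : nat) (M : topologicalType).
Local Notation E := 'rV[R]_n.
Local Notation DE := (@dderive R E (E : tvsType R)).
Local Notation DR := (@dderive R E (R^o : tvsType R)).
Variable A : set (chart M E).
Hypothesis hM : smooth_manifold A.

Let cov := manifold_cover hM.
Let hE : hausdorff_space (E : tvsType R). Proof. exact: (@norm_hausdorff _ E). Qed.
Let hR : hausdorff_space (R^o : tvsType R). Proof. exact: (@norm_hausdorff _ R^o). Qed.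

Variable w : chart M E -> E -> E -> R.
Hypothesis w1 : one_form A w.

Definition form_row (c : chart M E) (y : E) : E := \row_j w c y (delta_mx 0 j).
Definition form_mx (c : chart M E) (y : E) : 'M[R]_n :=
  \matrix_(i, j) dext w c y (delta_mx 0 i) (delta_mx 0 j).

Section OneChart.
Variable c : chart M E.
Hypothesis Ac : A c.
Let oc : open (img c) := chart_openI (cov.2 _ Ac).

Lemma form_linear y : img c y -> linear (w c y : E -> R^o).
Proof. by move=> iy; case: w1 => + _ _; apply. Qed.

Lemma form_rowE y u : img c y -> w c y u = (u *m (form_row c y)^T) 0 0.
Proof.
move=> iy; rewrite [LHS](linear_rV_sum u (form_linear iy)) mxE.
by apply: eq_bigr => i _; rewrite !mxE.
Qed.

Lemma form_row_smooth : @smooth_on R E (E : tvsType R) (img c) (form_row c).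
Proof.
move=> k; apply: Ck_on_mx => // i j; apply: (Ck_on_eq (f := fun y => w c y (delta_mx 0 j) : R^o) oc).
  by move=> y iy; rewrite mxE.
by case: w1 => _ + _; apply.
Qed.

Lemma row_pairing_linear (v : E) : linear (fun b : E => (v *m b^T) 0 0 : R^o).
Proof. by move=> t b b'; rewrite linearP mulmxDr -scalemxAr !mxE. Qed.

Lemma row_pairing_linearl (b : E) : linear (fun v : E => (v *m b^T) 0 0 : R^o).
Proof. by move=> t v v'; rewrite mulmxDl -scalemxAl !mxE. Qed.

Lemma row_pairing_continuous (v : E) : continuous (fun b : E => (v *m b^T) 0 0 : R^o).
Proof.
move=> b; have FF : Filter (nbhs b) by exact: _.
apply: (@mx_entry_cvg R _ (nbhs b) FF 1 1 (fun b => v *m b^T)).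
by apply: (mulmx_cvg (F := nbhs b)); [exact: cvg_cst|exact: trmx_continuous].
Qed.

Lemma form_derive y u v : img c y ->
  'D_u (fun z => w c z v : R^o) y = (v *m (DE u (form_row c) y)^T) 0 0.
Proof.
move=> iy; have sw : smooth_on (img c) (fun y => w c y v : R^o) by case: w1 => _ + _; apply.
rewrite (derive_dderive (W := R^o) u oc sw iy); apply: (cvg_dderive hR).
have H := diff_quot_linear (row_pairing_linear v) (@row_pairing_continuous v)
  (smooth_cvg hE oc form_row_smooth (v := u) iy).
by apply: (diff_quot_eq oc _ iy H) => z iz; rewrite /= form_rowE.
Qed.

Lemma dext_linearl y v : img c y -> linear (fun u => dext w c y u v : R^o).
Proof.
move=> iy t u u'; rewrite /dext !form_derive// (dderive_linear hE oc form_row_smooth iy).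
have E1 := row_pairing_linear v t (DE u (form_row c) y) (DE u' (form_row c) y).
have E2 := row_pairing_linearl (DE v (form_row c) y) t u u'.
have arith (X Z a b a' b' : R^o) : X = t *: a + b -> Z = t *: a' + b' -> X - Z = t *: (a - a') + (b - b').
  by move=> -> ->; rewrite scalerBr opprD addrACA.
exact: (arith _ _ _ _ _ _ E1 E2).
Qed.

Lemma dextC y u v : dext w c y u v = - dext w c y v u.
Proof. by rewrite /dext opprB. Qed.

Lemma dextE y u v : img c y -> dext w c y u v = (u *m form_mx c y *m v^T) 0 0.
Proof.
move=> iy; rewrite [LHS](linear_rV_sum u (dext_linearl v iy)) -mulmxA mxE; apply: eq_bigr => i _.
congr (_ * _); rewrite dextC mxE.
rewrite [dext _ _ _ _ _](linear_rV_sum v (dext_linearl _ iy)) -sumrN; apply: eq_bigr => j _.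
by rewrite !mxE [in RHS]dextC mulNr mulrC.
Qed.

Lemma form_mx_smooth : @smooth_on R E ('M[R]_(n, n) : tvsType R) (img c) (form_mx c).
Proof.
have sw v : smooth_on (img c) (fun y => w c y v : R^o) by case: w1 => _ + _; apply.
move=> k; apply: Ck_on_mx => // i j.
apply: (Ck_on_eq (f := fun y => DR (delta_mx 0 i) (fun z => w c z (delta_mx 0 j)) y +
    (-1) *: DR (delta_mx 0 j) (fun z => w c z (delta_mx 0 i)) y) oc).
  move=> y iy; rewrite mxE /dext.
  by rewrite !(derive_dderive (W := R^o) _ oc (sw _) iy) scaleN1r.
apply: Ck_on_add; first exact: (smooth_dderive hR oc (sw _)).
by apply: Ck_on_scale => //; [exact: Ck_on_cst|exact: (smooth_dderive hR oc (sw _))].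
Qed.

End OneChart.

Section Naturality.
Variables (c d : chart M E) (f : E -> E) (B : set E) (e : R).
Hypotheses (Ac : A c) (Ad : A d) (oB : open B) (Bc : B `<=` img c) (Bd : forall y, B y -> img d (f y)).
Hypothesis sf : @smooth_on R E (E : tvsType R) B f.
Hypothesis fw : forall y v, B y -> w d (f y) (DE v f y) = e * w c y v.

(** Naturality of the exterior derivative, for a constant factor [e]: both sides of [fw] are
    differentiated, and the terms with second derivatives of [f] cancel by symmetry. *)
Lemma dext_natural y u v : B y -> dext w d (f y) (DE u f y) (DE v f y) = e * dext w c y u v.
Proof.
move=> By; have od := chart_openI (cov.2 _ Ad); have oc := chart_openI (cov.2 _ Ac).
have key p q : e * 'D_p (fun z => w c z q : R^o) y = (DE p (DE q f) y *m (form_row d (f y))^T) 0 0 +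
    (DE q f y *m (DE (DE p f y) (form_row d) (f y))^T) 0 0.
  have sw : smooth_on (img c) (fun y => w c y q : R^o) by case: w1 => _ + _; apply.
  have H1 : diff_quot (fun z => e *: (w c z q : R^o)) y p @ 0^' --> e *: DR p (fun z => w c z q) y.
    have lZ : linear (fun t : R^o => e *: t) by move=> a b b'; rewrite scalerDr !scalerA mulrC.
    apply: (diff_quot_linear (L := fun t : R^o => e *: t) lZ); first exact: scaler_continuous.
    exact: (smooth_cvg hR oc sw (Bc By)).
  have H2 : diff_quot (fun z => DE q f z *m (form_row d (f z))^T : 'M[R]_1) y p @ 0^' -->
     DE p (DE q f) y *m (form_row d (f y))^T + DE q f y *m (DE (DE p f y) (form_row d) (f y))^T.
    apply: diff_quot_mulmx; first exact: (smooth_cvg hE oB (smooth_dderive hE oB sf q) By).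
    apply: (diff_quot_linear (L := @trmx R 1 n) (@trmx_linear R 1 n) (@trmx_continuous R 1 n)).
    apply: (diff_quot_comp (g := form_row d) hE od (form_row_smooth Ad) (Bd By)).
    exact: (smooth_cvg hE oB sf By).
  have H3 := diff_quot_linear (@mx_entry_linear R 1 1 0 0) (@mx_entry_continuous R 1 1 0 0) H2.
  have H4 := diff_quot_eq oB (g := fun z => e *: (w c z q : R^o)) (fun z Bz => etrans (esym (form_rowE Ad _ (Bd Bz))) (fw q Bz)) By H3.
  rewrite (derive_dderive (W := R^o) p oc sw (Bc By)).
  by apply: (etrans (cvg_unique (@norm_hausdorff _ R^o) H1 H4)); rewrite [LHS]mxE.
rewrite /dext mulrBr !key (dderiveC hE u v oB sf By) !(form_derive Ad)//; [|exact: Bd|exact: Bd].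
have arith (x z z' : R) : z - z' = x + z - (x + z') by rewrite opprD addrACA subrr add0r.
exact: arith.
Qed.

End Naturality.

End OneForms.

Lemma mx11_eq (R : realType) (X Y : 'M[R]_1) : X 0 0 = Y 0 0 -> X = Y.
Proof. by move=> H; rewrite [X]mx11_scalar H -mx11_scalar. Qed.

Lemma bilinear_mx_eq (R : realType) n (X Y : 'M[R]_n) :
  (forall u v : 'rV[R]_n, (u *m X *m v^T) 0 0 = (u *m Y *m v^T) 0 0) -> X = Y.
Proof.
move=> H; apply/matrixP => i j; have := H (delta_mx 0 i) (delta_mx 0 j).
by rewrite trmx_delta -!rowE -!colE !mxE.
Qed.

(** * Rescaled contact forms and the Webster metric *)

Section PseudoHermitian.
Context {R : realType} (n : nat) (M : topologicalType).
Local Notation E := 'rV[R]_n.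
Local Notation DE := (@dderive R E (E : tvsType R)).
Local Notation DR := (@dderive R E (R^o : tvsType R)).
Variable A : set (chart M E).
Hypothesis hM : smooth_manifold A.

Let cov := manifold_cover hM.
Let hR : hausdorff_space (R^o : tvsType R). Proof. exact: (@norm_hausdorff _ R^o). Qed.

Section Scaling.
Variables (w : chart M E -> E -> E -> R) (J : chart M E -> E -> E -> E) (s : M -> R^o).
Hypotheses (ss : smooth_fun A s) (s0 : forall x, 0 < s x).

Definition scale_form (c : chart M E) (y u : E) : R := s (prm c y) * w c y u.

Lemma scale_form_eq0 c y u : (scale_form c y u = 0) <-> (w c y u = 0).
Proof.
rewrite /scale_form; split=> [/eqP|->]; last by rewrite mulr0.
by rewrite mulf_eq0 gt_eqF//= => /eqP.
Qed.

Lemma scale_preserves_CR a : preserves_CR A w J a -> preserves_CR A scale_form J a.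
Proof.
move=> H c d x u Ac Ad cx dx; have [H1 H2] := H c d x u Ac Ad cx dx.
by split; rewrite !scale_form_eq0.
Qed.

Lemma scale_one_form : one_form A w -> one_form A scale_form.
Proof.
move=> [wl ws wp]; split.
- move=> c y Ac iy t u v; rewrite /scale_form (wl c y Ac iy t u v) mulrDr.
  by rewrite /GRing.scale /= mulrCA.
- move=> c u Ac k; exact: (Ck_on_scale (chart_openI (cov.2 _ Ac)) (ss Ac k) (ws c u Ac k)).
- move=> c d x u Ac Ad cx dx; rewrite /scale_form (wp c d x u Ac Ad cx dx).
  by rewrite (chartK (cov.2 _ Ac) cx) (chartK (cov.2 _ Ad) dx).
Qed.

(** In d(s w) = ds ^ w + s dw the first summand vanishes on vectors of the kernel. *)
Lemma dext_scale c y u v : one_form A w -> A c -> img c y -> w c y u = 0 -> w c y v = 0 ->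
  dext scale_form c y u v = s (prm c y) * dext w c y u v.
Proof.
move=> w1 Ac iy wu wv; have oc := chart_openI (cov.2 _ Ac).
have key p q : w c y q = 0 -> 'D_p (fun z => scale_form c z q : R^o) y = s (prm c y) * 'D_p (fun z => w c z q : R^o) y.
  move=> wq; have sw : smooth_on (img c) (fun z => w c z q : R^o) by case: w1 => _ + _; apply.
  have ssw : smooth_on (img c) (fun z => scale_form c z q : R^o) by case: (scale_one_form w1) => _ + _; apply.
  rewrite (derive_dderive (W := R^o) p oc sw iy) (derive_dderive (W := R^o) p oc ssw iy).
  apply: (cvg_dderive hR).
  have Hs : (fun h : R => s (prm c (y + h *: p))) @ (0 : R)^' --> s (prm c y).
    have sc : {for y, continuous (s \o prm c)} := smooth_cont (ss Ac) iy.
    by have L := @line_cvg R E y p; move=> N /sc /L.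
  have FF : Filter ((0 : R)^') by exact: _.
  have := scalev_cvg Hs (smooth_cvg hR oc sw (v := p) iy); move=> /(_ FF).
  apply: cvg_trans; apply: near_eq_cvg; apply: filterS filterT => h _.
  by rewrite /diff_quot /scale_form wq mulr0 !subr0 /GRing.scale /= mulrCA.
by rewrite /dext !key// mulrBr.
Qed.

Lemma scale_hermitian : pseudo_hermitian A w J -> pseudo_hermitian A scale_form J.
Proof.
move=> [[w1 nd] [Jk Js Jp] lv]; split.
- split; first exact: scale_one_form.
  move=> c y Ac iy; have [[u wu] nd'] := nd c y Ac iy; split.
    by exists u; rewrite mulf_neq0// gt_eqF.
  move=> v /scale_form_eq0 wv H; apply: nd' => // v' wv'.
  have /eqP := H v' ((scale_form_eq0 c y v').2 wv'); rewrite dext_scale//.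
  by rewrite mulf_eq0 gt_eqF//= => /eqP.
- split.
  + move=> c y Ac iy u v t /scale_form_eq0 wu /scale_form_eq0 wv.
    by have [k1 k2 k3] := Jk c y Ac iy u v t wu wv; split=> //; exact/scale_form_eq0.
  + by move=> c U X Ac oU Uc sX H; apply: Js => // z Uz; apply/scale_form_eq0; exact: H.
  + exact: scale_preserves_CR.
move=> c y u v Ac iy /scale_form_eq0 wu /scale_form_eq0 wv /=.
have [Ju _ _] := Jk c y Ac iy u u 0 wu wu; have [Jv JJv _] := Jk c y Ac iy v v 0 wv wv.
have [JJu _ _] := Jk c y Ac iy _ _ 0 Ju Ju.
have [l1 l2 l3] := lv c y u v Ac iy wu wv.
rewrite !dext_scale//; split; [by rewrite /= l1|by rewrite /= l2|].
by move=> u0; rewrite mulr_gt0// l3.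
Qed.

End Scaling.

Section Metric.
Variables (w : chart M E -> E -> E -> R) (J : chart M E -> E -> E -> E).
Hypothesis hp : pseudo_hermitian A w J.

Let w1 : one_form A w. Proof. by case: hp => -[]. Qed.

Definition reeb_field (c : chart M E) (y : E) : E := reeb (form_row w c y) (form_mx w c y).
Definition ker_proj (c : chart M E) (y u : E) : E := u - w c y u *: reeb_field c y.

(* The Webster metric w^2 + dw(J., .), the Levi form being extended by the Reeb field. *)
Definition cr_metric (c : chart M E) (y u v : E) : R :=
  w c y u * w c y v + dext w c y (J c y (ker_proj c y u)) (ker_proj c y v).

Section OneChart.
Variable c : chart M E.
Hypothesis Ac : A c.
Let oc : open (img c) := chart_openI (cov.2 _ Ac).

Lemma form_contact y : img c y -> contact_pair (form_row w c y) (form_mx w c y).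
Proof.
move=> iy; have [[_ /(_ c y Ac iy)[[u wu] nd]] _ _] := hp.
have rE v := form_rowE w1 Ac v iy; split.
- by apply: contra_neq wu => r0; rewrite rE r0 trmx0 mulmx0 mxE.
- by apply/matrixP => i j; rewrite !mxE dextC.
move=> v v0 H; apply: nd; first by rewrite rE v0 mxE.
move=> v' wv'; rewrite (dextE hM w1 Ac _ _ iy) H ?mxE//.
by apply: mx11_eq; rewrite -rE wv' mxE.
Qed.

Lemma form_reeb y : img c y -> w c y (reeb_field c y) = 1.
Proof.
by move=> iy; rewrite (form_rowE w1 Ac _ iy) (reebP (form_contact iy)).1 mxE eqxx.
Qed.

Lemma ker_projP y u : img c y -> w c y (ker_proj c y u) = 0.
Proof.
move=> iy; rewrite /ker_proj addrC -scaleNr (form_linear w1 Ac iy) form_reeb//.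
by rewrite /GRing.scale /= mulr1 addNr.
Qed.

Lemma ker_proj_linear y : img c y -> linear (ker_proj c y).
Proof.
move=> iy t u v; rewrite /ker_proj (form_linear w1 Ac iy) scalerDl opprD scalerBr addrACA.
by rewrite scalerA.
Qed.

Lemma J_linear y t u v : img c y -> w c y u = 0 -> w c y v = 0 ->
  J c y (t *: u + v) = t *: J c y u + J c y v.
Proof. by move=> iy wu wv; have [_ [/(_ c y Ac iy u v t wu wv)[]]] := hp. Qed.

Lemma J_zero y : img c y -> J c y 0 = 0.
Proof.
move=> iy; have w0 : w c y 0 = 0 by exact: (linear_zero (form_linear w1 Ac iy)).
have := J_linear (-1) iy w0 w0.
by rewrite scaler0 add0r scaleN1r addNr.
Qed.

Lemma levi_sym y u v : img c y -> w c y u = 0 -> w c y v = 0 ->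
  dext w c y (J c y u) v = dext w c y (J c y v) u.
Proof. by move=> iy wu wv; have [_ _ /(_ c y u v Ac iy wu wv)[]] := hp. Qed.

Lemma levi_pos y u : img c y -> w c y u = 0 -> u != 0 -> 0 < dext w c y (J c y u) u.
Proof. by move=> iy wu u0; have [_ _ /(_ c y u u Ac iy wu wu)[_ _]] := hp; apply. Qed.

Lemma cr_metric_linear y v : img c y -> linear (fun u => cr_metric c y u v : R^o).
Proof.
move=> iy t u u'; rewrite /cr_metric (form_linear w1 Ac iy) (ker_proj_linear iy).
rewrite J_linear ?ker_projP//.
have arith (X a a' b p q : R^o) : X = t *: p + q -> (t *: a + a') * b + X = t *: (a * b + p) + (a' * b + q).
  by move=> ->; rewrite mulrDl scalerDr addrACA scalerAl.
by apply: arith; exact: (dext_linearl hM w1 Ac _ iy).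
Qed.

Lemma cr_metric_pos y u : img c y -> u != 0 -> 0 < cr_metric c y u u.
Proof.
move=> iy u0; rewrite /cr_metric -expr2; have [p0|p0] := eqVneq (ker_proj c y u) 0.
  rewrite p0 J_zero// (linear_zero (dext_linearl hM w1 Ac _ iy)) addr0.
  rewrite exprn_even_gt0//=; apply: contra_neq u0 => wu.
  by move: p0; rewrite /ker_proj wu scale0r subr0.
by rewrite ltr_wpDl ?sqr_ge0// levi_pos// ker_projP.
Qed.

Lemma reeb_field_smooth : @smooth_on R E (E : tvsType R) (img c) (reeb_field c).
Proof.
move=> k; have sr := form_row_smooth hM w1 Ac k; have sm := form_mx_smooth hM w1 Ac k.
apply: (Ck_on_mulmx oc); first exact: sr.
apply: (Ck_on_invmx oc).
  by move=> y iy; apply: contact_mx_unit; [exact: oner_neq0|exact: form_contact].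
apply: Ck_on_add; first by apply: (Ck_on_mulmx oc) => //; exact: (Ck_on_trmx oc sr).
by apply: Ck_on_scale => //; exact: Ck_on_cst.
Qed.

Lemma ker_proj_smooth u : @smooth_on R E (E : tvsType R) (img c) (fun y => ker_proj c y u).
Proof.
have [_ ws _] := w1; move=> k.
apply: (@Ck_on_eq R (E : tvsType R) k E (img c) (fun y => u + ((-1) *: (w c y u : R^o)) *: reeb_field c y) _ oc) => [y _|].
  by rewrite /ker_proj scaleN1r scaleNr.
apply: Ck_on_add; first exact: Ck_on_cst.
apply: (Ck_on_scale oc); last exact: reeb_field_smooth.
by apply: (Ck_on_scale oc); [exact: Ck_on_cst|exact: ws].
Qed.

Lemma cr_metric_smooth u v : smooth_on (img c) (fun y => cr_metric c y u v : R^o).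
Proof.
have [_ ws _] := w1; have [_ [_ Js _] _] := hp; move=> k.
apply: (Ck_on_eq (f := fun y => (w c y u : R^o) *: (w c y v : R^o) +
    ((J c y (ker_proj c y u) *m form_mx w c y *m (ker_proj c y v)^T) 0 0 : R^o)) oc) => [y iy|].
  by rewrite /cr_metric (dextE hM w1 Ac _ _ iy).
apply: Ck_on_add; first by apply: (Ck_on_scale oc); exact: ws.
apply: (@Ck_on_mx_entry R k E (img c) 1 1 (fun y => J c y (ker_proj c y u) *m form_mx w c y *m (ker_proj c y v)^T) 0 0).
apply: (Ck_on_mulmx oc); last by apply: (Ck_on_trmx oc); exact: ker_proj_smooth.
apply: (Ck_on_mulmx oc); last exact: (form_mx_smooth hM w1 Ac k).
apply: (Js c (img c) (fun y => ker_proj c y u)) => //; first exact: ker_proj_smooth.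
by move=> y iy; exact: ker_projP.
Qed.

End OneChart.

(** The sign [e] also multiplies dw and the Reeb field, so the projection to the kernel is
    equivariant and w^2 is preserved. The Levi part acquires the factor [e], which positivity forces
    to be 1 wherever that part is nonzero. *)
Lemma cr_pullback (a : M -> M) (e : M -> R^o) : smooth_map A A a -> preserves_CR A w J a ->
  (forall x, e x ^+ 2 = 1) -> continuous e ->
  (forall c d x u, A c -> A d -> dom c x -> dom d (a x) ->
    w d (crd d (a x)) ('D_u (loc a c d) (crd c x)) = e x * w c (crd c x) u) ->
  pullback_scaled A cr_metric a (fun=> 1).
Proof.
move=> sa pa e2 ce wa c d x u v Ac Ad cx dx; have hc := cov.2 _ Ac; have hd := cov.2 _ Ad.
have ix := img_dom cx; have iax := img_dom dx.
have De q : 'D_q (loc a c d) (crd c x) = q *m jac (loc a c d) (crd c x).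
  rewrite (tangentE hM sa Ac Ad q cx dx).
  exact: (jac_mul (rep_open hM sa Ac Ad) (rep_smooth hM sa Ac Ad) q (rep_dom hM Ac cx dx)).
(* A continuous sign is locally constant, hence may be treated as a constant when
   differentiating. *)
have nO : nbhs x [set z | e z = e x].
  have c0 : nbhs (e x) [set t : R^o | 0 < t * e x].
    have : nbhs (e x) [set t : R^o | `|t - e x| < 1].
      by apply/nbhs_ballP; exists 1 => //= t; rewrite -ball_normE /= distrC.
    apply: filterS => t /= H; have := e2 x; move: (e x) H => y; rewrite ltr_norml => /andP[H1 H2] /eqP.
    rewrite sqrf_eq1 => /orP[/eqP y1|/eqP y1]; rewrite y1 in H1 H2 *; lra.
  have nz : nbhs x (e @^-1` [set t : R^o | 0 < t * e x]) := ce x _ c0.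
  apply: filterS nz => z /= H; have := e2 z; have := e2 x.
  move=> /eqP; rewrite sqrf_eq1 => /orP[/eqP y1|/eqP y1] /eqP; rewrite sqrf_eq1 => /orP[/eqP y2|/eqP y2]; move: H; rewrite y1 y2 //; lra.
pose B := locD a c d `&` prm c @^-1` [set z | e z = e x]°.
have oB : open B.
  apply: open_preim; [exact: (rep_open hM sa Ac Ad)| |exact: open_interior].
  by move=> z [iz _]; exact: prm_cont.
have Bx : B (crd c x).
  split; first exact: (rep_dom hM Ac cx dx).
  by rewrite /= (chartK hc cx); exact: nO.
have sf : @smooth_on R E (E : tvsType R) B (loc a c d).
  by move=> k; apply: Ck_on_sub (rep_smooth hM sa Ac Ad k) => z [].
have fw z q : B z -> w d (loc a c d z) (DE q (loc a c d) z) = e x * w c z q.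
  move=> [[iz dz] /interior_subset /= ez].
  have := wa c d (prm c z) q Ac Ad (dom_prm hc iz) dz.
  by rewrite (tangentE hM sa Ac Ad q (dom_prm hc iz) dz) (prmK hc iz) ez.
have fx : loc a c d (crd c x) = crd d (a x) by rewrite /loc /= (chartK hc cx).
set P := jac (loc a c d) (crd c x) in De.
have wP q : w d (crd d (a x)) (q *m P) = e x * w c (crd c x) q.
  by rewrite -De; exact: wa.
have dP p q : dext w d (crd d (a x)) (p *m P) (q *m P) = e x * dext w c (crd c x) p q.
  have DEP r : DE r (loc a c d) (crd c x) = r *m P by rewrite -(tangentE hM sa Ac Ad r cx dx) De.
  have H : dext w d (loc a c d (crd c x)) (DE p (loc a c d) (crd c x)) (DE q (loc a c d) (crd c x)) =
      e x * dext w c (crd c x) p q.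
    exact: (dext_natural hM w1 Ac Ad oB (fun z Bz => Bz.1.1) (fun z (Bz : B z) => img_dom Bz.1.2) sf fw p q Bx).
  by rewrite fx !DEP in H.
have Pa : P *m (form_row w d (crd d (a x)))^T = e x *: (form_row w c (crd c x))^T.
  apply/row_matrixP => i; rewrite !rowE; apply: mx11_eq.
  by rewrite mulmxA -scalemxAr -(form_rowE w1 Ad _ iax) wP (form_rowE w1 Ac _ ix) [RHS]mxE.
have PO : P *m form_mx w d (crd d (a x)) *m P^T = e x *: form_mx w c (crd c x).
  apply: bilinear_mx_eq => p q.
  rewrite -scalemxAr -scalemxAl [RHS]mxE -(dextE hM w1 Ac _ _ ix) -dP (dextE hM w1 Ad _ _ iax).
  by rewrite trmx_mul !mulmxA.
have [uP xP] := reeb_natural (e2 x) (form_contact Ac ix) (form_contact Ad iax) Pa PO.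
have piP q : ker_proj d (crd d (a x)) (q *m P) = ker_proj c (crd c x) q *m P.
  rewrite /ker_proj wP /reeb_field xP scalerA mulrAC -expr2 e2 mul1r mulmxBl.
  by rewrite -scalemxAl.
have JP q : J d (crd d (a x)) (ker_proj c (crd c x) q *m P) = J c (crd c x) (ker_proj c (crd c x) q) *m P.
  have [_ /(_ (ker_projP Ac q ix))] := pa c d x (ker_proj c (crd c x) q) Ac Ad cx dx.
  by rewrite !De.
(* The Levi form is positive before and after applying [a], and the two values differ by the factor
   [e x]. A trivial kernel leaves the sign free, but then the Levi part is zero. *)
have e1 : ker_proj c (crd c x) u != 0 -> e x = 1.
  move=> p0; have lc := levi_pos Ac ix (ker_projP Ac u ix) p0.
  have p0' : ker_proj c (crd c x) u *m P != 0.
    by apply: contra_neq p0 => H; rewrite -(mulmxK uP (ker_proj _ _ _)) H mul0mx.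
  have wp : w d (crd d (a x)) (ker_proj c (crd c x) u *m P) = 0.
    by rewrite wP (ker_projP Ac u ix) mulr0.
  have := levi_pos Ad iax wp p0'; rewrite JP dP (pmulr_lgt0 _ lc) => ep.
  by have /eqP := e2 x; rewrite sqrf_eq1 => /orP[/eqP//|/eqP em]; move: ep; rewrite em ltr0N1.
rewrite /cr_metric !De mul1r !wP !piP JP dP mulrACA -expr2 e2 mul1r; congr (_ + _).
have [p0|/e1 ->] := eqVneq (ker_proj c (crd c x) u) 0; last by rewrite mul1r.
by rewrite p0 (J_zero Ac ix) (linear_zero (dext_linearl hM w1 Ac _ ix)) mulr0.
Qed.

Lemma cr_riemannian : riemannian_metric A cr_metric.
Proof.
split.
- move=> c y Ac iy; split.
  + by move=> v; exact: cr_metric_linear.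
  + by move=> u v; rewrite /cr_metric mulrC levi_sym// ker_projP.
  + by move=> u u0; exact: cr_metric_pos.
- by move=> c u v Ac; exact: cr_metric_smooth.
(* Compatibility of the chart representatives is invariance under the identity map. *)
apply: (cr_pullback (e := fun=> 1)).
- exact: id_smooth_map.
- by have [_ [_ _ ?] _] := hp.
- by move=> x; rewrite expr1n.
- by move=> x; exact: cvg_cst.
by move=> c d x u Ac Ad cx dx; rewrite mul1r; have [_ _ ->] := w1.
Qed.

End Metric.

End PseudoHermitian.

(** * Invariant metrics in the CR case *)

Section CRCase.
Context {R : realType} (G : preTopologicalGroupType) (m : nat) (AG : set (chart G 'rV[R]_m)).
Context (M : topologicalType) (n : nat) (A : set (chart M 'rV[R]_n)).
Local Notation E := 'rV[R]_n.
Variable act : G -> M -> M.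
Hypothesis hM : smooth_manifold A.
Hypothesis hG : lie_group_of_diffeos AG A act.

Let cov := manifold_cover hM.

(* A linear form is determined up to a factor by its kernel. *)
Lemma CR_factor w J (a : M -> M) x : pseudo_hermitian A w J -> smooth_map A A a ->
  preserves_CR A w J a ->
  exists f : R, forall c d u, A c -> A d -> dom c x -> dom d (a x) ->
    w d (crd d (a x)) ('D_u (loc a c d) (crd c x)) = f * w c (crd c x) u.
Proof.
move=> [[w1 nd] _ _] sa pa; have [_ _ wp] := w1.
have [c Ac cx] := cov.1 x; have [d Ad dx] := cov.1 (a x).
have ix := img_dom cx; have iax := img_dom dx.
have [[u0 wu0] _] := nd c _ Ac ix.
pose L u := w d (crd d (a x)) ('D_u (loc a c d) (crd c x)).
have key u : L u = L u0 / w c (crd c x) u0 * w c (crd c x) u.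
  pose t := w c (crd c x) u / w c (crd c x) u0.
  have wk : w c (crd c x) (- t *: u0 + u) = 0.
    by rewrite (form_linear w1 Ac ix) /GRing.scale /= mulNr /t divfK// addNr.
  have := (pa c d x (- t *: u0 + u) Ac Ad cx dx).1.1 wk.
  rewrite (tangent_linear hM sa Ac Ad cx dx) (form_linear w1 Ad iax).
  rewrite -/(L u0) -/(L u) scaleNr addrC => /eqP; rewrite subr_eq0 => /eqP ->.
  by rewrite /GRing.scale /= /t mulrAC -mulrA [RHS]mulrC mulrA.
exists (L u0 / w c (crd c x) u0) => c' d' u Ac' Ad' cx' dx'.
have si := id_smooth_map hM.
rewrite (tangent_comp hM u sa si Ac' Ad Ad' cx' dx dx') /comp (wp d d' (a x) _ Ad Ad' dx dx').
rewrite (tangent_comp hM u si sa Ac' Ac Ad cx' cx dx) -[w d _ _]/(L _) key.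
by rewrite (wp c' c x _ Ac' Ac cx' cx).
Qed.

Lemma CR_invariant w J : pseudo_hermitian A w J -> (forall g, preserves_CR A w J (act g)) ->
  Hd_vanishes AG (Cinf_act act (fun (_ : G) (t : R^o) => t) : G -> Cinf A R^o -> Cinf A R^o) 1 ->
  exists2 h, riemannian_metric A h & forall g, pullback_scaled A h (act g) (fun=> 1).
Proof.
move=> hp pres H1; have [[w1 nd] _ _] := hp; have [_ ws _] := w1.
have sact := act_smooth_map hM hG.
have /choice[F FP] : forall g, exists f : M -> R^o, forall c d x u, A c -> A d -> dom c x -> dom d (act g x) ->
    w d (crd d (act g x)) ('D_u (loc (act g) c d) (crd c x)) = f x * w c (crd c x) u.
  move=> g; have /choice[f fP] := fun x => CR_factor x hp (sact g) (pres g).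
  by exists f => c d x u; exact: fP.
have F0 g x : F g x != 0.
  have [c Ac cx] := cov.1 x; have [d Ad dx] := cov.1 (act g x).
  have [[u wu] _] := nd c _ Ac (img_dom cx); apply/eqP => f0.
  have := FP g c d x u Ac Ad cx dx; rewrite f0 mul0r => /((pres g c d x u Ac Ad cx dx).1.2).
  by move/eqP; rewrite (negPf wu).
have FM g h x : F (g * h)%g x = F g (act h x) * F h x.
  have [c Ac cx] := cov.1 x; have [d Ad dx] := cov.1 (act h x); have [e Ae ex] := cov.1 (act g (act h x)).
  have [[u wu] _] := nd c _ Ac (img_dom cx).
  have ex' : dom e (act (g * h)%g x) by rewrite (lie_actM hG).
  apply: (mulIf wu); rewrite -(FP (g * h)%g c e x u Ac Ae cx ex').
  have -> : act (g * h)%g = act g \o act h by apply/funext => z; exact: (lie_actM hG).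
  rewrite (tangent_comp hM u (sact h) (sact g) Ac Ad Ae cx dx ex).
  by rewrite /comp (FP g d e _ _ Ad Ae dx ex) (FP h c d x u Ac Ad cx dx) mulrA.
have sF : smooth_family_fun AG A F.
  apply: (smooth_family_local hM hG) => E0 O p q c d u oO pO qO Ac Ad Ou HO.
  have sX := plot_crd qO Ac (fun u Hu => (HO u Hu).1).
  have sY := plot_crd (plot_act hM hG oO pO qO) Ad (fun u Hu => (HO u Hu).2).
  have iX z : O z -> img c (crd c (q z)) by move=> /HO[cz _]; exact: img_dom.
  have iY z : O z -> img d (crd d (act (p z) (q z))) by move=> /HO[_ dz]; exact: img_dom.
  have [[u0 wu0] _] := nd c _ Ac (iX u Ou).
  have oc := chart_openI (cov.2 _ Ac); have od := chart_openI (cov.2 _ Ad).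
  have sN : smooth_on O (fun z => w c (crd c (q z)) u0 : R^o).
    move=> k; exact: (Ck_on_comp (g := fun y => w c y u0 : R^o) oO oc iX (sX k) (ws c u0 Ac k)).
  (* A constant vector may enter the kernel of [w] away from the given point, so the quotient
     formula for [F] is used only where it does not. *)
  pose V := O `&` (fun z => w c (crd c (q z)) u0 : R^o) @^-1` [set t | t != 0].
  have oV : open V.
    apply: (open_preim (O := [set t : R^o | t != 0]) oO); last exact: open_neq.
    by move=> z Oz; exact: (smooth_cont sN Oz).
  exists V; first by split.
  have sw := tangent_smooth hM hG u0 oO pO qO Ac Ad HO.
  have FE z : V z -> ('D_u0 (loc (act (p z)) c d) (crd c (q z)) *m (form_row w d (crd d (act (p z) (q z))))^T) 0 0
      *: ((w c (crd c (q z)) u0)^-1 : R^o) = F (p z) (q z).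
    move=> [Oz w0]; have [cz dz] := HO z Oz.
    rewrite -(form_rowE w1 Ad _ (iY z Oz)) (FP (p z) c d _ _ Ac Ad cz dz).
    by rewrite /GRing.scale /= mulfK.
  have VO : V `<=` O by move=> z [].
  move=> k; apply: (Ck_on_eq oV FE); apply: (Ck_on_scale oV); last first.
    by apply: (Ck_on_invr oV) => [z []//|]; apply: Ck_on_sub VO (sN k).
  apply: (@Ck_on_mx_entry R k E0 V 1 1 (fun z => 'D_u0 (loc (act (p z)) c d) (crd c (q z)) *m
    (form_row w d (crd d (act (p z) (q z))))^T) 0 0).
  apply: (Ck_on_mulmx oV); first exact: Ck_on_sub VO (sw k).
  apply: (Ck_on_trmx oV); apply: (Ck_on_sub VO).
  exact: (Ck_on_comp (g := form_row w d : E -> (E : tvsType R)) oO od iY (sY k) (form_row_smooth hM w1 Ad k)).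
have [k sk kP] := cocycle_splits hM hG sF F0 FM H1.
have sk' := weight_smooth hM sk; have k0 := weight_gt0 k.
have hp' := scale_hermitian hM sk' k0 hp.
exists (cr_metric (scale_form w (weight k)) J); first exact: (cr_riemannian hM hp').
(* The factor by which [g] changes the rescaled form. Its square is 1 by the splitting of the
   cocycle. *)
move=> g; pose e x : R^o := (weight k (act g x) * F g x) * (weight k x)^-1.
apply: (cr_pullback hM hp' (e := e)) => //.
- exact: scale_preserves_CR.
- move=> x; rewrite /e exprMn (weight_sqr (kP g x)) exprVn mulfV//.
  by rewrite expf_neq0// gt_eqF.
- have sg : smooth_fun A (F g).
    move=> c Ac; have oc := chart_openI (cov.2 _ Ac).
    exact: (sF _ _ (fun=> g) _ oc (plot_cst _ _ _) (plot_prm hM Ac)).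
  have cw := smooth_fun_cont hM sk'; have cF := smooth_fun_cont hM sg.
  have ca : continuous (act g) by case: (sact g).
  move=> x; apply: (@continuousM R M (fun x => weight k (act g x) * F g x) (fun x => (weight k x)^-1)).
    apply: (@continuousM R M (fun x => weight k (act g x)) (F g)); last exact: cF.
    by apply: continuous_comp; [exact: ca|exact: cw].
  by apply: (@continuousV R M (weight k)); [rewrite gt_eqF|exact: cw].
move=> c d x u Ac Ad cx dx.
rewrite /scale_form (chartK (cov.2 _ Ac) cx) (chartK (cov.2 _ Ad) dx) (FP g c d x u Ac Ad cx dx).
by rewrite /e !mulrA divfK// gt_eqF.
Qed.

End CRCase.

Theorem theorem29 (R : realType)
  (n : nat) (M : topologicalType) (A : set (chart M 'rV[R]_n))
  (hM : smooth_manifold A) (M_connected : connected [set: M])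
  (G : preTopologicalGroupType) (m : nat) (AG : set (chart G 'rV[R]_m))
  (act : G -> M -> M)
  (hG : lie_group_of_diffeos AG A act)
  (hpres : preserves_CR_or_conformal A act)
  (hclosed : closed_in_Diff A act) :
  [<-> proper_action act;
       Hd_vanishes AG (Cinf_act act (fun (_ : G) (t : R^o) => t)
                            : G -> Cinf A R^o -> Cinf A R^o) 1;
       forall r : nat, (0 < r)%N ->
       forall (V : tvsType R) (aV : G -> V -> V),
       differentiable_module AG aV ->
       Hd_vanishes AG (Cinf_act act aV
                            : G -> Cinf A V -> Cinf A V) r].
Proof.
have to_proper : Hd_vanishes AG (Cinf_act act (fun (_ : G) (t : R^o) => t)
    : G -> Cinf A R^o -> Cinf A R^o) 1 -> proper_action act.
  move=> H1; have [h hr hinv] : exists2 h, riemannian_metric A h & forall g, pullback_scaled A h (act g) (fun=> 1).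
    case: hpres => [[w [J [hp pres]]]|[gm [hr pres]]]; first exact: (CR_invariant hM hG hp pres).
    exact: (conformal_invariant hM hG hr pres).
  exact: (isometric_proper hM M_connected hG hr hinv hclosed).
(* The second condition is the third in degree one for the trivial module on the reals, so two
   implications carry the whole equivalence. *)
have from_proper := proper_vanishing hM hG.
split; first by move=> H; exact: (from_proper H 1%N isT R^o _ (trivial_module hG)).
split; first by move=> /to_proper; exact: from_proper.
by move=> H; apply: to_proper; exact: (H 1%N isT R^o _ (trivial_module hG)).
Qed.
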